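(* Assume the setting described in the context. Fix $t\ge0$ and a sequence $\epsilon_k\to0$ such that $X^{\epsilon_k}(-t,\cdot)$ converges locally uniformly on $\mathbb C$ to a quasiconformal homeomorphism $X(-t,\cdot)$ of $\mathbb C$. Define $\omega(t,\cdot)=\omega_0(X(-t,\cdot))$ and $\mathbf v(t,\cdot)=K\ast\omega(t,\cdot)$. Then, as $k\to\infty$, (a) $\|\omega^{\epsilon_k}(t,\cdot)-\omega(t,\cdot)\|_1\to0$, and (b) $\|\mathbf v^{\epsilon_k}(t,\cdot)-\mathbf v(t,\cdot)\|_\infty\to0$.
   Context: Fix $\theta\in[0,2\pi]$ and $K(z)=\frac{e^{i\theta}}{2\pi z}$ on $\mathbb C\cong\mathbb R^2$. Let $\omega_0\in L^\infty(\mathbb C)$ be real-valued with compact support. For $\epsilon>0$ let $\omega_0^\epsilon\in C^\infty_c(\mathbb C)$ be real-valued with $\|\omega_0^\epsilon\|_\infty\le\|\omega_0\|_\infty$, $\|\omega_0^\epsilon\|_1\le\|\omega_0\|_1$ and $\|\omega_0^\epsilon-\omega_0\|_1\to0$. Let $\omega^\epsilon$ be the unique smooth solution of $\partial_t\omega^\epsilon+\mathbf v^\epsilon\cdot\nabla\omega^\epsilon=0$, $\mathbf v^\epsilon(t,\cdot)=K\ast\omega^\epsilon(t,\cdot)$, $\omega^\epsilon(0,\cdot)=\omega_0^\epsilon$, and let $X^\epsilon$ be the flow of $\mathbf v^\epsilon$: $\frac{d}{dt}X^\epsilon(t,z)=\mathbf v^\epsilon(t,X^\epsilon(t,z))$,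 $X^\epsilon(0,z)=z$, so that $\omega^\epsilon(t,X^\epsilon(t,z))=\omega_0^\epsilon(z)$. Here $X^\epsilon(-t,\cdot)$ denotes the inverse map of $X^\epsilon(t,\cdot)$, so $\omega^\epsilon(t,\cdot)=\omega_0^\epsilon(X^\epsilon(-t,\cdot))$. Each $X^\epsilon(t,\cdot)$ is $e^{t\|\omega_0\|_\infty}$-quasiconformal. *)

(* Defs.v *)
From HB Require Import structures.
From mathcomp Require Import all_boot all_order all_algebra.
From mathcomp Require Import all_classical all_reals all_analysis ess_sup_inf.
Set Implicit Arguments. Unset Strict Implicit. Unset Printing Implicit Defensive.
Import Order.TTheory GRing.Theory Num.Theory numFieldNormedType.Exports.
Local Open Scope classical_set_scope.
Local Open Scope ring_scope.

(* The complex plane C is modelled as R * R, z = (Re z, Im z). *)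
Section Plane.
Variable R : realType.
Local Notation C := (R * R)%type.

Definition leb2 := (@lebesgue_measure R \x @lebesgue_measure R)%E.

Definition cnorm (z : C) : R := Num.sqrt (z.1 ^+ 2 + z.2 ^+ 2).

(* Real and imaginary parts of K(z) = e^{i theta} / (2 pi z)
   = e^{i theta} * conj z / (2 pi |z|^2). *)
Definition Kre (theta : R) (z : C) : R :=
  (cos theta * z.1 + sin theta * z.2) / (2 * pi * (z.1 ^+ 2 + z.2 ^+ 2)).
Definition Kim (theta : R) (z : C) : R :=
  (sin theta * z.1 - cos theta * z.2) / (2 * pi * (z.1 ^+ 2 + z.2 ^+ 2)).

Definition Kconv (theta : R) (f : C -> R) (z : C) : C :=
  ((\int[leb2]_w (Kre theta (z - w) * f w))%R,
   (\int[leb2]_w (Kim theta (z - w) * f w))%R).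

Definition L1norm (f : C -> R) : \bar R := (\int[leb2]_z (`|f z|)%:E)%E.
Definition Linfnorm (f : C -> R) : \bar R := ess_sup leb2 (fun z => (`|f z|)%:E).
Definition Linfnorm_vec (f : C -> C) : \bar R := ess_sup leb2 (fun z => (cnorm (f z))%:E).

Definition homeomorphism (f : C -> C) : Prop :=
  exists g : C -> C, cancel f g /\ cancel g f /\ continuous f /\ continuous g.

(* Quasiconformal homeomorphism, metric definition:
   H_f(z) = limsup_{r -> 0} max_{|w-z|=r}|f w - f z| / min_{|w-z|=r}|f w - f z|
   is bounded on C. *)
Definition quasiconformal (f : C -> C) : Prop :=
  homeomorphism f /\
  exists H : R, forall z : C, exists2 delta : R, 0 < delta &
    forall r : R, 0 < r < delta -> forall w1 w2 : C,
      cnorm (w1 - z) = r -> cnorm (w2 - z) = r ->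
      cnorm (f w1 - f z) <= H * cnorm (f w2 - f z).

Fixpoint iterD (V : normedModType R) (vs : seq V) (f : V -> R) : V -> R :=
  match vs with
  | [::] => f
  | v :: vs' => fun x => 'D_v (iterD vs' f) x
  end.
Definition smooth (V : normedModType R) (f : V -> R) : Prop :=
  forall vs : seq V, continuous (iterD vs f) /\
    forall (x v : V), derivable (iterD vs f) x v.

Definition compact_support (f : C -> R) : Prop :=
  exists r : R, forall z, r < cnorm z -> f z = 0.

End Plane.

(* Main.v *)
(* The limit is governed by one estimate, uniform in epsilon: if h is Lipschitz with 0 <= h <= 1 and
   int h is small, then int h o X^epsilon(-t, .) is small, by an amount that depends only on t,
   ||omega_0||_infty and ||omega_0||_1.  Along the flow, d/ds int h o X(-s, .) =
   int (h o X(-s, .)) div v(s, .), and div v is a singular integral of the bounded function omega.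
   It is square integrable (the Hessian determinant has zero integral) and of bounded mean
   oscillation, hence exponentially integrable (John-Nirenberg, by a Bellman function on dyadic
   rectangles), so Young's inequality x y <= x log(1 + x) + (e^y - 1 - y) gives
   int h o X(-s, .) div v <= C log(1 + 1/m) int h o X(-s, .) + C m for every m > 0; on a time
   step of length of order 1/||omega_0||_infty this turns int h <= m into
   int h o X(-s, .) <= C sqrt m.
   Passing to the limit, the same holds for Y, and then
   |omega^k(t) - omega_0 o Y| <= |omega_0^k - omega_0^j| o X^k(-t, .)
     + |omega_0^j o X^k(-t, .) - omega_0^j o Y| + |omega_0^j - omega_0| o Y
   yields (a); (b) follows from |K * u| <= C (r ||u||_infty + ||u||_1 / r).
   That omega^epsilon(s, .) stays compactly supported is not assumed: it is obtained by following
   a particle in barycentric coordinates with respect to three other particles. *)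
Require Import Defs.
From HB Require Import structures.
From mathcomp Require Import all_boot all_order all_algebra.
From mathcomp Require Import all_classical all_reals all_analysis ess_sup_inf.
From mathcomp Require Import measurable_realfun ring lra.
Set Implicit Arguments. Unset Strict Implicit. Unset Printing Implicit Defensive.
Import Order.TTheory GRing.Theory Num.Theory numFieldNormedType.Exports.
Local Open Scope classical_set_scope.
Local Open Scope ring_scope.

(** * Integration on the plane *)

(** Since K is holomorphic off 0, dv/dzbar = e^{i theta} omega / 2 is bounded, while div v = 2 Re
    dv/dz is a Beurling transform of omega, with no sup bound uniform in epsilon. Gronwall therefore
    gives no uniform bound on the Jacobian, and smallness of integrals is propagated instead. The
    kernels are regularised at a scale s, which makes all fields bounded and Lipschitz; the square,
    oscillation and exponential bounds are independent of s, and s is fixed anew for each accuracy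
    of the time discretisation. Constants are of two kinds: the support radius and the Lipschitz
    constant of omega^epsilon depend on epsilon and only justify limits, while the sup norm, the L^1
    norm and t enter the final estimates. Absolute continuity of Y is a consequence of the limit
    estimate, not an input, so Borel functions are approximated by Lipschitz ones for Lebesgue
    measure and for its image under Y at the same time. Finally omega_0 is bounded with compact
    support only almost everywhere; passing to a better representative uses that Y-preimages of null
    sets are null. *)

Section RealDerive.
Context {R : realType}.
Implicit Types (f g : R -> R) (x a b c : R).
Lemma d1_eq f x a b : is_derive x 1 f a -> a = b -> is_derive x 1 f b.
Proof. by move=> h <-. Qed.
Lemma d1_id x : is_derive x 1 (fun x : R => x) 1.
Proof. exact: is_derive_id. Qed.
Lemma d1_cst c x : is_derive x 1 (fun _ : R => c) 0.
Proof. exact: is_derive_cst. Qed.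
Lemma d1_D f g x a b : is_derive x 1 f a -> is_derive x 1 g b -> is_derive x 1 (fun x => f x + g x) (a + b).
Proof. by move=> hf hg; exact: (is_deriveD hf hg). Qed.
Lemma d1_B f g x a b : is_derive x 1 f a -> is_derive x 1 g b -> is_derive x 1 (fun x => f x - g x) (a - b).
Proof. by move=> hf hg; exact: (is_deriveB hf hg). Qed.
Lemma d1_M f g x a b : is_derive x 1 f a -> is_derive x 1 g b -> is_derive x 1 (fun x => f x * g x) (a * g x + f x * b).
Proof.
move=> hf hg; apply: (d1_eq (is_deriveM hf hg)).
by rewrite /GRing.scale/=; ring.
Qed.
Lemma d1_Z c f x a : is_derive x 1 f a -> is_derive x 1 (fun x => c * f x) (c * a).
Proof.
move=> hf; apply: (d1_eq (d1_M (d1_cst c x) hf)); ring.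
Qed.
Lemma d1_V f x a : f x != 0 -> is_derive x 1 f a -> is_derive x 1 (fun x => (f x)^-1) (- a * (f x)^-1 ^+ 2).
Proof.
move=> fx hf; apply: (d1_eq (is_deriveV fx hf)).
by rewrite /GRing.scale/=; field.
Qed.
Lemma d1_X2 f x a : is_derive x 1 f a -> is_derive x 1 (fun x => f x ^+ 2) (2 * f x * a).
Proof.
move=> hf; apply: (d1_eq (d1_M hf hf)); ring.
Qed.
Lemma d1_comp f g x a b : is_derive (g x) 1 f a -> is_derive x 1 g b -> is_derive x 1 (fun x => f (g x)) (a * b).
Proof. by move=> hf hg; exact: (is_derive1_comp hf hg). Qed.
End RealDerive.

Section PlaneMeasure.
Context {R : realType}.
Local Notation C := (R * R)%type.
Local Notation mu := (@lebesgue_measure R).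
Implicit Types (f g : C -> R) (z w : C).

Lemma normC z : `|z| = Num.max `|z.1| `|z.2|.
Proof. by case: z => a b. Qed.

Lemma norm1_le z : `|z.1| <= `|z|.
Proof. by rewrite normC le_max lexx. Qed.

Lemma norm2_le z : `|z.2| <= `|z|.
Proof. by rewrite normC le_max lexx orbT. Qed.

Lemma normC_le z r : (`|z| <= r) = (`|z.1| <= r) && (`|z.2| <= r).
Proof. by rewrite normC ge_max. Qed.

Lemma normC_lt z r : (`|z| < r) = (`|z.1| < r) && (`|z.2| < r).
Proof. by rewrite normC gt_max. Qed.

(** Measurable sets of [R * R] come from the product structure, not from the topology; the rational
    squares inside an open set bridge the two. *)
Lemma open_measurable2 (A : set C) : open A -> measurable A.
Proof.
move=> oA.
pose B (p : rat * rat * rat) : set C :=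
  `]ratr p.1.1 - ratr p.2 : R, ratr p.1.1 + ratr p.2[ `*` `]ratr p.1.2 - ratr p.2, ratr p.1.2 + ratr p.2[.
have -> : A = \bigcup_(p in [set p | B p `<=` A]) B p.
  apply/seteqP; split => [z Az|z [p]]; last exact.
  have /nbhs_ballP[e /= e0 eA] : nbhs z A by exact: open_nbhs_nbhs.
  have e40 : 0 < e / 4 by rewrite divr_gt0.
  have [r] := @rat_in_itvoo R (e / 4) (e / 2) ltac:(lra).
  rewrite in_itv/= => /andP[r1 r2].
  have [q1] := @rat_in_itvoo R (z.1 - e / 4) (z.1 + e / 4) ltac:(lra).
  rewrite in_itv/= => /andP[q11 q12].
  have [q2] := @rat_in_itvoo R (z.2 - e / 4) (z.2 + e / 4) ltac:(lra).
  rewrite in_itv/= => /andP[q21 q22].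
  exists (q1, q2, r).
    move=> w /= [/=]; rewrite !in_itv/= => /andP[w1 w2] /andP[w3 w4].
    apply: eA; rewrite -ball_normE /ball_/= normC_lt/= !ltr_norml.
    by apply/andP; split; lra.
  split; rewrite /= in_itv/=; lra.
rewrite bigcup_mkcond; apply: countable_bigcupT_measurable => [|p].
  exact: countableP.
case: ifP => // _; apply: measurableX; exact: measurable_itv.
Qed.

Lemma continuous2_measurable f : continuous f -> measurable_fun setT f.
Proof.
move=> /continuousP cf.
apply: (measurability _ (measurable_realfun.RGenOpens.measurableE R)).
move=> _ [_ [a [b ->] <-]]; rewrite setTI; apply: open_measurable2; apply: cf.
exact: interval_open.
Qed.

(** The pushforward by the reflection agrees with Lebesgue measure on half-open intervals.
    Reflections rather than translations are the basic symmetry because convolution evaluates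
    kernels at [z - w]; a translation is two reflections. *)
Lemma lebesgue_reflect (c : R) (A : set R) : measurable A ->
  mu ((fun x => c - x) @^-1` A) = mu A.
Proof.
move=> mA.
have mf : measurable_fun setT (fun x : R => c - x).
  by apply: continuous_measurable_fun => x; apply: cvgB; [exact: cvg_cst|exact: cvg_id].
have mf' : measurable_fun setT (fun x : measurableTypeR R => c - x : measurableTypeR R).
  exact: mf.
pose nu : {measure set (measurableTypeR R) -> \bar R} :=
  measure_function_pushforward__canonical__measure_function_Measure mu mf'.
suff /(_ A mA) -> : forall X : set R, measurable X -> mu X = nu X by [].
move=> X mX; apply: lebesgue_measure_unique => // Y [[a b] _ <-]/=.
rewrite /nu/= /pushforward.
have -> : (fun x => c - x) @^-1` `]a, b]%classic = `[c - b, c - a[%classic.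
  by apply/seteqP; split => x /=; rewrite !in_itv/= => /andP[? ?]; apply/andP; split; lra.
rewrite !lebesgue_measure_itv/= !lte_fin.
have -> : (c - b < c - a) = (a < b) by apply/idP/idP => ?; lra.
by case: ifP => // ab; rewrite -!EFinD; congr (_%:E); lra.
Qed.

Lemma lebesgue2_reflect (c : C) (A : set C) : measurable A ->
  @leb2 R ((fun z => c - z) @^-1` A) = @leb2 R A.
Proof.
have mf : measurable_fun setT (fun z : C => c - z).
  apply/measurable_fun_pairP; split; apply: (measurableT_comp (f := fun x : R => _ - x)) => //;
  by apply: continuous_measurable_fun => x; apply: cvgB; [exact: cvg_cst|exact: cvg_id].
move=> mA.
have mf' : measurable_fun setT (fun z : measurableTypeR R * measurableTypeR R =>
    c - z : measurableTypeR R * measurableTypeR R) by exact: mf.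
pose nu : {measure set (measurableTypeR R * measurableTypeR R) -> \bar R} :=
  measure_function_pushforward__canonical__measure_function_Measure (@leb2 R) mf'.
suff /(_ A mA) -> : forall X : set C, measurable X -> @leb2 R X = nu X by [].
move=> X mX; apply: product_measure_unique => // A1 B1 mA1 mB1.
rewrite /nu/= /pushforward.
have -> : (fun z : C => c - z) @^-1` (A1 `*` B1) =
  ((fun x => c.1 - x) @^-1` A1) `*` ((fun x => c.2 - x) @^-1` B1) by [].
have mfR (d : R) : measurable_fun setT (fun x : R => d - x).
  by apply: continuous_measurable_fun => x; apply: cvgB; [exact: cvg_cst|exact: cvg_id].
rewrite product_measure1E//; last 2 first.
  by rewrite -[_ @^-1` _]setTI; exact: mfR.
  by rewrite -[_ @^-1` _]setTI; exact: mfR.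
congr (_ * _)%E; exact: lebesgue_reflect.
Qed.

Lemma measurable_reflect (c : C) : measurable_fun setT (fun z : C => c - z).
Proof.
apply/measurable_fun_pairP; split; apply: (measurableT_comp (f := fun x : R => _ - x)) => //;
  by apply: continuous_measurable_fun => x; apply: cvgB; [exact: cvg_cst|exact: cvg_id].
Qed.

Lemma ge0_integral_reflect (c : C) (F : C -> \bar R) : measurable_fun setT F ->
  (forall z, 0 <= F z)%E ->
  (\int[@leb2 R]_z F (c - z)%R = \int[@leb2 R]_z F z)%E.
Proof.
move=> mF F0.
have mf : measurable_fun setT (fun z : measurableTypeR R * measurableTypeR R =>
    c - z : measurableTypeR R * measurableTypeR R) by exact: measurable_reflect.
pose nu : {measure set (measurableTypeR R * measurableTypeR R) -> \bar R} :=
  measure_function_pushforward__canonical__measure_function_Measure (@leb2 R) mf.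
transitivity (\int[nu]_z F z)%E.
  by rewrite /nu/= ge0_integral_pushforward.
by apply: eq_measure_integral => A mA _; exact: (lebesgue2_reflect c mA).
Qed.

End PlaneMeasure.

Section PlaneIntegral.
Context {R : realType}.
Local Notation C := (R * R)%type.
Implicit Types (f g : C -> R) (z w c : C).

Definition Ig f := (@leb2 R).-integrable setT (EFin \o f).
Definition J f : R := (\int[@leb2 R]_z f z)%R.

Lemma Ig_meas f : Ig f -> measurable_fun setT f.
Proof. by move=> /measurable_int/measurable_EFinP. Qed.

Lemma Ig_le f g : measurable_fun setT f -> Ig g -> (forall z, `|f z| <= g z) -> Ig f.
Proof.
move=> mf ig fg; apply: le_integrable ig => //; first exact/measurable_EFinP.
by move=> z _ /=; rewrite lee_fin (le_trans (fg z))// ler_norm.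
Qed.

Lemma eq_Ig f g : f =1 g -> Ig f -> Ig g.
Proof. by move=> /funext ->. Qed.

Lemma eq_J f g : f =1 g -> J f = J g.
Proof. by move=> /funext ->. Qed.

Lemma IgD f g : Ig f -> Ig g -> Ig (fun z => f z + g z).
Proof. by move=> jf jg; have := integrableD measurableT jf jg. Qed.

Lemma IgB f g : Ig f -> Ig g -> Ig (fun z => f z - g z).
Proof. by move=> jf jg; have := integrableB measurableT jf jg. Qed.

Lemma IgZ k f : Ig f -> Ig (fun z => k * f z).
Proof. by move=> jf; have := integrableZl measurableT k jf. Qed.

Lemma Ig_abs f : Ig f -> Ig (fun z => `|f z|).
Proof. by move=> jf; have := integrable_abse jf. Qed.

Lemma JD f g : Ig f -> Ig g -> J (fun z => f z + g z) = J f + J g.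
Proof. by move=> jf jg; exact: RintegralD. Qed.

Lemma JB f g : Ig f -> Ig g -> J (fun z => f z - g z) = J f - J g.
Proof. by move=> jf jg; exact: RintegralB. Qed.

Lemma JZ k f : Ig f -> J (fun z => k * f z) = k * J f.
Proof. by move=> jf; exact: RintegralZl. Qed.

Lemma J0 : J (fun _ => 0) = 0.
Proof. by rewrite /J Rintegral_cst// mul0r. Qed.

Lemma J_ge0 f : (forall z, 0 <= f z) -> 0 <= J f.
Proof. by move=> f0; apply: Rintegral_ge0. Qed.

Lemma J_le f g : Ig f -> Ig g -> (forall z, f z <= g z) -> J f <= J g.
Proof. by move=> jf jg fg; apply: le_Rintegral. Qed.

Lemma J_abs f : Ig f -> `|J f| <= J (fun z => `|f z|).
Proof. by move=> jf; apply: le_normr_Rintegral. Qed.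

Lemma J_abs_le f g : measurable_fun setT f -> Ig g -> (forall z, `|f z| <= g z) -> `|J f| <= J g.
Proof.
move=> mf ig fg; have jf := Ig_le mf ig fg.
by rewrite (le_trans (J_abs jf))// J_le//; exact: Ig_abs.
Qed.

Lemma JE f : Ig f -> (J f)%:E = (\int[@leb2 R]_z (f z)%:E)%E.
Proof. by move=> jf; rewrite fineK//; exact: integrable_fin_num. Qed.

Lemma ge0_Ig f K : measurable_fun setT f -> (forall z, 0 <= f z) ->
  (\int[@leb2 R]_z (f z)%:E <= K%:E)%E -> Ig f /\ J f <= K.
Proof.
move=> mf f0 fK; have jf : Ig f.
  apply/integrableP; split; first exact/measurable_EFinP.
  under eq_integral do rewrite /= ger0_norm//.
  by rewrite (le_lt_trans fK)// ltry.
by split=> //; rewrite -lee_fin JE.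
Qed.

Lemma Ig_reflect c f : Ig f -> Ig (fun w => f (c - w)).
Proof.
move=> jf; have mf := Ig_meas jf.
have mfc : measurable_fun setT (fun w => f (c - w)).
  by apply: (measurableT_comp mf); exact: measurable_reflect.
apply/integrableP; split; first exact/measurable_EFinP.
rewrite (@ge0_integral_reflect R c (fun w => `|(f w)%:E|%E))//.
  by case/integrableP: jf.
by apply/measurable_EFinP; exact: measurableT_comp.
Qed.

Lemma J_reflect c f : measurable_fun setT f -> J (fun w => f (c - w)) = J f.
Proof.
move=> mf; rewrite /J /Rintegral; congr fine.
rewrite integralE [in RHS]integralE; congr (_ - _)%E.
- have mp : measurable_fun setT (EFin \o f)^\+%E.
    by apply: measurable_funepos; exact/measurable_EFinP.
  rewrite -(@ge0_integral_reflect R c _ mp)//.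
  by apply: eq_integral => x _; rewrite !funeposE.
- have mn : measurable_fun setT (EFin \o f)^\-%E.
    by apply: measurable_funeneg; exact/measurable_EFinP.
  rewrite -(@ge0_integral_reflect R c _ mn)//.
  by apply: eq_integral => x _; rewrite !funenegE.
Qed.

(** The norm of a pair is the maximum norm, so this is the indicator of a square, which suits
    Fubini. *)
Definition box (r : R) z : R := (`|z| <= r)%R%:R.

Lemma measurable_norm2 : measurable_fun setT (fun z : C => `|z|).
Proof. by apply: continuous2_measurable => z; exact: norm_continuous. Qed.

Lemma box_set r : [set z : C | `|z| <= r] = `[- r, r]%classic `*` `[- r, r]%classic.
Proof.
by apply/seteqP; split=> z /=; rewrite normC_le !ler_norml !in_itv/= => /andP.
Qed.

Lemma measurable_box_set r : measurable [set z : C | `|z| <= r].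
Proof. by rewrite box_set; apply: measurableX; exact: measurable_itv. Qed.

Lemma boxE r : box r = \1_[set z : C | `|z| <= r].
Proof.
apply/funext => z; rewrite /box indicE; congr (nat_of_bool _)%:R.
by apply/idP/idP => [h|/set_mem//]; exact/mem_set.
Qed.

Lemma measurable_box r : measurable_fun setT (box r).
Proof. by rewrite boxE; exact: measurable_indic (measurable_box_set r). Qed.

Lemma leb2_box r : 0 <= r -> @leb2 R [set z : C | `|z| <= r] = (4 * r ^+ 2)%:E.
Proof.
move=> r0; have E : @lebesgue_measure R `[- r, r]%classic = (2 * r)%:E.
  rewrite lebesgue_measure_itv/= lte_fin.
  case: ifP => [_|/negbT]; first by rewrite -EFinD; congr EFin; ring.
  by rewrite -leNgt => r0'; congr EFin; lra.
rewrite box_set /leb2 product_measure1E; [|exact: measurable_itv..].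
by rewrite [X in (X * _)%E]E [X in (_ * X)%E]E -EFinM; congr EFin; ring.
Qed.

Lemma Ig_box r : 0 <= r -> Ig (box r) /\ J (box r) = 4 * r ^+ 2.
Proof.
move=> r0.
have E : (\int[@leb2 R]_z (box r z)%:E = (4 * r ^+ 2)%:E)%E.
  have mb := measurable_box_set r; rewrite boxE.
  rewrite integral_indic//.
  by rewrite setIT; exact: leb2_box.
have b0 z : 0 <= box r z by rewrite /box.
have [jb _] := @ge0_Ig (box r) (4 * r ^+ 2) (measurable_box r) b0 ltac:(by rewrite E).
split=> //; by apply: EFin_inj; rewrite JE.
Qed.

Lemma bounded_Ig f M r : measurable_fun setT f -> 0 <= r -> (forall z, `|f z| <= M) ->
  (forall z, r < `|z| -> f z = 0) -> Ig f /\ J (fun z => `|f z|) <= M * (4 * r ^+ 2).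
Proof.
move=> mf r0 fM f0; have [jb Jb] := Ig_box r0.
have M0 : 0 <= M by rewrite (le_trans _ (fM 0)).
have fb z : `|f z| <= M * box r z.
  rewrite /box; case: (leP `|z| r) => [|/f0 ->]; first by rewrite mulr1.
  by rewrite normr0 mulr0.
have jf : Ig f by apply: Ig_le mf _ fb; exact: IgZ.
split=> //; rewrite -Jb -JZ//; apply: J_le => //; [exact: Ig_abs|exact: IgZ].
Qed.

(** Layers in place of polar coordinates: f is dominated by the series of the [a n * box (rho n)],
    which is integrated term by term. *)
Lemma layer_Ig f (a rho : nat -> R) S : measurable_fun setT f -> (forall z, 0 <= f z) ->
  (forall n, 0 <= a n) -> (forall n, 0 <= rho n) ->
  (forall z, 0 < f z -> exists2 n, `|z| <= rho n & f z <= a n) ->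
  (forall n, \sum_(i < n) a i * (4 * rho i ^+ 2) <= S) ->
  Ig f /\ J f <= S.
Proof.
move=> mf f0 a0 rho0 fa aS; apply: ge0_Ig => //.
pose h n z := (a n * box (rho n) z)%:E.
have h0 n z : (0 <= h n z)%E by rewrite lee_fin mulr_ge0.
have mh n : measurable_fun setT (h n).
  by apply/measurable_EFinP; apply: measurable_funM => //; exact: measurable_box.
apply: (@le_trans _ _ (\int[@leb2 R]_z \sum_(0 <= n <oo) h n z)%E).
  apply: ge0_le_integral => //.
  - by move=> z _; rewrite lee_fin.
  - exact/measurable_EFinP.
  - by apply: ge0_emeasurable_sum => *; [exact: h0|exact: mh].
  - move=> z _; have [/fa[n zn fn]|] := ltP 0 (f z); last first.
      by move=> fz; apply: (@le_trans _ _ 0%E); rewrite ?lee_fin ?nneseries_ge0.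
    apply: (@le_trans _ _ (h n z)).
      by rewrite /h lee_fin /box zn mulr1.
    rewrite (@nneseriesD1 _ _ n xpredT)//=.
    rewrite leeDl//; apply: (@nneseries_ge0 _ (h^~ z) (fun k => k != n) 0%N) => k _ _; exact: h0.
rewrite integral_nneseries//.
apply: lime_le; first by apply: is_cvg_nneseries => *; apply: integral_ge0 => *; exact: h0.
apply: nearW => n; rewrite big_mkord.
rewrite (eq_bigr (fun i : 'I_n => (a i * (4 * rho i ^+ 2))%:E)).
  by rewrite sumEFin lee_fin; exact: aS.
move=> i _; rewrite /h.
have [jb Jb] := Ig_box (rho0 i).
by rewrite -Jb -JZ// JE//; exact: IgZ.
Qed.

Lemma geo_sum_le (q : R) n : 0 <= q < 1 -> \sum_(i < n) q ^+ i <= (1 - q)^-1.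
Proof.
move=> /andP[q0 q1].
have : (1 - q) * \sum_(i < n) q ^+ i = 1 - q ^+ n.
  by rewrite -opprB mulNr -subrX1 opprB.
move=> E; rewrite -(ler_pM2l (_ : 0 < 1 - q)) ?subr_gt0// E mulfV ?gt_eqF ?subr_gt0//.
by rewrite gerBl exprn_ge0.
Qed.

Lemma exists_dyadic (x : R) : 1 <= x -> exists n, 2 ^+ n <= x < 2 ^+ n.+1.
Proof.
move=> x1.
have ex : exists n, x < 2 ^+ n.
  exists (Num.truncn x).+1; rewrite (lt_trans (truncnS_gt x))//.
  by rewrite -natrX ltr_nat ltn_expl.
pose m := ex_minn ex; have := erefl m; rewrite {1}/m; case: ex_minnP => -[|n] xn mn _.
  by move: xn; rewrite expr0 ltNge x1.
exists n; rewrite xn andbT leNgt; apply/negP => /mn; by rewrite ltnn.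
Qed.

End PlaneIntegral.

(** * The kernel *)

Section Kernels.
Context {R : realType}.
Local Notation C := (R * R)%type.
Implicit Types (f g : C -> R) (z w c y : C).

Lemma measurable_inv d (T : measurableType d) (f : T -> R) : measurable_fun setT f ->
  (forall x, 0 <= f x) -> measurable_fun setT (fun x => (f x)^-1).
Proof.
move=> mf f0; rewrite (_ : (fun x => _) = (fun x => f x `^ (-1))).
  by apply: (measurableT_comp (f := fun y : R => y `^ (-1))) => //; exact: measurable_powR.
by apply/funext => x; rewrite powR_inv1.
Qed.

Lemma measurable1 : measurable_fun setT (fun z : C => z.1).
Proof. exact: measurable_fst. Qed.

Lemma measurable2 : measurable_fun setT (fun z : C => z.2).
Proof. exact: measurable_snd. Qed.

Definition nq z : R := z.1 ^+ 2 + z.2 ^+ 2.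

Lemma nq_ge z : `|z| ^+ 2 <= nq z.
Proof.
rewrite normC /nq; have := sqr_ge0 z.1; have := sqr_ge0 z.2.
by rewrite maxEle; case: ifP => _; rewrite real_normK ?num_real//; lra.
Qed.

Lemma nq_le z : nq z <= 2 * `|z| ^+ 2.
Proof.
have h (a : R) : `|a| <= `|z| -> a ^+ 2 <= `|z| ^+ 2.
  by move=> az; rewrite -[a ^+ 2]ger0_norm ?sqr_ge0// normrX ler_sqr ?nnegrE.
by have := h _ (norm1_le z); have := h _ (norm2_le z); rewrite /nq; lra.
Qed.

Lemma nq_ge0 z : 0 <= nq z.
Proof. by rewrite /nq addr_ge0 ?sqr_ge0. Qed.

Lemma nq_gt0 z : 0 < `|z| -> 0 < nq z.
Proof. by move=> z0; rewrite (lt_le_trans _ (nq_ge z))// exprn_gt0. Qed.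

Lemma measurable_nq : measurable_fun setT nq.
Proof.
by apply: measurable_funD; apply: measurable_funX; [exact: measurable1|exact: measurable2].
Qed.

(** The real part of (a + i b) / (2 pi z). The pairs (cos theta, sin theta) and (sin theta, - cos
    theta) give the two components of K, so one family serves both. *)
Definition kap (a b : R) z : R := (a * z.1 + b * z.2) / (2 * pi * nq z).

Lemma measurable_kap a b : measurable_fun setT (kap a b).
Proof.
apply: measurable_funM.
  by apply: measurable_funD; apply: measurable_funM.
apply: measurable_inv; first by apply: measurable_funM => //; exact: measurable_nq.
by move=> z; rewrite !mulr_ge0 ?nq_ge0 ?pi_ge0.
Qed.

Lemma kap_le a b z : `|a| <= 1 -> `|b| <= 1 -> `|kap a b z| <= `|z|^-1.
Proof.
move=> a1 b1; have [z0|z0] := leP `|z| 0.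
  have -> : z = 0 by apply/eqP; rewrite -normr_le0.
  by rewrite /kap/= !mulr0 addr0 mul0r normr0 invr_ge0.
have n0 := nq_gt0 z0; have p2 := @pi_ge2 R.
have p0 : 0 < 2 * pi * nq z by rewrite !mulr_gt0 ?pi_gt0.
rewrite /kap normrM normfV (gtr0_norm p0) ler_pdivrMr// ler_pdivlMl//.
have h1 : `|a * z.1 + b * z.2| <= 2 * `|z|.
  rewrite (le_trans (ler_normD _ _))// !normrM.
  have := ler_pM (normr_ge0 _) (normr_ge0 _) a1 (norm1_le z).
  have := ler_pM (normr_ge0 _) (normr_ge0 _) b1 (norm2_le z).
  lra.
apply: (@le_trans _ _ (`|z| * (2 * `|z|))); first by rewrite ler_pM2l.
have := nq_ge z; nra.
Qed.

(** The real part of - (a + i b) y / (2 pi w^2), with w^-2 written as conj(w)^2 / |w|^4. It is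
    linear in y, which is what a barycentric combination cancels. *)
Definition dkap (a b : R) w y : R :=
  - (a * (y.1 * (w.1 ^+ 2 - w.2 ^+ 2) - y.2 * (- 2 * w.1 * w.2))
     - b * (y.1 * (- 2 * w.1 * w.2) + y.2 * (w.1 ^+ 2 - w.2 ^+ 2)))
  / (2 * pi * nq w ^+ 2).

(* Real form of 1/(y-w) = -1/w - y/w^2 - y^2/(w^2(w-y)). *)
Lemma kap_taylor a b w y : `|a| <= 1 -> `|b| <= 1 -> 0 < `|w| -> 2 * `|y| <= `|w| ->
  `|kap a b (y - w) - kap a b (- w) - dkap a b w y| <= 16 * `|y| ^+ 2 / `|w| ^+ 3.
Proof.
move=> a1 b1 w0 yw; pose u := w - y.
have u0 : `|w| <= 2 * `|u|.
  have : `|w| <= `|u| + `|y| by rewrite /u; have := ler_normD (w - y) y; rewrite subrK.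
  lra.
have nw0 := nq_gt0 w0; have nu0 : 0 < nq u by apply: nq_gt0; lra.
(* In complex notation c is conj(w)^2, s is y^2, t is their product, and E is the real part of (a +
   i b) t conj(u). *)
pose c1 := w.1 ^+ 2 - w.2 ^+ 2; pose c2 := - 2 * w.1 * w.2.
pose s1 := y.1 ^+ 2 - y.2 ^+ 2; pose s2 := 2 * y.1 * y.2.
pose t1 := s1 * c1 - s2 * c2; pose t2 := s1 * c2 + s2 * c1.
pose E := a * (t1 * u.1 + t2 * u.2) - b * (t2 * u.1 - t1 * u.2).
have -> : kap a b (y - w) - kap a b (- w) - dkap a b w y = - (E / (2 * pi * nq w ^+ 2 * nq u)).
  rewrite /kap /dkap /E /t1 /t2 /s1 /s2 /c1 /c2; move: nw0 nu0; rewrite /u /nq/= => nw0 nu0.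
  have pi0 : (pi : R) != 0 by rewrite gt_eqF ?pi_gt0.
  move: (pi : R) pi0 => p p0; case: (w) (y) nw0 nu0 => [w1 w2] [y1 y2] /= /gt_eqF/negbT nw0 /gt_eqF/negbT nu0.
  by field; rewrite nw0 nu0 p0.
rewrite normrN normrM normfV; have pi2 := @pi_ge2 R.
have p0 : 0 < 2 * pi * nq w ^+ 2 * nq u by rewrite !mulr_gt0 ?exprn_gt0 ?pi_gt0.
rewrite (gtr0_norm p0) ler_pdivrMr//.
have sq (p : C) : `|p.1 ^+ 2 - p.2 ^+ 2| <= 2 * `|p| ^+ 2 /\ `|2 * p.1 * p.2| <= 2 * `|p| ^+ 2.
  have := norm1_le p; have := norm2_le p => p1 p2; have := normr_ge0 p.1; have := normr_ge0 p.2.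
  split; [rewrite (le_trans (ler_normB _ _))// !normrX|rewrite !normrM ger0_norm//]; nra.
have [hc1 hc2] := sq w; have [hs1 hs2] := sq y; rewrite -/c1 in hc1; rewrite -/s1 -/s2 in hs1 hs2.
have {}hc2 : `|c2| <= 2 * `|w| ^+ 2 by rewrite (_ : c2 = - (2 * w.1 * w.2)) ?normrN// /c2; ring.
set Y := `|y| ^+ 2 in hs1 hs2 *; set W := `|w| ^+ 2 in hc1 hc2 *.
have Y0 : 0 <= Y by rewrite /Y exprn_ge0.
have W0 : 0 <= W by rewrite /W exprn_ge0.
have pr (p q : R) : `|p| <= 2 * Y -> `|q| <= 2 * W -> `|p * q| <= 4 * (Y * W).
  by move=> pY qW; rewrite normrM (le_trans (ler_pM _ _ pY qW))//; lra.
have ht1 : `|t1| <= 8 * (Y * W).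
  by rewrite (le_trans (ler_normB _ _))//; have := pr _ _ hs1 hc1; have := pr _ _ hs2 hc2; lra.
have ht2 : `|t2| <= 8 * (Y * W).
  by rewrite (le_trans (ler_normD _ _))//; have := pr _ _ hs1 hc2; have := pr _ _ hs2 hc1; lra.
have YW0 : 0 <= Y * W by rewrite mulr_ge0.
have pu (p : R) (q : R) : `|p| <= 8 * (Y * W) -> `|q| <= `|u| -> `|p * q| <= 8 * (Y * W) * `|u|.
  by move=> pY qu; rewrite normrM ler_pM.
have hE : `|E| <= 32 * (Y * W) * `|u|.
  rewrite /E (le_trans (ler_normB _ _))// !normrM.
  have e1 : `|t1 * u.1 + t2 * u.2| <= 16 * (Y * W) * `|u|.
    rewrite (le_trans (ler_normD _ _))//.
    by have := pu _ _ ht1 (norm1_le u); have := pu _ _ ht2 (norm2_le u); lra.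
  have e2 : `|t2 * u.1 - t1 * u.2| <= 16 * (Y * W) * `|u|.
    rewrite (le_trans (ler_normB _ _))//.
    by have := pu _ _ ht2 (norm1_le u); have := pu _ _ ht1 (norm2_le u); lra.
  have := ler_pM (normr_ge0 _) (normr_ge0 _) a1 e1.
  have := ler_pM (normr_ge0 _) (normr_ge0 _) b1 e2; lra.
apply: (le_trans hE).
have u00 : 0 < `|u| by lra.
have Wn : W ^+ 2 <= nq w ^+ 2 by rewrite lerXn2r ?nnegrE ?nq_ge0 ?nq_ge.
have Un := nq_ge u.
have w3 : 0 < `|w| ^+ 3 by rewrite exprn_gt0.
have -> : 16 * Y / `|w| ^+ 3 * (2 * pi * nq w ^+ 2 * nq u) =
   (32 * Y) * (pi * (nq w ^+ 2 * nq u) / `|w| ^+ 3) by ring.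
have -> : 32 * (Y * W) * `|u| = (32 * Y) * (W * `|u|) by ring.
apply: ler_wpM2l; first by lra.
rewrite ler_pdivlMr//.
have h1 : W ^+ 2 * `|u| ^+ 2 <= nq w ^+ 2 * nq u by rewrite ler_pM// ?exprn_ge0.
have h2 : W * `|u| * `|w| ^+ 3 = W ^+ 2 * (`|w| * `|u|) by rewrite /W; ring.
rewrite h2; apply: (@le_trans _ _ (2 * (W ^+ 2 * `|u| ^+ 2))).
  have -> : 2 * (W ^+ 2 * `|u| ^+ 2) = W ^+ 2 * (2 * `|u| * `|u|) by ring.
  by apply: ler_wpM2l; [exact: sqr_ge0|apply: ler_wpM2r => //; exact: ltW].
apply: ler_pM => //.
by rewrite mulr_ge0 ?sqr_ge0.
Qed.

End Kernels.

Section Kernels2.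
Context {R : realType}.
Local Notation C := (R * R)%type.
Implicit Types (f g : C -> R) (z w c y : C).

Lemma le_pow (a b : R) n : 0 <= a -> a <= b -> a ^+ n <= b ^+ n.
Proof. by move=> x0 xy; rewrite lerXn2r ?nnegrE// (le_trans x0). Qed.

(** The two profiles that dominate all kernels: |w|^-1 is integrable at the origin and |w|^-3 at
    infinity, with masses of order r and 1 / r. *)
Definition near r w : R := box r w / `|w|.
Definition far r w : R := (1 - box r w) / `|w| ^+ 3.

Lemma box_ge0 r z : 0 <= box r z.
Proof. by rewrite /box. Qed.

Lemma half_pow n : (2^-1 : R) ^+ n = (2 ^+ n)^-1.
Proof. by rewrite exprVn. Qed.

Lemma near_ge0 r w : 0 <= near r w.
Proof. by rewrite /near mulr_ge0 ?box_ge0. Qed.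

Lemma far_ge0 r w : 0 <= far r w.
Proof.
apply: divr_ge0; last by rewrite exprn_ge0.
by rewrite /box; case: (leP `|w| r) => _; rewrite ?subrr ?subr0.
Qed.

Lemma measurable_near r : measurable_fun setT (near r).
Proof.
apply: measurable_funM; first exact: measurable_box.
by apply: measurable_inv => //; exact: measurable_norm2.
Qed.

Lemma measurable_far r : measurable_fun setT (far r).
Proof.
apply: measurable_funM.
  by apply: measurable_funB => //; exact: measurable_box.
apply: measurable_inv; first by apply: measurable_funX; exact: measurable_norm2.
by move=> z; rewrite exprn_ge0.
Qed.

Lemma sum_half (K : R) n : 0 <= K -> \sum_(i < n) K * 2^-1 ^+ i <= 2 * K.
Proof.
move=> K0; rewrite -mulr_sumr mulrC ler_wpM2r//.
have := @geo_sum_le R 2^-1 n; have -> : (1 - 2^-1 : R)^-1 = 2 by field.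
by apply; lra.
Qed.

Lemma near_Ig r : 0 < r -> Ig (near r) /\ J (near r) <= 16 * r.
Proof.
move=> r0; apply: (@layer_Ig _ _ (fun n => 2 ^+ n.+1 / r) (fun n => r / 2 ^+ n)).
- exact: measurable_near.
- by move=> z; exact: near_ge0.
- by move=> n; rewrite divr_ge0 ?exprn_ge0 ?ltW.
- by move=> n; rewrite divr_ge0 ?exprn_ge0 ?ltW.
- move=> w; rewrite /near /box; case: (leP `|w| r) => [wr|]; last by rewrite mul0r ltxx.
  rewrite mul1r invr_gt0 => w0.
  have [|n /andP[n1 n2]] := @exists_dyadic R (r / `|w|); first by rewrite ler_pdivlMr// mul1r.
  exists n.
    by rewrite ler_pdivlMr ?exprn_gt0// mulrC -ler_pdivlMr.
  rewrite ler_pdivlMr// mulrC ltW//.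
- move=> n; rewrite (eq_bigr (fun i : 'I_n => (8 * r) * 2^-1 ^+ i)).
    by rewrite (le_trans (sum_half _ _))//; lra.
  move=> i _; rewrite half_pow (exprS 2 i); field.
  by rewrite (gt_eqF r0) expf_neq0.
Qed.

Lemma far_Ig r : 0 < r -> Ig (far r) /\ J (far r) <= 32 / r.
Proof.
move=> r0; apply: (@layer_Ig _ _ (fun n => ((r * 2 ^+ n) ^+ 3)^-1) (fun n => r * 2 ^+ n.+1)).
- exact: measurable_far.
- by move=> z; exact: far_ge0.
- by move=> n; rewrite invr_ge0 exprn_ge0// mulr_ge0 ?exprn_ge0 ?ltW.
- by move=> n; rewrite mulr_ge0 ?exprn_ge0 ?ltW.
- move=> w; rewrite /far /box; case: (leP `|w| r) => [_|wr]; first by rewrite subrr mul0r ltxx.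
  rewrite subr0 mul1r => _; have w0 : 0 < `|w| by lra.
  have [|n /andP[n1 n2]] := @exists_dyadic R (`|w| / r); first by rewrite ler_pdivlMr// mul1r ltW.
  exists n; first by move: n2; rewrite ltr_pdivrMr// mulrC => /ltW.
  rewrite lef_pV2 ?posrE ?exprn_gt0 ?mulr_gt0 ?exprn_gt0//.
  apply: le_pow; first by rewrite mulr_ge0 ?exprn_ge0 ?ltW.
  by rewrite mulrC -ler_pdivlMr.
- move=> n; rewrite (eq_bigr (fun i : 'I_n => (16 / r) * 2^-1 ^+ i)).
    by apply: (le_trans (sum_half _ _)); [rewrite divr_ge0// ltW|lra].
  move=> i _; rewrite half_pow (exprS 2 i); field.
  by rewrite (gt_eqF r0) expf_neq0.
Qed.

(** A majorant, in the maximum norm, of half the Laplacian of (1/2) log(|z|^2 + s). Scaling makes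
    its mass independent of s. *)
Definition pker (s : R) w : R := s / (`|w| ^+ 2 + s) ^+ 2.

Lemma measurable_pker s : 0 < s -> measurable_fun setT (pker s).
Proof.
move=> s0; apply: measurable_funM => //; apply: measurable_inv.
  by apply/measurable_funX/measurable_funD => //; apply: measurable_funX; exact: measurable_norm2.
by move=> z; rewrite sqr_ge0.
Qed.

Lemma pker_Ig d : 0 < d -> Ig (pker (d ^+ 2)) /\ J (pker (d ^+ 2)) <= 32.
Proof.
move=> d0; have s0 : 0 < d ^+ 2 by rewrite exprn_gt0.
apply: (@layer_Ig _ _ (fun n => ((4 ^+ n) ^+ 2 * d ^+ 2)^-1) (fun n => d * 2 ^+ n.+1)).
- exact: measurable_pker.
- by move=> z; rewrite /pker divr_ge0 ?sqr_ge0 ?exprn_ge0 ?ltW.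
- by move=> n; rewrite invr_ge0 mulr_ge0 ?exprn_ge0 ?exprn_ge0 ?ltW.
- by move=> n; rewrite mulr_ge0 ?exprn_ge0 ?ltW.
- move=> w _; rewrite /pker.
  have q0 : 0 < (`|w| ^+ 2 + d ^+ 2) by rewrite ltr_wpDl ?exprn_ge0.
  have hb n : 2 ^+ n * d <= `|w| \/ n = 0%N ->
     d ^+ 2 / (`|w| ^+ 2 + d ^+ 2) ^+ 2 <= ((4 ^+ n) ^+ 2 * d ^+ 2)^-1.
    move=> hn; rewrite ler_pdivrMr ?exprn_gt0// ler_pdivlMl ?mulr_gt0 ?exprn_gt0//.
    have -> : (4 ^+ n) ^+ 2 * d ^+ 2 * d ^+ 2 = (4 ^+ n * d ^+ 2) ^+ 2 by ring.
    apply: le_pow; first by rewrite mulr_ge0 ?exprn_ge0 ?ltW.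
    case: hn => [hn|->]; last by rewrite expr0 mul1r lerDr exprn_ge0.
    rewrite (@le_trans _ _ (`|w| ^+ 2))//; last by rewrite lerDl ltW.
    have -> : 4 ^+ n * d ^+ 2 = (2 ^+ n * d) ^+ 2 :> R.
      by rewrite exprMn -exprM mulnC exprM; congr (_ ^+ _ * _); ring.
    by apply: le_pow => //; rewrite mulr_ge0 ?exprn_ge0 ?ltW.
  have [wd|wd] := leP `|w| d.
    exists 0%N; last by apply: hb; right.
    by rewrite expr1; nra.
  have [|n /andP[n1 n2]] := @exists_dyadic R (`|w| / d); first by rewrite ler_pdivlMr// mul1r ltW.
  exists n; first by move: n2; rewrite ltr_pdivrMr// mulrC => /ltW.
  by apply: hb; left; move: n1; rewrite ler_pdivlMr.
- move=> n; apply: (@le_trans _ _ (\sum_(i < n) 16 * 2^-1 ^+ i)); last first.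
    by rewrite (le_trans (sum_half _ _))//; lra.
  apply: ler_sum => i _; rewrite half_pow.
  have -> : ((4 ^+ i) ^+ 2 * d ^+ 2)^-1 * (4 * (d * 2 ^+ i.+1) ^+ 2) = 16 * (4 ^+ i)^-1.
    have -> : 4 ^+ i = (2 ^+ i) ^+ 2 :> R.
      by rewrite -exprM mulnC exprM; congr (_ ^+ _); ring.
    rewrite (exprS 2 i); field.
    by rewrite (gt_eqF d0) expf_neq0.
  by rewrite ler_wpM2l// lef_pV2 ?posrE ?exprn_gt0// le_pow//; lra.
Qed.

End Kernels2.

(** * Iterated integrals over squares and integration along lines *)

Section Iterated.
Context {R : realType}.
Local Notation C := (R * R)%type.
Local Notation mu := (@lebesgue_measure R).
Implicit Types (f g h : C -> R) (z w : C).

Lemma box_compact (n : R) : compact [set z : C | `|z| <= n].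
Proof. by rewrite box_set; apply: compact_setX; exact: segment_compact. Qed.

Lemma cont_box_bounded g n : continuous g -> exists2 M, 0 <= M & forall z, `|z| <= n -> `|g z| <= M.
Proof.
move=> cg.
have cc : compact (g @` [set z : C | `|z| <= n]).
  apply: continuous_compact; last exact: box_compact.
  by apply: continuous_subspaceT.
have [M [Mr HM]] := compact_bounded cc.
exists (`|M| + 1); first by rewrite addr_ge0.
move=> z zn; apply: HM; last by exists z.
by rewrite (le_lt_trans (ler_norm M))// ltrDl.
Qed.

Lemma Ig_boxcont g n : 0 <= n -> continuous g -> Ig (fun z => box n z * g z).
Proof.
move=> n0 cg; have [M M0 gM] := cont_box_bounded n cg.
have [|||//] := @bounded_Ig _ (fun z => box n z * g z) M n _ n0.
- by apply: measurable_funM; [exact: measurable_box|exact: continuous2_measurable].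
- move=> z; rewrite /box; case: (leP `|z| n) => zn; first by rewrite mul1r gM.
  by rewrite mul0r normr0.
- by move=> z; rewrite /box ltNge => /negbTE ->; rewrite mul0r.
Qed.

Let inner1 (h : C -> R) n y : (\int[mu]_x (box n (x, y) * h (x, y))%:E =
  if (`|y| <= n)%R then \int[mu]_(x in `[(- n)%R, n]) (h (x, y))%:E else 0)%E.
Proof.
rewrite [X in if _ then X else _]integral_mkcond; case: ifPn => [yn|yn].
  apply: eq_integral => x _; rewrite patchE /box normC_le/= yn andbT.
  rewrite mem_setE in_itv/= -ler_norml.
  by case: ifP; rewrite ?mul1r ?mul0r.
rewrite -[RHS](integral0 mu setT); apply: eq_integral => x _.
by rewrite /box normC_le/= (negbTE yn) andbF mul0r.
Qed.

Let inner2 (h : C -> R) n x : (\int[mu]_y (box n (x, y) * h (x, y))%:E =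
  if (`|x| <= n)%R then \int[mu]_(y in `[(- n)%R, n]) (h (x, y))%:E else 0)%E.
Proof.
rewrite [X in if _ then X else _]integral_mkcond; case: ifPn => [yn|yn].
  apply: eq_integral => y _; rewrite patchE /box normC_le/= yn andTb.
  rewrite mem_setE in_itv/= -ler_norml.
  by case: ifP; rewrite ?mul1r ?mul0r.
rewrite -[RHS](integral0 mu setT); apply: eq_integral => y _.
by rewrite /box normC_le/= (negbTE yn) andFb mul0r.
Qed.

Lemma J_iter1 h n : Ig (fun z => box n z * h z) ->
  (J (fun z => box n z * h z))%:E =
  (\int[mu]_y (if (`|y| <= n)%R then \int[mu]_(x in `[(- n)%R, n]) (h (x, y))%:E else 0))%E.
Proof.
move=> jh; rewrite JE// /leb2 -integral21_prod_meas1//.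
by apply: eq_integral => y _; exact: inner1.
Qed.

Lemma J_iter2 h n : Ig (fun z => box n z * h z) ->
  (J (fun z => box n z * h z))%:E =
  (\int[mu]_x (if (`|x| <= n)%R then \int[mu]_(y in `[(- n)%R, n]) (h (x, y))%:E else 0))%E.
Proof.
move=> jh; rewrite JE// /leb2 -integral12_prod_meas1//.
by apply: eq_integral => x _; exact: inner2.
Qed.

Lemma J_iter1_eq h h' n : Ig (fun z => box n z * h z) -> Ig (fun z => box n z * h' z) ->
  (forall y, (`|y| <= n)%R -> \int[mu]_(x in `[(- n)%R, n]) (h (x, y))%:E =
                          \int[mu]_(x in `[(- n)%R, n]) (h' (x, y))%:E)%E ->
  J (fun z => box n z * h z) = J (fun z => box n z * h' z).
Proof.
move=> jh jh' E; apply: EFin_inj; rewrite (J_iter1 jh) (J_iter1 jh').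
by apply: eq_integral => y _; case: ifP => // /E.
Qed.

Lemma J_iter2_eq h h' n : Ig (fun z => box n z * h z) -> Ig (fun z => box n z * h' z) ->
  (forall x, (`|x| <= n)%R -> \int[mu]_(y in `[(- n)%R, n]) (h (x, y))%:E =
                          \int[mu]_(y in `[(- n)%R, n]) (h' (x, y))%:E)%E ->
  J (fun z => box n z * h z) = J (fun z => box n z * h' z).
Proof.
move=> jh jh' E; apply: EFin_inj; rewrite (J_iter2 jh) (J_iter2 jh').
by apply: eq_integral => y _; case: ifP => // /E.
Qed.

Let bound_aux (F : R -> \bar R) n c : 0 <= n -> 0 <= c -> measurable_fun setT F ->
  (forall x, `|F x| <= (if (`|x| <= n)%R then c%:E else 0))%E ->
  (`|\int[mu]_x F x| <= (c * (2 * n))%:E)%E.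
Proof.
move=> n0 c0 mF Fc; apply: (le_trans (le_abse_integral _ _ _)) => //.
have E : @lebesgue_measure R `[- n, n]%classic = (2 * n)%:E.
  rewrite lebesgue_measure_itv/= lte_fin.
  case: ifP => [_|/negbT]; first by rewrite -EFinD; congr EFin; ring.
  by rewrite -leNgt => r0'; congr EFin; lra.
apply: (@le_trans _ _ (\int[mu]_(x in `[(- n)%R, n]) c%:E)%E); last first.
  by rewrite integral_cst// [X in (_ * X)%E]E EFinM.
rewrite [leRHS]integral_mkcond; apply: ge0_le_integral => //.
- exact: measurableT_comp.
- by apply/(measurable_restrictT _ _).1 => //.
- move=> x _; apply: (le_trans (Fc x)).
  by rewrite patchE mem_setE in_itv/= -ler_norml.
Qed.

Lemma J_iter1_bound h n c : 0 <= n -> 0 <= c -> Ig (fun z => box n z * h z) ->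
  (forall y, (`|y| <= n)%R -> `|\int[mu]_(x in `[(- n)%R, n]) (h (x, y))%:E| <= c%:E)%E ->
  `|J (fun z => box n z * h z)| <= c * (2 * n).
Proof.
move=> n0 c0 jh hc; rewrite -lee_fin.
have -> : (`|J (fun z => box n z * h z)|%:E = `|(J (fun z => box n z * h z))%:E|)%E by [].
rewrite (J_iter1 jh); apply: bound_aux => //.
- rewrite (_ : (fun y => _) = (fun y => \int[mu]_x (box n (x, y) * h (x, y))%:E))%E.
    exact: measurable_fubini_G jh.
  by apply/funext => y; rewrite inner1.
- by move=> y; case: ifP => [/hc//|]; rewrite abse0.
Qed.

Lemma J_iter2_bound h n c : 0 <= n -> 0 <= c -> Ig (fun z => box n z * h z) ->
  (forall x, (`|x| <= n)%R -> `|\int[mu]_(y in `[(- n)%R, n]) (h (x, y))%:E| <= c%:E)%E ->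
  `|J (fun z => box n z * h z)| <= c * (2 * n).
Proof.
move=> n0 c0 jh hc; rewrite -lee_fin.
have -> : (`|J (fun z => box n z * h z)|%:E = `|(J (fun z => box n z * h z))%:E|)%E by [].
rewrite (J_iter2 jh); apply: bound_aux => //.
- rewrite (_ : (fun y => _) = (fun x => \int[mu]_y (box n (x, y) * h (x, y))%:E))%E.
    exact: measurable_fubini_F jh.
  by apply/funext => y; rewrite inner2.
- by move=> y; case: ifP => [/hc//|]; rewrite abse0.
Qed.

Lemma cont_line1 (h : R * R -> R) (y : R) : continuous h -> continuous (fun x => h (x, y)).
Proof.
move=> ch x; have : (fun x : R => (x, y)) @ x --> (x, y).
  exact: (@cvg_pair _ _ _ (nbhs x) (nbhs x) (nbhs y) _ _ _ id (cst y) cvg_id (cvg_cst y)).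
by move=> hc; exact: (cvg_comp _ _ hc (ch (x, y))).
Qed.
Lemma cont_line2 (h : R * R -> R) (x : R) : continuous h -> continuous (fun y => h (x, y)).
Proof.
move=> ch y; have : (fun y : R => (x, y)) @ y --> (x, y).
  exact: (@cvg_pair _ _ _ (nbhs y) (nbhs x) (nbhs y) _ _ _ (cst x) id (cvg_cst x) cvg_id).
by move=> hc; exact: (cvg_comp _ _ hc (ch (x, y))).
Qed.

Lemma FTC_itv (F f : R -> R) (n : R) : 0 < n -> continuous f ->
  (forall x : R, is_derive x 1 F (f x)) ->
  (\int[mu]_(x in `[(- n)%R, n]) (f x)%:E = (F n - F (- n)%R)%:E)%E.
Proof.
move=> n0 cf dF; rewrite EFinB; apply: continuous_FTC2.
- by lra.
- exact: continuous_subspaceT.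
- have dFx (x : R) : derivable F x 1 by case: (dF x).
  have cF (x : R) : {for x, continuous F} by apply/differentiable_continuous/derivable1_diffP.
  split; first by move=> x _; exact: dFx.
  + exact/cvg_at_right_filter/cF.
  + exact/cvg_at_left_filter/cF.
- by move=> x _; rewrite derive1E; case: (dF x).
Qed.

End Iterated.

(** * Exponential integrability of functions of bounded mean oscillation *)

Section Bellman.
Context {R : realType}.
Local Notation C := (R * R)%type.
Implicit Types (z w : C).

Lemma expR_le2 (x : R) : `|x| <= 4^-1 -> expR x <= 1 + x + 2 * x ^+ 2.
Proof.
rewrite ler_norml => /andP[x1 x2].
have e0 := expR_gt0 x; have := expR_ge1Dx (- x) => h.
have E : expR x * expR (- x) = 1 by rewrite -expRD subrr expR0.
have h2 : expR x * (1 - x) <= 1 by rewrite -[leRHS]E ler_wpM2l// ltW.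
have h3 : 1 <= (1 + x + 2 * x ^+ 2) * (1 - x).
  have : 0 <= x ^+ 2 * (1 - 2 * x) by rewrite mulr_ge0 ?sqr_ge0//; lra.
  have -> : (1 + x + 2 * x ^+ 2) * (1 - x) = 1 + x ^+ 2 * (1 - 2 * x) by ring.
  by lra.
by rewrite -(ler_pM2r (_ : 0 < 1 - x)); lra.
Qed.

(** The Bellman function is bel(variance) * exp(mean). It majorises the mean of exp F and, for small
    variance, is preserved when two halves of a rectangle are merged. *)
Definition bel (V : R) : R := 1 + 4 * V - 4 * V ^+ 2.

(* Concavity of [bel] beats the first-order cross term between the jump [d] of the mean
   and the difference of the two variances. *)
Lemma bel_two_point (d Vp Vm : R) : 0 <= Vp <= 50^-1 -> 0 <= Vm <= 50^-1 ->
  (Vp + Vm) / 2 + d ^+ 2 <= 50^-1 ->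
  expR d * bel Vp + expR (- d) * bel Vm <= 2 * bel ((Vp + Vm) / 2 + d ^+ 2).
Proof.
move=> /andP[p0 p1] /andP[m0 m1] dV; set D := d ^+ 2 in dV *.
have D0 : 0 <= D by exact: sqr_ge0.
have d4 : `|d| <= 4^-1.
  rewrite -(ler_pXn2r (_ : (0 < 2)%N))// ?nnegrE//.
  by rewrite real_normK ?num_real// -/D; lra.
have e1 := expR_le2 d4; have e2 : expR (- d) <= 1 - d + 2 * d ^+ 2.
  by have := @expR_le2 (- d); rewrite normrN sqrrN; exact.
rewrite -/D in e1 e2.
have b1 : 0 <= bel Vp by rewrite /bel; nra.
have b2 : 0 <= bel Vm by rewrite /bel; nra.
apply: (@le_trans _ _ ((1 + d + 2 * D) * bel Vp + (1 - d + 2 * D) * bel Vm)).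
  by apply: lerD; apply: ler_wpM2r.
pose v := (Vp + Vm) / 2; pose u := (Vp - Vm) / 2.
have -> : Vp = v + u by rewrite /v /u; field.
have -> : Vm = v - u by rewrite /v /u; field.
have -> : (v + u + (v - u)) / 2 = v by field.
rewrite /bel.
set G := 4 * D - 8 * v * D - 4 * D ^+ 2 + 4 * u ^+ 2 - 2 * D * (1 + 4 * v - 4 * v ^+ 2 - 4 * u ^+ 2)
         - d * u * (4 - 8 * v).
suff G0 : 0 <= G by rewrite -subr_ge0 (_ : _ - _ = 2 * G); [rewrite mulr_ge0|rewrite /G; ring].
rewrite /G.
have v0 : 0 <= v by rewrite /v; lra.
have vD : v + D <= 50^-1 by rewrite /v; lra.
have s0 : 0 <= u ^+ 2 by exact: sqr_ge0.
(* The cross term leaves D / 2 and (4 / 3) u^2 of the leading terms 2 D and 4 u^2 of G; since v + D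
   <= 1 / 50, the part D / 2 absorbs 25 D (v + D), more than the remaining negative terms. *)
have h1 : d * u * (4 - 8 * v) <= (3 / 2) * D + (8 / 3) * u ^+ 2.
  have h : d * u <= (3 / 8) * D + (2 / 3) * u ^+ 2.
    have := sqr_ge0 (d * (3 / 4) - u); rewrite sqrrB exprMn -/D; lra.
  have h4 : 0 <= 4 - 8 * v <= 4 by lra.
  move: h4 => /andP[h4 h5].
  have := ler_wpM2r h4 h.
  have : ((3 / 8) * D + (2 / 3) * u ^+ 2) * (4 - 8 * v) <= ((3 / 8) * D + (2 / 3) * u ^+ 2) * 4.
    by apply: ler_wpM2l => //; lra.
  by lra.
have : 0 <= D * (50^-1 - v - D) by rewrite mulr_ge0//; lra.
have : 0 <= D * v by rewrite mulr_ge0.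
have : 0 <= D * v ^+ 2 by rewrite mulr_ge0// sqr_ge0.
have : 0 <= D * u ^+ 2 by rewrite mulr_ge0.
have : 0 <= D ^+ 2 by exact: sqr_ge0.
by lra.
Qed.

(** The two-point inequality for unnormalised integrals over two halves of area m: a, a2, e stand
    for the integrals of F, F^2, exp F. The variance over the union is the mean of the two variances
    plus the square of half the jump of the means. *)
Lemma bel_combine (k m a a2 e b b2 f : R) : 0 < m -> 0 <= k ->
  0 <= a2 / m - (a / m) ^+ 2 <= 50^-1 -> 0 <= b2 / m - (b / m) ^+ 2 <= 50^-1 ->
  (a2 + b2) / (2 * m) - ((a + b) / (2 * m)) ^+ 2 <= 50^-1 ->
  e <= k * (m * (bel (a2 / m - (a / m) ^+ 2) * expR (a / m))) ->
  f <= k * (m * (bel (b2 / m - (b / m) ^+ 2) * expR (b / m))) ->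
  e + f <= k * (2 * m * (bel ((a2 + b2) / (2 * m) - ((a + b) / (2 * m)) ^+ 2)
                          * expR ((a + b) / (2 * m)))).
Proof.
move=> m0 k0; set Vp := a2 / m - _; set Vm := b2 / m - _ => hp hm.
pose X := (a + b) / (2 * m); pose d := (a / m - b / m) / 2.
have m0' : m != 0 by rewrite gt_eqF.
have -> : (a2 + b2) / (2 * m) - ((a + b) / (2 * m)) ^+ 2 = (Vp + Vm) / 2 + d ^+ 2.
  by rewrite /Vp /Vm /d; field.
rewrite -/X => hV he hf.
rewrite (_ : a / m = X + d) in he; last by rewrite /X /d; field.
rewrite (_ : b / m = X - d) in hf; last by rewrite /X /d; field.
apply: (le_trans (lerD he hf)); rewrite !expRD.
have := bel_two_point hp hm hV => h.
have -> : k * (m * (bel Vp * (expR X * expR d))) + k * (m * (bel Vm * (expR X * expR (- d)))) =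
  (k * m * expR X) * (expR d * bel Vp + expR (- d) * bel Vm) by ring.
have -> : k * (2 * m * (bel ((Vp + Vm) / 2 + d ^+ 2) * expR X)) =
  (k * m * expR X) * (2 * bel ((Vp + Vm) / 2 + d ^+ 2)) by ring.
by apply: ler_wpM2l => //; rewrite !mulr_ge0 ?expR_ge0// ltW.
Qed.

End Bellman.

Section Rect.
Context {R : realType}.
Local Notation C := (R * R)%type.
Implicit Types (z : C) (F : C -> R).

(** Half-open sides make halving an exact identity between indicators. *)
Definition rect (a p w h : R) z : R :=
  if (a <= z.1 < a + w) && (p <= z.2 < p + h) then 1 else 0.

Lemma rectE (a p w h : R) : rect a p w h = \1_(`[a, a + w[%classic `*` `[p, p + h[%classic).
Proof.
apply/funext => z; rewrite /rect indicE; case: ifPn => [/andP[h1 h2]|hn].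
  by rewrite mem_set//; split; rewrite /= in_itv/=.
by rewrite memNset// => -[] /=; rewrite !in_itv/= => h1 h2; rewrite h1 h2 in hn.
Qed.

Lemma measurable_rect (a p w h : R) : measurable_fun setT (rect a p w h).
Proof. by rewrite rectE; apply: measurable_indic; apply: measurableX; exact: measurable_itv. Qed.

Lemma rect_ge0 (a p w h : R) z : 0 <= rect a p w h z.
Proof. by rewrite /rect; case: ifP. Qed.

Lemma rect_le1 (a p w h : R) z : rect a p w h z <= 1.
Proof. by rewrite /rect; case: ifP => _. Qed.

Lemma rect_supp (a p w h : R) z : 0 <= w -> 0 <= h -> `|a| + `|p| + w + h < `|z| -> rect a p w h z = 0.
Proof.
move=> w0 h0 hz; rewrite /rect; case: ifP => // /andP[/andP[z1 z2] /andP[z3 z4]].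
move: hz; rewrite ltNge normC_le !ler_norml => /negP[].
have := ler_norm a; have := ler_norm p; have := ler_norm (- a); have := ler_norm (- p).
by rewrite !normrN => ? ? ? ?; apply/andP; split; apply/andP; split; lra.
Qed.

Lemma rect_splitx (a p w h : R) z : 0 <= w ->
  rect a p (2 * w) h z = rect a p w h z + rect (a + w) p w h z.
Proof.
move=> w0; rewrite /rect; have -> : a + w + w = a + 2 * w by ring.
case: (_ <= z.2 < _)%R; rewrite ?andbF ?andbT ?addr0//.
by have [h1|h1] := leP a z.1; have [h2|h2] := ltP z.1 (a + w);
  have [h3|h3] := ltP z.1 (a + 2 * w); rewrite /= ?addr0 ?add0r//; lra.
Qed.

Lemma rect_splity (a p w h : R) z : 0 <= h ->
  rect a p w (2 * h) z = rect a p w h z + rect a (p + h) w h z.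
Proof.
move=> w0; rewrite /rect; have -> : p + h + h = p + 2 * h by ring.
case: (_ <= z.1 < _)%R; rewrite ?andFb ?andTb ?addr0//.
by have [h1|h1] := leP p z.2; have [h2|h2] := ltP z.2 (p + h);
  have [h3|h3] := ltP z.2 (p + 2 * h); rewrite /= ?addr0 ?add0r//; lra.
Qed.

Lemma Ig_rectM (a p w h : R) F B : 0 <= w -> 0 <= h -> measurable_fun setT F ->
  (forall z, `|F z| <= B) -> Ig (fun z => rect a p w h z * F z).
Proof.
move=> w0 h0 mF FB.
have [||||//] := @bounded_Ig R (fun z => rect a p w h z * F z) B (`|a| + `|p| + w + h).
- by apply: measurable_funM => //; exact: measurable_rect.
- by rewrite !addr_ge0.
- by move=> z; rewrite normrM (le_trans _ (FB z))// ler_piMl// ger0_norm ?rect_le1 ?rect_ge0.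
- by move=> z hz; rewrite rect_supp// mul0r.
Qed.

Lemma Ig_rect (a p w h : R) : 0 <= w -> 0 <= h -> Ig (rect a p w h).
Proof.
move=> w0 h0; apply: (@eq_Ig _ (fun z => rect a p w h z * 1)); first by move=> z; rewrite mulr1.
by apply: (@Ig_rectM _ _ _ _ _ 1) => // z; rewrite normr1.
Qed.

Lemma J_rect (a p w h : R) : 0 <= w -> 0 <= h -> J (rect a p w h) = w * h.
Proof.
move=> w0 h0; apply: EFin_inj; rewrite JE; last exact: Ig_rect.
have E (c l : R) : 0 <= l -> @lebesgue_measure R `[c, c + l[%classic = l%:E.
  move=> l0; rewrite lebesgue_measure_itv/= lte_fin.
  case: ifP => [_|/negbT]; first by rewrite -EFinD; congr EFin; ring.
  by rewrite -leNgt => r0'; congr EFin; lra.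
have mQ : measurable (`[a, a + w[%classic `*` `[p, p + h[%classic : set C).
  by apply: measurableX; exact: measurable_itv.
rewrite rectE integral_indic//.
rewrite setIT; transitivity (@lebesgue_measure R `[a, (a + w)%R[%classic * @lebesgue_measure R `[p, (p + h)%R[%classic)%E.
  by apply: product_measure1E; exact: measurable_itv.
by rewrite [X in (X * _)%E]E// [X in (_ * X)%E]E// EFinM.
Qed.

Section JohnNirenberg.
Variables (F : C -> R) (B L : R).
Hypotheses (mF : measurable_fun setT F) (FB : forall z, `|F z| <= B).
Hypothesis FL : forall z z', `|F z - F z'| <= L * `|z - z'|.

Let m1 (a p w h : R) := J (fun z => rect a p w h z * F z).
Let m2 (a p w h : R) := J (fun z => rect a p w h z * F z ^+ 2).
Let ex (a p w h : R) := J (fun z => rect a p w h z * expR (F z)).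
Let V (a p w h : R) := m2 a p w h / (w * h) - (m1 a p w h / (w * h)) ^+ 2.

Hypothesis HV : forall a p w h : R, 0 < w -> h = w \/ h = 2 * w -> V a p w h <= 50^-1.

Let i1 (a p w h : R) : 0 <= w -> 0 <= h -> Ig (fun z => rect a p w h z * F z).
Proof. by move=> w0 h0; exact: Ig_rectM FB. Qed.

Let i2 (a p w h : R) : 0 <= w -> 0 <= h -> Ig (fun z => rect a p w h z * F z ^+ 2).
Proof.
move=> w0 h0; apply: (@Ig_rectM _ _ _ _ _ (B ^+ 2)) => //; first exact: measurable_funX.
by move=> z; rewrite normrX le_pow.
Qed.

Let ie (a p w h : R) : 0 <= w -> 0 <= h -> Ig (fun z => rect a p w h z * expR (F z)).
Proof.
move=> w0 h0; apply: (@Ig_rectM _ _ _ _ _ (expR B)) => //.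
  by apply: measurableT_comp => //; exact: measurable_expR.
by move=> z; rewrite ger0_norm ?expR_ge0// ler_expR (le_trans (ler_norm _)).
Qed.

Let V_ge0 (a p w h : R) : 0 < w -> 0 < h -> 0 <= V a p w h.
Proof.
move=> w0 h0; have [w0' h0'] := (ltW w0, ltW h0); set x := m1 a p w h / (w * h).
have wh : 0 < w * h by rewrite mulr_gt0.
have : 0 <= J (fun z => rect a p w h z * F z ^+ 2 - 2 * x * (rect a p w h z * F z) + x ^+ 2 * rect a p w h z).
  apply: J_ge0 => z; have -> : rect a p w h z * F z ^+ 2 - 2 * x * (rect a p w h z * F z) + x ^+ 2 * rect a p w h z
    = rect a p w h z * (F z - x) ^+ 2 by ring.
  by rewrite mulr_ge0 ?sqr_ge0 ?rect_ge0.
have [[j1 j2] jr] := (i1 a p w0' h0', i2 a p w0' h0', Ig_rect a p w0' h0').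
rewrite (JD (IgB j2 (IgZ (2 * x) j1)) (IgZ (x ^+ 2) jr)) (JB j2 (IgZ (2 * x) j1)).
rewrite (JZ _ j1) (JZ _ jr) J_rect// -/(m1 a p w h) -/(m2 a p w h) => h2.
have E : m1 a p w h = x * (w * h) by rewrite /x mulfVK// gt_eqF.
rewrite /V -/x -(pmulr_lge0 _ wh) mulrBl mulfVK ?gt_eqF//; move: h2; rewrite E.
by move=> h2; apply: (le_trans h2); rewrite le_eqVlt; apply/orP; left; apply/eqP; ring.
Qed.

Let bel_ge1 (v : R) : 0 <= v <= 50^-1 -> 1 <= bel v.
Proof. by move=> /andP[v0 v1]; rewrite /bel; nra. Qed.

(** The Bellman bound on one rectangle up to a factor k. A square is cut into two w x 2w rectangles
    and each of these into two squares, so only two shapes occur and merging never enlarges k. *)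
Let good k a p w h := ex a p w h <= k * (w * h * (bel (V a p w h) * expR (m1 a p w h / (w * h)))).

Let sx (a p w h : R) G : 0 <= w -> (forall a p w h : R, 0 <= w -> 0 <= h -> Ig (fun z => rect a p w h z * G z)) ->
  0 <= h ->
  J (fun z => rect a p (2 * w) h z * G z) =
  J (fun z => rect a p w h z * G z) + J (fun z => rect (a + w) p w h z * G z).
Proof.
move=> w0 iG h0; rewrite -JD; [|exact: iG..].
by apply: eq_J => z; rewrite rect_splitx// mulrDl.
Qed.

Let sy (a p w h : R) G : 0 <= w -> (forall a p w h : R, 0 <= w -> 0 <= h -> Ig (fun z => rect a p w h z * G z)) ->
  0 <= h ->
  J (fun z => rect a p w (2 * h) z * G z) =
  J (fun z => rect a p w h z * G z) + J (fun z => rect a (p + h) w h z * G z).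
Proof.
move=> w0 iG h0; rewrite -JD; [|exact: iG..].
by apply: eq_J => z; rewrite rect_splity// mulrDl.
Qed.

Let good_x k a p w : 0 <= k -> 0 < w -> good k a p w (2 * w) -> good k (a + w) p w (2 * w) ->
  good k a p (2 * w) (2 * w).
Proof.
move=> k0 w0 g1 g2; have w0' := ltW w0; have w2 : 0 <= 2 * w by rewrite mulr_ge0.
rewrite /good /V /m1 /m2 /ex !sx//.
have -> : 2 * w * (2 * w) = 2 * (w * (2 * w)) by ring.
have E : forall a p, 0 <= V a p w (2 * w) <= 50^-1.
  by move=> a' p'; rewrite V_ge0 ?mulr_gt0//= HV//; right.
apply: bel_combine; [by rewrite !mulr_gt0|exact: k0|exact: E|exact: E| |exact: g1|exact: g2].
have := @HV a p (2 * w) (2 * w); rewrite /V /m1 /m2 !sx//.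
have -> : 2 * w * (2 * w) = 2 * (w * (2 * w)) by ring.
by apply; [rewrite mulr_gt0|left].
Qed.

Let good_y k a p w : 0 <= k -> 0 < w -> good k a p w w -> good k a (p + w) w w ->
  good k a p w (2 * w).
Proof.
move=> k0 w0 g1 g2; have w0' := ltW w0.
rewrite /good /V /m1 /m2 /ex !sy//.
have -> : w * (2 * w) = 2 * (w * w) by ring.
have E : forall a p, 0 <= V a p w w <= 50^-1.
  by move=> a' p'; rewrite V_ge0//= HV//; left.
apply: bel_combine; [by rewrite !mulr_gt0|exact: k0|exact: E|exact: E| |exact: g1|exact: g2].
have := @HV a p w (2 * w); rewrite /V /m1 /m2 !sy//.
have -> : w * (2 * w) = 2 * (w * w) by ring.
by apply => //; right.
Qed.

(** On a square of side w the Lipschitz function F exceeds its mean by at most L * w; this is the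
    only loss, and it disappears under subdivision. *)
Let good_base a p w : 0 < w -> good (expR (L * w)) a p w w.
Proof.
move=> w0; have w0' := ltW w0; have ww : 0 < w * w by rewrite mulr_gt0.
set x := m1 a p w w / (w * w); rewrite /good -/x.
have [j1 jr] := (i1 a p w0' w0', Ig_rect a p w0' w0').
have L0 : 0 <= L.
  have := FL (1, 1) 0; rewrite subr0 normC/= normr1 maxxx mulr1; exact: le_trans.
have hx z : rect a p w w z * F z <= rect a p w w z * (x + L * w).
  have [|r1] : rect a p w w z = 0 \/ rect a p w w z = 1.
  - by rewrite /rect; case: ifP => _; [right|left].
  - by move=> ->; rewrite !mul0r.
  rewrite r1 !mul1r -lerBlDr.
  have : J (fun z' => (F z - L * w) * rect a p w w z') <= m1 a p w w.
    apply: J_le => //; first exact: IgZ.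
    move=> z'; rewrite mulrC /rect; case: ifPn => [r'|_]; last by rewrite !mul0r.
    rewrite !mul1r lerBlDr -lerBlDl (le_trans (ler_norm _))// (le_trans (FL _ _))// ler_wpM2l//.
    have /andP[/andP[z1 z2] /andP[z3 z4]] : (a <= z.1 < a + w) && (p <= z.2 < p + w).
      by move: r1; rewrite /rect; case: ifP => // _ /esym/eqP; rewrite oner_eq0.
    move: r' => /andP[/andP[z5 z6] /andP[z7 z8]].
    by rewrite normC_le/= !ler_norml; apply/andP; split; apply/andP; split; lra.
  by rewrite (JZ _ jr) J_rect// -ler_pdivlMr.
have V1 := bel_ge1 (_ : 0 <= V a p w w <= 50^-1).
have {}V1 : 1 <= bel (V a p w w) by apply: V1; rewrite V_ge0//= HV//; left.
apply: (@le_trans _ _ (J (fun z => expR (x + L * w) * rect a p w w z))).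
  apply: J_le; [exact: ie|exact: IgZ|].
  move=> z; rewrite mulrC; move: (hx z); rewrite /rect; case: ifP => _; rewrite ?mul1r ?mulr1 ?mulr0//.
  by rewrite ler_expR.
rewrite (JZ _ jr) J_rect// expRD.
have -> : expR x * expR (L * w) * (w * w) = expR (L * w) * (w * w * (1 * expR x)) by ring.
apply: ler_wpM2l; first exact: expR_ge0.
by apply: ler_wpM2l; [exact: ltW|apply: ler_wpM2r; rewrite ?expR_ge0].
Qed.

Let good_n n a p w : 0 < w -> good (expR (L * w / 2 ^+ n)) a p w w.
Proof.
elim: n a p w => [|n IH] a p w w0; first by rewrite expr0 divr1; exact: good_base.
pose v := w / 2; have v0 : 0 < v by rewrite divr_gt0.
have -> : w = 2 * v by rewrite /v; field.
have -> : L * (2 * v) / 2 ^+ n.+1 = L * v / 2 ^+ n.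
  by rewrite exprS; field; rewrite expf_neq0.
by apply: good_x => //; rewrite ?expR_ge0//; apply: good_y; rewrite ?expR_ge0//; exact: IH.
Qed.

(** Subtracting 1 + F leaves a quantity quadratic in F, so the bound contains the second moment and
    not the area. The square can therefore be taken as large as needed. *)
Lemma square_exp_bound a p w : 0 < w -> `|m1 a p w w / (w * w)| <= 4^-1 ->
  J (fun z => rect a p w w z * (expR (F z) - 1 - F z)) <= 6 * m2 a p w w.
Proof.
move=> w0 x4; have w0' := ltW w0; have ww : 0 < w * w by rewrite mulr_gt0.
have [[j1 jr] je] := (i1 a p w0' w0', Ig_rect a p w0' w0', ie a p w0' w0').
set x := m1 a p w w / (w * w) in x4 *; set v := V a p w w.
have v01 : 0 <= v <= 50^-1 by rewrite /v V_ge0//= HV//; left.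
have exle : ex a p w w <= w * w * (bel v * expR x).
  set K := w * w * _; have K0 : 0 <= K.
    exact: (mulr_ge0 (ltW ww) (mulr_ge0 (le_trans ler01 (bel_ge1 v01)) (expR_ge0 _))).
  apply/ler_addgt0Pr => e e0.
  have L0 : 0 <= L.
    have := FL (1, 1) 0; rewrite subr0 normC/= normr1 maxxx mulr1; exact: le_trans.
  have ke0 : 0 <= 2 * K / e by apply: divr_ge0; [exact: mulr_ge0|exact: ltW].
  have Lw0 : 0 <= L * w by rewrite mulr_ge0.
  (* With 2^n above T, the number y = L w / 2^n satisfies y <= 1 / 4 and 2 K y <= e, so the factor
     exp(y) of [good_n] costs at most e. *)
  pose T := (L * w + 1) * (4 + 2 * K / e).
  have T0 : 0 < T by rewrite /T mulr_gt0//; lra.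
  have [n nT] : exists n : nat, T < 2 ^+ n.
    exists (Num.truncn T).+1; rewrite (lt_trans (truncnS_gt T))//.
    by rewrite -natrX ltr_nat ltn_expl.
  have := good_n n a p w0; rewrite /good -/x -/v -/K => h; apply: (le_trans h).
  set y := L * w / 2 ^+ n.
  have n0 : 0 < 2 ^+ n :> R by rewrite exprn_gt0.
  have y0 : 0 <= y by rewrite /y divr_ge0 ?(ltW n0).
  have yT : y * (4 + 2 * K / e) <= 1.
    rewrite /y mulrAC ler_pdivrMr// mul1r (le_trans _ (ltW nT))// /T ler_wpM2r//.
      by rewrite addr_ge0.
    by rewrite lerDl.
  have y4 : y <= 4^-1 by have := mulr_ge0 y0 ke0; lra.
  have yK : y * (2 * K) <= e.
    have : y * (2 * K / e) <= 1 by lra.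
    by rewrite mulrA ler_pdivrMr// mul1r.
  have := @expR_le2 R y; rewrite ger0_norm// => /(_ y4) hy.
  have {}hy : expR y <= 1 + 2 * y by nra.
  have := ler_wpM2r K0 hy; nra.
have E : J (fun z => rect a p w w z * (expR (F z) - 1 - F z)) = ex a p w w - w * w - m1 a p w w.
  rewrite -(J_rect a p w0' w0') -(JB je jr) -(JB (IgB je jr) j1).
  by apply: eq_J => z; ring.
have m1E : m1 a p w w = w * w * x by rewrite /x mulrC mulfVK// gt_eqF.
have m2E : m2 a p w w = w * w * (v + x ^+ 2) by rewrite /v /V -/x subrK mulrC mulfVK// gt_eqF.
rewrite E m1E m2E.
have hx := expR_le2 x4.
(* Here bel v <= 1 + 4 v and exp x <= 1 + x + 2 x^2, and the last factor is at most 3 / 2 because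
   |x| <= 1 / 4. *)
have key : bel v * expR x <= 1 + x + 6 * (v + x ^+ 2).
  have b0 : 0 <= bel v := le_trans ler01 (bel_ge1 v01).
  move: x4 v01; rewrite ler_norml => /andP[x1 x2] /andP[v0 v1].
  apply: (le_trans (ler_wpM2l b0 hx)); rewrite [in leLHS]/bel.
  have s0 := sqr_ge0 x; have xx : x ^+ 2 <= 16^-1 by nra.
  have : (1 + x + 2 * x ^+ 2) * (4 * v) <= (3/2) * (4 * v) by apply: ler_wpM2r; lra.
  have : 0 <= (1 + x + 2 * x ^+ 2) * (4 * v ^+ 2) by rewrite mulr_ge0 ?mulr_ge0 ?sqr_ge0//; lra.
  by lra.
have := ler_wpM2l (ltW ww) key; lra.
Qed.

End JohnNirenberg.

(** The convex conjugate of exp x - 1 - x is (1 + y) ln (1 + y) - y, and ln (1 + y) <= y bounds it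
    by y ln (1 + y). The tangent of exp at ln (1 + y) gives the inequality. *)
Lemma young_exp (x y : R) : 0 <= y -> y * x <= y * ln (1 + y) + (expR x - 1 - x).
Proof.
move=> y0; have y1 : 0 < 1 + y by lra.
have h := expR_ge1Dx (x - ln (1 + y)).
have e : expR x = (1 + y) * expR (x - ln (1 + y)).
  by rewrite -{1}(lnK (_ : 1 + y \in Num.pos))// -expRD addrC subrK.
have hl : ln (1 + y) <= y.
  by rewrite -[leRHS]expRK ler_ln ?posrE ?expR_gt0// expR_ge1Dx.
have := ler_wpM2l (ltW y1) h; rewrite -e; nra.
Qed.

End Rect.

(** * Convolutions and the divergence of the regularised velocity *)

Section Lipschitz.
Context {R : realType}.
Local Notation C := (R * R)%type.
Implicit Types (z w : C) (k f : C -> R).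

Lemma bounded_deriv_lip (F df : R -> R) (L a b : R) :
  (forall x : R, a <= x <= b -> is_derive x 1 F (df x)) -> (forall x, a <= x <= b -> `|df x| <= L) ->
  forall x y, a <= x <= b -> a <= y <= b -> `|F x - F y| <= L * `|x - y|.
Proof.
move=> dF dL.
have W x y : a <= x <= b -> a <= y <= b -> x <= y -> `|F x - F y| <= L * `|x - y|.
  move=> /andP[ax xb] /andP[ay yb] xy.
  have [||c cxy E] := @MVT_segment R F df x y xy.
  - move=> u; rewrite in_itv/= => /andP[u1 u2]; apply: dF; lra.
  - apply: derivable_within_continuous => u; rewrite in_itv/= => /andP[u1 u2].
    by have [] := dF u ltac:(lra).
  - rewrite distrC E normrM [`|x - y|]distrC; apply: ler_wpM2r => //; apply: dL.
    by move: cxy; rewrite in_itv/= => /andP[u1 u2]; lra.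
move=> x y hx hy; have [xy|xy] := leP x y; first exact: W.
by rewrite distrC [`|x - y|]distrC; apply: W => //; exact: ltW.
Qed.

(** An algebra stable under convolution with integrable functions; membership yields continuity,
    measurability and boundedness at once. *)
Definition BL k := exists2 c, 0 <= c & (forall z, `|k z| <= c) /\
  (forall z z', `|k z - k z'| <= c * `|z - z'|).

Lemma BL_cst c : BL (fun _ => c).
Proof.
by exists `|c| => //; split=> [//|z z']; rewrite subrr normr0 mulr_ge0.
Qed.

Lemma BL_D k f : BL k -> BL f -> BL (fun z => k z + f z).
Proof.
move=> [c c0 [k1 k2]] [d d0 [f1 f2]]; exists (c + d); rewrite ?addr_ge0//; split=> [z|z z'].
  by rewrite (le_trans (ler_normD _ _))// lerD.
have -> : k z + f z - (k z' + f z') = (k z - k z') + (f z - f z') by ring.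
by rewrite (le_trans (ler_normD _ _))// mulrDl lerD.
Qed.

Lemma BL_M k f : BL k -> BL f -> BL (fun z => k z * f z).
Proof.
move=> [c c0 [k1 k2]] [d d0 [f1 f2]]; exists (c * d + c * d); rewrite ?addr_ge0 ?mulr_ge0//.
split=> [z|z z'].
  by rewrite normrM (le_trans (ler_pM _ _ (k1 z) (f1 z)))// lerDl mulr_ge0.
have -> : k z * f z - k z' * f z' = (k z - k z') * f z + k z' * (f z - f z') by ring.
rewrite (le_trans (ler_normD _ _))// !normrM.
have := ler_pM (normr_ge0 _) (normr_ge0 _) (k2 z z') (f1 z).
have := ler_pM (normr_ge0 _) (normr_ge0 _) (k1 z') (f2 z z').
by lra.
Qed.

Lemma BL_Z a k : BL k -> BL (fun z => a * k z).
Proof. by move=> hk; apply: BL_M => //; exact: BL_cst. Qed.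

Lemma BL_B k f : BL k -> BL f -> BL (fun z => k z - f z).
Proof.
move=> hk hf; have := BL_D hk (BL_Z (-1) hf); congr BL.
by apply/funext => z; ring.
Qed.

Lemma lip_continuous k c : (forall z z', `|k z - k z'| <= c * `|z - z'|) -> continuous k.
Proof.
move=> kL z; apply/cvgrPdist_le => /= e e0.
have c1 : 0 < `|c| + 1 by rewrite ltr_wpDl.
have : \forall t \near z, `|z - t| <= e / (`|c| + 1).
  apply/nbhs_ballP; exists (e / (`|c| + 1)); first by rewrite /= divr_gt0.
  by move=> t; rewrite -ball_normE /ball_/= => /ltW.
apply: filterS => t zt; apply: (le_trans (kL _ _)).
apply: (@le_trans _ _ ((`|c| + 1) * (e / (`|c| + 1)))); last by rewrite mulrC divfK ?gt_eqF.
have h : c <= `|c| + 1 by rewrite (le_trans (ler_norm c))// lerDl.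
by apply: (le_trans (ler_wpM2r (normr_ge0 _) h)); apply: ler_wpM2l => //; exact: ltW.
Qed.

Lemma BL_continuous k : BL k -> continuous k.
Proof. by move=> [c _ [_ kL]]; exact: lip_continuous kL. Qed.

Lemma BL_measurable k : BL k -> measurable_fun setT k.
Proof. by move=> /BL_continuous/continuous2_measurable. Qed.

Lemma measurable_shift (z : C) k : measurable_fun setT k -> measurable_fun setT (fun w => k (z - w)).
Proof. by move=> mk; apply: (measurableT_comp mk); exact: measurable_reflect. Qed.

Definition conv k (b : C -> R) z := J (fun w => k (z - w) * b w).

Lemma Ig_conv k b z : BL k -> Ig b -> Ig (fun w => k (z - w) * b w).
Proof.
move=> bk jb; have [c c0 [k1 k2]] := bk.
apply: (@Ig_le _ _ (fun w => c * `|b w|)).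
- exact: (measurable_funM (measurable_shift z (BL_measurable bk)) (Ig_meas jb)).
- exact/IgZ/Ig_abs.
- by move=> w; rewrite normrM ler_wpM2r.
Qed.

Lemma conv_BLc (c : R) k b : BL k -> (forall z, `|k z| <= c) -> (forall z z', `|k z - k z'| <= c * `|z - z'|) ->
  Ig b -> (forall z, `|conv k b z| <= c * J (fun w => `|b w|)) /\
   (forall z z', `|conv k b z - conv k b z'| <= c * J (fun w => `|b w|) * `|z - z'|).
Proof.
move=> bk k1 k2 jb; split=> [z|z z'].
  rewrite -(JZ _ (Ig_abs jb)); apply: J_abs_le.
  - exact: Ig_meas (Ig_conv z bk jb).
  - exact/IgZ/Ig_abs.
  - by move=> w; rewrite normrM ler_wpM2r.
rewrite /conv -(JB (Ig_conv z bk jb) (Ig_conv z' bk jb)) mulrAC -(JZ _ (Ig_abs jb)).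
apply: J_abs_le.
- exact: Ig_meas (IgB (Ig_conv z bk jb) (Ig_conv z' bk jb)).
- exact/IgZ/Ig_abs.
- move=> w; rewrite -mulrBl normrM ler_wpM2r// (le_trans (k2 _ _))//.
  by have -> : z - w - (z' - w) = z - z' by rewrite opprB addrA subrK.
Qed.

Lemma BL_conv k b : BL k -> Ig b -> BL (conv k b).
Proof.
move=> bk jb; have [c c0 [k1 k2]] := bk; have [h1 h2] := conv_BLc bk k1 k2 jb.
by exists (c * J (fun w => `|b w|)); [rewrite mulr_ge0// J_ge0|split].
Qed.

Lemma convD k f b z : BL k -> BL f -> Ig b -> conv (fun u => k u + f u) b z = conv k b z + conv f b z.
Proof.
move=> bk bf jb; rewrite /conv -(JD (Ig_conv z bk jb) (Ig_conv z bf jb)).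
by apply: eq_J => w; rewrite mulrDl.
Qed.

Lemma convZ a k b z : BL k -> Ig b -> conv (fun u => a * k u) b z = a * conv k b z.
Proof.
move=> bk jb; rewrite /conv -(JZ _ (Ig_conv z bk jb)).
by apply: eq_J => w; rewrite mulrA.
Qed.

(** Differentiation under the integral with majorant c |b|: all derivatives fall on the kernel, and
    b need only be integrable. *)
Lemma conv_derive (phi dphi : R -> C -> R) (b : C -> R) (c : R) (t : R) : Ig b ->
  (forall t, measurable_fun setT (phi t)) -> (forall t w, `|phi t w| <= c) ->
  (forall (t : R) w, is_derive t 1 (phi ^~ w) (dphi t w)) -> (forall t w, `|dphi t w| <= c) ->
  is_derive t 1 (fun t => J (fun w => phi t w * b w)) (J (fun w => dphi t w * b w)).
Proof.
move=> jb mphi phic dphiE dphic.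
pose f (x : R) w := phi x w * b w.
have jf x : Ig (f x).
  apply: (@Ig_le _ _ (fun w => c * `|b w|)).
  - exact: (measurable_funM (mphi x) (Ig_meas jb)).
  - exact/IgZ/Ig_abs.
  - by move=> w; rewrite normrM ler_wpM2r.
have df (x : R) w : is_derive x 1 (f ^~ w) (dphi x w * b w).
  rewrite /f; have hd := dphiE x w.
  by apply: (d1_eq (d1_M hd (d1_cst (b w) x))); ring.
have jG : Ig (fun w => `|c * b w|) by exact/Ig_abs/IgZ.
have d1f (x : R) w : partial1of2 f x w = dphi x w * b w.
  by rewrite partial1of2E; case: (df x w).
have tI : `]t - 1, t + 1[%classic t by rewrite /= in_itv/=; lra.
have E1 : derivable (fun t => J (f t)) t 1.
  apply: (@derivable_under_integral R _ _ (@leb2 R) f setT measurableT t (t - 1) (t + 1) tI _ _ (fun w => `|c * b w|)) => //.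
  - by move=> x _; exact: jf.
  - move=> x w _ _; rewrite d1f !normrM ler_wpM2r// (le_trans (dphic _ _))//.
    exact: ler_norm.
apply: DeriveDef => //; rewrite -derive1E.
rewrite (@differentiation_under_integral R _ _ (@leb2 R) f setT measurableT t (t - 1) (t + 1) tI _ _ (fun w => `|c * b w|))//.
- by apply: eq_J => w; rewrite d1f.
- by move=> x _; exact: jf.
- move=> x w _ _; rewrite d1f !normrM ler_wpM2r// (le_trans (dphic _ _))//.
  exact: ler_norm.
Qed.

Lemma is_derive_shift (F : R -> R) (a d t : R) : is_derive (t - a) 1 F d ->
  is_derive t 1 (fun t => F (t - a)) d.
Proof.
move=> dF.
have dg : is_derive t 1 (fun t : R => t - a) 1.
  by apply: (d1_eq (d1_B (d1_id t) (d1_cst a t))); ring.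
by have := @d1_comp R F (fun t => t - a) t d 1 dF dg; rewrite mulr1.
Qed.

Lemma conv_derive1 k kx b : BL k -> BL kx -> Ig b ->
  (forall x y : R, is_derive x 1 (fun x => k (x, y)) (kx (x, y))) ->
  forall x y : R, is_derive x 1 (fun x => conv k b (x, y)) (conv kx b (x, y)).
Proof.
move=> bk bkx jb dk x y.
have [c c0 [k1 k2]] := bk; have [c' c0' [kx1 kx2]] := bkx.
apply: (@conv_derive (fun t w => k ((t, y) - w)) (fun t w => kx ((t, y) - w)) b (c + c')) => //.
- by move=> t; apply: measurable_shift; exact: BL_measurable.
- by move=> t w; rewrite (le_trans (k1 _))// lerDl.
- move=> t w; exact: (is_derive_shift (dk (t - w.1) (y - w.2))).
- by move=> t w; rewrite (le_trans (kx1 _))// lerDr.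
Qed.

Lemma conv_derive2 k ky b : BL k -> BL ky -> Ig b ->
  (forall x y : R, is_derive y 1 (fun y => k (x, y)) (ky (x, y))) ->
  forall x y : R, is_derive y 1 (fun y => conv k b (x, y)) (conv ky b (x, y)).
Proof.
move=> bk bky jb dk x y.
have [c c0 [k1 k2]] := bk; have [c' c0' [ky1 ky2]] := bky.
apply: (@conv_derive (fun t w => k ((x, t) - w)) (fun t w => ky ((x, t) - w)) b (c + c')) => //.
- by move=> t; apply: measurable_shift; exact: BL_measurable.
- by move=> t w; rewrite (le_trans (k1 _))// lerDl.
- move=> t w; exact: (is_derive_shift (dk (x - w.1) (t - w.2))).
- by move=> t w; rewrite (le_trans (ky1 _))// lerDr.
Qed.

End Lipschitz.

(** * Kernels regularised at scale s *)

Section RegKernels.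
Context {R : realType}.
Local Notation C := (R * R)%type.
Implicit Types (z w : C).
Variable s : R.
Hypothesis s0 : 0 < s.

(** Let psi = (1/2) log(|z|^2 + s). Then [al] and [be] are its first derivatives, [kA], [kB], [kD]
    are psi_xx, psi_xy, psi_yy, and [kE] is psi_xyy; all are polynomials in [al], [be], [ga]. *)
Definition ga z : R := (nq z + s)^-1.
Definition al z : R := z.1 * ga z.
Definition be z : R := z.2 * ga z.
Definition kA z : R := ga z - 2 * (al z * al z).
Definition kB z : R := -2 * (al z * be z).
Definition kD z : R := ga z - 2 * (be z * be z).
Definition kE z : R := -2 * (al z * ga z) + 8 * (al z * (be z * be z)).

Lemma nqs_gt0 z : 0 < nq z + s.
Proof. by rewrite ltr_wpDl ?nq_ge0. Qed.

Lemma ga_gt0 z : 0 < ga z.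
Proof. by rewrite invr_gt0 nqs_gt0. Qed.

Lemma ga_le z : 0 < `|z| -> ga z <= `|z|^-2.
Proof.
move=> z0; rewrite /ga lef_pV2 ?posrE ?nqs_gt0 ?exprn_gt0//.
by rewrite (le_trans (nq_ge z))// lerDl ltW.
Qed.

Lemma al_le z : 0 < `|z| -> `|al z| <= `|z|^-1.
Proof.
move=> z0; rewrite /al normrM (gtr0_norm (ga_gt0 z)).
apply: (le_trans (ler_pM _ _ (norm1_le z) (ga_le z0))) => //; first exact/ltW/ga_gt0.
by rewrite le_eqVlt; apply/orP; left; apply/eqP; field; rewrite gt_eqF.
Qed.

Lemma be_le z : 0 < `|z| -> `|be z| <= `|z|^-1.
Proof.
move=> z0; rewrite /be normrM (gtr0_norm (ga_gt0 z)).
apply: (le_trans (ler_pM _ _ (norm2_le z) (ga_le z0))) => //; first exact/ltW/ga_gt0.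
by rewrite le_eqVlt; apply/orP; left; apply/eqP; field; rewrite gt_eqF.
Qed.

(** A crude bound that blows up as s tends to 0. It serves regularity and integrability only; the
    decay bounds [al_le], [kB_le], [kD_le] are free of s. *)
Definition c0 : R := 1 + s^-1.

Lemma c0_ge1 : 1 <= c0.
Proof. by rewrite /c0 lerDl invr_ge0 ltW. Qed.

Lemma ga_bd z : `|ga z| <= c0.
Proof.
rewrite gtr0_norm ?ga_gt0// /c0 (@le_trans _ _ s^-1)//; last by rewrite lerDr.
by rewrite lef_pV2 ?posrE ?nqs_gt0// lerDr nq_ge0.
Qed.

Let sq_bd (x q : R) : 0 <= q -> x ^+ 2 <= q -> `|x * (q + s)^-1| <= c0.
Proof.
move=> q0 xq; have c1 := c0_ge1; have qs : 0 < q + s by rewrite ltr_wpDl.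
rewrite -(ler_pXn2r (_ : (0 < 2)%N)) ?nnegrE//; last by lra.
rewrite real_normK ?num_real// exprMn.
apply: (@le_trans _ _ (s^-1)); last first.
  by apply: (@le_trans _ _ c0); [rewrite /c0 lerDr|nra].
rewrite exprVn ler_pdivrMr ?exprn_gt0// ler_pdivlMl//.
have := ler_wpM2l (ltW s0) xq; have := mulr_ge0 q0 q0; have := mulr_ge0 q0 (ltW s0).
by have := sqr_ge0 s; lra.
Qed.

Lemma al_bd z : `|al z| <= c0.
Proof. by apply: sq_bd; [exact: nq_ge0|rewrite /nq lerDl sqr_ge0]. Qed.

Lemma be_bd z : `|be z| <= c0.
Proof. by apply: sq_bd; [exact: nq_ge0|rewrite /nq lerDr sqr_ge0]. Qed.

Let dinv (c x : R) : 0 < c -> is_derive x 1 (fun x : R => (x ^+ 2 + c)^-1) (- (2 * x) * ((x ^+ 2 + c)^-1) ^+ 2).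
Proof.
move=> c0'; have q0 : x ^+ 2 + c != 0 by rewrite gt_eqF// ltr_wpDl ?sqr_ge0.
have dq : is_derive x 1 (fun x : R => x ^+ 2 + c) (2 * x).
  by apply: (d1_eq (d1_D (d1_X2 (d1_id x)) (d1_cst c x))); ring.
exact: (@d1_V R (fun x => x ^+ 2 + c) x _ q0 dq).
Qed.

Lemma ga_dx (x y : R) : is_derive x 1 (fun x => ga (x, y)) (-2 * (al (x, y) * ga (x, y))).
Proof.
have := @dinv (y ^+ 2 + s) x (ltr_wpDl (sqr_ge0 y) s0).
rewrite (_ : (fun x : R => (x ^+ 2 + (y ^+ 2 + s))^-1) = (fun x => ga (x, y))).
  by move=> h; apply: (is_derive_eq h); rewrite /al /ga /nq/= addrA; ring.
by apply/funext => u; rewrite /ga /nq/= addrA.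
Qed.

Lemma ga_dy (x y : R) : is_derive y 1 (fun y => ga (x, y)) (-2 * (be (x, y) * ga (x, y))).
Proof.
have := @dinv (x ^+ 2 + s) y (ltr_wpDl (sqr_ge0 x) s0).
have E (u : R) : u ^+ 2 + (x ^+ 2 + s) = x ^+ 2 + u ^+ 2 + s by ring.
rewrite (_ : (fun y : R => (y ^+ 2 + (x ^+ 2 + s))^-1) = (fun y => ga (x, y))).
  by move=> h; apply: (is_derive_eq h); rewrite /be /ga /nq/= E; ring.
by apply/funext => u; rewrite /ga /nq/= E.
Qed.

Lemma al_dx (x y : R) : is_derive x 1 (fun x => al (x, y)) (kA (x, y)).
Proof.
apply: (d1_eq (d1_M (d1_id x) (ga_dx x y))).
by rewrite /kA /al/=; ring.
Qed.

Lemma al_dy (x y : R) : is_derive y 1 (fun y => al (x, y)) (kB (x, y)).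
Proof.
apply: (d1_eq (d1_Z x (ga_dy x y))).
by rewrite /kB /be /al/=; ring.
Qed.

Lemma be_dx (x y : R) : is_derive x 1 (fun x => be (x, y)) (kB (x, y)).
Proof.
apply: (d1_eq (d1_Z y (ga_dx x y))).
by rewrite /kB /be /al/=; ring.
Qed.

Lemma be_dy (x y : R) : is_derive y 1 (fun y => be (x, y)) (kD (x, y)).
Proof.
apply: (d1_eq (d1_M (d1_id y) (ga_dy x y))).
by rewrite /kD /be/=; ring.
Qed.

Lemma kD_dx (x y : R) : is_derive x 1 (fun x => kD (x, y)) (kE (x, y)).
Proof.
apply: (d1_eq (d1_B (ga_dx x y) (d1_Z 2 (d1_M (be_dx x y) (be_dx x y))))).
by rewrite /kE /kB; ring.
Qed.

Lemma kB_dy (x y : R) : is_derive y 1 (fun y => kB (x, y)) (kE (x, y)).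
Proof.
apply: (d1_eq (d1_Z (-2) (d1_M (al_dy x y) (be_dy x y)))).
by rewrite /kE /kD /kB; ring.
Qed.

Let bd2 (a b c d : R) : `|a| <= c -> `|b| <= d -> `|a * b| <= c * d.
Proof. by move=> ac bd; rewrite normrM ler_pM. Qed.

Let n2 : `|-2 : R| = 2.
Proof. by rewrite normrN ger0_norm. Qed.

Let lip2 (k kx ky : C -> R) (c d : R) : (forall z, `|k z| <= c) ->
  (forall x y : R, is_derive x 1 (fun x => k (x, y)) (kx (x, y))) ->
  (forall x y : R, is_derive y 1 (fun y => k (x, y)) (ky (x, y))) ->
  (forall z, `|kx z| <= d) -> (forall z, `|ky z| <= d) -> BL k.
Proof.
move=> kc hx hy kxd kyd.
have c0' : 0 <= c by rewrite (le_trans _ (kc 0)).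
have d0' : 0 <= d by rewrite (le_trans _ (kxd 0)).
exists (c + 2 * d); first by rewrite addr_ge0 ?mulr_ge0.
split=> [z|[x y] [x' y']]; first by rewrite (le_trans (kc z))// lerDl mulr_ge0.
have -> : k (x, y) - k (x', y') = (k (x, y) - k (x', y)) + (k (x', y) - k (x', y')) by ring.
pose N := `|x| + `|x'| + `|y| + `|y'|.
have nn (u : R) : `|u| <= N -> - N <= u <= N by rewrite ler_norml.
have [u1 u2 u3 u4] : [/\ `|x| <= N, `|x'| <= N, `|y| <= N & `|y'| <= N].
  by rewrite /N; split; have := normr_ge0 x; have := normr_ge0 x'; have := normr_ge0 y; have := normr_ge0 y'; lra.
have := @bounded_deriv_lip R (fun x => k (x, y)) (fun x => kx (x, y)) d (- N) N (fun u _ => hx u y)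
   (fun u _ => kxd (u, y)) x x' (nn _ u1) (nn _ u2).
have := @bounded_deriv_lip R (fun y => k (x', y)) (fun y => ky (x', y)) d (- N) N (fun u _ => hy x' u)
   (fun u _ => kyd (x', u)) y y' (nn _ u3) (nn _ u4).
move=> h1 h2; rewrite (le_trans (ler_normD _ _))//.
have m1 := norm1_le ((x, y) - (x', y')); have m2 := norm2_le ((x, y) - (x', y')).
rewrite /= in m1 m2; set D := `|(x, y) - (x', y')| in m1 m2 *.
have D0 : 0 <= D := normr_ge0 _.
have := ler_wpM2l d0' m1; have := ler_wpM2l d0' m2; have := mulr_ge0 c0' D0.
lra.
Qed.

Lemma BL_ga : BL ga.
Proof.
apply: (@lip2 ga (fun z => -2 * (al z * ga z)) (fun z => -2 * (be z * ga z)) c0 (2 * (c0 * c0))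
  ga_bd ga_dx ga_dy) => z;
by rewrite normrM n2 ler_wpM2l// bd2 ?al_bd ?be_bd ?ga_bd.
Qed.

Let kbd z : [/\ `|kA z| <= c0 + 2 * (c0 * c0), `|kB z| <= c0 + 2 * (c0 * c0) & `|kD z| <= c0 + 2 * (c0 * c0)].
Proof.
have c1 := c0_ge1.
have := ga_bd z; have := bd2 (al_bd z) (al_bd z); have := bd2 (be_bd z) (be_bd z).
have := bd2 (al_bd z) (be_bd z); rewrite /kA /kB /kD => h1 h2 h3 h4; split.
- by rewrite (le_trans (ler_normB _ _))// normrM (ger0_norm (_ : 0 <= 2))//; lra.
- by rewrite normrM n2; lra.
- by rewrite (le_trans (ler_normB _ _))// normrM (ger0_norm (_ : 0 <= 2))//; lra.
Qed.

Lemma BL_al : BL al.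
Proof. by apply: (@lip2 al kA kB c0 (c0 + 2 * (c0 * c0)) al_bd al_dx al_dy) => z; have [] := kbd z. Qed.

Lemma BL_be : BL be.
Proof. by apply: (@lip2 be kB kD c0 (c0 + 2 * (c0 * c0)) be_bd be_dx be_dy) => z; have [] := kbd z. Qed.

Lemma BL_kA : BL kA.
Proof. by apply: (BL_B BL_ga); apply/BL_Z/BL_M; exact: BL_al. Qed.

Lemma BL_kB : BL kB.
Proof. by apply/BL_Z/BL_M; [exact: BL_al|exact: BL_be]. Qed.

Lemma BL_kD : BL kD.
Proof. by apply: (BL_B BL_ga); apply/BL_Z/BL_M; exact: BL_be. Qed.

Lemma BL_kE : BL kE.
Proof.
apply: BL_D; apply: BL_Z; apply: BL_M; [exact: BL_al|exact: BL_ga|exact: BL_al|].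
by apply: BL_M; exact: BL_be.
Qed.

Lemma kB_le z : 0 < `|z| -> `|kB z| <= 2 / `|z| ^+ 2.
Proof.
move=> z0; rewrite /kB normrM n2 ler_wpM2l// (le_trans (bd2 (al_le z0) (be_le z0)))//.
by rewrite -invfM expr2.
Qed.

Lemma kD_le z : 0 < `|z| -> `|kD z| <= 3 / `|z| ^+ 2.
Proof.
move=> z0; rewrite /kD (le_trans (ler_normB _ _))// normrM (ger0_norm (_ : 0 <= 2))// (gtr0_norm (ga_gt0 z)).
have := ga_le z0; have := bd2 (be_le z0) (be_le z0); rewrite -invfM -expr2; lra.
Qed.

End RegKernels.

Section SigmaFinite.
Context {R : realType}.

(** Required for Tonelli's theorem over pairs of points of the plane, in Young's convolution
    inequality. *)
Lemma leb2_sigma_finite : sigma_finite setT (@leb2 R).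
Proof.
exists (fun n : nat => [set z : R * R | `|z| <= n%:R]) => [|n]; last first.
  by split; [exact: measurable_box_set|rewrite leb2_box// ltry].
apply/seteqP; split => // z _; exists (Num.truncn `|z|).+1 => //=.
exact: ltW (truncnS_gt _).
Qed.
HB.instance Definition _ := Measure.on (@leb2 R).
HB.instance Definition _ := Measure_isSigmaFinite.Build _ _ _ (@leb2 R) leb2_sigma_finite.

End SigmaFinite.

(** * Square integrability of the divergence, uniformly in s *)

Section L2bound.
Context {R : realType}.
Local Notation C := (R * R)%type.
Implicit Types (z w : C).
Variables (s : R) (b : C -> R) (M r : R).
Hypotheses (s0 : 0 < s) (mb : measurable_fun setT b) (r0 : 0 < r).
Hypotheses (bM : forall z, `|b z| <= M) (br : forall z, r < `|z| -> b z = 0).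
Local Notation al := (@al R s). Local Notation kA := (@kA R s). Local Notation kB := (@kB R s).
Local Notation kD := (@kD R s). Local Notation kE := (@kE R s).

Let jb : Ig b. Proof. by have [] := bounded_Ig mb (ltW r0) bM br. Qed.
Let N1 := J (fun w => `|b w|).
Let N10 : 0 <= N1. Proof. exact: J_ge0. Qed.

Let jb2 : Ig (fun w => b w ^+ 2).
Proof.
have [] // := @bounded_Ig R (fun w => b w ^+ 2) (M ^+ 2) r _ (ltW r0).
- exact: measurable_funX.
- by move=> z; rewrite normrX le_pow.
- by move=> z /br ->; rewrite expr0n.
Qed.

Lemma conv_decay k (c n : R) z : BL k -> 2 * r <= n -> (forall u : C, n / 2 <= `|u| -> `|k u| <= c) ->
  n <= `|z| -> `|conv k b z| <= c * N1.
Proof.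
move=> bk rn kc nz; rewrite -(JZ _ (Ig_abs jb)); apply: J_abs_le.
- exact: Ig_meas (Ig_conv z bk jb).
- exact/IgZ/Ig_abs.
move=> w; have [wr|/br ->] := leP `|w| r; last by rewrite mulr0 normr0 mulr0.
rewrite normrM ler_wpM2r// kc//.
have := ler_normD (z - w) w; rewrite subrK; lra.
Qed.

(** With u = psi * b these are u_x, u_xx, u_xy, u_yy and u_xyy. *)
Let p := conv al b. Let A := conv kA b. Let B := conv kB b. Let D := conv kD b. Let E := conv kE b.

Let bp : BL p := BL_conv (BL_al s0) jb.
Let bA : BL A := BL_conv (BL_kA s0) jb.
Let bB : BL B := BL_conv (BL_kB s0) jb.
Let bD : BL D := BL_conv (BL_kD s0) jb.
Let bE : BL E := BL_conv (BL_kE s0) jb.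

Let decay (n : R) z : 2 * r <= n -> n <= `|z| ->
  [/\ `|p z| <= 2 / n * N1, `|B z| <= 8 / n ^+ 2 * N1 & `|D z| <= 12 / n ^+ 2 * N1].
Proof.
move=> rn nz; have n0 : 0 < n by apply: lt_le_trans rn; rewrite mulr_gt0.
have sq (u : C) : n / 2 <= `|u| -> 0 < `|u| /\ (`|u| ^+ 2)^-1 <= 4 / n ^+ 2.
  move=> nu; have u0 : 0 < `|u| by rewrite (lt_le_trans _ nu)// divr_gt0.
  split=> //; have -> : 4 / n ^+ 2 = ((n / 2) ^+ 2)^-1 by field; rewrite gt_eqF.
  rewrite lef_pV2 ?posrE ?exprn_gt0 ?divr_gt0//; apply: le_pow => //.
  by rewrite divr_ge0// ltW.
split; apply: (conv_decay (n := n)) => //.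
- exact: BL_al.
- move=> u nu; have [u0 _] := sq u nu; rewrite (le_trans (al_le s0 u0))//.
  have -> : 2 / n = (n / 2)^-1 by field; rewrite gt_eqF.
  by rewrite lef_pV2 ?posrE ?divr_gt0.
- exact: BL_kB.
- by move=> u nu; have [u0 h] := sq u nu; rewrite (le_trans (kB_le s0 u0))//; lra.
- exact: BL_kD.
- by move=> u nu; have [u0 h] := sq u nu; rewrite (le_trans (kD_le s0 u0))//; lra.
Qed.

Let prod_bd (x y c d : R) : `|x| <= c -> `|y| <= d -> `|x * y| <= c * d.
Proof. by move=> xc yd; rewrite normrM ler_pM. Qed.

(* The Hessian determinant is a divergence: det D^2 psi = d_x (psi_x psi_yy) - d_y (psi_x psi_xy). *)
Lemma det_box (n : R) : 2 * r <= n ->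
  `|J (fun z => box n z * (A z * D z - B z * B z))| <= 192 * N1 ^+ 2 / n ^+ 2.
Proof.
move=> rn; have n0 : 0 < n by apply: lt_le_trans rn; rewrite mulr_gt0.
have n00 := ltW n0.
pose c := 48 * N1 ^+ 2 / n ^+ 3.
have c0 : 0 <= c by rewrite divr_ge0 ?mulr_ge0 ?sqr_ge0// exprn_ge0.
pose h1 z := A z * D z + p z * E z; pose h2 z := B z * B z + p z * E z.
have bl1 : BL h1 by apply: BL_D; exact: BL_M.
have bl2 : BL h2 by apply: BL_D; exact: BL_M.
have j1 := Ig_boxcont n00 (BL_continuous bl1); have j2 := Ig_boxcont n00 (BL_continuous bl2).
have ndec (z : C) : `|z.1| = n \/ `|z.2| = n -> n <= `|z|.
  by case=> <-; [exact: norm1_le|exact: norm2_le].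
have cE (x y x' y' : R) : `|x| <= 2 / n * N1 -> `|x'| <= 2 / n * N1 -> `|y| <= 12 / n ^+ 2 * N1 ->
    `|y'| <= 12 / n ^+ 2 * N1 -> `|x * y - x' * y'| <= c.
  move=> hx hx' hy hy'; rewrite (le_trans (ler_normB _ _))//.
  have := prod_bd hx hy; have := prod_bd hx' hy'.
  have -> : c = 2 * (2 / n * N1 * (12 / n ^+ 2 * N1)) by rewrite /c; field; rewrite gt_eqF.
  by lra.
have b1 : `|J (fun z => box n z * h1 z)| <= c * (2 * n).
  apply: J_iter1_bound => // y yn.
  have dF (x : R) : is_derive x 1 (fun x => p (x, y) * D (x, y)) (h1 (x, y)).
    apply: d1_M; first exact: (conv_derive1 (BL_al s0) (BL_kA s0) jb (al_dx s0)).
    exact: (conv_derive1 (BL_kD s0) (BL_kE s0) jb (kD_dx s0)).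
  have cF : continuous (fun x => h1 (x, y)).
    by apply: cont_line1; exact: BL_continuous.
  rewrite (FTC_itv n0 cF dF) abse_EFin lee_fin.
  have [q1 _ q2] := decay (z := (n, y)) rn (ndec (n, y) (or_introl (ger0_norm n00))).
  have [|q3 _ q4] := decay (z := (- n, y)) rn; first by apply: ndec; left; rewrite /= normrN ger0_norm.
  exact: cE.
have b2 : `|J (fun z => box n z * h2 z)| <= c * (2 * n).
  apply: J_iter2_bound => // x xn.
  have dF (y : R) : is_derive y 1 (fun y => p (x, y) * B (x, y)) (h2 (x, y)).
    apply: d1_M; first exact: (conv_derive2 (BL_al s0) (BL_kB s0) jb (al_dy s0)).
    exact: (conv_derive2 (BL_kB s0) (BL_kE s0) jb (kB_dy s0)).
  have cF : continuous (fun y => h2 (x, y)).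
    by apply: cont_line2; exact: BL_continuous.
  rewrite (FTC_itv n0 cF dF) abse_EFin lee_fin.
  have [q1 q2 _] := decay (z := (x, n)) rn (ndec (x, n) (or_intror (ger0_norm n00))).
  have [|q3 q4 _] := decay (z := (x, - n)) rn; first by apply: ndec; right; rewrite /= normrN ger0_norm.
  have le12 : 8 / n ^+ 2 * N1 <= 12 / n ^+ 2 * N1.
    by apply: ler_wpM2r => //; apply: ler_wpM2r; [rewrite invr_ge0 exprn_ge0|lra].
  by apply: cE => //; [exact: le_trans le12|exact: le_trans le12].
have -> : (fun z => box n z * (A z * D z - B z * B z)) = (fun z => box n z * h1 z - box n z * h2 z).
  by apply/funext => z; rewrite /h1 /h2; ring.
rewrite (JB j1 j2) (le_trans (ler_normB _ _))//.
have -> : 192 * N1 ^+ 2 / n ^+ 2 = c * (2 * n) + c * (2 * n) by rewrite /c; field; rewrite gt_eqF.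
exact: (lerD b1 b2).
Qed.

(** The Laplacian of psi: non-negative, even, and of mass at most 64 whatever s is. *)
Let kP u := kA u + kD u.
Let bkP : BL kP := BL_D (BL_kA s0) (BL_kD s0).

Let kPE u : kP u = 2 * (s / (nq u + s) ^+ 2).
Proof.
rewrite /kP /kA /kD /al /be /ga; have := nqs_gt0 s0 u; rewrite /nq => h.
by field; rewrite gt_eqF.
Qed.

Let kP0 u : 0 <= kP u.
Proof. by rewrite kPE mulr_ge0// divr_ge0 ?sqr_ge0// ltW. Qed.

Let kPle u : kP u <= 2 * pker s u.
Proof.
rewrite kPE /pker ler_wpM2l// ler_pM2l// lef_pV2 ?posrE ?exprn_gt0 ?nqs_gt0//; last first.
  by rewrite ltr_wpDl ?exprn_ge0.
by apply: le_pow; [rewrite addr_ge0 ?exprn_ge0// ltW|rewrite lerD2r nq_ge].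
Qed.

Let jkP : Ig kP /\ J kP <= 64.
Proof.
have [d d0 sd] : exists2 d : R, 0 < d & s = d ^+ 2.
  by exists (Num.sqrt s); rewrite ?sqrtr_gt0// sqr_sqrtr// ltW.
have [jp Jp] := pker_Ig d0; rewrite -sd in jp Jp.
have jk : Ig kP.
  apply: Ig_le (BL_measurable bkP) (IgZ 2 jp) _ => u.
  by rewrite ger0_norm.
split=> //; apply: (le_trans (J_le jk (IgZ 2 jp) kPle)).
by rewrite (JZ 2 jp); lra.
Qed.

Let kPC u : kP (- u) = kP u.
Proof. by rewrite !kPE /nq/= !sqrrN. Qed.

(** Cauchy-Schwarz for the positive kernel, by expanding the integral of kP (b - t)^2; t = c / 64 is
    the optimal shift for mass 64. *)
Let CS z : conv kP b z ^+ 2 <= 64 * conv kP (fun w => b w ^+ 2) z.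
Proof.
have [jk Jk] := jkP; set c := conv kP b z; pose t := c / 64.
have i1 := Ig_conv z bkP jb; have i2 := Ig_conv z bkP jb2.
have i3 : Ig (fun w => kP (z - w)) by exact: (Ig_reflect z jk).
have : 0 <= J (fun w => kP (z - w) * b w ^+ 2 - (2 * t) * (kP (z - w) * b w) + t ^+ 2 * kP (z - w)).
  apply: J_ge0 => w.
  have -> : kP (z - w) * b w ^+ 2 - (2 * t) * (kP (z - w) * b w) + t ^+ 2 * kP (z - w)
    = kP (z - w) * (b w - t) ^+ 2 by ring.
  by rewrite mulr_ge0 ?sqr_ge0.
rewrite (JD (IgB i2 (IgZ (2 * t) i1)) (IgZ _ i3)) (JB i2 (IgZ (2 * t) i1)) (JZ _ i1) (JZ _ i3).
rewrite (J_reflect z (BL_measurable bkP)).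
rewrite -/(conv kP b z) -/(conv kP (fun w => b w ^+ 2) z) -/c => h.
have : t ^+ 2 * J kP <= t ^+ 2 * 64 by rewrite ler_wpM2l ?sqr_ge0.
by move: h; rewrite /t; lra.
Qed.

(** Tonelli exchanges the integrals, and evenness of [kP] turns the integral in z into its mass. *)
Let young_box (n : R) : 0 <= n ->
  J (fun z => box n z * conv kP (fun w => b w ^+ 2) z) <= J kP * J (fun w => b w ^+ 2).
Proof.
move=> n0; have [jk Jk] := jkP.
have bc := BL_conv bkP jb2.
have jbox := Ig_boxcont n0 (BL_continuous bc).
rewrite -lee_fin JE//.
apply: (@le_trans _ _ (\int[@leb2 R]_z \int[@leb2 R]_w (kP (z - w) * b w ^+ 2)%:E)%E).
  apply: ge0_le_integral => //.
  - by move=> z _; rewrite lee_fin mulr_ge0// J_ge0// => w; rewrite mulr_ge0 ?sqr_ge0.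
  - by apply/measurable_EFinP; exact: (Ig_meas jbox).
  - rewrite (_ : (fun z => _) = (fun z => (conv kP (fun w => b w ^+ 2) z)%:E)).
      by apply/measurable_EFinP; exact: BL_measurable.
    by apply/funext => z; rewrite -(JE (Ig_conv z bkP jb2)).
  - move=> z _; rewrite -(JE (Ig_conv z bkP jb2)).
    rewrite lee_fin ler_piMl//; last by rewrite /box; case: (leP `|z| n).
    by rewrite J_ge0// => w; rewrite mulr_ge0 ?sqr_ge0.
have mk : measurable_fun setT (fun zw : C * C => (kP (zw.1 - zw.2) * b zw.2 ^+ 2)%:E).
  apply/measurable_EFinP; apply: measurable_funM.
    apply: (measurableT_comp (BL_measurable bkP)).
    apply/measurable_fun_pairP; split; apply: measurable_funB.
    - exact: (measurableT_comp measurable1 measurable_fst).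
    - exact: (measurableT_comp measurable1 measurable_snd).
    - exact: (measurableT_comp measurable2 measurable_fst).
    - exact: (measurableT_comp measurable2 measurable_snd).
  by apply: measurable_funX; exact: (measurableT_comp mb measurable_snd).
have g0 (zw : C * C) : (0 <= (kP (zw.1 - zw.2) * b zw.2 ^+ 2)%:E)%E.
  by rewrite lee_fin mulr_ge0 ?sqr_ge0.
have FT := @fubini_tonelli _ _ _ _ R (@leb2 R) (@leb2 R) (fun zw : C * C => (kP (zw.1 - zw.2) * b zw.2 ^+ 2)%:E) mk g0.
apply: (@le_trans _ _ (\int[@leb2 R]_w \int[@leb2 R]_z (kP (z - w) * b w ^+ 2)%:E)%E).
  by rewrite le_eqVlt; apply/orP; left; apply/eqP; exact: FT.
rewrite le_eqVlt; apply/orP; left; apply/eqP.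
transitivity (\int[@leb2 R]_w (J kP * b w ^+ 2)%:E)%E.
  apply: eq_integral => w _.
  have jw : Ig (fun z => kP (z - w)).
    by apply: (@eq_Ig _ (fun z => kP (w - z))); [move=> z; rewrite -kPC opprB|exact: Ig_reflect].
  have jw' : Ig (fun z => kP (z - w) * b w ^+ 2).
    by apply: (@eq_Ig _ (fun z => b w ^+ 2 * kP (z - w))); [move=> z; rewrite mulrC|exact: IgZ].
  transitivity (\int[@leb2 R]_z (kP (z - w) * b w ^+ 2)%:E)%E; first by [].
  rewrite -(JE jw'); congr EFin.
  rewrite (@eq_J _ _ (fun z => b w ^+ 2 * kP (z - w))); last by move=> z; rewrite mulrC.
  rewrite (JZ _ jw) mulrC; congr (_ * _).
  rewrite -(J_reflect w (BL_measurable bkP)); apply: eq_J => z.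
  by rewrite -kPC opprB.
by rewrite -(JE (IgZ _ jb2)) (JZ _ jb2).
Qed.

(** This is 2 pi times the divergence of the field with components [kreg a c s] and
    [kreg c (- a) s]. Only the trace-free part of the Hessian of psi enters: a regularised Beurling
    kernel. *)
Definition dkern (a c : R) (u : C) : R := a * (kA u - kD u) + 2 * c * kB u.

Lemma BL_dkern a c : BL (dkern a c).
Proof. by apply: BL_D; apply: BL_Z; [apply: BL_B; [exact: BL_kA|exact: BL_kD]|exact: BL_kB]. Qed.

(** Pointwise, (a (A - D) + 2 c B)^2 <= (A - D)^2 + 4 B^2 = (A + D)^2 - 4 (A D - B^2), because a^2 +
    c^2 = 1. The trace A + D is a convolution with a kernel of mass 64, whence 4096 = 64^2; the
    determinant contributes O(n^-2) on the square of radius n, and n tends to infinity. *)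
Lemma L2_bound (a c m : R) : a ^+ 2 + c ^+ 2 = 1 -> 0 <= m ->
  J (fun z => box m z * conv (dkern a c) b z ^+ 2) <= 4096 * J (fun w => b w ^+ 2).
Proof.
move=> ac m0; set f := conv (dkern a c) b.
have bf : BL f by apply: BL_conv => //; exact: BL_dkern.
have fE z : f z = a * (A z - D z) + 2 * c * B z.
  have bAD : BL (fun u => kA u - kD u) := BL_B (BL_kA s0) (BL_kD s0).
  rewrite /f /dkern (convD z (BL_Z a bAD) (BL_Z (2 * c) (BL_kB s0)) jb).
  rewrite (convZ a z bAD jb) (convZ (2 * c) z (BL_kB s0) jb); congr (_ * _ + _).
  rewrite /A /D /conv -(JB (Ig_conv z (BL_kA s0) jb) (Ig_conv z (BL_kD s0) jb)).
  by apply: eq_J => w; ring.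
have PE z : conv kP b z = A z + D z := convD z (BL_kA s0) (BL_kD s0) jb.
have fle z : f z ^+ 2 <= conv kP b z ^+ 2 - 4 * (A z * D z - B z * B z).
  rewrite PE fE.
  have : 0 <= (c * (A z - D z) - 2 * a * B z) ^+ 2 by exact: sqr_ge0.
  have -> : (c * (A z - D z) - 2 * a * B z) ^+ 2 =
    (a ^+ 2 + c ^+ 2) * ((A z - D z) ^+ 2 + 4 * (B z * B z)) - (a * (A z - D z) + 2 * c * B z) ^+ 2 by ring.
  by rewrite ac mul1r; lra.
have bf2 : BL (fun z => f z ^+ 2) by exact: BL_M.
have main (n : R) : 2 * r <= n -> J (fun z => box n z * f z ^+ 2) <= 4096 * J (fun w => b w ^+ 2) + 768 * N1 ^+ 2 / n ^+ 2.
  move=> rn; have n0 : 0 <= n by apply: le_trans rn; rewrite mulr_ge0// ltW.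
  have bP := BL_conv bkP jb; have bP2 := BL_conv bkP jb2.
  have bdet : BL (fun z => A z * D z - B z * B z) by apply: BL_B; exact: BL_M.
  have jf := Ig_boxcont n0 (BL_continuous bf2).
  have jP2 := Ig_boxcont n0 (BL_continuous bP2).
  have jdet := Ig_boxcont n0 (BL_continuous bdet).
  apply: (@le_trans _ _ (J (fun z => 64 * (box n z * conv kP (fun w => b w ^+ 2) z) -
     4 * (box n z * (A z * D z - B z * B z))))).
    apply: J_le => //; first by apply: IgB; exact: IgZ.
    move=> z; have h1 := fle z; have h2 := CS z.
    have -> : 64 * (box n z * conv kP (fun w => b w ^+ 2) z) - 4 * (box n z * (A z * D z - B z * B z)) =
      box n z * (64 * conv kP (fun w => b w ^+ 2) z - 4 * (A z * D z - B z * B z)) by ring.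
    by apply: ler_wpM2l; [exact: box_ge0|lra].
  rewrite (JB (IgZ 64 jP2) (IgZ 4 jdet)) (JZ _ jP2) (JZ _ jdet).
  have h1 := young_box n0; have h2 := det_box rn; have [_ Jk] := jkP.
  have J2 : 0 <= J (fun w => b w ^+ 2) by apply: J_ge0 => w; exact: sqr_ge0.
  have := ler_wpM2r J2 Jk.
  by move: h2; rewrite ler_norml => /andP[h2 _]; lra.
have mr0 : 0 <= m + 2 * r := addr_ge0 m0 (mulr_ge0 (ler0n _ 2) (ltW r0)).
have K0 : 0 <= 768 * N1 ^+ 2 := mulr_ge0 (ler0n _ 768) (sqr_ge0 N1).
have mono n : m <= n -> J (fun z => box m z * f z ^+ 2) <= J (fun z => box n z * f z ^+ 2).
  move=> mn; have cf2 := BL_continuous bf2.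
  apply: J_le; [exact: (Ig_boxcont m0 cf2)|exact: (Ig_boxcont (le_trans m0 mn) cf2)|].
  move=> z; apply: ler_wpM2r; first exact: sqr_ge0.
  rewrite /box; case: (leP `|z| m) => [zm|_]; last exact: ler0n.
  by rewrite (le_trans zm mn).
move: (m + 2 * r) mr0 (lerDl m (2 * r)) (lerDr (2 * r) m) main mono K0.
rewrite (mulr_ge0 (ler0n _ 2) (ltW r0)) m0 => q q0 mq rq.
move: (768 * N1 ^+ 2) (J _) (fun n => J (fun z => box n z * f z ^+ 2)) => K J2 F main mono K0.
apply/ler_addgt0Pr => e e0.
pose n := q + K / e + 1.
have T0 : 0 <= K / e := divr_ge0 K0 (ltW e0).
have n1 : 1 <= n by rewrite /n; lra.
have qn : q <= n by rewrite /n; lra.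
apply: (le_trans (mono n (le_trans mq qn))); apply: (le_trans (main n (le_trans rq qn))).
have n2 : 0 < n ^+ 2 by rewrite exprn_gt0//; lra.
rewrite lerD2l ler_pdivrMr//.
have h1 : K <= e * n by rewrite mulrC -ler_pdivrMr// /n; lra.
have h2 : e * n <= e * n ^+ 2.
  by apply: ler_wpM2l; [exact: ltW|rewrite expr2 ler_peMl//; lra].
exact: le_trans h1 h2.
Qed.

End L2bound.

(** * Regularity of the divergence kernel *)

Section BMO.
Context {R : realType}.
Local Notation C := (R * R)%type.
Implicit Types (z w u : C).

Section KernelDiff.
Variable s : R.
Hypothesis s0 : 0 < s.
Local Notation al := (@al R s). Local Notation be := (@be R s). Local Notation ga := (@ga R s).

Let nqd u v : `|nq u - nq v| <= 2 * `|u - v| * (`|u| + `|v|).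
Proof.
rewrite /nq; have -> : u.1 ^+ 2 + u.2 ^+ 2 - (v.1 ^+ 2 + v.2 ^+ 2) =
  (u - v).1 * (u.1 + v.1) + (u - v).2 * (u.2 + v.2) by rewrite /=; ring.
have h (a b c d : R) : `|a| <= `|u - v| -> `|c| <= `|u| -> `|d| <= `|v| -> `|a * (c + d)| <= `|u - v| * (`|u| + `|v|).
  by move=> h1 h2 h3; rewrite normrM ler_pM// (le_trans (ler_normD _ _))// lerD.
rewrite (le_trans (ler_normD _ _))//.
have := h _ 0 _ _ (norm1_le (u - v)) (norm1_le u) (norm1_le v).
have := h _ 0 _ _ (norm2_le (u - v)) (norm2_le u) (norm2_le v); lra.
Qed.

(* x/Q - x'/Q' = ((x - x')(Q + Q')/2 + (x + x')(Q' - Q)/2) / (Q Q') *)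
Let lin_diff (x x' : R) u v (l : R) : `|x| <= `|u| -> `|x'| <= `|v| -> `|x - x'| <= l ->
  `|u - v| <= l -> 2 * l <= `|u| -> 0 < `|u| ->
  `|x * ga u - x' * ga v| <= 28 * l / `|u| ^+ 2.
Proof.
move=> xu xv xx uv lu u0.
have vu : `|v| <= 3 / 2 * `|u| /\ `|u| / 2 <= `|v|.
  have := ler_normD (u - v) v; have := ler_normD (v - u) u; rewrite !subrK [`|v - u|]distrC; lra.
have [v1 v2] := vu; have v0 : 0 < `|v| by lra.
have l0 : 0 <= l by rewrite (le_trans _ uv).
have gu := ga_le s0 u0; have gv := ga_le s0 v0.
have gu0 := ga_gt0 s0 u; have gv0 := ga_gt0 s0 v.
set G := `|u| ^- 2 in gu.
have G0 : 0 < G by rewrite invr_gt0 exprn_gt0.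
have {}gv : ga v <= 4 * G.
  apply: (le_trans gv); have -> : 4 * G = ((`|u| / 2) ^+ 2)^-1 by rewrite /G; field; rewrite gt_eqF.
  by rewrite lef_pV2 ?posrE ?exprn_gt0 ?divr_gt0//; apply: le_pow => //; lra.
have -> : x * ga u - x' * ga v = (x - x') * (ga v + ga u) / 2 + (x + x') * (nq v - nq u) * (ga u * ga v) / 2.
  rewrite /ga; have := nqs_gt0 s0 u; have := nqs_gt0 s0 v => h1 h2.
  by field; rewrite !gt_eqF.
have -> : 28 * l / `|u| ^+ 2 = 28 * l * G by [].
have e1 : `|(x - x') * (ga v + ga u) / 2| <= 5 / 2 * l * G.
  rewrite !normrM [`|2^-1|]ger0_norm// [`|ga v + ga u|]ger0_norm; last by lra.
  have : `|x - x'| * (ga v + ga u) <= l * (5 * G) by apply: ler_pM => //; lra.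
  lra.
have e2 : `|(x + x') * (nq v - nq u) * (ga u * ga v) / 2| <= 25 * l * G.
  rewrite !normrM [`|2^-1|]ger0_norm// [`|ga u|]gtr0_norm// [`|ga v|]gtr0_norm//.
  have a1 : `|x + x'| <= 5 / 2 * `|u| by rewrite (le_trans (ler_normD _ _))//; lra.
  have a2 : `|nq v - nq u| <= 5 * l * `|u|.
    apply: (le_trans (nqd v u)); rewrite [`|v - u|]distrC.
    have : `|u - v| * (`|v| + `|u|) <= l * (5 / 2 * `|u|) by apply: ler_pM => //; lra.
    by lra.
  have a3 : ga u * ga v <= G * (4 * G) by apply: ler_pM => //; exact: ltW.
  have a4 : `|x + x'| * `|nq v - nq u| <= 5 / 2 * `|u| * (5 * l * `|u|) by exact: ler_pM.
  have a5 : `|x + x'| * `|nq v - nq u| * (ga u * ga v) <= 5 / 2 * `|u| * (5 * l * `|u|) * (G * (4 * G)).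
    by apply: ler_pM => //; rewrite mulr_ge0// ltW.
  have E : `|u| * `|u| * G = 1 by rewrite -expr2 /G mulfV// expf_neq0// gt_eqF.
  have : 5 / 2 * `|u| * (5 * l * `|u|) * (G * (4 * G)) = 50 * l * G * (`|u| * `|u| * G) by field.
  by rewrite E => E'; rewrite E' in a5; lra.
by rewrite (le_trans (ler_normD _ _))//; have := mulr_ge0 l0 (ltW G0); lra.
Qed.

(** Hormander's condition with a constant independent of s. The terms [ga] cancel in [kA - kD], so
    the kernel is a quadratic form in [al] and [be], and differences of products reduce to
    [lin_diff]. *)
Lemma dkern_diff a c u v (l : R) : `|a| <= 1 -> `|c| <= 1 ->
  `|u - v| <= l -> 2 * l <= `|u| -> 0 < `|u| ->
  `|dkern s a c u - dkern s a c v| <= 896 * l / `|u| ^+ 3.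
Proof.
move=> a1 c1 uv lu u0.
have v2 : `|u| / 2 <= `|v|.
  by have := ler_normD (u - v) v; rewrite subrK; lra.
have v0 : 0 < `|v| by lra.
have l0 : 0 <= l by rewrite (le_trans _ uv).
set H := 28 * l / `|u| ^+ 2.
have H0 : 0 <= H by rewrite divr_ge0 ?mulr_ge0// exprn_ge0.
have da : `|al u - al v| <= H.
  apply: lin_diff => //; [exact: norm1_le|exact: norm1_le|].
  exact: (le_trans (norm1_le (u - v)) uv).
have db : `|be u - be v| <= H.
  apply: lin_diff => //; [exact: norm2_le|exact: norm2_le|].
  exact: (le_trans (norm2_le (u - v)) uv).
set U := `|u|^-1; have U0 : 0 < U by rewrite invr_gt0.
have Vu : `|v|^-1 <= 2 * U.
  have -> : 2 * U = (`|u| / 2)^-1 by rewrite /U; field; rewrite gt_eqF.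
  by rewrite lef_pV2 ?posrE ?divr_gt0.
have au : `|al u| <= 2 * U by rewrite (le_trans (al_le s0 u0))// -/U; lra.
have bu : `|be u| <= 2 * U by rewrite (le_trans (be_le s0 u0))// -/U; lra.
have av : `|al v| <= 2 * U by rewrite (le_trans (al_le s0 v0)).
have bv : `|be v| <= 2 * U by rewrite (le_trans (be_le s0 v0)).
have pr (x y x' y' : R) : `|x - x'| <= H -> `|y - y'| <= H -> `|y| <= 2 * U -> `|x'| <= 2 * U ->
    `|x * y - x' * y'| <= 4 * (H * U).
  move=> hx hy y1 x1; have -> : x * y - x' * y' = (x - x') * y + x' * (y - y') by ring.
  rewrite (le_trans (ler_normD _ _))// !normrM.
  have := ler_pM (normr_ge0 _) (normr_ge0 _) hx y1; have := ler_pM (normr_ge0 _) (normr_ge0 _) x1 hy; lra.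
have -> : dkern s a c u - dkern s a c v =
  2 * a * (be u * be u - be v * be v) - 2 * a * (al u * al u - al v * al v) - 4 * c * (al u * be u - al v * be v).
  by rewrite /dkern /kA /kB /kD; ring.
have -> : 896 * l / `|u| ^+ 3 = 32 * (H * U) by rewrite /H /U; field; rewrite gt_eqF.
have HU : 0 <= H * U by rewrite mulr_ge0// ltW.
rewrite (le_trans (ler_normB _ _))//.
have h1 : `|2 * a * (be u * be u - be v * be v)| <= 8 * (H * U).
  rewrite !normrM [`|2|]ger0_norm//.
  have := ler_pM (normr_ge0 _) (normr_ge0 _) a1 (pr _ _ _ _ db db bu bv); lra.
have h2 : `|2 * a * (al u * al u - al v * al v)| <= 8 * (H * U).
  rewrite !normrM [`|2|]ger0_norm//.
  have := ler_pM (normr_ge0 _) (normr_ge0 _) a1 (pr _ _ _ _ da da au av); lra.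
have h3 : `|4 * c * (al u * be u - al v * be v)| <= 16 * (H * U).
  rewrite !normrM [`|4|]ger0_norm//.
  have := ler_pM (normr_ge0 _) (normr_ge0 _) c1 (pr _ _ _ _ da db bu av); lra.
have h4 := ler_normB (2 * a * (be u * be u - be v * be v)) (2 * a * (al u * al u - al v * al v)).
by apply: (le_trans (lerD h4 h3)); lra.
Qed.

End KernelDiff.
End BMO.

(** * From bounded functions to bounded mean oscillation *)

Section Entropy.
Context {R : realType}.
Local Notation C := (R * R)%type.
Implicit Types (z w u : C) (k b : C -> R).

Lemma conv_bD k b1 b2 z : BL k -> Ig b1 -> Ig b2 ->
  conv k (fun w => b1 w + b2 w) z = conv k b1 z + conv k b2 z.
Proof.
move=> bk j1 j2; rewrite /conv -(JD (Ig_conv z bk j1) (Ig_conv z bk j2)).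
by apply: eq_J => w; rewrite mulrDr.
Qed.

Lemma conv_bZ k (c : R) b z : BL k -> Ig b -> conv k (fun w => c * b w) z = c * conv k b z.
Proof.
move=> bk j1; rewrite /conv -(JZ _ (Ig_conv z bk j1)).
by apply: eq_J => w; rewrite mulrCA.
Qed.

(** The far contribution: 896 from [dkern_diff] times 32 / 2 from [far_Ig] at radius 2 l. *)
Definition cB : R := 896 * 16.
(** The near contribution is 4096 from [L2_bound] times the area 64 w^2 of the square of radius 4 w;
    the factors 2 come from (x + y)^2 <= 2 x^2 + 2 y^2. *)
Definition cV : R := 2 * (4096 * 64) + 2 * cB ^+ 2.

Lemma cV_ge1 : 1 <= cV.
Proof. by rewrite /cV; have := sqr_ge0 cB; lra. Qed.

Section OneField.
Variables (s a c : R) (b : C -> R) (M r : R).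
Hypotheses (s0 : 0 < s) (ac : a ^+ 2 + c ^+ 2 = 1) (mb : measurable_fun setT b) (r0 : 0 < r).
Hypotheses (bM : forall z, `|b z| <= M) (br : forall z, r < `|z| -> b z = 0).
Let k := dkern s a c.
Let bk : BL k := BL_dkern s0 a c.
Let f := conv k b.

Let sq1 (x : R) : x ^+ 2 <= 1 -> `|x| <= 1.
Proof.
move=> x2; have : `|x| ^+ 2 <= 1 ^+ 2 by rewrite real_normK ?num_real// expr1n.
by rewrite ler_pXn2r// ?nnegrE.
Qed.

Let a1 : `|a| <= 1.
Proof. by apply: sq1; have := sqr_ge0 c; have := ac; lra. Qed.

Let c1 : `|c| <= 1.
Proof. by apply: sq1; have := sqr_ge0 a; have := ac; lra. Qed.

Let M0 : 0 <= M. Proof. exact: le_trans (normr_ge0 _) (bM 0). Qed.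

(** The classical splitting for a singular integral of a bounded function: the part of b near the
    rectangle is handled in L^2, and the far part oscillates by at most [cB * M] by Hormander's
    condition. *)
Lemma var_bound (a0 p w h : R) : 0 < w -> h = w \/ h = 2 * w ->
  J (fun z => rect a0 p w h z * f z ^+ 2) / (w * h) - (J (fun z => rect a0 p w h z * f z) / (w * h)) ^+ 2
    <= cV * M ^+ 2.
Proof.
move=> w0 hw; have w0' := ltW w0.
have [h0 h2] : 0 < h /\ h <= 2 * w by case: hw => ->; split; rewrite ?mulr_gt0//; lra.
have hw1 : w <= h by case: hw => ->; lra.
have h0' := ltW h0.
(* l bounds the distance from the corner z0 to any point of the rectangle, because h <= 2 w; the
   kernel difference is used beyond distance l2 = 2 l, as [dkern_diff] requires. *)
pose z0 : C := (a0, p); pose l := 2 * w; pose l2 := 2 * l.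
have l0 : 0 < l by rewrite mulr_gt0.
have l20 : 0 < l2 by rewrite mulr_gt0.
pose chi u := box l2 (z0 - u).
have mchi : measurable_fun setT chi by apply: measurable_shift; exact: measurable_box.
have chi01 u : chi u = 0 \/ chi u = 1.
  by rewrite /chi /box; case: (leP `|z0 - u| l2) => _; [right|left].
pose b1 u := b u * chi u; pose b2 u := b u * (1 - chi u).
have mb1 : measurable_fun setT b1 by apply: measurable_funM.
have mb2 : measurable_fun setT b2 by apply: measurable_funM => //; apply: measurable_funB.
have b1M u : `|b1 u| <= M by rewrite /b1; case: (chi01 u) => ->; rewrite ?mulr0 ?mulr1 ?normr0.
have b2M u : `|b2 u| <= M by rewrite /b2; case: (chi01 u) => ->; rewrite ?subrr ?subr0 ?mulr0 ?mulr1 ?normr0.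
have b1r u : r < `|u| -> b1 u = 0 by move=> /br bu0; rewrite /b1 bu0 mul0r.
have b2r u : r < `|u| -> b2 u = 0 by move=> /br bu0; rewrite /b2 bu0 mul0r.
have [j1 _] := bounded_Ig mb1 (ltW r0) b1M b1r.
have [j2 _] := bounded_Ig mb2 (ltW r0) b2M b2r.
pose f1 := conv k b1; pose f2 := conv k b2.
have fE z : f z = f1 z + f2 z.
  rewrite -(conv_bD z bk j1 j2) /f; congr conv; apply/funext => u.
  by rewrite /b1 /b2; ring.
pose x0 := f2 z0.
have f2b z : rect a0 p w h z = 1 -> `|f2 z - x0| <= cB * M.
  move=> r1.
  have /andP[/andP[z1 z2] /andP[z3 z4]] : (a0 <= z.1 < a0 + w) && (p <= z.2 < p + h).
    by move: r1; rewrite /rect; case: ifP => // _ /esym/eqP; rewrite oner_eq0.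
  have zz0 : `|z0 - z| <= l.
    by rewrite normC_le/= !ler_norml /l; apply/andP; split; apply/andP; split; lra.
  rewrite /x0 /f2 /conv -(JB (Ig_conv z bk j2) (Ig_conv z0 bk j2)).
  have [jf Jf] := far_Ig l20.
  have jf' := Ig_reflect z0 jf.
  apply: (@le_trans _ _ (J (fun u => M * (896 * l) * far l2 (z0 - u)))).
    apply: J_abs_le.
    - exact: Ig_meas (IgB (Ig_conv z bk j2) (Ig_conv z0 bk j2)).
    - exact: IgZ.
    - move=> u; rewrite -mulrBl normrM.
      have [ul|ul] := leP `|z0 - u| l2.
        by rewrite /b2 /chi /far /box ul subrr !mulr0 normr0 mulr0 mul0r mulr0.
      have u0 : 0 < `|z0 - u| by rewrite (lt_trans l20).
      have := @dkern_diff R s s0 a c (z0 - u) (z - u) l a1 c1.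
      have -> : z0 - u - (z - u) = z0 - z by rewrite opprB addrA subrK.
      move=> /(_ zz0 (ltW ul) u0); rewrite distrC => hk.
      have -> : far l2 (z0 - u) = (`|z0 - u| ^+ 3)^-1.
        by rewrite /far /box leNgt ul/= subr0 mul1r.
      have := ler_pM (normr_ge0 _) (normr_ge0 _) hk (b2M u); rewrite /k; lra.
  rewrite (JZ _ jf') (J_reflect z0 (measurable_far l2)).
  have Ml : 0 <= M * (896 * l) := mulr_ge0 M0 (mulr_ge0 (ler0n _ 896) (ltW l0)).
  apply: (le_trans (ler_wpM2l Ml Jf)).
  rewrite le_eqVlt; apply/orP; left; apply/eqP; rewrite /cB /l2.
  move: (896 : R) => c896; have lN0 : l != 0 by rewrite gt_eqF.
  by field.
have bf : BL f by apply: BL_conv => //; case: (bounded_Ig mb (ltW r0) bM br).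
have bf1 : BL f1 by exact: BL_conv.
have [cf cf0 [cf1 _]] := bf; have [cg cg0 [cg1 _]] := bf1.
have wh : 0 < w * h by rewrite mulr_gt0.
have i1 : Ig (fun z => rect a0 p w h z * f z) := Ig_rectM a0 p w0' h0' (BL_measurable bf) cf1.
have bff := BL_M bf bf; have [ch ch0 [ch1 _]] := bff.
have i2 : Ig (fun z => rect a0 p w h z * f z ^+ 2) := Ig_rectM a0 p w0' h0' (BL_measurable bff) ch1.
have ir := Ig_rect a0 p w0' h0'.
set A2 := J (fun z => rect a0 p w h z * f z ^+ 2); set A1 := J (fun z => rect a0 p w h z * f z).
pose m := `|a0| + `|p| + w + h.
have m0 : 0 <= m by rewrite /m !addr_ge0.
have bf12 : BL (fun z => f1 z ^+ 2) := BL_M bf1 bf1.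
have jb1 := Ig_boxcont m0 (BL_continuous bf12).
have key : A2 - 2 * x0 * A1 + x0 ^+ 2 * (w * h) <=
    2 * J (fun z => box m z * f1 z ^+ 2) + 2 * (cB * M) ^+ 2 * (w * h).
  rewrite -(J_rect a0 p w0' h0') /A1 /A2 -(JZ _ i1) -(JZ _ ir) -(JZ _ ir) -(JZ _ jb1).
  rewrite -(JB i2 (IgZ (2 * x0) i1)) -(JD (IgB i2 (IgZ (2 * x0) i1)) (IgZ _ ir)) -(JD (IgZ 2 jb1) (IgZ _ ir)).
  apply: J_le; [exact: (IgD (IgB i2 (IgZ (2 * x0) i1)) (IgZ _ ir))|exact: (IgD (IgZ 2 jb1) (IgZ _ ir))|].
  move=> z; have [->|r1] : rect a0 p w h z = 0 \/ rect a0 p w h z = 1.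
  - by rewrite /rect; case: ifP => _; [right|left].
  - by rewrite !mul0r !mulr0 !addr0 subr0 mulr_ge0// mulr_ge0 ?box_ge0 ?sqr_ge0.
  have bz : box m z = 1.
    rewrite /box; case: leP => // mz.
    by move: r1; rewrite (rect_supp w0' h0' mz) => /esym/eqP; rewrite oner_eq0.
  rewrite r1 bz !mul1r !mulr1 fE.
  have h3 : (f2 z - x0) ^+ 2 <= (cB * M) ^+ 2.
    rewrite -[leLHS]ger0_norm ?sqr_ge0// normrX; apply: le_pow => //; exact: f2b.
  have -> : (f1 z + f2 z) ^+ 2 - 2 * x0 * (f1 z + f2 z) + x0 ^+ 2 = (f1 z + (f2 z - x0)) ^+ 2 by ring.
  have : 0 <= (f1 z - (f2 z - x0)) ^+ 2 by exact: sqr_ge0.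
  rewrite sqrrB sqrrD; lra.
have L2 := L2_bound s0 mb1 r0 b1M b1r ac m0.
have Jb1 : J (fun u => b1 u ^+ 2) <= M ^+ 2 * (4 * l2 ^+ 2).
  have [jb Jb] := Ig_box (ltW l20).
  have jbr := Ig_reflect z0 jb.
  rewrite -Jb -(J_reflect z0 (measurable_box l2)) -(JZ _ jbr).
  have [jb2 _] : Ig (fun u => b1 u ^+ 2) /\ J (fun u => `|b1 u ^+ 2|) <= M ^+ 2 * (4 * r ^+ 2).
    apply: bounded_Ig; [exact: measurable_funX|exact: ltW| |].
    - by move=> u; rewrite normrX le_pow.
    - by move=> u /b1r ->; rewrite expr0n.
  apply: J_le => //; first exact: IgZ.
  move=> u; rewrite /b1 -/(chi u); case: (chi01 u) => ->; first by rewrite !mulr0 expr0n.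
  by rewrite !mulr1 -[leLHS]ger0_norm ?sqr_ge0// normrX le_pow.
(* The mean minimises the mean square deviation, so it may be replaced by x0. *)
have Vle : A2 / (w * h) - (A1 / (w * h)) ^+ 2 <= (A2 - 2 * x0 * A1 + x0 ^+ 2 * (w * h)) / (w * h).
  have wh' : w * h != 0 by rewrite gt_eqF.
  rewrite -subr_ge0 (_ : _ - _ = (A1 / (w * h) - x0) ^+ 2) ?sqr_ge0//.
  by field; rewrite !gt_eqF.
apply: (le_trans Vle); rewrite ler_pdivrMr//; apply: (le_trans key).
have M2 : 0 <= M ^+ 2 by exact: sqr_ge0.
have e1 := ler_wpM2l (ler0n R 4096) Jb1.
have e2 : 4096 * (M ^+ 2 * (4 * l2 ^+ 2)) = 4096 * 64 * (M ^+ 2 * w ^+ 2).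
  by rewrite /l2 /l; move: (4096 : R) => c4096; ring.
have e3 : M ^+ 2 * w ^+ 2 <= M ^+ 2 * (w * h) by rewrite ler_wpM2l// expr2 ler_wpM2l.
have e4 := le_trans L2 e1; rewrite e2 in e4.
rewrite /cV; have -> : (2 * (4096 * 64) + 2 * cB ^+ 2) * M ^+ 2 * (w * h) =
  2 * (4096 * 64 * (M ^+ 2 * (w * h))) + 2 * (cB * M) ^+ 2 * (w * h).
  by move: (4096 : R) cB => c4096 cB'; ring.
have K64 : 0 <= 4096 * 64 :> R := mulr_ge0 (ler0n _ 4096) (ler0n _ 64).
rewrite lerD2r; apply: ler_wpM2l; first exact: ler0n.
exact: (le_trans e4 (ler_wpM2l K64 e3)).
Qed.

End OneField.

End Entropy.

(** * Entropy bound for the integral of a density against the divergence *)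

Section Entropy2.
Context {R : realType}.
Local Notation C := (R * R)%type.
Implicit Types (z w u : C) (k b : C -> R).

Let half_itv (W x : R) : 0 <= W -> - (W / 2) <= x -> x < - (W / 2) + W -> - W <= x <= W.
Proof. by move=> ? ? ?; apply/andP; split; lra. Qed.

Let wide_itv (q B x : R) : 0 <= B -> - q <= x -> x <= q ->
  - ((2 * q + 2 + 16 * B) / 2) <= x < - ((2 * q + 2 + 16 * B) / 2) + (2 * q + 2 + 16 * B).
Proof. by move=> ? ? ?; apply/andP; split; lra. Qed.

(** [young_exp] with y = rho / t, integrated over one large square. The logarithm is that of 1 + 1 /
    t because rho <= 1. *)
Lemma entropy_unit (s a c : R) (b : C -> R) (M r : R) (rho : C -> R) (q t : R) :
  0 < s -> a ^+ 2 + c ^+ 2 = 1 -> measurable_fun setT b -> 0 < r ->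
  (forall z, `|b z| <= M) -> (forall z, r < `|z| -> b z = 0) -> cV * M ^+ 2 <= 50^-1 ->
  measurable_fun setT rho -> (forall z, 0 <= rho z <= 1) -> 0 < q -> (forall z, q < `|z| -> rho z = 0) ->
  0 < t ->
  J (fun z => rho z * conv (dkern s a c) b z) <= ln (1 + t^-1) * J rho + t * (6 * (4096 * J (fun w => b w ^+ 2))).
Proof.
move=> s0 ac mb r0 bM br hM mr rho01 q0 rq t0.
set F := conv (dkern s a c) b; set B2 := 4096 * J (fun w => b w ^+ 2).
have [jb _] := bounded_Ig mb (ltW r0) bM br.
have bF : BL F := BL_conv (BL_dkern s0 a c) jb.
have [L L0 [FB FL]] := bF; have mF := BL_measurable bF.
have B20 : 0 <= B2 := mulr_ge0 (ler0n _ 4096) (J_ge0 (fun w => sqr_ge0 (b w))).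
have L2b (m : R) (m0 : 0 <= m) : J (fun z => box m z * F z ^+ 2) <= B2 := L2_bound s0 mb r0 bM br ac m0.
clearbody B2.
have HV (a0 p w h : R) (w0 : 0 < w) (hw : h = w \/ h = 2 * w) :=
  le_trans (var_bound s0 ac mb r0 bM br a0 p w0 hw) hM.
(* The square of side W contains the support of rho. Moreover W^2 >= 16 B2 while x^2 W^2 <= B2 for
   the mean x of F, so |x| <= 1 / 4 as [square_exp_bound] requires. *)
pose W := 2 * q + 2 + 16 * B2.
have W0 : 0 < W by rewrite /W; lra.
have W0' := ltW W0.
pose Q := rect (- (W / 2)) (- (W / 2)) W W.
have bFF : BL (fun z => F z ^+ 2) := BL_M bF bF.
have [L' L'0 [FB' _]] := bFF.
have i1 : Ig (fun z => Q z * F z) := Ig_rectM _ _ W0' W0' mF FB.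
have i2 : Ig (fun z => Q z * F z ^+ 2) := Ig_rectM _ _ W0' W0' (BL_measurable bFF) FB'.
have iQ : Ig Q := Ig_rect _ _ W0' W0'.
have JQ : J Q = W * W := J_rect _ _ W0' W0'.
have QB : J (fun z => Q z * F z ^+ 2) <= B2.
  have L2 := L2b W W0'.
  apply: le_trans L2; apply: J_le => //; first exact: (Ig_boxcont W0' (BL_continuous bFF)).
  move=> z; apply: ler_wpM2r; first exact: sqr_ge0.
  rewrite /Q /rect /box; case: ifP => [/andP[/andP[z1 z2] /andP[z3 z4]]|_]; last exact: ler0n.
  have -> // : `|z| <= W.
  by rewrite normC_le !ler_norml !half_itv.
set x := J (fun z => Q z * F z) / (W * W).
have WW : 0 < W * W by rewrite mulr_gt0.
have xB : x ^+ 2 * (W * W) <= B2.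
  have : 0 <= J (fun z => Q z * F z ^+ 2 - (2 * x) * (Q z * F z) + x ^+ 2 * Q z).
    apply: J_ge0 => z; have -> : Q z * F z ^+ 2 - (2 * x) * (Q z * F z) + x ^+ 2 * Q z = Q z * (F z - x) ^+ 2 by ring.
    by rewrite mulr_ge0 ?sqr_ge0 ?rect_ge0.
  rewrite (JD (IgB i2 (IgZ (2 * x) i1)) (IgZ _ iQ)) (JB i2 (IgZ (2 * x) i1)) (JZ _ i1) (JZ _ iQ) JQ.
  have -> : J (fun z => Q z * F z) = x * (W * W) by rewrite /x mulfVK// gt_eqF.
  move=> h; apply: le_trans QB; rewrite -subr_ge0; apply: (le_trans h).
  by rewrite le_eqVlt; apply/orP; left; apply/eqP; ring.
have x4 : `|x| <= 4^-1.
  rewrite -(ler_pXn2r (_ : (0 < 2)%N))// ?nnegrE// real_normK ?num_real//.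
  rewrite -(ler_pM2r WW); apply: (le_trans xB).
  have : 0 <= 16 * B2 * W by rewrite !mulr_ge0.
  have W1 : 16 * B2 + 1 <= W by rewrite /W; lra.
  have : (16 * B2 + 1) * 1 <= W * W by apply: ler_pM => //; rewrite /W; lra.
  lra.
have sq := square_exp_bound mF FB FL HV W0 x4.
have ie : Ig (fun z => Q z * (expR (F z) - 1 - F z)).
  apply: (@Ig_rectM _ _ _ _ _ _ (expR L + 1 + L) W0' W0').
    by apply: measurable_funB => //; apply: measurable_funB => //; apply: measurableT_comp => //; exact: measurable_expR.
  move=> z; rewrite (le_trans (ler_normB _ _))// lerD//; rewrite (le_trans (ler_normB _ _))// normr1 lerD//.
  by rewrite ger0_norm ?expR_ge0// ler_expR (le_trans (ler_norm _)).
have irho : Ig rho.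
  have [] // := @bounded_Ig R rho 1 q mr (ltW q0) _ rq.
  by move=> z; have /andP[h1 h2] := rho01 z; rewrite ger0_norm.
have irF : Ig (fun z => rho z * F z).
  have [] // := @bounded_Ig R (fun z => rho z * F z) L q _ (ltW q0).
  - exact: measurable_funM.
  - by move=> z; have /andP[h1 h2] := rho01 z; rewrite normrM (ger0_norm h1); exact: le_trans (ler_piMl (normr_ge0 _) h2) (FB z).
  - by move=> z /rq ->; rewrite mul0r.
apply: (@le_trans _ _ (J (fun z => ln (1 + t^-1) * rho z + t * (Q z * (expR (F z) - 1 - F z))))); last first.
  rewrite (JD (IgZ _ irho) (IgZ _ ie)) (JZ _ irho) (JZ _ ie) lerD2l ler_pM2l//.
  by apply: (le_trans sq); rewrite ler_wpM2l.
apply: J_le => //; first exact: (IgD (IgZ _ irho) (IgZ _ ie)).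
move=> z; have /andP[h1 h2] := rho01 z.
have e0 : 0 <= expR (F z) - 1 - F z by have := expR_ge1Dx (F z); lra.
have l0 : 0 <= ln (1 + t^-1) by rewrite ln_ge0// lerDl invr_ge0 ltW.
have [zq|/rq ->] := leP `|z| q; last first.
  by rewrite mul0r mulr0 add0r !mulr_ge0 ?rect_ge0// ltW.
have -> : Q z = 1.
  move: zq; rewrite normC_le !ler_norml => /andP[/andP[z1 z2] /andP[z3 z4]].
  rewrite /Q /rect; case: ifPn => // /negP[]; rewrite /W.
  by rewrite !wide_itv.
rewrite mul1r; have y0 : 0 <= rho z / t by rewrite divr_ge0// ltW.
have := young_exp (F z) y0.
rewrite -(ler_pM2l t0) => h; have E : t * (rho z / t * F z) = rho z * F z by field; rewrite gt_eqF.
rewrite E in h; apply: (le_trans h); rewrite mulrDr lerD2r.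
have -> : t * (rho z / t * ln (1 + rho z / t)) = rho z * ln (1 + rho z / t) by field; rewrite gt_eqF.
rewrite mulrC ler_wpM2r// ler_ln ?posrE; last 2 first.
- by rewrite ltr_wpDr.
- by rewrite ltr_wpDr// invr_ge0 ltW.
by rewrite lerD2l ler_piMl// invr_ge0 ltW.
Qed.

(** Dividing b by [cK * M] meets the smallness hypothesis of [entropy_unit], since 50 cV <= cK^2. *)
Definition cK : R := 50 * cV + 1.

Lemma cK_ge1 : 1 <= cK. Proof. by rewrite /cK; have := @cV_ge1 R; lra. Qed.

Lemma entropy_bound (s a c : R) (b : C -> R) (M r : R) (rho : C -> R) (q t : R) :
  0 < s -> a ^+ 2 + c ^+ 2 = 1 -> measurable_fun setT b -> 0 < r -> 0 < M ->
  (forall z, `|b z| <= M) -> (forall z, r < `|z| -> b z = 0) ->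
  measurable_fun setT rho -> (forall z, 0 <= rho z <= 1) -> 0 < q -> (forall z, q < `|z| -> rho z = 0) ->
  0 < t ->
  J (fun z => rho z * conv (dkern s a c) b z) <=
    cK * M * ln (1 + t^-1) * J rho + t * (6 * (4096 * J (fun w => b w ^+ 2))) / M.
Proof.
move=> s0 ac mb r0 M0 bM br mr rho01 q0 rq t0.
have K1 := @cK_ge1; have K0 : 0 < cK by lra.
pose kk := (cK * M)^-1; have k0 : 0 < kk by rewrite invr_gt0 mulr_gt0.
have kM : kk * M = cK^-1 by rewrite /kk; field; rewrite !gt_eqF.
have [jb _] := bounded_Ig mb (ltW r0) bM br.
have [jb2 _] : Ig (fun u => b u ^+ 2) /\ J (fun u => `|b u ^+ 2|) <= M ^+ 2 * (4 * r ^+ 2).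
  apply: bounded_Ig; [exact: measurable_funX|exact: ltW| |].
  - by move=> u; rewrite normrX le_pow.
  - by move=> u /br ->; rewrite expr0n.
have := @entropy_unit s a c (fun w => kk * b w) (kk * M) r rho q t s0 ac _ r0.
move=> /(_ (measurable_funM (measurable_cst _) mb)) h.
have {}h H1 H2 H3 := h H1 H2 H3 mr rho01 q0 rq t0.
set B2 := J (fun w => b w ^+ 2).
have E1 : J (fun z => rho z * conv (dkern s a c) (fun w => kk * b w) z) =
    kk * J (fun z => rho z * conv (dkern s a c) b z).
  have [L L0 [FB _]] := BL_conv (BL_dkern s0 a c) jb.
  have mF := BL_measurable (BL_conv (BL_dkern s0 a c) jb).
  have irF : Ig (fun z => rho z * conv (dkern s a c) b z).
    have [] // := @bounded_Ig R (fun z => rho z * conv (dkern s a c) b z) L q _ (ltW q0).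
    - exact: measurable_funM.
    - by move=> z; have /andP[h1 h2] := rho01 z; rewrite normrM (ger0_norm h1); exact: le_trans (ler_piMl (normr_ge0 _) h2) (FB z).
    - by move=> z /rq ->; rewrite mul0r.
  rewrite -(JZ _ irF); apply: eq_J => z.
  by rewrite (conv_bZ kk z (BL_dkern s0 a c) jb) mulrCA.
have E2 : J (fun w => (kk * b w) ^+ 2) = kk ^+ 2 * B2.
  by rewrite -(JZ _ jb2); apply: eq_J => w; rewrite exprMn.
rewrite E1 E2 in h.
have B20 : 0 <= B2 by rewrite J_ge0// => w; exact: sqr_ge0.
have hh : kk * J (fun z => rho z * conv (dkern s a c) b z) <=
  ln (1 + t^-1) * J rho + t * (6 * (4096 * (kk ^+ 2 * B2))).
  apply: h.
  - by move=> z; rewrite normrM gtr0_norm// ler_pM2l.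
  - by move=> z /br ->; rewrite mulr0.
  - rewrite kM exprVn; have V1 := @cV_ge1 R.
    rewrite ler_pdivrMr ?exprn_gt0// ler_pdivlMl//.
    rewrite /cK; move: V1; move: cV => V V1.
    have -> : (50 * V + 1) ^+ 2 = (50 * V) ^+ 2 + 100 * V + 1 by ring.
    by have := sqr_ge0 (50 * V); lra.
rewrite -(ler_pM2l k0); apply: (le_trans hh).
rewrite mulrDr; apply: lerD.
  rewrite le_eqVlt; apply/orP; left; apply/eqP; rewrite /kk.
  by field; rewrite !gt_eqF.
have -> : kk * (t * (6 * (4096 * B2)) / M) = t * (6 * (4096 * B2)) * (kk / M) by ring.
have -> : t * (6 * (4096 * (kk ^+ 2 * B2))) = t * (6 * (4096 * B2)) * kk ^+ 2 by ring.
apply: ler_wpM2l; first exact: (mulr_ge0 (ltW t0) (mulr_ge0 (ler0n _ 6) (mulr_ge0 (ler0n _ 4096) B20))).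
rewrite expr2 ler_pM2l// /kk lef_pV2 ?posrE ?mulr_gt0//.
by rewrite ler_peMl// ltW.
Qed.

End Entropy2.

(** * Transport along one time step *)

Section Shear.
Context {R : realType}.
Local Notation C := (R * R)%type.
Local Notation mu := (@lebesgue_measure R).
Implicit Types (z w : C).

Definition Lip (k : C -> R) := exists2 c, 0 <= c & forall z z', `|k z - k z'| <= c * `|z - z'|.

Lemma Lip_fst : Lip fst.
Proof. by exists 1 => // z z'; rewrite mul1r; exact: (norm1_le (z - z')). Qed.

Lemma Lip_snd : Lip snd.
Proof. by exists 1 => // z z'; rewrite mul1r; exact: (norm2_le (z - z')). Qed.

Lemma Lip_shift (k b : C -> R) h : Lip k -> BL b -> Lip (fun z => k z - h * b z).
Proof.
move=> [c c0 kc] [d d0 [_ bd]]; exists (c + `|h| * d); first by rewrite addr_ge0 ?mulr_ge0.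
move=> z z'; have -> : k z - h * b z - (k z' - h * b z') = (k z - k z') - h * (b z - b z') by ring.
rewrite (le_trans (ler_normB _ _))// mulrDl lerD// normrM -mulrA ler_wpM2l//.
Qed.

Lemma BL_comp (s k1 k2 : C -> R) : BL s -> Lip k1 -> Lip k2 -> BL (fun z => s (k1 z, k2 z)).
Proof.
move=> [c c0 [s1 s2]] [d d0 kd] [e e0 ke].
exists (c + c * (d + e)); first by rewrite addr_ge0 ?mulr_ge0 ?addr_ge0.
split=> [z|z z']; first by rewrite (le_trans (s1 _))// lerDl mulr_ge0 ?addr_ge0.
apply: (le_trans (s2 _ _)); rewrite mulrDl.
have n0 : 0 <= `|z - z'| by [].
have h : `|(k1 z, k2 z) - (k1 z', k2 z')| <= (d + e) * `|z - z'|.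
  rewrite normC_le/= mulrDl; apply/andP; split.
    by rewrite (le_trans (kd z z'))// lerDl mulr_ge0.
  by rewrite (le_trans (ke z z'))// lerDr mulr_ge0.
have := ler_wpM2l c0 h; have := mulr_ge0 c0 n0; lra.
Qed.

Lemma antiderivative (r : R -> R) (m : R) : continuous r -> (forall x, m < `|x| -> r x = 0) ->
  exists G : R -> R, forall x : R, is_derive x 1 G (r x).
Proof.
move=> cr r0.
have ir : mu.-integrable setT (EFin \o r).
  have i1 : mu.-integrable `[- m, m]%classic (EFin \o r).
    by apply: continuous_compact_integrable; [exact: segment_compact|exact: continuous_subspaceT].
  have mI := measurable_itv (`[- m, m] : interval R).
  have := proj1 (@integrable_mkcond _ _ _ mu _ (EFin \o r) mI) i1; congr (integrable _ _ _).
  apply/funext => x; rewrite patchE mem_setE in_itv/= -ler_norml; case: leP => // /r0 E.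
  by rewrite /= E.
exists (fun x => \int[mu]_(t in `]-oo, x]) r t)%R => x.
have iu : mu.-integrable [set` Interval -oo%O (BRight (x + 1))] (EFin \o r).
  by apply: integrableS ir => //; exact: measurable_itv.
have xx1 : x < x + 1 by rewrite ltrDl.
have [d1 d2] := @continuous_FTC1 R r -oo%O x (x + 1) xx1 iu (ltNyr x) (cr x).
by apply: (DeriveDef d1); rewrite -derive1E; exact: d2.
Qed.

(** An antiderivative G of r turns both sides into boundary values, whether or not x - h a(x) is
    monotone. At the ends a displacement of at most 1 stays where r vanishes and G is constant. *)
Lemma subst_itv (r a da : R -> R) (m h : R) : 0 < m -> continuous r -> (forall x, m < `|x| -> r x = 0) ->
  (forall x : R, is_derive x 1 a (da x)) -> continuous da -> continuous a -> (forall x, `|h * a x| <= 1) ->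
  (\int[mu]_(x in `[(- (m + 2))%R, (m + 2)%R]) (r (x - h * a x)%R * (1 - h * da x))%:E =
   \int[mu]_(x in `[(- (m + 2))%R, (m + 2)%R]) (r x)%:E)%E.
Proof.
move=> m0 cr r0 dae cda ca ha; have [G dG] := antiderivative cr r0.
have n0 : 0 < m + 2 by lra.
have dX (x : R) : is_derive x 1 (fun x => x - h * a x) (1 - h * da x).
  exact: d1_B (d1_id x) (d1_Z h (dae x)).
have dGX (x : R) : is_derive x 1 (fun x => G (x - h * a x)) (r (x - h * a x) * (1 - h * da x)).
  exact: (@d1_comp R G (fun x => x - h * a x) x _ _ (dG _) (dX x)).
have cX : continuous (fun x => x - h * a x).
  by move=> x; apply: cvgB; [exact: cvg_id|apply: cvgM; [exact: cvg_cst|exact: ca]].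
have crX : continuous (fun x => r (x - h * a x) * (1 - h * da x)).
  move=> x; apply: cvgM; first exact: (continuous_comp (cX x) (cr _)).
  by apply: cvgB; [exact: cvg_cst|apply: cvgM; [exact: cvg_cst|exact: cda]].
rewrite (FTC_itv n0 crX dGX) (FTC_itv n0 cr dG); congr ((_ - _)%:E).
- have := @bounded_deriv_lip R G r 0 (m + 1) (m + 3) (fun x _ => dG x).
  have h1 x : m + 1 <= x <= m + 3 -> `|r x| <= 0.
    by move=> /andP[x1 x2]; rewrite r0 ?normr0// (lt_le_trans _ (ler_norm x))//; lra.
  move=> /(_ h1 (m + 2 - h * a (m + 2)) (m + 2)) h2.
  have := ha (m + 2); rewrite ler_norml => /andP[a1 a2].
  apply/eqP; rewrite -subr_eq0 -normr_le0; apply: (le_trans (h2 _ _)); rewrite ?mul0r//; lra.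
- have := @bounded_deriv_lip R G r 0 (- (m + 3)) (- (m + 1)) (fun x _ => dG x).
  have h1 x : - (m + 3) <= x <= - (m + 1) -> `|r x| <= 0.
    move=> /andP[x1 x2]; rewrite r0 ?normr0//; apply: (@lt_le_trans _ _ (- x)); first by lra.
    by rewrite -normrN ler_norm.
  move=> /(_ h1 (- (m + 2) - h * a (- (m + 2))) (- (m + 2))) h2.
  have := ha (- (m + 2)); rewrite ler_norml => /andP[a1 a2].
  apply/eqP; rewrite -subr_eq0 -normr_le0; apply: (le_trans (h2 _ _)); rewrite ?mul0r//; lra.
Qed.

Lemma box_J (f : C -> R) n : (forall z, n < `|z| -> f z = 0) -> J f = J (fun z => box n z * f z).
Proof.
move=> f0; apply: eq_J => z; rewrite /box; case: leP => [_|/f0 ->]; first by rewrite mul1r.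
by rewrite mulr0.
Qed.

Lemma Ig_BLbox (f : C -> R) n : 0 <= n -> BL f -> (forall z, n < `|z| -> f z = 0) -> Ig f.
Proof.
move=> n0 bf f0; apply: eq_Ig (Ig_boxcont n0 (BL_continuous bf)) => z.
by rewrite /box; case: leP => [_|/f0 ->]; [rewrite mul1r|rewrite mulr0].
Qed.

Section Subst.
Variables (s a da : C -> R) (m h : R).
Hypotheses (m0 : 0 < m) (bs : BL s) (ba : BL a) (bda : BL da).
Hypothesis s0 : forall z, m < `|z| -> s z = 0.
Hypothesis ha : forall z, `|h * a z| <= 1.

Let x0 (x y : R) : m < `|x| -> s (x, y) = 0.
Proof. by move=> mx; apply: s0; exact: (lt_le_trans mx (norm1_le (x, y))). Qed.

Let y0 (x y : R) : m < `|y| -> s (x, y) = 0.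
Proof. by move=> mx; apply: s0; exact: (lt_le_trans mx (norm2_le (x, y))). Qed.

Let far1 (x e : R) : `|e| <= 1 -> m + 2 < `|x| -> m < `|x - e|.
Proof. by move=> e1 mx; have := ler_normD (x - e) e; rewrite subrK; lra. Qed.

Let bc : BL (fun z => 1 - h * da z).
Proof. by apply: BL_B; [exact: BL_cst|exact: BL_Z]. Qed.

Lemma J_subst1 : (forall x y : R, is_derive x 1 (fun x => a (x, y)) (da (x, y))) ->
  J (fun z => s (z.1 - h * a z, z.2) * (1 - h * da z)) = J s.
Proof.
move=> dae; have n0 : 0 <= m + 2 by rewrite addr_ge0// ltW.
have b1 : BL (fun z => s (z.1 - h * a z, z.2) * (1 - h * da z)).
  by apply: BL_M => //; apply: BL_comp => //; [exact: Lip_shift Lip_fst ba|exact: Lip_snd].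
rewrite (@box_J (fun z => s (z.1 - h * a z, z.2) * (1 - h * da z)) (m + 2)); last first.
  move=> z; rewrite ltNge normC_le negb_and -!ltNge => /orP[z1|z2].
    by rewrite x0 ?mul0r//; exact: far1.
  by rewrite y0 ?mul0r//; move: z2; have := m0; lra.
rewrite (@box_J s (m + 2)); last by move=> z mz; apply: s0; move: mz; have := m0; lra.
have j1 := Ig_boxcont n0 (BL_continuous b1); have j2 := Ig_boxcont n0 (BL_continuous bs).
apply: (J_iter1_eq j1 j2) => y _.
apply: (@subst_itv (fun x => s (x, y)) (fun x => a (x, y)) (fun x => da (x, y))) => //.
- by apply: cont_line1; exact: BL_continuous.
- by move=> x; exact: x0.
- by apply: cont_line1; exact: BL_continuous.
- by apply: cont_line1; exact: BL_continuous.
Qed.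

Lemma J_subst2 : (forall x y : R, is_derive y 1 (fun y => a (x, y)) (da (x, y))) ->
  J (fun z => s (z.1, z.2 - h * a z) * (1 - h * da z)) = J s.
Proof.
move=> dae; have n0 : 0 <= m + 2 by rewrite addr_ge0// ltW.
have b1 : BL (fun z => s (z.1, z.2 - h * a z) * (1 - h * da z)).
  by apply: BL_M => //; apply: BL_comp => //; [exact: Lip_fst|exact: Lip_shift Lip_snd ba].
rewrite (@box_J (fun z => s (z.1, z.2 - h * a z) * (1 - h * da z)) (m + 2)); last first.
  move=> z; rewrite ltNge normC_le negb_and -!ltNge => /orP[z1|z2].
    by rewrite x0 ?mul0r//; move: z1; have := m0; lra.
  by rewrite y0 ?mul0r//; exact: far1.
rewrite (@box_J s (m + 2)); last by move=> z mz; apply: s0; move: mz; have := m0; lra.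
have j1 := Ig_boxcont n0 (BL_continuous b1); have j2 := Ig_boxcont n0 (BL_continuous bs).
apply: (J_iter2_eq j1 j2) => x _.
apply: (@subst_itv (fun y => s (x, y)) (fun y => a (x, y)) (fun y => da (x, y))) => //.
- by apply: cont_line2; exact: BL_continuous.
- by move=> y; exact: y0.
- by apply: cont_line2; exact: BL_continuous.
- by apply: cont_line2; exact: BL_continuous.
Qed.

End Subst.

Lemma J_diff_le (f g : C -> R) (n e : R) : 0 <= n -> BL f -> BL g ->
  (forall z, n < `|z| -> f z = 0) -> (forall z, n < `|z| -> g z = 0) ->
  (forall z, `|f z - g z| <= e) -> `|J f - J g| <= e * (4 * n ^+ 2).
Proof.
move=> n0 bf bg f0 g0 fg.
have jf := Ig_BLbox n0 bf f0; have jg := Ig_BLbox n0 bg g0.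
rewrite -(JB jf jg); apply: (le_trans (J_abs (IgB jf jg))).
have [//||//] := @bounded_Ig R (fun z => f z - g z) e n _ n0 fg.
- by apply: measurable_funB; exact: BL_measurable.
- by move=> z nz; rewrite f0// g0// subrr.
Qed.

(* The map z -> z - h (a, b)(z) is, up to O(h^2), a composition of two shears, and each shear
   is a one-dimensional substitution on lines. *)
Lemma shear_step (rho a b da db : C -> R) (m h Lr A L : R) : 0 < m -> 0 <= h -> 0 <= Lr -> 0 <= A -> 0 <= L ->
  BL rho -> (forall z z', `|rho z - rho z'| <= Lr * `|z - z'|) -> (forall z, m < `|z| -> rho z = 0) ->
  BL a -> BL b -> BL da -> BL db ->
  (forall z, `|a z| <= A) -> (forall z, `|b z| <= A) -> (forall z, `|da z| <= L) -> (forall z, `|db z| <= L) ->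
  (forall z z', `|b z - b z'| <= L * `|z - z'|) ->
  (forall x y : R, is_derive x 1 (fun x => a (x, y)) (da (x, y))) ->
  (forall x y : R, is_derive y 1 (fun y => b (x, y)) (db (x, y))) ->
  h * A <= 1 ->
  `|J (fun z => rho (z.1 - h * a z, z.2 - h * b z)) - J rho - h * J (fun z => rho z * (da z + db z))|
    <= 3 * (Lr * L * A * (4 * (m + 2) ^+ 2)) * h ^+ 2.
Proof.
move=> m0 h0 Lr0 A0 L0 br rL r0 ba bb bda bdb aA bA daL dbL bL dae dbe hA.
have m20 : 0 <= m + 2 by lra.
have hb (k : C -> R) : (forall z, `|k z| <= A) -> forall z, `|h * k z| <= h * A.
  by move=> kA z; rewrite normrM ger0_norm// ler_wpM2l.
have haA := hb a aA; have hbA := hb b bA.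
have ha1 z : `|h * a z| <= 1 := le_trans (haA z) hA.
have hb1 z : `|h * b z| <= 1 := le_trans (hbA z) hA.
have z0 (p q : R) : m < `|p| \/ m < `|q| -> rho (p, q) = 0.
  by case=> hm; apply: r0; [exact: (lt_le_trans hm (norm1_le (p, q)))|exact: (lt_le_trans hm (norm2_le (p, q)))].
have far1 (x e : R) : `|e| <= 1 -> m + 2 < `|x| -> m < `|x - e|.
  by move=> e1 mx; have := ler_normD (x - e) e; rewrite subrK; lra.
have far2 (x e : R) : `|e| <= 1 -> m + 1 < `|x| -> m < `|x - e|.
  by move=> e1 mx; have := ler_normD (x - e) e; rewrite subrK; lra.
have supp (k : C -> C) : (forall z, m + 2 < `|z.1| -> m < `|(k z).1|) -> (forall z, m + 2 < `|z.2| -> m < `|(k z).2|) ->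
    forall z, m + 2 < `|z| -> rho (k z) = 0.
  move=> h1 h2 z; rewrite ltNge normC_le negb_and -!ltNge => hz; rewrite (surjective_pairing (k z)); apply: z0.
  by case/orP: hz => [/h1|/h2]; [left|right].
pose s2 z := rho (z.1, z.2 - h * b z).
have bs2 : BL s2 by apply: BL_comp => //; [exact: Lip_fst|exact: Lip_shift Lip_snd bb].
have s20 z : m + 1 < `|z| -> s2 z = 0.
  rewrite ltNge normC_le negb_and -!ltNge => /orP[hz|hz]; apply: (z0 _ _); [left; lra|right; exact: far2].
have l1 : Lip (fun z => z.1 - h * a z) := Lip_shift h Lip_fst ba.
have bI1 : BL (fun z => s2 (z.1 - h * a z, z.2)) by apply: BL_comp => //; exact: Lip_snd.
have bI0 : BL (fun z => rho (z.1 - h * a z, z.2 - h * b z)).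
  by apply: BL_comp => //; exact: Lip_shift Lip_snd bb.
have I1z z : m + 2 < `|z| -> s2 (z.1 - h * a z, z.2) = 0.
  by apply: (supp (fun z => (z.1 - h * a z, z.2 - h * b (z.1 - h * a z, z.2)))) => w hw /=; exact: far1.
have I0z z : m + 2 < `|z| -> rho (z.1 - h * a z, z.2 - h * b z) = 0.
  by apply: (supp (fun z => (z.1 - h * a z, z.2 - h * b z))) => w hw /=; exact: far1.
have m2lt z : m + 2 < `|z| -> rho z = 0 by move=> hz; apply: r0; lra.
have s2z z : m + 2 < `|z| -> s2 z = 0 by move=> hz; apply: s20; lra.
have nle (p q e : R) : `|p| <= e -> `|q| <= e -> `|(p, q)| <= e by move=> hp hq; rewrite normC_le/= hp hq.
(* The composed shears evaluate b at the point already moved by the first shear, a distance at most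
   h A away; the discrepancy is therefore of second order in h. *)
have d01 : `|J (fun z => rho (z.1 - h * a z, z.2 - h * b z)) - J (fun z => s2 (z.1 - h * a z, z.2))|
    <= Lr * L * A * h ^+ 2 * (4 * (m + 2) ^+ 2).
  apply: (J_diff_le m20 bI0 bI1 I0z I1z) => z; rewrite /s2/=.
  apply: (le_trans (rL _ _)); rewrite -!mulrA; apply: ler_wpM2l => //.
  apply: (nle _ _ _); rewrite /= ?subrr ?normr0 ?mulr_ge0//.
  have -> : z.2 - h * b z - (z.2 - h * b (z.1 - h * a z, z.2)) = h * (b (z.1 - h * a z, z.2) - b z) by ring.
  rewrite normrM ger0_norm//.
  have -> : L * (A * h ^+ 2) = h * (L * (h * A)) by ring.
  apply: ler_wpM2l => //; apply: (le_trans (bL _ _)); apply: ler_wpM2l => //.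
  apply: (nle _ _ _); last by rewrite /= subrr normr0 mulr_ge0.
  by rewrite /= addrAC subrr add0r normrN.
have sE1 := J_subst1 (_ : 0 < m + 1) bs2 ba bda s20 ha1 dae.
have sE2 := J_subst2 m0 br bb bdb r0 hb1 dbe.
have {sE1} sE1 := sE1 ltac:(lra).
have ext1 : J (fun z => s2 (z.1 - h * a z, z.2)) = J s2 + h * J (fun z => s2 (z.1 - h * a z, z.2) * da z).
  have bp : BL (fun z => s2 (z.1 - h * a z, z.2) * da z) by exact: BL_M.
  have j1 := Ig_BLbox m20 bI1 I1z.
  have j2 : Ig (fun z => s2 (z.1 - h * a z, z.2) * da z).
    by apply: (Ig_BLbox m20 bp) => z /I1z ->; rewrite mul0r.
  rewrite -sE1 -(JZ _ j2); have -> : (fun z => s2 (z.1 - h * a z, z.2) * (1 - h * da z)) =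
    (fun z => s2 (z.1 - h * a z, z.2) - h * (s2 (z.1 - h * a z, z.2) * da z)).
    by apply/funext => z; ring.
  by rewrite (JB j1 (IgZ h j2)) subrK.
have ext2 : J s2 = J rho + h * J (fun z => s2 z * db z).
  have bp : BL (fun z => s2 z * db z) by exact: BL_M.
  have j1 := Ig_BLbox m20 bs2 s2z.
  have j2 : Ig (fun z => s2 z * db z).
    by apply: (Ig_BLbox m20 bp) => z /s2z ->; rewrite mul0r.
  rewrite -sE2 -(JZ _ j2); have -> : (fun z => rho (z.1, z.2 - h * b z) * (1 - h * db z)) =
    (fun z => s2 z - h * (s2 z * db z)).
    by apply/funext => z; rewrite /s2; ring.
  by rewrite (JB j1 (IgZ h j2)) subrK.
have bra : BL (fun z => rho z * da z) by exact: BL_M.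
have brb : BL (fun z => rho z * db z) by exact: BL_M.
(* After the exact substitutions, da and db are integrated against sheared copies of rho. Replacing
   these by rho costs O(h), hence O(h^2) with the prefactor h. *)
have dA : `|J (fun z => s2 (z.1 - h * a z, z.2) * da z) - J (fun z => rho z * da z)|
    <= Lr * L * A * h * (4 * (m + 2) ^+ 2).
  apply: (J_diff_le m20 _ bra) => [|z /I1z ->|z /m2lt ->|z]; rewrite ?mul0r//; first exact: BL_M.
  rewrite -mulrBl normrM.
  have -> : Lr * L * A * h = Lr * (h * A) * L by ring.
  apply: ler_pM => //; rewrite /s2/=; apply: (le_trans (rL _ _)); apply: ler_wpM2l => //.
  by apply: (nle _ _ _); rewrite /= addrAC subrr add0r normrN.
have dB : `|J (fun z => s2 z * db z) - J (fun z => rho z * db z)|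
    <= Lr * L * A * h * (4 * (m + 2) ^+ 2).
  apply: (J_diff_le m20 _ brb) => [|z /s2z ->|z /m2lt ->|z]; rewrite ?mul0r//; first exact: BL_M.
  rewrite -mulrBl normrM.
  have -> : Lr * L * A * h = Lr * (h * A) * L by ring.
  apply: ler_pM => //; rewrite /s2/=; apply: (le_trans (rL _ _)); apply: ler_wpM2l => //.
  by apply: (nle _ _ _); rewrite /= ?subrr ?normr0 ?mulr_ge0// addrAC subrr add0r normrN.
have jra : Ig (fun z => rho z * da z) by apply: (Ig_BLbox m20 bra) => z /m2lt ->; rewrite mul0r.
have jrb : Ig (fun z => rho z * db z) by apply: (Ig_BLbox m20 brb) => z /m2lt ->; rewrite mul0r.
have -> : J (fun z => rho z * (da z + db z)) = J (fun z => rho z * da z) + J (fun z => rho z * db z).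
  by rewrite -(JD jra jrb); apply: eq_J => z; rewrite mulrDr.
rewrite ext1 ext2 in d01.
have hh := h0; have dA' := ler_wpM2l hh dA; have dB' := ler_wpM2l hh dB.
move: (J _) (J _) (J _) (J _) (J _) (J _) d01 dA' dB' {dA dB} => I0 j0 j1 j2 j3 j4 d01 dA dB.
have -> : 3 * (Lr * L * A * (4 * (m + 2) ^+ 2)) * h ^+ 2 = Lr * L * A * h ^+ 2 * (4 * (m + 2) ^+ 2)
  + (h * (Lr * L * A * h * (4 * (m + 2) ^+ 2)) + h * (Lr * L * A * h * (4 * (m + 2) ^+ 2))) by ring.
rewrite -[X in X * `|_|](ger0_norm hh) -normrM in dA.
rewrite -[X in X * `|_|](ger0_norm hh) -normrM in dB.
have -> : j4 - j3 - h * (j0 + I0) =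
  (j4 - (j3 + h * j2 + h * j1)) + (h * (j1 - j0) + h * (j2 - I0)) by ring.
apply: (le_trans (ler_normD _ _)); apply: lerD => //.
by apply: (le_trans (ler_normD _ _)); exact: lerD.
Qed.

End Shear.

(** * The flow *)

Section ChainRule.
Context {R : realType}.
Local Notation V := (R * (R * R))%type.
Implicit Types (F : V -> R).

Let E0 : V := (1, (0, 0)).
Let E1 : V := (0, (1, 0)).
Let E2 : V := (0, (0, 1)).

Lemma slice_deriv (V1 V2 : normedModType R) (f : V1 -> R) (g : V2 -> R) p v q w :
  (forall h : R, f (h *: v + p) = g (h *: w + q)) ->
  derivable f p v -> derivable g q w /\ 'D_w g q = 'D_v f p.
Proof.
move=> fg df.
have E : (fun h : R => h^-1 *: ((f \o shift p) (h *: v) - f p)) =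
         (fun h : R => h^-1 *: ((g \o shift q) (h *: w) - g q)).
  apply/funext => h /=; rewrite fg; congr (_ *: (_ - _)).
  by have := fg 0; rewrite !scale0r !add0r.
by split; [rewrite /derivable -E|rewrite /derive -E].
Qed.

Lemma slice_diff1 F (p0 : V) (f : R -> V) (a : R) :
  (forall h x : R, h *: p0 + f x = f (h + x)) -> derivable F (f a) p0 ->
  is_derive a 1 (fun x => F (f x)) ('D_p0 F (f a)).
Proof.
move=> pf dF; have [|d1 d2] := @slice_deriv V R^o F (fun x => F (f x)) (f a) p0 a 1 _ dF.
  by move=> h; rewrite pf [h *: 1]mulr1.
by apply: DeriveDef.
Qed.

Lemma slice0 F (s x y : R) : smooth F ->
  is_derive s 1 (fun s => F (s, (x, y))) ('D_E0 F (s, (x, y))).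
Proof.
move=> sF; apply: (@slice_diff1 F E0 (fun s => (s, (x, y)))); last by case: (sF [::]).
by move=> h u; congr (_, (_, _)) => /=; rewrite ?[h *: 1]mulr1 ?[h *: 0]mulr0 ?add0r.
Qed.

Lemma slice1 F (s x y : R) : smooth F ->
  is_derive x 1 (fun x => F (s, (x, y))) ('D_E1 F (s, (x, y))).
Proof.
move=> sF; apply: (@slice_diff1 F E1 (fun x => (s, (x, y)))); last by case: (sF [::]).
by move=> h u; congr (_, (_, _)) => /=; rewrite ?[h *: 1]mulr1 ?[h *: 0]mulr0 ?add0r.
Qed.

Lemma slice2 F (s x y : R) : smooth F ->
  is_derive y 1 (fun y => F (s, (x, y))) ('D_E2 F (s, (x, y))).
Proof.
move=> sF; apply: (@slice_diff1 F E2 (fun y => (s, (x, y)))); last by case: (sF [::]).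
by move=> h u; congr (_, (_, _)) => /=; rewrite ?[h *: 1]mulr1 ?[h *: 0]mulr0 ?add0r.
Qed.

Lemma deriv_affine (f df : R -> R) (D e a b : R) :
  (forall x : R, is_derive x 1 f (df x)) ->
  (forall x, `|x - a| <= `|b - a| -> `|df x - D| <= e) ->
  `|f b - f a - D * (b - a)| <= e * `|b - a|.
Proof.
move=> fd h; have d0 : 0 <= `|b - a| by [].
have -> : f b - f a - D * (b - a) = f b - D * b - (f a - D * a) by ring.
apply: (@bounded_deriv_lip R (fun x => f x - D * x) (fun x => df x - D * 1) e (a - `|b - a|) (a + `|b - a|)).
- by move=> x /andP[x1 x2]; rewrite mulr1; apply: h; rewrite ler_norml; apply/andP; split; lra.
- by rewrite -ler_distl.
- by apply/andP; split; lra.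
Qed.

Let subp3 (s x y u a b : R) : ((u, (a, b)) : V) - (s, (x, y)) = (u - s, (a - x, b - y)).
Proof. by []. Qed.

Lemma norm3_le (s x y : R) e : (`|(s, (x, y)) : V| <= e) = [&& `|s| <= e, `|x| <= e & `|y| <= e].
Proof.
have -> : `|(s, (x, y)) : V| = Num.max `|s| `|(x, y) : R * R| by [].
by rewrite ge_max normC_le.
Qed.

(** [smooth] speaks of directional derivatives only. Their continuity gives total differentiability:
    change one coordinate at a time and apply the mean value inequality. *)
Lemma smooth_linear_approx F (p : V) : smooth F -> forall e, 0 < e -> exists2 d, 0 < d &
  forall q, `|q - p| <= d -> `|F q - F p - ('D_E0 F p * (q.1 - p.1) + 'D_E1 F p * (q.2.1 - p.2.1)
    + 'D_E2 F p * (q.2.2 - p.2.2))| <= e * `|q - p|.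
Proof.
move=> sF e e0; have e3 : 0 < e / 3 by lra.
have near v : \forall q \near p, `|'D_v F q - 'D_v F p| <= e / 3.
  have [cF _] := sF [:: v]; have := cF p; rewrite /= => /cvgrPdist_le /(_ _ e3).
  by apply: filterS => q; rewrite distrC.
have [d /= d0 hd] : exists2 d : R, 0 < d & forall q, `|q - p| < d ->
    [/\ `|'D_E0 F q - 'D_E0 F p| <= e / 3, `|'D_E1 F q - 'D_E1 F p| <= e / 3
      & `|'D_E2 F q - 'D_E2 F p| <= e / 3].
  have [d d0 hd] := proj1 (nbhs_ballP _ _) (filterI (near E0) (filterI (near E1) (near E2))).
  exists d => // q qp; have [|h1 [h2 h3]] := hd q; last by [].
  by rewrite -ball_normE /ball_/= distrC.
exists (d / 2); first by lra.
move: p {near} hd => [s [x y]] hd [u [a b]]; rewrite subp3.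
set n := `|(u - s, (a - x, b - y)) : V|; move=> nd.
have /and3P[n1 n2 n3] : [&& `|u - s| <= n, `|a - x| <= n & `|b - y| <= n] by rewrite -norm3_le.
have dd (u' a' b' : R) : `|u' - s| <= n -> `|a' - x| <= n -> `|b' - y| <= n ->
    `|(u', (a', b')) - (s, (x, y)) : V| < d.
  move=> h1 h2 h3; apply: (@le_lt_trans _ _ (d / 2)); last by lra.
  by rewrite subp3 norm3_le; apply/and3P; split; exact: le_trans nd.
have z0 (c : R) : `|c - c| <= n by rewrite subrr normr0 normr_ge0.
have a0 := @deriv_affine (fun u => F (u, (a, b))) (fun u => 'D_E0 F (u, (a, b)))
  ('D_E0 F (s, (x, y))) (e / 3) s u (fun u => slice0 _ _ _ sF).
have a1 := @deriv_affine (fun a => F (s, (a, b))) (fun a => 'D_E1 F (s, (a, b)))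
  ('D_E1 F (s, (x, y))) (e / 3) x a (fun u => slice1 _ _ _ sF).
have a2 := @deriv_affine (fun b => F (s, (x, b))) (fun b => 'D_E2 F (s, (x, b)))
  ('D_E2 F (s, (x, y))) (e / 3) y b (fun u => slice2 _ _ _ sF).
have {}a0 := a0 (fun u' h => let: And3 r _ _ := hd (u', (a, b)) (dd _ _ _ (le_trans h n1) n2 n3) in r).
have {}a1 := a1 (fun u' h => let: And3 _ r _ := hd (s, (u', b)) (dd _ _ _ (z0 s) (le_trans h n2) n3) in r).
have {}a2 := a2 (fun u' h => let: And3 _ _ r := hd (s, (x, u')) (dd _ _ _ (z0 s) (z0 x) (le_trans h n3)) in r).
have b0 := le_trans a0 (ler_wpM2l (ltW e3) n1).
have b1 := le_trans a1 (ler_wpM2l (ltW e3) n2).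
have b2 := le_trans a2 (ler_wpM2l (ltW e3) n3).
have -> : e * n = e / 3 * n + (e / 3 * n + e / 3 * n) by lra.
rewrite /=; set T0 := 'D_E0 F _ in b0 *; set T1 := 'D_E1 F _ in b1 *; set T2 := 'D_E2 F _ in b2 *.
have -> : F (u, (a, b)) - F (s, (x, y)) - (T0 * (u - s) + T1 * (a - x) + T2 * (b - y)) =
  (F (u, (a, b)) - F (s, (a, b)) - T0 * (u - s)) + ((F (s, (a, b)) - F (s, (x, b)) - T1 * (a - x))
  + (F (s, (x, b)) - F (s, (x, y)) - T2 * (b - y))) by ring.
apply: (le_trans (ler_normD _ _)); apply: lerD => //.
by apply: (le_trans (ler_normD _ _)); exact: lerD.
Qed.

Let quot_bd (u v : R) : `|u - v| <= 1 -> `|v| <= `|u| + 1.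
Proof. by have := ler_normB u (u - v); rewrite opprB addrC subrK; lra. Qed.

Lemma smooth_chain F (c1 c2 : R -> R) (s d1 d2 : R) : smooth F ->
  is_derive s 1 c1 d1 -> is_derive s 1 c2 d2 ->
  is_derive s 1 (fun u => F (u, (c1 u, c2 u)))
    ('D_E0 F (s, (c1 s, c2 s)) + d1 * 'D_E1 F (s, (c1 s, c2 s)) + d2 * 'D_E2 F (s, (c1 s, c2 s))).
Proof.
move=> sF dc1 dc2; have [p Ep] : exists p, p = (s, (c1 s, c2 s)) by eexists.
rewrite -Ep; have HF := smooth_linear_approx p sF.
move: ('D_E0 F p) ('D_E1 F p) ('D_E2 F p) HF => T0 T1 T2 HF; rewrite {}Ep in HF *.
have lim (c : R -> R) d : is_derive s 1 c d -> (fun h : R => h^-1 * (c (h + s) - c s)) @ 0^' --> d.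
  move=> [dc <-].
  have -> : (fun h : R => h^-1 * (c (h + s) - c s)) = (fun h : R => h^-1 *: ((c \o shift s) (h *: 1) - c s)).
    by apply/funext => h /=; rewrite [h *: 1]mulr1.
  exact: dc.
have cc (c : R -> R) d : is_derive s 1 c d -> {for s, continuous c}.
  by case=> dc _; apply/differentiable_continuous/derivable1_diffP.
(* For small h the difference quotients of c1 and c2 are within 1 of their limits, so the curve
   moves by at most K |h|. *)
pose K := `|d1| + `|d2| + 3.
have [K1 Kd1 Kd2] : [/\ 1 <= K, `|d1| + 1 <= K & `|d2| + 1 <= K].
  by rewrite /K; have := normr_ge0 d1; have := normr_ge0 d2; split; lra.
have K0 : 0 < K := lt_le_trans ltr01 K1.
have main : (fun h : R => h^-1 *: (((fun u => F (u, (c1 u, c2 u))) \o shift s) (h *: 1)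
     - F (s, (c1 s, c2 s)))) @ 0^' --> T0 + d1 * T1 + d2 * T2.
  apply/cvgrPdist_le => /= e e0.
  pose N := `|T1| + `|T2| + 1.
  have N0 : 0 < N by rewrite /N; have := normr_ge0 T1; have := normr_ge0 T2; lra.
  have eK : 0 < e / 2 / K by rewrite !divr_gt0.
  have [d dp hd] := HF _ eK.
  have eN : 0 < Num.min 1 (e / 2 / N) by rewrite lt_min ltr01 !divr_gt0.
  have l1 := proj1 (cvgrPdist_le _ _) (lim _ _ dc1) _ eN; have l2 := proj1 (cvgrPdist_le _ _) (lim _ _ dc2) _ eN.
  have sh (c : R -> R) dd : is_derive s 1 c dd -> \forall h \near 0^', `|c (h + s) - c s| <= d.
    move=> /cc cs; apply: nbhs_dnbhs.
    have : (fun h : R => c (h + s)) @ 0 --> c s.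
      apply: (@cvg_comp _ _ _ (fun h => h + s) c (nbhs 0) (nbhs s)); last exact: cs.
      have Q : (fun h : R => h + s) @ 0 --> 0 + s by apply: cvgD; [exact: cvg_id|exact: cvg_cst].
      by rewrite add0r in Q.
    by move=> /cvgrPdist_le /(_ _ dp); apply: filterS => h; rewrite distrC.
  near=> h.
  have hn0 : h != 0 by near: h; exact: nbhs_dnbhs_neq.
  have q1 : `|d1 - h^-1 * (c1 (h + s) - c1 s)| <= Num.min 1 (e / 2 / N) by near: h; exact: l1.
  have q2 : `|d2 - h^-1 * (c2 (h + s) - c2 s)| <= Num.min 1 (e / 2 / N) by near: h; exact: l2.
  have r0 : `|h| <= d.
    near: h; apply: nbhs_dnbhs; apply/nbhs_ballP; exists d => // h.
    by rewrite -ball_normE /ball_/= sub0r normrN => /ltW.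
  have r1 : `|c1 (h + s) - c1 s| <= d by near: h; exact: sh dc1.
  have r2 : `|c2 (h + s) - c2 s| <= d by near: h; exact: sh dc2.
  rewrite /= [h *: 1]mulr1; set D1 := c1 (h + s) - c1 s in q1 r1; set D2 := c2 (h + s) - c2 s in q2 r2.
  have := hd (h + s, (c1 (h + s), c2 (h + s))).
  rewrite subp3 addrK norm3_le r0 r1 r2 => /(_ isT); rewrite /=.
rewrite -/D1 -/D2.
  set n := `|(h, (D1, D2)) : V|; move=> A.
  have ih0 : 0 < `|h| by rewrite normr_gt0.
  have q (Dk dk : R) : `|dk - h^-1 * Dk| <= Num.min 1 (e / 2 / N) ->
      `|Dk| <= (`|dk| + 1) * `|h| /\ `|dk - h^-1 * Dk| <= e / 2 / N.
    rewrite le_min => /andP[b1 b2]; split => //; rewrite -ler_pdivrMr//.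
    have -> : `|Dk| / `|h| = `|h^-1 * Dk| by rewrite normrM normfV mulrC.
    exact: quot_bd.
  have [m1 {}q1] := q _ _ q1; have [m2 {}q2] := q _ _ q2.
  have nK : n <= K * `|h|.
    rewrite norm3_le; apply/and3P; split.
    - by rewrite ler_peMl.
    - by apply: (le_trans m1); rewrite ler_wpM2r.
    - by apply: (le_trans m2); rewrite ler_wpM2r.
  have {}A := le_trans A (ler_wpM2l (ltW eK) nK).
  have {}A : `|h^-1 * (F (h + s, (c1 (h + s), c2 (h + s))) - F (s, (c1 s, c2 s)) - (T0 * h + T1 * D1 + T2 * D2))| <= e / 2.
    rewrite normrM normfV mulrC ler_pdivrMr//; apply: (le_trans A).
    by rewrite mulrA divfK// gt_eqF.
  have -> : T0 + d1 * T1 + d2 * T2 - h^-1 * (F (h + s, (c1 (h + s), c2 (h + s))) - F (s, (c1 s, c2 s))) =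
    - (h^-1 * (F (h + s, (c1 (h + s), c2 (h + s))) - F (s, (c1 s, c2 s)) - (T0 * h + T1 * D1 + T2 * D2)))
    + (T1 * (d1 - h^-1 * D1) + T2 * (d2 - h^-1 * D2)) by field.
  apply: (le_trans (ler_normD _ _)); rewrite normrN.
  rewrite [leRHS](splitr e); apply: (lerD A).
  apply: (le_trans (ler_normD _ _)); rewrite !normrM.
  apply: (@le_trans _ _ (`|T1| * (e / 2 / N) + `|T2| * (e / 2 / N))).
    by apply: lerD; apply: ler_wpM2l.
  rewrite -mulrDl; apply: (@le_trans _ _ (N * (e / 2 / N))); last by rewrite mulrC divfK// gt_eqF.
  by apply: ler_wpM2r; [exact/ltW/divr_gt0/N0/divr_gt0|rewrite /N lerDl].
apply: DeriveDef; first by apply/cvg_ex; exists (T0 + d1 * T1 + d2 * T2).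
by apply: cvg_lim.
Unshelve. all: by end_near.
Qed.

Lemma deriv0_const (G : R -> R) : (forall s : R, is_derive s 1 G 0) -> forall s, G s = G 0.
Proof.
move=> dG s; have z (x : R) : `|x - 0| <= `|s - 0| -> `|(0 : R) - 0| <= 0 by rewrite subrr normr0.
have := @deriv_affine G (fun _ => 0) 0 0 0 s dG z.
by rewrite !mul0r subr0 normr_le0 subr_eq0 => /eqP.
Qed.

Lemma smooth_lip F (n : R) : 0 <= n -> smooth F -> exists2 L, 0 <= L &
  forall p q : V, `|p| <= n -> `|q| <= n -> `|F p - F q| <= L * `|p - q|.
Proof.
move=> n0 sF.
have cpt : compact [set p : V | `|p| <= n].
  have -> : [set p : V | `|p| <= n] = `[- n, n]%classic `*` [set z : R * R | `|z| <= n].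
    apply/seteqP; split=> -[s [x y]] /=; rewrite norm3_le in_itv/= -ler_norml normC_le/=.
      by move=> /and3P[-> -> ->].
    by move=> [-> /andP[-> ->]].
  by apply: compact_setX; [exact: segment_compact|exact: box_compact].
have bd v : exists2 M, 0 <= M & forall p, `|p| <= n -> `|'D_v F p| <= M.
  have cc : compact ('D_v F @` [set p : V | `|p| <= n]).
    apply: continuous_compact => //; apply: continuous_subspaceT.
    by have [cF _] := sF [:: v]; exact: cF.
  have [M [Mr HM]] := compact_bounded cc.
  exists (`|M| + 1); first by rewrite addr_ge0.
  move=> z zn; apply: HM; last by exists z.
  by rewrite (le_lt_trans (ler_norm M))// ltrDl.
have [M0 M00 h0] := bd E0; have [M1 M10 h1] := bd E1; have [M2 M20 h2] := bd E2.
exists (M0 + M1 + M2); first by rewrite !addr_ge0.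
move=> [s [x y]] [u [a b]]; rewrite !norm3_le => /and3P[p1 p2 p3] /and3P[q1 q2 q3].
rewrite subp3.
set k := `|(s - u, (x - a, y - b)) : V|.
have /and3P[n1 n2 n3] : [&& `|s - u| <= k, `|x - a| <= k & `|y - b| <= k] by rewrite -norm3_le.
have N (c : R) : `|c| <= n -> - n <= c <= n by rewrite ler_norml.
have a0 := @bounded_deriv_lip R (fun u => F (u, (x, y))) _ M0 (- n) n (fun u _ => slice0 u x y sF)
  (fun u' h => h0 (u', (x, y)) ltac:(by rewrite norm3_le p2 p3 ler_norml h)) s u (N _ p1) (N _ q1).
have a1 := @bounded_deriv_lip R (fun x => F (u, (x, y))) _ M1 (- n) n (fun x _ => slice1 u x y sF)
  (fun u' h => h1 (u, (u', y)) ltac:(by rewrite norm3_le q1 p3 ler_norml h)) x a (N _ p2) (N _ q2).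
have a2 := @bounded_deriv_lip R (fun y => F (u, (a, y))) _ M2 (- n) n (fun y _ => slice2 u a y sF)
  (fun u' h => h2 (u, (a, u')) ltac:(by rewrite norm3_le q1 q2 ler_norml h)) y b (N _ p3) (N _ q3).
have b0 := le_trans a0 (ler_wpM2l M00 n1).
have b1 := le_trans a1 (ler_wpM2l M10 n2).
have b2 := le_trans a2 (ler_wpM2l M20 n3).
have -> : F (s, (x, y)) - F (u, (a, b)) =
  (F (s, (x, y)) - F (u, (x, y))) + ((F (u, (x, y)) - F (u, (a, y))) + (F (u, (a, y)) - F (u, (a, b)))) by ring.
have -> : (M0 + M1 + M2) * k = M0 * k + (M1 * k + M2 * k) by ring.
apply: (le_trans (ler_normD _ _)); apply: lerD => //.
by apply: (le_trans (ler_normD _ _)); exact: lerD.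
Qed.

Lemma is_derive_pair (c : R -> R * R) (s : R) (d : R * R) : derivable c s 1 -> 'D_1 c s = d ->
  is_derive s 1 (fun u => (c u).1) d.1 /\ is_derive s 1 (fun u => (c u).2) d.2.
Proof.
move=> dc <-.
have l : (fun h : R => h^-1 *: ((c \o shift s) (h *: 1) - c s)) @ 0^' --> 'D_1 c s by exact: dc.
move: ('D_1 c s) l => [a b] l.
have l1 : (fun h : R => h^-1 *: (((fun u => (c u).1) \o shift s) (h *: 1) - (c s).1)) @ 0^' --> a.
  exact: (cvg_comp _ _ l (@cvg_fst _ _ (nbhs a) (nbhs b) _)).
have l2 : (fun h : R => h^-1 *: (((fun u => (c u).2) \o shift s) (h *: 1) - (c s).2)) @ 0^' --> b.
  exact: (cvg_comp _ _ l (@cvg_snd _ _ (nbhs a) (nbhs b) _)).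
split; apply: DeriveDef; try exact: (cvg_lim _ l1); try exact: (cvg_lim _ l2).
  by apply/cvg_ex; exists a.
by apply/cvg_ex; exists b.
Qed.

End ChainRule.

(** * Velocity of a bounded density *)

Section Velocity.
Context {R : realType}.
Local Notation C := (R * R)%type.
Local Notation mu := (@lebesgue_measure R).
Implicit Types (f g : C -> R) (z w y : C).

Lemma kap_abs_le a b (r m : R) f z w : `|a| <= 1 -> `|b| <= 1 -> 0 < r -> `|f w| <= m ->
  `|kap a b (z - w) * f w| <= m * near r (z - w) + r^-1 * `|f w|.
Proof.
move=> a1 b1 r0 fm; rewrite normrM.
have k := ler_wpM2r (normr_ge0 (f w)) (kap_le (z - w) a1 b1); apply: (le_trans k).
rewrite /near /box; case: (leP `|z - w| r) => h.
  rewrite mul1r mulrC; apply: (@le_trans _ _ (m * `|z - w|^-1)); first by rewrite ler_wpM2r// invr_ge0.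
  by rewrite lerDl mulr_ge0// invr_ge0 ltW.
rewrite mul0r mulr0 add0r ler_wpM2r// lef_pV2 ?posrE//; first exact: ltW.
exact: lt_trans h.
Qed.

Lemma kap_Ig a b m f z : `|a| <= 1 -> `|b| <= 1 -> Ig f -> (forall w, `|f w| <= m) ->
  Ig (fun w => kap a b (z - w) * f w).
Proof.
move=> a1 b1 jf fm; have [jn _] := near_Ig (@ltr01 R).
apply: (@Ig_le _ _ (fun w => m * near 1 (z - w) + 1^-1 * `|f w|)).
- apply: measurable_funM; last exact: Ig_meas.
  exact: (measurable_shift z (measurable_kap a b)).
- exact: (IgD (IgZ m (Ig_reflect z jn)) (IgZ _ (Ig_abs jf))).
- by move=> w; exact: kap_abs_le.
Qed.

Lemma kap_bound a b m f (r : R) z : `|a| <= 1 -> `|b| <= 1 -> Ig f -> (forall w, `|f w| <= m) -> 0 < r ->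
  `|J (fun w => kap a b (z - w) * f w)| <= 16 * m * r + J (fun w => `|f w|) / r.
Proof.
move=> a1 b1 jf fm r0; have [jn Jn] := near_Ig r0.
have m0 : 0 <= m := le_trans (normr_ge0 _) (fm 0).
have jn' := IgZ m (Ig_reflect z jn); have jf' := IgZ r^-1 (Ig_abs jf).
apply: (le_trans (J_abs_le _ (IgD jn' jf') (fun w => kap_abs_le z a1 b1 r0 (fm w)))).
  exact: Ig_meas (kap_Ig z a1 b1 jf fm).
rewrite (JD jn' jf') (JZ m (Ig_reflect z jn)) (JZ r^-1 (Ig_abs jf)) (J_reflect z (measurable_near r)).
rewrite [_ / r]mulrC lerD2r; have -> : 16 * m * r = m * (16 * r) by ring.
exact: ler_wpM2l.
Qed.

(** If the positive or the negative part has infinite integral, their difference is infinite and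
    [fine] sends it to 0. Divergent velocity integrals thus have the value 0. *)
Lemma J_nIg f : measurable_fun setT f -> ~ Ig f -> J f = 0.
Proof.
move=> mf nf; rewrite /J /Rintegral integralE.
have mE : measurable_fun setT (EFin \o f) by exact/measurable_EFinP.
have mp : measurable_fun setT (EFin \o f)^\+%E by exact: measurable_funepos.
have mn : measurable_fun setT (EFin \o f)^\-%E by exact: measurable_funeneg.
have p0 : (0 <= \int[@leb2 R]_z ((EFin \o f)^\+ z))%E by apply: integral_ge0 => z _; exact: funepos_ge0.
have n0 : (0 <= \int[@leb2 R]_z ((EFin \o f)^\- z))%E by apply: integral_ge0 => z _; exact: funeneg_ge0.
have : (\int[@leb2 R]_z ((EFin \o f)^\+ z))%E = +oo%E \/ (\int[@leb2 R]_z ((EFin \o f)^\- z))%E = +oo%E.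
  have [->|/eqP pf] := pselect ((\int[@leb2 R]_z ((EFin \o f)^\+ z))%E = +oo%E); first by left.
  have [->|/eqP qf] := pselect ((\int[@leb2 R]_z ((EFin \o f)^\- z))%E = +oo%E); first by right.
  exfalso; apply: nf.
  apply/integrableP; split => //.
  rewrite (_ : (fun x => _) = ((EFin \o f)^\+ \+ (EFin \o f)^\-)%E); last by rewrite -fune_abse.
  rewrite ge0_integralD//.
  by rewrite lte_add_pinfty// ltey.
by case=> E; move: p0 n0; rewrite E; case: (integral _ _ _) => [x||].
Qed.

Lemma measurable_lt1 d (T : measurableType d) (g : T -> R) : measurable_fun setT g ->
  measurable_fun setT (fun x => (g x < 1)%R%:R : R).
Proof.
move=> mg; rewrite (_ : (fun x => _) = \1_(g @^-1` [set u | u < 1])).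
  apply: measurable_indic; rewrite -[X in measurable X]setTI; apply: mg => //.
  by apply: open_measurable; exact: open_lt.
apply/funext => x; rewrite indicE; congr (nat_of_bool _)%:R.
by apply/idP/idP => [h|/set_mem//]; exact/mem_set.
Qed.

Let inner (a b y : R) : 2^-1 <= `|a| ->
  (\int[mu]_x (((`|a * x + b * y| < 1)%R)%:R / (1 + y ^+ 2))%:E <= (4 / (1 + y ^+ 2))%:E)%E.
Proof.
move=> a2; have k0 : 0 <= (1 + y ^+ 2)^-1 by rewrite invr_ge0 addr_ge0 ?sqr_ge0.
have a0 : a != 0 by rewrite -normr_gt0; lra.
pose c := - (b * y / a).
have E : @lebesgue_measure R `[c - 2, c + 2]%classic = 4%:E.
  rewrite lebesgue_measure_itv/= lte_fin; case: ifP => [_|/negbT]; last by rewrite -leNgt => h; exfalso; lra.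
  by rewrite -EFinD; congr EFin; ring.
apply: (@le_trans _ _ (\int[mu]_(x in `[(c - 2)%R, (c + 2)%R]) ((1 + y ^+ 2)^-1)%:E)%E); last first.
  by rewrite integral_cst// [X in (_ * X)%E]E -EFinM mulrC.
rewrite [leRHS]integral_mkcond; apply: ge0_le_integral => //.
- by move=> x _; rewrite lee_fin mulr_ge0.
- apply/measurable_EFinP; apply: measurable_funM => //.
  apply: measurable_lt1; apply: continuous_measurable_fun.
  move=> x; apply: cvg_norm; apply: cvgD; last exact: cvg_cst.
  by apply: cvgM; [exact: cvg_cst|exact: cvg_id].
- by apply/(measurable_restrictT _ _).1 => //.
move=> x _; rewrite patchE mem_setE in_itv/= -ler_distl.
case: ifPn => [_|]; first by rewrite lee_fin; case: (_ < _); rewrite ?mul1r ?mul0r.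
rewrite -ltNge => h; rewrite lee_fin; case: ltP => h1; last by rewrite mul0r.
exfalso; have e1 : a * x + b * y = a * (x - c) by rewrite /c; field.
move: h1; rewrite e1 normrM; have := ler_pM _ _ a2 (ltW h); rewrite invr_ge0 => /(_ _ _); lra.
Qed.

Let invD1 : measurable_fun setT (fun y : R => (1 + y ^+ 2)^-1).
Proof.
apply: (measurable_inv (f := fun y : R => 1 + y ^+ 2)); last by move=> y; rewrite addr_ge0 ?sqr_ge0.
by apply: measurable_funD => //; exact: measurable_funX.
Qed.

Let outer : (\int[mu]_y (4 / (1 + y ^+ 2))%:E <= 16%:E)%E.
Proof.
have E (y : R) : (4 / (1 + y ^+ 2))%:E = (4%:E * (oneDsqr y)^-1%:E)%E by rewrite -EFinM.
under eq_integral do rewrite E.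
rewrite ge0_integralZl//; last exact/measurable_EFinP.
rewrite ge0_symfun_integralT//=.
- rewrite (_ : [set x | _] = `[0, +oo[%classic); last first.
    by apply/seteqP; split => x/=; rewrite in_itv/= andbT.
  rewrite integral0y_oneDsqr -!EFinM lee_fin; have := @pihalf_lt2 R; lra.
- exact: continuous_oneDsqrV.
- by move=> x/=; rewrite /oneDsqr sqrrN.
Qed.

(** The region where [kap a b] has no lower bound of order |z|^-2. *)
Definition strip (a b : R) z : R := (`|a * z.1 + b * z.2| < 1)%R%:R.

Lemma measurable_strip a b : measurable_fun setT (strip a b).
Proof.
apply: measurable_lt1; apply: measurableT_comp; first exact: normr_measurable.
by apply: measurable_funD; apply: measurable_funM.
Qed.

(** At infinity |z|^-2 is not integrable on the plane, but it is on a strip of bounded width: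
    projecting on the coordinate that is not across the strip leaves 1 / (1 + y^2) on the line. *)
Lemma strip_Ig a b : a ^+ 2 + b ^+ 2 = 1 -> exists S : C -> R, [/\ Ig S, forall z, 0 <= S z &
  forall z, 1 <= `|z| -> strip a b z / `|z| ^+ 2 <= S z].
Proof.
move=> ab.
have sge0 z : 0 <= strip a b z by [].
have gen (k : C -> R) : measurable_fun setT k -> (forall z, `|k z| <= `|z|) ->
    (\int[@leb2 R]_z (strip a b z / (1 + k z ^+ 2))%:E <= 16%:E)%E ->
    exists S : C -> R, [/\ Ig S, forall z, 0 <= S z & forall z, 1 <= `|z| -> strip a b z / `|z| ^+ 2 <= S z].
  move=> mk kz h; have q0 z : 0 < 1 + k z ^+ 2 by rewrite ltr_wpDr// sqr_ge0.
  have [||j _] := @ge0_Ig R (fun z => strip a b z / (1 + k z ^+ 2)) 16 _ _ h.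
  - apply: measurable_funM; first exact: measurable_strip.
    by apply: (measurableT_comp invD1).
  - by move=> z; rewrite divr_ge0// ltW.
  exists (fun z => 2 * (strip a b z / (1 + k z ^+ 2))); split; first exact: IgZ.
    by move=> z; rewrite mulr_ge0// divr_ge0// ltW.
  move=> z z1; rewrite mulrCA; apply: ler_wpM2l => //.
  have z2 : 0 < `|z| ^+ 2 by rewrite exprn_gt0// (lt_le_trans ltr01).
  rewrite -[2 / _]invrK invf_div lef_pV2 ?posrE ?divr_gt0// ler_pdivrMr//.
  have : k z ^+ 2 <= `|z| ^+ 2 by rewrite -[k z ^+ 2]ger0_norm ?sqr_ge0// normrX lerXn2r ?nnegrE.
  have : 1 <= `|z| ^+ 2 by rewrite exprn_ege1.
  lra.
have mf (k : C -> R) : measurable_fun setT k ->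
    measurable_fun setT (fun z => (strip a b z / (1 + k z ^+ 2))%:E).
  move=> mk; apply/measurable_EFinP; apply: measurable_funM; first exact: measurable_strip.
  exact: (measurableT_comp invD1).
have m1 := measurable_fst; have m2 := measurable_snd.
have [ha|ha] := leP 2^-1 `|a|.
- apply: (gen snd) => //; first exact: norm2_le.
  rewrite /leb2 fubini_tonelli2//=; last 2 first.
  + exact: mf.
  + by move=> z; rewrite lee_fin divr_ge0// addr_ge0// sqr_ge0.
  apply: le_trans outer; apply: ge0_le_integral => //.
  + by move=> y _; apply: integral_ge0 => x _; rewrite lee_fin divr_ge0// addr_ge0// sqr_ge0.
  + apply: measurable_fun_fubini_tonelli_G; first exact: mf.
    by move=> z; rewrite lee_fin divr_ge0// addr_ge0// sqr_ge0.
  + by apply/measurable_EFinP; apply: measurable_funM.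
  + by move=> y _; exact: inner.
have hb : 2^-1 <= `|b|.
  rewrite leNgt; apply/negP => hb.
  have h1 := ltr_pM (normr_ge0 a) (normr_ge0 a) ha ha.
  have h2 := ltr_pM (normr_ge0 b) (normr_ge0 b) hb hb.
  move: ab; rewrite -[a ^+ 2]real_normK ?num_real// -[b ^+ 2]real_normK ?num_real// !expr2.
  by move: h1 h2; move: (`|a| * `|a|) (`|b| * `|b|) => p q; lra.
apply: (gen fst) => //; first exact: norm1_le.
rewrite /leb2 fubini_tonelli1//=; last 2 first.
+ exact: mf.
+ by move=> z; rewrite lee_fin divr_ge0// addr_ge0// sqr_ge0.
apply: le_trans outer; apply: ge0_le_integral => //.
+ by move=> y _; apply: integral_ge0 => x _; rewrite lee_fin divr_ge0// addr_ge0// sqr_ge0.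
+ apply: measurable_fun_fubini_tonelli_F; first exact: mf.
  by move=> z; rewrite lee_fin divr_ge0// addr_ge0// sqr_ge0.
+ by apply/measurable_EFinP; apply: measurable_funM.
move=> x _; rewrite /fubini_F; apply: le_trans (inner a x hb).
by rewrite le_eqVlt; apply/orP; left; apply/eqP; apply: eq_integral => y _; rewrite /strip/= addrC.
Qed.

End Velocity.

(** * Barycentric combinations of velocities *)

Section Marker.
Context {R : realType}.
Local Notation C := (R * R)%type.
Implicit Types (f g : C -> R) (z w y p : C).

Lemma ab_le1 (a b : R) : a ^+ 2 + b ^+ 2 = 1 -> `|a| <= 1 /\ `|b| <= 1.
Proof.
have h (x y : R) : x ^+ 2 + y ^+ 2 = 1 -> `|x| <= 1.
  move=> xy; rewrite -[1]normr1 -ler_sqr ?nnegrE// !real_normK ?num_real// expr1n.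
  by have := sqr_ge0 y; lra.
by move=> ab; split; [exact: h ab|apply: (h b a); rewrite addrC].
Qed.

Lemma near_in (r : R) w : `|w| <= r -> near r w = `|w|^-1.
Proof. by move=> h; rewrite /near /box h mul1r. Qed.

Lemma far_out (r : R) w : r < `|w| -> far r w = (`|w| ^+ 3)^-1.
Proof. by move=> h; rewrite /far /box leNgt h subr0 mul1r. Qed.

Lemma dkap_le a b w y : `|a| <= 1 -> `|b| <= 1 -> 0 < `|w| -> `|dkap a b w y| <= 6 * `|y| / `|w| ^+ 2.
Proof.
move=> a1 b1 w0; have nw0 := nq_gt0 w0; have nw := nq_ge w; have pi2 := @pi_ge2 R.
have W0 : 0 < `|w| ^+ 2 by rewrite exprn_gt0.
set W := `|w| ^+ 2 in nw W0 *; set N := nq w in nw0 nw.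
have p0 : 0 < 2 * pi * N ^+ 2 by rewrite !mulr_gt0 ?exprn_gt0 ?pi_gt0.
have h1 : `|w.1 ^+ 2 - w.2 ^+ 2| <= N.
  by rewrite ler_norml /N /nq; have := sqr_ge0 w.1; have := sqr_ge0 w.2; move=> ? ?; apply/andP; split; lra.
have h2 : `|- 2 * w.1 * w.2| <= N.
  rewrite ler_norml /N /nq; have := sqr_ge0 (w.1 + w.2); have := sqr_ge0 (w.1 - w.2).
  by rewrite sqrrB sqrrD => ? ?; apply/andP; split; lra.
have y1 := norm1_le y; have y2 := norm2_le y.
have m (p q s t : R) : `|p| <= s -> `|q| <= t -> `|p * q| <= s * t by move=> ? ?; rewrite normrM ler_pM.
have N0 := ltW nw0.
have e : `|a * (y.1 * (w.1 ^+ 2 - w.2 ^+ 2) - y.2 * (- 2 * w.1 * w.2))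
     - b * (y.1 * (- 2 * w.1 * w.2) + y.2 * (w.1 ^+ 2 - w.2 ^+ 2))| <= 4 * (`|y| * N).
  have e1 : `|y.1 * (w.1 ^+ 2 - w.2 ^+ 2) - y.2 * (- 2 * w.1 * w.2)| <= 2 * (`|y| * N).
    by apply: (le_trans (ler_normB _ _)); have := m _ _ _ _ y1 h1; have := m _ _ _ _ y2 h2; lra.
  have e2 : `|y.1 * (- 2 * w.1 * w.2) + y.2 * (w.1 ^+ 2 - w.2 ^+ 2)| <= 2 * (`|y| * N).
    by apply: (le_trans (ler_normD _ _)); have := m _ _ _ _ y1 h2; have := m _ _ _ _ y2 h1; lra.
  by apply: (le_trans (ler_normB _ _)); have := m _ _ _ _ a1 e1; have := m _ _ _ _ b1 e2; lra.
rewrite /dkap normrM normrN normfV (gtr0_norm p0) ler_pdivrMr//; apply: (le_trans e).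
have -> : 6 * `|y| / W * (2 * pi * N ^+ 2) = (`|y| * N) * (12 * pi * (N / W)) by ring.
have : 1 <= N / W by rewrite ler_pdivlMr// mul1r.
move=> q; rewrite [leLHS]mulrC; apply: ler_wpM2l; first by rewrite mulr_ge0.
by move: q; move: (N / W) => q hq; nra.
Qed.

(** Moving the base point changes the kernel by O(|w|^-2) at infinity. Off the strip this is
    dominated by the kernel itself, and on the strip it is integrable because f is bounded. So the
    velocity integral converges at every point or at none. *)
Lemma kap_Ig_indep a b m f z z' : a ^+ 2 + b ^+ 2 = 1 -> measurable_fun setT f -> (forall w, `|f w| <= m) ->
  Ig (fun w => kap a b (z - w) * f w) -> Ig (fun w => kap a b (z' - w) * f w).
Proof.
move=> ab mf fm ik; have [a1 b1] := ab_le1 ab; have [S [iS S0 hS]] := strip_Ig ab.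
have m0 : 0 <= m := le_trans (normr_ge0 _) (fm 0).
pose d := z' - z; pose r := 2 * `|d| + 1; pose K := 6 * `|d| + 16 * `|d| ^+ 2.
have d0 : 0 <= `|d| by []; have K0 : 0 <= K by rewrite addr_ge0// mulr_ge0// exprn_ge0.
have r'0 : 0 < r + `|d| by rewrite /r; lra.
have [jn _] := near_Ig r'0.
apply: (@Ig_le _ _ (fun w => (m * near (r + `|d|) (z' - w) + (1 + K * 16) * `|kap a b (z - w) * f w|)
    + (K * m) * S (z - w))).
- by apply: measurable_funM => //; exact: (measurable_shift z' (measurable_kap a b)).
- apply: IgD; last exact: IgZ (Ig_reflect z iS).
  by apply: IgD; [exact: IgZ (Ig_reflect z' jn)|exact: IgZ (Ig_abs ik)].
move=> w; have Sw := S0 (z - w); have kw : 0 <= `|kap a b (z - w) * f w| by [].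
have nw := near_ge0 (r + `|d|) (z' - w).
have e : z' - w = d + (z - w) by rewrite /d addrA subrK.
have [zr|zr] := leP `|z - w| r.
  rewrite normrM; have := ler_pM (normr_ge0 _) (normr_ge0 _) (kap_le (z' - w) a1 b1) (fm w).
  have -> : `|z' - w|^-1 = near (r + `|d|) (z' - w).
    rewrite near_in// e; apply: (le_trans (ler_normD _ _)); lra.
  have := mulr_ge0 (mulr_ge0 K0 m0) Sw; have : 0 <= (1 + K * 16) * `|kap a b (z - w) * f w|.
    by rewrite mulr_ge0// addr_ge0// mulr_ge0.
  rewrite [_ * m]mulrC; lra.
set u := z - w in zr Sw kw *.
have u1 : 1 <= `|u| by move: zr; rewrite /r; lra.
have u0 : 0 < `|u| by lra.
have := @kap_taylor R a b (- u) d a1 b1; rewrite normrN opprK => /(_ u0).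
have -> : 2 * `|d| <= `|u| by move: zr; rewrite /r; lra.
move=> /(_ isT) T; have D := @dkap_le a b (- u) d a1 b1; rewrite normrN in D; have {}D := D u0.
have I2 : 0 < `|u| ^- 2 by rewrite invr_gt0 exprn_gt0.
have E3 : 16 * `|d| ^+ 2 / `|u| ^+ 3 <= 16 * `|d| ^+ 2 * `|u| ^- 2.
  apply: ler_wpM2l; first by rewrite mulr_ge0// exprn_ge0.
  rewrite lef_pV2 ?posrE ?exprn_gt0//; rewrite [leRHS]exprS; have : 0 < `|u| ^+ 2 by rewrite exprn_gt0.
  by move: u1; move: (`|u| ^+ 2) (`|u|) => p q q1 p0; nra.
have kk : `|kap a b (z' - w)| <= `|kap a b u| + K * `|u| ^- 2.
  have -> : kap a b (z' - w) = (kap a b (d + u) - kap a b u - dkap a b (- u) d) + (kap a b u + dkap a b (- u) d).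
    by rewrite e; ring.
  apply: (le_trans (ler_normD _ _)); have := ler_normD (kap a b u) (dkap a b (- u) d).
  by move: T D E3; rewrite /K; lra.
have hf : `|f w| * `|u| ^- 2 <= m * S u + 16 * `|kap a b u * f w|.
  have := hS _ u1; rewrite /strip; case: ltP => hl.
    rewrite mul1r => h; have : `|f w| * `|u| ^- 2 <= m * S u by apply: ler_pM => //; exact: ltW.
    by move: kw; lra.
  (* Off the strip |kap| >= 1 / (2 pi nq u) >= 1 / (4 pi |u|^2), and 4 pi < 16. *)
  move=> _; have nu := nq_le u; have nu0 := nq_gt0 u0.
  have p4 := @pihalf_lt2 R; have p0 := @pi_gt0 R.
  have : `|u| ^- 2 <= 16 * `|kap a b u|.
    rewrite /kap normrM normfV (gtr0_norm (_ : 0 < 2 * pi * nq u)) ?mulr_gt0// mulrA ler_pdivlMr ?mulr_gt0//.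
    rewrite mulrC ler_pdivrMr ?exprn_gt0//; have U0 : 0 < `|u| ^+ 2 by rewrite exprn_gt0.
    apply: (@le_trans _ _ (16 * 1 * `|u| ^+ 2)); last by rewrite ler_wpM2r ?ler_wpM2l// ltW.
    by move: nu nu0 U0 p4 p0; move: (nq u) (`|u| ^+ 2) (pi : R) => x y p; nra.
  move=> h; have := ler_wpM2l (normr_ge0 (f w)) h; have := mulr_ge0 m0 Sw.
  by rewrite [X in _ -> _ -> _ <= _ + 16 * X]normrM; lra.
have k1 := ler_wpM2r (normr_ge0 (f w)) kk; have k2 := ler_wpM2l K0 hf; have k3 := mulr_ge0 m0 nw.
rewrite -normrM mulrDl -normrM in k1.
have -> : K * m * S u = K * (m * S u) by ring.
have -> : (1 + K * 16) * `|kap a b u * f w| = `|kap a b u * f w| + K * (16 * `|kap a b u * f w|) by ring.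
rewrite mulrDr in k2; have E : K / `|u| ^+ 2 * `|f w| = K * (`|f w| / `|u| ^+ 2) by ring.
by rewrite E in k1; lra.
Qed.

Definition vel a b f z : R := J (fun w => kap a b (z - w) * f w).

(* In a barycentric combination of velocities the affine part of the kernel cancels, and what
   remains decays like the cube of the distance. *)
Lemma vel_barycentric a b m f (P : R) y p0 p1 p2 (c0 c1 c2 : R) :
  a ^+ 2 + b ^+ 2 = 1 -> measurable_fun setT f -> (forall w, `|f w| <= m) -> 0 < P ->
  `|y| <= P -> `|p0| <= P -> `|p1| <= P -> `|p2| <= P -> c0 + c1 + c2 = 1 ->
  y.1 = c0 * p0.1 + c1 * p1.1 + c2 * p2.1 -> y.2 = c0 * p0.2 + c1 * p1.2 + c2 * p2.2 ->
  `|vel a b f y - (c0 * vel a b f p0 + c1 * vel a b f p1 + c2 * vel a b f p2)|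
    <= 560 * m * P * (1 + `|c0| + `|c1| + `|c2|).
Proof.
move=> ab mf fm P0 yP h0 h1 h2 c012 ey1 ey2; have [a1 b1] := ab_le1 ab.
have m0 : 0 <= m := le_trans (normr_ge0 _) (fm 0).
set A := 1 + `|c0| + `|c1| + `|c2|.
have A0 : 0 <= A by rewrite /A !addr_ge0.
have mk z : measurable_fun setT (fun w => kap a b (z - w) * f w).
  by apply: measurable_funM => //; exact: (measurable_shift z (measurable_kap a b)).
(* If the integral diverges at y, it diverges everywhere, and all four velocities are 0 by the
   default value. *)
have [iy|ny] := pselect (Ig (fun w => kap a b (y - w) * f w)); last first.
  have z0 z : vel a b f z = 0.
    by apply: J_nIg => // iz; apply: ny; exact: kap_Ig_indep iz.
  rewrite !z0 !mulr0 !addr0 subr0 normr0.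
  exact: (mulr_ge0 (mulr_ge0 (mulr_ge0 (ler0n _ 560) m0) (ltW P0)) A0).
have iK z : Ig (fun w => kap a b (z - w) * f w) by exact: kap_Ig_indep iy.
have -> : vel a b f y - (c0 * vel a b f p0 + c1 * vel a b f p1 + c2 * vel a b f p2) =
  J (fun w => kap a b (y - w) * f w - (c0 * (kap a b (p0 - w) * f w) + c1 * (kap a b (p1 - w) * f w)
     + c2 * (kap a b (p2 - w) * f w))).
  rewrite (JB (iK y) (IgD (IgD (IgZ _ (iK p0)) (IgZ _ (iK p1))) (IgZ _ (iK p2)))).
  rewrite (JD (IgD (IgZ _ (iK p0)) (IgZ _ (iK p1))) (IgZ _ (iK p2))).
  by rewrite (JD (IgZ _ (iK p0)) (IgZ _ (iK p1))) (JZ _ (iK p0)) (JZ _ (iK p1)) (JZ _ (iK p2)).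
have P3 : 0 < 3 * P by lra.
have P2 : 0 < 2 * P by lra.
have [jn Jn] := near_Ig P3; have [jf Jf] := far_Ig P2.
have jn' z := Ig_reflect z jn.
pose N w := near (3 * P) (y - w) + `|c0| * near (3 * P) (p0 - w) + `|c1| * near (3 * P) (p1 - w)
  + `|c2| * near (3 * P) (p2 - w).
have iN : Ig N by apply: IgD (IgZ _ (jn' p2)); apply: IgD (IgZ _ (jn' p1)); exact: IgD (jn' y) (IgZ _ (jn' p0)).
have JN : J N = A * J (near (3 * P)).
  rewrite /N (JD (IgD (IgD (jn' y) (IgZ _ (jn' p0))) (IgZ _ (jn' p1))) (IgZ _ (jn' p2))).
  rewrite (JD (IgD (jn' y) (IgZ _ (jn' p0))) (IgZ _ (jn' p1))) (JD (jn' y) (IgZ _ (jn' p0))).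
  rewrite (JZ _ (jn' p0)) (JZ _ (jn' p1)) (JZ _ (jn' p2)) !(J_reflect _ (measurable_near (3 * P))) /A.
  by ring.
have q0 : 0 <= 16 * P ^+ 2 by rewrite mulr_ge0// exprn_ge0// ltW.
have pt w : `|kap a b (y - w) * f w - (c0 * (kap a b (p0 - w) * f w) + c1 * (kap a b (p1 - w) * f w)
     + c2 * (kap a b (p2 - w) * f w))| <= m * (N w + 16 * P ^+ 2 * A * far (2 * P) w).
  have -> : kap a b (y - w) * f w - (c0 * (kap a b (p0 - w) * f w) + c1 * (kap a b (p1 - w) * f w)
     + c2 * (kap a b (p2 - w) * f w)) = f w * (kap a b (y - w) - (c0 * kap a b (p0 - w) + c1 * kap a b (p1 - w)
     + c2 * kap a b (p2 - w))) by ring.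
  rewrite normrM; apply: ler_pM => //.
  have tri (e e0 e1 e2 g0 g1 g2 g3 : R) : `|e| <= g3 -> `|e0| <= g0 -> `|e1| <= g1 -> `|e2| <= g2 ->
      `|e - (c0 * e0 + c1 * e1 + c2 * e2)| <= g3 + `|c0| * g0 + `|c1| * g1 + `|c2| * g2.
    move=> l l0 l1 l2; apply: (le_trans (ler_normB _ _)).
    have := ler_normD (c0 * e0 + c1 * e1) (c2 * e2); have := ler_normD (c0 * e0) (c1 * e1); rewrite !normrM.
    have := ler_wpM2l (normr_ge0 c0) l0; have := ler_wpM2l (normr_ge0 c1) l1; have := ler_wpM2l (normr_ge0 c2) l2.
    lra.
  have [wP|wP] := leP `|w| (2 * P).
    apply: (@le_trans _ _ (N w)); last by rewrite lerDl (mulr_ge0 (mulr_ge0 q0 A0))// far_ge0.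
    have nn z : `|z| <= P -> `|kap a b (z - w)| <= near (3 * P) (z - w).
      move=> zP; rewrite near_in ?kap_le//; apply: (le_trans (ler_normB _ _)); lra.
    by apply: tri; exact: nn.
  have w0 : 0 < `|w| := lt_trans P2 wP.
  apply: (@le_trans _ _ (16 * P ^+ 2 * A * far (2 * P) w)); last first.
    by rewrite lerDr /N !addr_ge0// ?mulr_ge0// near_ge0.
  rewrite (far_out wP).
  have tt z : `|z| <= P -> `|kap a b (z - w) - kap a b (- w) - dkap a b w z| <= 16 * P ^+ 2 / `|w| ^+ 3.
    move=> zP; apply: (le_trans (kap_taylor a1 b1 w0 _)); first lra.
    rewrite ler_wpM2r ?invr_ge0 ?exprn_ge0// ler_wpM2l//.
    by rewrite lerXn2r ?nnegrE// ltW.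
  have := tri _ _ _ _ _ _ _ _ (tt y yP) (tt p0 h0) (tt p1 h1) (tt p2 h2).
  have -> : kap a b (y - w) - kap a b (- w) - dkap a b w y -
    (c0 * (kap a b (p0 - w) - kap a b (- w) - dkap a b w p0) + c1 * (kap a b (p1 - w) - kap a b (- w) - dkap a b w p1)
    + c2 * (kap a b (p2 - w) - kap a b (- w) - dkap a b w p2)) =
    (kap a b (y - w) - (c0 * kap a b (p0 - w) + c1 * kap a b (p1 - w) + c2 * kap a b (p2 - w)))
    - (1 - (c0 + c1 + c2)) * kap a b (- w).
    by rewrite /dkap ey1 ey2; ring.
  rewrite c012 subrr mul0r subr0 => H; apply: (le_trans H).
  by rewrite le_eqVlt; apply/orP; left; apply/eqP; rewrite /A; ring.
have iB := IgD iN (IgZ (16 * P ^+ 2 * A) jf).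
apply: (le_trans (J_abs_le _ (IgZ m iB) pt)).
  by apply: measurable_funB => //; apply: measurable_funD; [apply: measurable_funD|]; exact: measurable_funM.
rewrite (JZ m iB) (JD iN (IgZ _ jf)) (JZ _ jf) JN.
have -> : 560 * m * P * A = m * (560 * P * A) by ring.
apply: ler_wpM2l => //.
have e1 := ler_wpM2l A0 Jn; have e2 := ler_wpM2l (mulr_ge0 q0 A0) Jf.
have e3 : 16 * P ^+ 2 * A * (32 / (2 * P)) = 256 * P * A by field; rewrite gt_eqF.
rewrite e3 in e2; have := mulr_ge0 (ltW P0) A0; lra.
Qed.

End Marker.

(** * Continuous induction *)

Section RealInduction.
Context {R : realType}.

Lemma real_induction (P : R -> Prop) (a b : R) : P a ->
  (forall s, a < s <= b -> (forall u, a <= u < s -> P u) -> P s) ->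
  (forall s, a <= s < b -> (forall u, a <= u <= s -> P u) ->
    exists2 d, 0 < d & forall u, s < u <= s + d -> u <= b -> P u) ->
  forall s, a <= s <= b -> P s.
Proof.
move=> Pa cl op s /andP[as_ sb].
pose S := [set x | a <= x <= b /\ forall u, a <= u <= x -> P u].
have Sa : S a.
  split; first by rewrite lexx (le_trans as_).
  by move=> u /andP[h1 h2]; have -> : u = a by apply/eqP; rewrite eq_le h1 h2.
have ubS : has_sup S by split; [exists a|exists b => x [/andP[]]].
have aS : a <= sup S by apply: sup_upper_bound.
have Sb : sup S <= b by apply: ge_sup; [exists a|move=> x [/andP[]]].
have below u : a <= u < sup S -> P u.
  move=> /andP[au us]; have [x [_ hx] ux] : exists2 x, S x & u < x by exact: (sup_gt (proj1 ubS)).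
  by apply: hx; rewrite au ltW.
have Psup : P (sup S).
  move: aS; rewrite le_eqVlt => /orP[/eqP <-//|aS].
  by apply: cl => //; rewrite aS Sb.
have upto u : a <= u <= sup S -> P u.
  move=> /andP[au]; rewrite le_eqVlt => /orP[/eqP -> //|us].
  by apply: below; rewrite au us.
suff E : b <= sup S by apply: upto; rewrite as_ (le_trans sb).
rewrite leNgt; apply/negP => lt.
have [|d d0 hd] := op (sup S) _ upto; first by rewrite aS lt.
have : S (Num.min b (sup S + d)).
  split.
    rewrite ge_min lexx andbT le_min; apply/andP; split; first by rewrite (le_trans aS).
    by apply: (le_trans aS); rewrite lerDl ltW.
  move=> u /andP[au]; rewrite le_min => /andP[ub ud].
  have [us|us] := leP u (sup S); first by apply: upto; rewrite au us.
  by apply: hd => //; rewrite us ud.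
move=> /(sup_upper_bound ubS); rewrite ge_min; apply/negP; rewrite negb_or -!ltNge lt.
by rewrite ltrDl d0.
Qed.

Lemma closed_left (f : R -> R) (a s Q : R) : {for s, continuous f} -> a < s ->
  (forall u, a <= u < s -> `|f u| <= Q) -> `|f s| <= Q.
Proof.
move=> cf as_ h; rewrite leNgt; apply/negP => hq.
have e0 : 0 < `|f s| - Q by rewrite subr_gt0.
have := cf; move=> /cvgrPdist_lt /(_ _ e0) => /nbhs_ballP[d /= d0 hd].
pose u := Num.max a (s - d / 2).
have us : u < s by rewrite /u gt_max as_ ltrBlDr ltrDl divr_gt0.
have [] : `|f s| - `|f u| < `|f s| - Q /\ `|f u| <= Q; last by lra.
split; last by apply: h; rewrite us andbT le_max lexx.
apply: le_lt_trans (hd u _); first exact: lerB_dist.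
rewrite /ball/= ltr_norml; apply/andP; split; first by move: us; lra.
have : s - d / 2 <= u by rewrite le_max lexx orbT.
by move: d0; lra.
Qed.

Lemma is_derive_cont (f : R -> R) (s d : R) : is_derive s 1 f d -> {for s, continuous f}.
Proof. by case=> df _; apply/differentiable_continuous/derivable1_diffP. Qed.

Lemma open_right (f : R -> R) (s Q : R) : {for s, continuous f} -> `|f s| < Q ->
  exists2 d, 0 < d & forall u, s < u <= s + d -> `|f u| <= Q.
Proof.
move=> cf hq; have e0 : 0 < Q - `|f s| by rewrite subr_gt0.
have := cf; move=> /cvgrPdist_le /(_ _ e0) => /nbhs_ballP[d /= d0 hd].
exists (d / 2); first by rewrite divr_gt0.
move=> u /andP[su ud]; have := hd u; rewrite /ball/= => /(_ _) H.
have {}H : `|f s - f u| <= Q - `|f s|.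
  by apply: H; rewrite ltr_norml; apply/andP; split; lra.
by have := ler_distD 0 (f u) (f s); have := lerB_dist (f u) (f s); rewrite distrC; lra.
Qed.

(** While both functions stay below Q, they move by at most D h; the strict inequality r + D h < Q
    then reopens the bound beyond the current time. *)
Lemma bootstrap (f1 f2 d1 d2 : R -> R) (T h r Q D : R) :
  (forall u, T <= u <= T + h -> is_derive u 1 f1 (d1 u)) ->
  (forall u, T <= u <= T + h -> is_derive u 1 f2 (d2 u)) ->
  `|f1 T| <= r -> `|f2 T| <= r -> 0 <= D -> r + D * h < Q ->
  (forall u, T <= u <= T + h -> `|f1 u| <= Q -> `|f2 u| <= Q -> `|d1 u| <= D /\ `|d2 u| <= D) ->
  forall u, T <= u <= T + h -> `|f1 u| <= Q /\ `|f2 u| <= Q.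
Proof.
move=> e1 e2 r1 r2 D0 Dh hd u hu.
have h0 : 0 <= h by move: hu => /andP[]; lra.
have rQ : r <= Q by have := mulr_ge0 D0 h0; lra.
apply: (@real_induction (fun u => `|f1 u| <= Q /\ `|f2 u| <= Q) T (T + h)) hu.
- by split; lra.
- move=> s /andP[Ts sh] hs; have hh : T <= s <= T + h by rewrite ltW.
  by split; [apply: (closed_left (is_derive_cont (e1 s hh)) Ts)|apply: (closed_left (is_derive_cont (e2 s hh)) Ts)];
    move=> v /hs[].
move=> s /andP[Ts sh] hs; have hh : T <= s <= T + h by rewrite Ts ltW.
have sub v : T <= v <= s -> T <= v <= T + h by move=> /andP[-> /= vs]; exact: le_trans (ltW sh).
have dD : D * (s - T) <= D * h by apply: ler_wpM2l => //; lra.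
have TT : T <= T <= s by rewrite lexx.
have ss : T <= s <= s by rewrite lexx Ts.
have nT : `|s - T| = s - T by rewrite ger0_norm; lra.
have B (f d : R -> R) : (forall u, T <= u <= T + h -> is_derive u 1 f (d u)) -> `|f T| <= r ->
    (forall v, T <= v <= s -> `|d v| <= D) -> `|f s| < Q.
  move=> ef rf df; have := @bounded_deriv_lip R f d D T s (fun v hv => ef v (sub v hv)) df s T ss TT.
  rewrite nT => H; have := ler_normD (f T) (f s - f T); rewrite addrC subrK; lra.
have b1 : `|f1 s| < Q by apply: (B f1 d1) => // v hv; have [] := hd v (sub v hv) (proj1 (hs v hv)) (proj2 (hs v hv)).
have b2 : `|f2 s| < Q by apply: (B f2 d2) => // v hv; have [] := hd v (sub v hv) (proj1 (hs v hv)) (proj2 (hs v hv)).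
have [x1 x10 hx1] := open_right (is_derive_cont (e1 s hh)) b1.
have [x2 x20 hx2] := open_right (is_derive_cont (e2 s hh)) b2.
exists (Num.min x1 x2); first by rewrite lt_min x10.
move=> v /andP[sv]; rewrite -lerBlDl le_min !lerBlDl => /andP[v1 v2] _.
by split; [apply: hx1|apply: hx2]; rewrite sv.
Qed.

End RealInduction.

(** * Barycentric coordinates of a particle over a short time *)

Section Flow.
Context {R : realType}.
Local Notation C := (R * R)%type.
Implicit Types (f g : C -> R) (z w y p : C).

Definition supp (r : R) f := forall z, r < `|z| -> f z = 0.

Lemma supp_le r q f : r <= q -> supp r f -> supp q f.
Proof. by move=> rq h z qz; apply: h; exact: le_lt_trans qz. Qed.

Lemma supp_Ig (r m : R) f : 0 < r -> measurable_fun setT f -> (forall z, `|f z| <= m) -> supp r f ->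
  Ig f /\ J (fun z => `|f z|) <= m * (4 * r ^+ 2).
Proof. by move=> r0 mf fm sf; apply: bounded_Ig => //; exact: ltW. Qed.

Lemma vel_supp (a b r m : R) f z : a ^+ 2 + b ^+ 2 = 1 -> 0 < r -> measurable_fun setT f ->
  (forall z, `|f z| <= m) -> supp r f -> `|vel a b f z| <= 20 * m * r.
Proof.
move=> ab r0 mf fm sf; have [a1 b1] := ab_le1 ab; have [jf Jf] := supp_Ig r0 mf fm sf.
apply: (le_trans (kap_bound z a1 b1 jf fm r0)).
have -> : 20 * m * r = 16 * m * r + m * (4 * r ^+ 2) / r by field; rewrite gt_eqF.
by rewrite lerD2l ler_wpM2r// invr_ge0 ltW.
Qed.

(** By Cramer's rule f1 and f2 are the barycentric coordinates of Y in the triangle A B C.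
    Differentiating the affine relation, the velocities enter only through the defects r1 and r2,
    which is exactly what [vel_barycentric] bounds. *)
Lemma bary_deriv (Y1 Y2 A1 A2 B1 B2 C1 C2 : R -> R) (u y1 y2 a1 a2 b1 b2 c1 c2 : R) :
  is_derive u 1 Y1 y1 -> is_derive u 1 Y2 y2 -> is_derive u 1 A1 a1 -> is_derive u 1 A2 a2 ->
  is_derive u 1 B1 b1 -> is_derive u 1 B2 b2 -> is_derive u 1 C1 c1 -> is_derive u 1 C2 c2 ->
  let D v := (B1 v - A1 v) * (C2 v - A2 v) - (B2 v - A2 v) * (C1 v - A1 v) in
  let f1 v := ((Y1 v - A1 v) * (C2 v - A2 v) - (Y2 v - A2 v) * (C1 v - A1 v)) * (D v)^-1 in
  let f2 v := ((B1 v - A1 v) * (Y2 v - A2 v) - (B2 v - A2 v) * (Y1 v - A1 v)) * (D v)^-1 in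
  let r1 := y1 - ((1 - f1 u - f2 u) * a1 + f1 u * b1 + f2 u * c1) in
  let r2 := y2 - ((1 - f1 u - f2 u) * a2 + f1 u * b2 + f2 u * c2) in
  D u != 0 ->
  [/\ is_derive u 1 f1 ((r1 * (C2 u - A2 u) - r2 * (C1 u - A1 u)) / D u),
    is_derive u 1 f2 (((B1 u - A1 u) * r2 - (B2 u - A2 u) * r1) / D u),
    Y1 u = (1 - f1 u - f2 u) * A1 u + f1 u * B1 u + f2 u * C1 u &
    Y2 u = (1 - f1 u - f2 u) * A2 u + f1 u * B2 u + f2 u * C2 u].
Proof.
move=> hY1 hY2 hA1 hA2 hB1 hB2 hC1 hC2 D f1 f2 r1 r2 D0.
have dm (F1 F2 G1 G2 H1 H2 K1 K2 : R -> R) (p1 p2 q1 q2 s1 s2 t1 t2 : R) :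
  is_derive u 1 F1 p1 -> is_derive u 1 F2 p2 -> is_derive u 1 G1 q1 -> is_derive u 1 G2 q2 ->
  is_derive u 1 H1 s1 -> is_derive u 1 H2 s2 -> is_derive u 1 K1 t1 -> is_derive u 1 K2 t2 ->
  is_derive u 1 (fun v => (F1 v - F2 v) * (G1 v - G2 v) - (H1 v - H2 v) * (K1 v - K2 v))
   (((p1 - p2) * (G1 u - G2 u) + (F1 u - F2 u) * (q1 - q2)) -
    ((s1 - s2) * (K1 u - K2 u) + (H1 u - H2 u) * (t1 - t2))).
  move=> i1 i2 i3 i4 i5 i6 i7 i8.
  exact: d1_B (d1_M (d1_B i1 i2) (d1_B i3 i4)) (d1_M (d1_B i5 i6) (d1_B i7 i8)).
have dD := dm _ _ _ _ _ _ _ _ _ _ _ _ _ _ _ _ hB1 hA1 hC2 hA2 hB2 hA2 hC1 hA1.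
have dN1 := dm _ _ _ _ _ _ _ _ _ _ _ _ _ _ _ _ hY1 hA1 hC2 hA2 hY2 hA2 hC1 hA1.
have dN2 := dm _ _ _ _ _ _ _ _ _ _ _ _ _ _ _ _ hB1 hA1 hY2 hA2 hB2 hA2 hY1 hA1.
have dV := d1_V D0 dD.
have e1 := d1_M dN1 dV; have e2 := d1_M dN2 dV.
rewrite /r1 /r2 /f1 /f2 {r1 r2 f1 f2 dV}; rewrite /D in D0 e1 e2 *; cbv beta in D0, e1, e2.
cbv beta.
move: (Y1 u) (Y2 u) (A1 u) (A2 u) (B1 u) (B2 u) (C1 u) (C2 u) e1 e2 D0 {dN1 dN2 dD dm}.
move=> Yu1 Yu2 Au1 Au2 Bu1 Bu2 Cu1 Cu2 e1 e2 D0.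
by split; [apply: (d1_eq e1); field|apply: (d1_eq e2); field|field|field].
Qed.

Let abs_01 (q : R) : `|q| <= 10^-1 -> `|q| <= 2.
Proof. lra. Qed.

Let abs_12 (q : R) : `|q - 1| <= 10^-1 -> `|q| <= 2.
Proof. by rewrite !ler_norml => /andP[? ?]; apply/andP; split; lra. Qed.

Let dif0 (q s : R) : `|q| <= 10^-1 -> `|s| <= 10^-1 -> `|q - s| <= 2 / 10.
Proof. by move=> l1 l2; have := ler_normB q s; lra. Qed.

Let dif1 (q s : R) : `|q - 1| <= 10^-1 -> `|s| <= 10^-1 -> `|q - s| <= 12 / 10.
Proof.
move=> l1 l2; have -> : q - s = 1 + ((q - 1) - s) by ring.
by apply: (le_trans (ler_normD _ _)); have := ler_normB (q - 1) s; rewrite normr1; lra.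
Qed.

Let det_lb (a1 a2 b1 b2 c1 c2 : R) : `|a1| <= 10^-1 -> `|a2| <= 10^-1 -> `|b1 - 1| <= 10^-1 ->
  `|b2| <= 10^-1 -> `|c1| <= 10^-1 -> `|c2 - 1| <= 10^-1 ->
  2^-1 <= (b1 - a1) * (c2 - a2) - (b2 - a2) * (c1 - a1).
Proof.
move=> h1 h2 h3 h4 h5 h6.
have k2 := ler_pM (normr_ge0 _) (normr_ge0 _) (dif0 h4 h2) (dif0 h5 h1); rewrite -normrM in k2.
have l1 : 8 / 10 <= b1 - a1 by move: h1 h3; rewrite !ler_norml => /andP[? ?] /andP[? ?]; lra.
have l2 : 8 / 10 <= c2 - a2 by move: h2 h6; rewrite !ler_norml => /andP[? ?] /andP[? ?]; lra.
have k1 : (8 / 10) * (8 / 10) <= (b1 - a1) * (c2 - a2) by apply: ler_pM => //; lra.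
by move: k2; rewrite ler_norml => /andP[_]; lra.
Qed.

Let rate_le (W Dt q1 q2 s1 s2 : R) : 0 <= W -> 2^-1 <= Dt -> `|q1| <= W -> `|q2| <= W ->
  `|s1| <= 12 / 10 -> `|s2| <= 2 / 10 -> `|(q1 * s1 - q2 * s2) / Dt| <= 3 * W + 1.
Proof.
move=> W0 D2 l1 l2 l3 l4; have D0 : 0 < Dt by lra.
rewrite normrM normfV (gtr0_norm D0) ler_pdivrMr//.
have m1 := ler_pM (normr_ge0 _) (normr_ge0 _) l1 l3; have m2 := ler_pM (normr_ge0 _) (normr_ge0 _) l2 l4.
have m3 : (3 * W + 1) * 2^-1 <= (3 * W + 1) * Dt by apply: ler_wpM2l => //; lra.
by apply: (le_trans (ler_normB _ _)); rewrite !normrM; lra.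
Qed.

Let tri (r k0 k1 k2 q0 q1 q2 : R) : `|k0| <= 1 + (r + 1) + (r + 1) -> `|k1| <= r + 1 -> `|k2| <= r + 1 ->
  `|q0| <= 2 -> `|q1| <= 2 -> `|q2| <= 2 -> `|k0 * q0 + k1 * q1 + k2 * q2| <= 2 * (2 + 4 * (r + 1)).
Proof.
move=> g0 g1 g2 l0 l1 l2; apply: (le_trans (ler_normD _ _)).
have := ler_normD (k0 * q0) (k1 * q1); rewrite !normrM.
have := ler_pM (normr_ge0 _) (normr_ge0 _) g0 l0; have := ler_pM (normr_ge0 _) (normr_ge0 _) g1 l1.
have := ler_pM (normr_ge0 _) (normr_ge0 _) g2 l2; lra.
Qed.

Let sumA (r f1 f2 : R) : `|f1| <= r + 1 -> `|f2| <= r + 1 ->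
  `|1 - f1 - f2| <= 1 + (r + 1) + (r + 1) /\ 1 + `|1 - f1 - f2| + `|f1| + `|f2| <= 2 + 4 * (r + 1).
Proof.
move=> g1 g2; suff : `|1 - f1 - f2| <= 1 + (r + 1) + (r + 1) by split => //; lra.
by apply: (le_trans (ler_normB _ _)); have := ler_normB 1 f1; rewrite normr1; lra.
Qed.

Let nl (A q1 q2 : R) : 2 <= A -> `|q1| <= 2 -> `|q2| <= 2 -> `|(q1, q2) : C| <= 2 * A.
Proof. by move=> A2 l1 l2; rewrite normC_le /=; apply/andP; split; lra. Qed.

Variables (c d M : R) (om : R -> C -> R) (X Xi : R -> C -> C).
Hypotheses (cd : c ^+ 2 + d ^+ 2 = 1) (M0 : 0 < M) (omM : forall s z, `|om s z| <= M).
Hypothesis (mom : forall s, measurable_fun setT (om s)).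
Hypothesis dX1 : forall (s : R) z, is_derive s 1 (fun u => (X u z).1) (vel c d (om s) (X s z)).
Hypothesis dX2 : forall (s : R) z, is_derive s 1 (fun u => (X u z).2) (vel d (- c) (om s) (X s z)).
Hypotheses (XiX : forall s z, Xi s (X s z) = z) (XXi : forall s z, X s (Xi s z) = z).
Hypothesis tr : forall s z, om s (X s z) = om 0 z.

Let dc : d ^+ 2 + (- c) ^+ 2 = 1.
Proof. by rewrite sqrrN addrC. Qed.

Let near1 T z : exists2 e, 0 < e & forall u, T <= u <= T + e -> `|X u (Xi T z) - z| <= 10^-1.
Proof.
have k (F : R -> R) : {for T, continuous F} -> exists2 e, 0 < e &
    forall u, T <= u <= T + e -> `|F u - F T| <= 10^-1.
  move=> cF; have [||e e0 he] := @open_right R (fun u => F u - F T) T 10^-1.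
  - by apply: cvgB => //; exact: cvg_cst.
  - by rewrite subrr normr0 invr_gt0.
  exists e => // u /andP[]; rewrite le_eqVlt => /orP[/eqP <- _|Tu ue]; last by apply: he; rewrite Tu.
  by rewrite subrr normr0 invr_ge0.
have [e1 e10 h1] := k _ (is_derive_cont (dX1 T (Xi T z))).
have [e2 e20 h2] := k _ (is_derive_cont (dX2 T (Xi T z))).
exists (Num.min e1 e2); first by rewrite lt_min e10.
move=> u /andP[Tu]; rewrite -lerBlDl le_min !lerBlDl => /andP[u1 u2].
move: h1 h2; rewrite XXi => h1 h2.
by rewrite normC_le; apply/andP; split; [apply: h1|apply: h2]; rewrite Tu.
Qed.

(** No speed bound is known before the support is: a bounded density may have divergent velocity
    integrals. Three particles passing through (0,0), (1,0), (0,1) at time T stay close to these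
    points by continuity, and relative to them every other particle has controlled speed. The time e
    is thus the same for all particles. *)
Lemma short_stay T r : 0 < r -> supp r (om T) ->
  exists2 e, 0 < e & exists2 q, 0 < q & forall u, T <= u <= T + e -> supp q (om u).
Proof.
move=> r0 sT.
have [e0 e00 h0] := near1 T (0, 0); have [e1 e10 h1] := near1 T (1, 0); have [e2 e20 h2] := near1 T (0, 1).
have [K K0 KE] : exists2 K, 0 <= K & K = 560 * M.
  exists (560 * M); [exact: (mulr_ge0 (ler0n _ 560) (ltW M0))|exact: erefl].
(* While the coordinates are at most r + 1, A bounds 1 plus the sum of the absolute barycentric
   weights and 2 A bounds positions; W bounds the velocity defect, and D the speed of the
   coordinates. *)
pose A := 2 + 4 * (r + 1); pose W := 2 * K * A ^+ 2; pose D := 3 * W + 1.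
have A2 : 2 <= A by rewrite /A; lra.
have P0 : 0 < 2 * A by lra.
have W0 : 0 <= W by rewrite /W; apply: mulr_ge0; [apply: mulr_ge0|apply: exprn_ge0; lra].
have D0 : 0 < D by rewrite /D; lra.
pose e := Num.min (Num.min e0 e1) (Num.min e2 (2 * D)^-1).
have ep : 0 < e by rewrite !lt_min e00 e10 e20 invr_gt0 mulr_gt0.
have De : D * e <= 2^-1.
  apply: (@le_trans _ _ (D * (2 * D)^-1)); last by rewrite invfM mulrCA divff ?mulr1// gt_eqF.
  by rewrite ler_pM2l// /e !ge_min lexx !orbT.
exists e => //; exists (2 * A); first by lra.
have small u : T <= u <= T + e -> [/\ T <= u <= T + e0, T <= u <= T + e1 & T <= u <= T + e2].
  move=> /andP[-> /=]; rewrite -lerBlDl !le_min !lerBlDl => /andP[/andP[-> ->] /andP[-> _]].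
  by [].
(* A point z where om v is not 0 lies on a trajectory that met the support at time T. Its
   coordinates start at most r and move by at most 1 / 2. *)
move=> v hv z zA; apply/eqP; apply/negP => /negP nz.
pose x := Xi v z; have zE : z = X v x by rewrite /x XXi.
pose y0 := X T x; have xE : x = Xi T y0 by rewrite /y0 XiX.
have y0r : `|y0| <= r.
  by rewrite leNgt; apply: contra_neqN nz => /sT; rewrite /y0 tr zE tr.
pose Y1 u := (X u x).1; pose Y2 u := (X u x).2.
pose p u := X u (Xi T (0, 0)); pose p1 u := X u (Xi T (1, 0)); pose p2 u := X u (Xi T (0, 1)).
pose A1 u := (p u).1; pose A2_ u := (p u).2.
pose B1 u := (p1 u).1; pose B2 u := (p1 u).2.
pose C1 u := (p2 u).1; pose C2 u := (p2 u).2.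
have bn u : T <= u <= T + e -> [/\ `|A1 u| <= 10^-1 /\ `|A2_ u| <= 10^-1,
    `|B1 u - 1| <= 10^-1 /\ `|B2 u| <= 10^-1 & `|C1 u| <= 10^-1 /\ `|C2 u - 1| <= 10^-1].
  move=> /small[/h0 k0 /h1 k1 /h2 k2]; move: k0 k1 k2; rewrite !normC_le /= !subr0.
  by move=> /andP[-> ->] /andP[-> ->] /andP[-> ->].
pose Dt u := (B1 u - A1 u) * (C2 u - A2_ u) - (B2 u - A2_ u) * (C1 u - A1 u).
pose f1 u := ((Y1 u - A1 u) * (C2 u - A2_ u) - (Y2 u - A2_ u) * (C1 u - A1 u)) * (Dt u)^-1.
pose f2 u := ((B1 u - A1 u) * (Y2 u - A2_ u) - (B2 u - A2_ u) * (Y1 u - A1 u)) * (Dt u)^-1.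
pose U1 u w := vel c d (om u) w; pose U2 u w := vel d (- c) (om u) w.
pose r1 u := U1 u (X u x) - ((1 - f1 u - f2 u) * U1 u (p u) + f1 u * U1 u (p1 u) + f2 u * U1 u (p2 u)).
pose r2 u := U2 u (X u x) - ((1 - f1 u - f2 u) * U2 u (p u) + f1 u * U2 u (p1 u) + f2 u * U2 u (p2 u)).
have Dt2 u : T <= u <= T + e -> 2^-1 <= Dt u.
  by move=> /bn[[a1 a2] [b1 b2] [c1 c2]]; exact: det_lb.
have bd u : T <= u <= T + e -> [/\
    is_derive u 1 f1 ((r1 u * (C2 u - A2_ u) - r2 u * (C1 u - A1 u)) / Dt u),
    is_derive u 1 f2 (((B1 u - A1 u) * r2 u - (B2 u - A2_ u) * r1 u) / Dt u),
    Y1 u = (1 - f1 u - f2 u) * A1 u + f1 u * B1 u + f2 u * C1 u &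
    Y2 u = (1 - f1 u - f2 u) * A2_ u + f1 u * B2 u + f2 u * C2 u].
  move=> /Dt2 h; apply: (bary_deriv (dX1 u x) (dX2 u x) (dX1 u _) (dX2 u _) (dX1 u _) (dX2 u _) (dX1 u _) (dX2 u _)).
  by rewrite gt_eqF//; apply: lt_le_trans h.
have pT w : X T (Xi T w) = w := XXi T w.
have TT : T <= T <= T + e by rewrite lexx lerDl ltW.
have fT : `|f1 T| <= r /\ `|f2 T| <= r.
  have [-> ->] : f1 T = y0.1 /\ f2 T = y0.2.
    rewrite /f1 /f2 /Dt /Y1 /Y2 /A1 /A2_ /B1 /B2 /C1 /C2 /p /p1 /p2 !pT /= -/y0.
    by rewrite !subr0 !mulr0 !mul0r !subr0 !mulr1 !mul1r invr1 !mulr1.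
  by move: y0r; rewrite normC_le => /andP[].
have ctl u : T <= u <= T + e -> `|f1 u| <= r + 1 -> `|f2 u| <= r + 1 ->
    `|X u x| <= 2 * A /\ 1 + `|1 - f1 u - f2 u| + `|f1 u| + `|f2 u| <= A.
  move=> hu g1 g2; have [g0 gA] := sumA g1 g2; split => //.
  have [_ _ E1 E2] := bd u hu; have [[a1 a2] [b1 b2] [c1 c2]] := bn u hu.
  rewrite normC_le -/(Y1 u) -/(Y2 u) E1 E2; apply/andP; split; apply: (tri g0 g1 g2);
    by [exact: abs_01|exact: abs_12].
have rate u : T <= u <= T + e -> `|f1 u| <= r + 1 -> `|f2 u| <= r + 1 ->
    `|(r1 u * (C2 u - A2_ u) - r2 u * (C1 u - A1 u)) / Dt u| <= D /\
    `|((B1 u - A1 u) * r2 u - (B2 u - A2_ u) * r1 u) / Dt u| <= D.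
  move=> hu g1 g2; have [yA sA] := ctl u hu g1 g2.
  have [_ _ E1 E2] := bd u hu; have [[a1 a2] [b1 b2] [c1 c2]] := bn u hu.
  have pp0 : `|p u| <= 2 * A by rewrite (surjective_pairing (p u)); apply: nl => //; exact: abs_01.
  have pp1 : `|p1 u| <= 2 * A.
    by rewrite (surjective_pairing (p1 u)); apply: nl => //; [exact: abs_12|exact: abs_01].
  have pp2 : `|p2 u| <= 2 * A.
    by rewrite (surjective_pairing (p2 u)); apply: nl => //; [exact: abs_01|exact: abs_12].
  have S1 : 1 - f1 u - f2 u + f1 u + f2 u = 1 by ring.
  have rW : 560 * M * (2 * A) * (1 + `|1 - f1 u - f2 u| + `|f1 u| + `|f2 u|) <= W.
    rewrite -KE; have -> : W = K * (2 * A) * A by rewrite /W; ring.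
    by apply: ler_wpM2l => //; apply: mulr_ge0 => //; exact: ltW.
  have hr1 : `|r1 u| <= W := le_trans (vel_barycentric cd (mom u) (omM u) P0 yA pp0 pp1 pp2 S1 E1 E2) rW.
  have hr2 : `|r2 u| <= W := le_trans (vel_barycentric dc (mom u) (omM u) P0 yA pp0 pp1 pp2 S1 E1 E2) rW.
  split; first by apply: rate_le (Dt2 u hu) hr1 hr2 _ _ => //; [exact: dif1|exact: dif0].
  have -> : (B1 u - A1 u) * r2 u - (B2 u - A2_ u) * r1 u = r2 u * (B1 u - A1 u) - r1 u * (B2 u - A2_ u) by ring.
  by apply: rate_le (Dt2 u hu) hr2 hr1 _ _ => //; [exact: dif1|exact: dif0].
have rQ : r + D * e < r + 1 by rewrite ltrD2l (le_lt_trans De)// invf_lt1// ltr1n.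
have [k1 k2] := bootstrap (fun u hu => let: And4 q _ _ _ := bd u hu in q) (fun u hu => let: And4 _ q _ _ := bd u hu in q)
  (proj1 fT) (proj2 fT) (ltW D0) rQ rate hv.
have [zz _] := ctl v hv k1 k2.
by move: zA; rewrite zE ltNge zz.
Qed.

End Flow.

(** * Growth of the support *)

Section FlowSupport.
Context {R : realType}.
Local Notation C := (R * R)%type.
Implicit Types (f g : C -> R) (z w y x : C).

Record flow (c d M : R) (om : R -> C -> R) (X Xi : R -> C -> C) : Prop := Flow {
  fl_cd : c ^+ 2 + d ^+ 2 = 1;
  fl_M : 0 < M;
  fl_om : forall s z, `|om s z| <= M;
  fl_meas : forall s, measurable_fun setT (om s);
  fl_d1 : forall (s : R) z, is_derive s 1 (fun u => (X u z).1) (vel c d (om s) (X s z));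
  fl_d2 : forall (s : R) z, is_derive s 1 (fun u => (X u z).2) (vel d (- c) (om s) (X s z));
  fl_XiX : forall s z, Xi s (X s z) = z;
  fl_XXi : forall s z, X s (Xi s z) = z;
  fl_tr : forall s z, om s (X s z) = om 0 z }.

Variables (c d M : R) (om : R -> C -> R) (X Xi : R -> C -> C).
Hypothesis fl : flow c d M om X Xi.

Lemma fl_dc : d ^+ 2 + (- c) ^+ 2 = 1.
Proof. by rewrite sqrrN addrC (fl_cd fl). Qed.

Lemma displacement V a b x :
  (forall v, a <= v <= b -> `|vel c d (om v) (X v x)| <= V /\ `|vel d (- c) (om v) (X v x)| <= V) ->
  forall u v, a <= u <= b -> a <= v <= b -> `|X u x - X v x| <= V * `|u - v|.
Proof.
move=> h u v hu hv; rewrite normC_le; apply/andP; split.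
  exact: (@bounded_deriv_lip R (fun u => (X u x).1) _ V a b (fun s _ => fl_d1 fl s x) (fun s hs => proj1 (h s hs))).
exact: (@bounded_deriv_lip R (fun u => (X u x).2) _ V a b (fun s _ => fl_d2 fl s x) (fun s hs => proj2 (h s hs))).
Qed.

Lemma speed (r : R) s z : 0 < r -> supp r (om s) ->
  `|vel c d (om s) z| <= 20 * M * r /\ `|vel d (- c) (om s) z| <= 20 * M * r.
Proof.
move=> r0 sr; split; apply: vel_supp => //; try exact: (fl_meas fl); try exact: (fl_om fl).
  exact: fl_cd fl.
exact: fl_dc.
Qed.


Let suppP q u : (forall x, om 0 x != 0 -> `|X u x| <= q) -> supp q (om u).
Proof.
move=> h z; rewrite -(fl_XXi fl u z) (fl_tr fl) ltNge => hz.
by apply/eqP; apply: contraNT hz => /h; rewrite (fl_XXi fl).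
Qed.

Let suppE q u x : supp q (om u) -> om 0 x != 0 -> `|X u x| <= q.
Proof. by move=> h; apply: contraNT; rewrite -ltNge => /h; rewrite (fl_tr fl) => ->. Qed.

(** Support in radius 2 r gives speed at most 40 M r, so particles move at most r / 2 in time 1 /
    (80 M). This length does not depend on r and the step can be iterated; [short_stay] supplies the
    opening half of the induction. *)
Lemma doubling T r h : 0 < r -> supp r (om T) -> 0 <= h -> 80 * M * h <= 1 ->
  forall u, T <= u <= T + h -> supp (2 * r) (om u).
Proof.
move=> r0 sT h0 Mh; have r20 : 0 < 2 * r by lra.
have rate : 20 * M * (2 * r) * h <= r / 2.
  have -> : 20 * M * (2 * r) * h = (r / 2) * (80 * M * h) by field.
  by rewrite -[leRHS]mulr1; apply: ler_wpM2l => //; lra.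
have rate0 : 0 <= 20 * M * (2 * r).
  by apply: mulr_ge0 (ltW r20); apply: mulr_ge0 (ltW (fl_M fl)); exact: (ler0n _ 20).
apply: real_induction.
- by apply: supp_le sT; lra.
- move=> s /andP[Ts sh] hs; apply: suppP => x x0; rewrite normC_le; apply/andP; split.
    apply: (closed_left (f := fun u => (X u x).1) (is_derive_cont (fl_d1 fl s x)) Ts) => v hv.
    by apply: (le_trans (norm1_le (X v x))); apply: suppE => //; exact: hs.
  apply: (closed_left (f := fun u => (X u x).2) (is_derive_cont (fl_d2 fl s x)) Ts) => v hv.
  by apply: (le_trans (norm2_le (X v x))); apply: suppE => //; exact: hs.
move=> s /andP[Ts sh] hs.
have ss : T <= s <= s by rewrite Ts lexx.
have TT : T <= T <= s by rewrite Ts lexx.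
have [e e0 [q q0 hq]] := short_stay (fl_cd fl) (fl_M fl) (fl_om fl) (fl_meas fl) (fl_d1 fl) (fl_d2 fl)
  (fl_XiX fl) (fl_XXi fl) (fl_tr fl) r20 (hs s ss).
(* The radius q may exceed 2 r by far. The time is cut so short that even the speed allowed by q
   moves a particle by at most r / 2; with r / 2 up to time s it stays within 2 r. *)
pose V := 20 * M * q + 1.
have V0 : 0 < V.
  rewrite /V ltr_wpDl//; apply: mulr_ge0 (ltW q0); apply: mulr_ge0 (ltW (fl_M fl)); exact: (ler0n _ 20).
exists (Num.min e (r / 2 / V)); first by rewrite lt_min e0 !divr_gt0.
move=> u /andP[su]; rewrite -lerBlDl le_min => /andP[ue uV] _; apply: suppP => x x0.
have xT := suppE sT x0.
have m1 : `|X s x - X T x| <= r / 2.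
  have := @displacement (20 * M * (2 * r)) T s x (fun v hv => speed _ r20 (hs v hv)) s T ss TT.
  move=> H; apply: (le_trans H); apply: le_trans rate; apply: ler_wpM2l => //.
  by rewrite ger0_norm; lra.
have ul : u <= s + e by lra.
have uu : s <= u <= u by rewrite lexx ltW.
have s2 : s <= s <= u by rewrite lexx ltW.
have hv2 v : s <= v <= u -> supp q (om v) by move=> /andP[v1 v2]; apply: hq; rewrite v1 (le_trans v2).
have m2 : `|X u x - X s x| <= r / 2.
  have := @displacement (20 * M * q) s u x (fun v hv => speed _ q0 (hv2 v hv)) u s uu s2.
  move=> H; apply: (le_trans H); rewrite ger0_norm ?subr_ge0 1?ltW//.
  move: uV; rewrite ler_pdivlMr// mulrC /V mulrDl mul1r; lra.
have -> : X u x = (X u x - X s x) + ((X s x - X T x) + X T x) by rewrite !subrK.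
apply: (le_trans (ler_normD _ _)); have := ler_normD (X s x - X T x) (X T x); lra.
Qed.

Lemma flow_compact (r t : R) : 0 < r -> supp r (om 0) ->
  exists2 q, 0 < q & forall u, 0 <= u <= t -> supp q (om u).
Proof.
move=> r0 s0; have M0 := fl_M fl.
pose h := (80 * M)^-1.
have M80 : 0 < 80 * M by apply: mulr_gt0 => //; rewrite ltr0n.
have h0 : 0 < h by rewrite invr_gt0.
have hM : 80 * M * h <= 1 by rewrite /h divff// gt_eqF.
have H n : forall u, 0 <= u <= h *+ n -> supp (2 ^+ n * r) (om u).
  elim: n => [|n IH] u /andP[u0 un].
    have -> : u = 0 by apply/eqP; rewrite eq_le u0 -(mulr0n h) un.
    by rewrite expr0 mul1r.
  have [uh|uh] := leP u (h *+ n).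
    have : supp (2 ^+ n * r) (om u) by apply: IH; rewrite u0.
    apply: supp_le; rewrite ler_pM2r// exprS ler_peMl ?exprn_ge0//; lra.
  rewrite exprS -mulrA; apply: (@doubling (h *+ n) _ h) => //; rewrite ?(ltW h0)//.
  - by rewrite mulr_gt0// exprn_gt0.
  - by apply: IH; rewrite lexx mulrn_wge0// ltW.
  - by rewrite ltW//= addrC -mulrS.
pose n := (Num.truncn (t / h)).+1.
exists (2 ^+ n * r); first by rewrite mulr_gt0// exprn_gt0.
move=> u /andP[u0 ut]; apply: H; rewrite u0/= -mulr_natl -ler_pdivrMr//.
apply: ltW; apply: le_lt_trans (truncnS_gt _); by rewrite ler_pM2r// invr_gt0.
Qed.

End FlowSupport.

(** * Lipschitz bounds for velocity and flow *)

Section FlowLipschitz.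
Context {R : realType}.
Local Notation C := (R * R)%type.
Implicit Types (f g h k b : C -> R) (z w y x : C).

Lemma vel_shift (a b : R) f z e : measurable_fun setT f ->
  vel a b f (z + e) = vel a b (fun w => f (w + e)) z.
Proof.
move=> mf; rewrite /vel.
pose h w := kap a b (z + e - w) * f w.
have mh : measurable_fun setT h.
  by apply: measurable_funM => //; exact: (measurable_shift _ (measurable_kap a b)).
rewrite -/h -(J_reflect e mh).
have mh' : measurable_fun setT (fun w => h (e - w)) by exact: measurable_shift.
rewrite -(J_reflect 0 mh'); apply: eq_J => w.
by rewrite /h sub0r opprK opprD addrA addrK [e + w]addrC.
Qed.

Lemma measurable_shiftD f e : measurable_fun setT f -> measurable_fun setT (fun w => f (w + e)).
Proof.
move=> mf; have mh' : measurable_fun setT (fun w => f (e - w)) by exact: measurable_shift.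
have := measurable_shift 0 mh'; congr (measurable_fun _ _).
by apply/funext => w; rewrite sub0r opprK addrC.
Qed.

Lemma velB (a b m : R) f g z : `|a| <= 1 -> `|b| <= 1 -> Ig f -> Ig g ->
  (forall w, `|f w| <= m) -> (forall w, `|g w| <= m) ->
  vel a b (fun w => f w - g w) z = vel a b f z - vel a b g z.
Proof.
move=> a1 b1 jf jg fm gm.
rewrite /vel -(JB (kap_Ig z a1 b1 jf fm) (kap_Ig z a1 b1 jg gm)).
by apply: eq_J => w; rewrite mulrBr.
Qed.

(** The kernel is not differentiated: the shift of the point is moved onto the density, whose
    Lipschitz bound makes the difference small. For shifts larger than 1 the sup bound of the
    velocity suffices. *)
Lemma vel_lip (a b m L q e : R) f g z z' : a ^+ 2 + b ^+ 2 = 1 -> 0 < q -> 0 <= L -> 0 <= e ->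
  measurable_fun setT f -> measurable_fun setT g -> (forall w, `|f w| <= m) -> (forall w, `|g w| <= m) ->
  supp q f -> supp q g ->
  (forall w w', `|f w - g w'| <= L * (e + `|w - w'|)) ->
  `|vel a b f z - vel a b g z'| <= (20 * L * (q + 1) + 40 * m * q) * (e + `|z - z'|).
Proof.
move=> ab q0 L0 e0 mf mg fm gm sf sg fg; have [a1 b1] := ab_le1 ab.
have m0 : 0 <= m := le_trans (normr_ge0 _) (fm 0).
have mq0 : 0 <= 40 * m * q by rewrite mulr_ge0 ?mulr_ge0// ltW.
have Lq0 : 0 <= 20 * L * (q + 1) by rewrite mulr_ge0 ?mulr_ge0// addr_ge0// ltW.
set d := z' - z; have dE : `|z - z'| = `|d| by rewrite distrC.
have d0 : 0 <= `|d| by [].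
have [d1|d1] := leP `|d| 1; last first.
  have v1 := vel_supp z ab q0 mf fm sf; have v2 := vel_supp z' ab q0 mg gm sg.
  apply: (le_trans (ler_normB _ _)); rewrite dE mulrDl; apply: ler_wpDl.
    by apply: mulr_ge0 => //; exact: addr_ge0.
  apply: (@le_trans _ _ (40 * m * q * 1)); first by lra.
  by apply: ler_wpM2l => //; lra.
have -> : z' = z + d by rewrite addrC subrK.
rewrite (vel_shift _ _ _ _ mg).
have mg' := measurable_shiftD d mg.
have q1 : 0 < q + 1 by lra.
have sg' : supp (q + 1) (fun w => g (w + d)).
  move=> w qw; apply: sg; have := lerB_dist w (- d); rewrite opprK normrN; lra.
have sf' : supp (q + 1) f by apply: supp_le sf; lra.
have [jf _] := supp_Ig q1 mf fm sf'; have [jg _] := supp_Ig q1 mg' (fun w => gm (w + d)) sg'.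
rewrite -(velB z a1 b1 jf jg fm (fun w => gm (w + d))).
have mfg : measurable_fun setT (fun w => f w - g (w + d)) by exact: measurable_funB.
have sfg : supp (q + 1) (fun w => f w - g (w + d)) by move=> w qw; rewrite sf'// sg'// subrr.
have bfg w : `|f w - g (w + d)| <= L * (e + `|d|).
  by apply: (le_trans (fg _ _)); rewrite opprD addrA subrr sub0r normrN.
have -> : `|z - (z + d)| = `|d| by rewrite opprD addrA subrr sub0r normrN.
apply: (le_trans (vel_supp z ab q1 mfg bfg sfg)).
have -> : 20 * (L * (e + `|d|)) * (q + 1) = 20 * L * (q + 1) * (e + `|d|) by ring.
by apply: ler_wpM2r; [exact: addr_ge0|rewrite lerDl].
Qed.

Lemma deriv_ge0_le (F df : R -> R) (a b : R) : a <= b ->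
  (forall x : R, a <= x <= b -> is_derive x 1 F (df x)) -> (forall x : R, a <= x <= b -> 0 <= df x) -> F a <= F b.
Proof.
move=> ab dF d0.
have [||x xab E] := @MVT_segment R F df a b ab.
- by move=> u; rewrite in_itv/= => /andP[u1 u2]; apply: dF; lra.
- apply: derivable_within_continuous => u; rewrite in_itv/= => /andP[u1 u2].
  by have [] := dF u ltac:(lra).
- rewrite -subr_ge0 E mulr_ge0 ?subr_ge0//; apply: d0.
  by move: xab; rewrite in_itv/=.
Qed.

(** q and L may vary with the approximation; they are quantified after the tolerances in the uniform
    estimates, which depend on M, the L^1 bound and the time only. *)
Record tameflow (c d M : R) (om : R -> C -> R) (X Xi : R -> C -> C) (t q L : R) : Prop := Tameflow {
  tf_flow : flow c d M om X Xi;
  tf_q : 0 < q;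
  tf_L : 0 <= L;
  tf_supp : forall u, 0 <= u <= t -> supp q (om u);
  tf_X0 : forall z, X 0 z = z;
  tf_lip : forall u v z z', 0 <= u <= t -> 0 <= v <= t -> `|om u z - om v z'| <= L * (`|u - v| + `|z - z'|) }.

Variables (c d M : R) (om : R -> C -> R) (X Xi : R -> C -> C) (t q L : R).
Hypothesis tf : tameflow c d M om X Xi t q L.
Let fl := tf_flow tf.

Definition speedb : R := 20 * M * q.
Definition vlip : R := 20 * L * (q + 1) + 40 * M * q.

Lemma speedb_ge0 : 0 <= speedb.
Proof. apply: mulr_ge0 (ltW (tf_q tf)); apply: mulr_ge0 (ltW (fl_M fl)); exact: (ler0n _ 20). Qed.

Lemma vlip_ge0 : 0 <= vlip.
Proof.
have q0 := tf_q tf; rewrite /vlip; apply: addr_ge0.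
  by apply: mulr_ge0; [apply: mulr_ge0 (tf_L tf); exact: (ler0n _ 20)|lra].
apply: mulr_ge0 (ltW (tf_q tf)); apply: mulr_ge0 (ltW (fl_M fl)); exact: (ler0n _ 40).
Qed.

Lemma tf_speed u z : 0 <= u <= t ->
  `|vel c d (om u) z| <= speedb /\ `|vel d (- c) (om u) z| <= speedb.
Proof. by move=> hu; apply: (speed fl) => //; [exact: tf_q tf|exact: (tf_supp tf)]. Qed.

Lemma tf_vlip u v z z' : 0 <= u <= t -> 0 <= v <= t ->
  `|vel c d (om u) z - vel c d (om v) z'| <= vlip * (`|u - v| + `|z - z'|) /\
  `|vel d (- c) (om u) z - vel d (- c) (om v) z'| <= vlip * (`|u - v| + `|z - z'|).
Proof.
move=> hu hv; have fg w w' := tf_lip tf w w' hu hv.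
split; apply: (@vel_lip _ _ M L q) => //; try exact: (fl_meas fl); try exact: (fl_om fl); try exact: (tf_supp tf).
- exact: fl_cd fl.
- exact: tf_q tf.
- exact: tf_L tf.
- exact: fl_dc fl.
- exact: tf_q tf.
- exact: tf_L tf.
Qed.

Lemma tf_disp x u v : 0 <= u <= t -> 0 <= v <= t -> `|X u x - X v x| <= speedb * `|u - v|.
Proof. by move=> hu hv; apply: (displacement fl (a := 0) (b := t)) => // w hw; exact: tf_speed. Qed.

(** Gronwall run backwards: the squared Euclidean distance of two trajectories times exp(4 vlip s)
    is non-decreasing, so the distance at time u controls the one at time 0. The factor 2 absorbs
    the comparison of norms. *)
Definition XiL : R := 2 * expR (4 * vlip * t).

Lemma Xi_lip u z z' : 0 <= u <= t -> `|Xi u z - Xi u z'| <= XiL * `|z - z'|.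
Proof.
move=> /andP[u0 ut]; have V0 := vlip_ge0; set x := Xi u z; set y := Xi u z'.
have zE : z = X u x by rewrite /x (fl_XXi fl).
have zE' : z' = X u y by rewrite /y (fl_XXi fl).
pose D s := nq (X s x - X s y); pose v1 s w := vel c d (om s) w; pose v2 s w := vel d (- c) (om s) w.
pose dD s := 2 * ((X s x).1 - (X s y).1) * (v1 s (X s x) - v1 s (X s y))
           + 2 * ((X s x).2 - (X s y).2) * (v2 s (X s x) - v2 s (X s y)).
have eD (s : R) : is_derive s 1 D (dD s).
  apply: d1_D; apply: d1_X2; apply: d1_B; first [exact: (fl_d1 fl)|exact: (fl_d2 fl)].
pose k := 4 * vlip.
have eE (s : R) : is_derive s 1 (fun s => expR (k * s)) (expR (k * s) * k).
  have := @d1_comp R expR (fun s => k * s) s _ _ (is_derive_expR (k * s)) (d1_Z k (d1_id s)).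
  by rewrite mulr1.
have := @deriv_ge0_le (fun s => D s * expR (k * s)) (fun s => dD s * expR (k * s) + D s * (expR (k * s) * k)) 0 u u0
  (fun s _ => d1_M (eD s) (eE s)).
move=> H; have {H} : D 0 * expR (k * 0) <= D u * expR (k * u).
  apply: H => s /andP[s0 su]; have hs : 0 <= s <= t by rewrite s0 (le_trans su).
  rewrite [_ * k]mulrC [D s * _]mulrA -mulrDl; apply: mulr_ge0; last exact: expR_ge0.
  have [l1 l2] := tf_vlip (X s x) (X s y) hs hs; rewrite subrr normr0 add0r in l1 l2.
  have n1 := norm1_le (X s x - X s y); have n2 := norm2_le (X s x - X s y).
  have nD := nq_ge (X s x - X s y); rewrite -/(D s) in nD.
  set n := `|X s x - X s y| in l1 l2 n1 n2 nD.
  have n0 : 0 <= n := normr_ge0 _.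
  have p (A B : R) : `|A| <= n -> `|B| <= vlip * n -> - (vlip * n ^+ 2) <= A * B.
    move=> hA hB; have := ler_pM (normr_ge0 _) (normr_ge0 _) hA hB; rewrite -normrM.
    rewrite (_ : n * (vlip * n) = vlip * n ^+ 2); last by ring.
    by move=> h; have := ler_norm (- (A * B)); rewrite normrN; lra.
  have p1 := p _ _ n1 l1; have p2 := p _ _ n2 l2; have p3 := ler_wpM2l V0 nD.
  by rewrite /dD /k /v1 /v2; move: p1 p2 p3; rewrite /=; lra.
rewrite mulr0 expR0 mulr1 /D !(tf_X0 tf) -zE -zE' => H.
have E0 := expR_ge0 (k * u).
have h1 : nq (x - y) <= 2 * `|z - z'| ^+ 2 * expR (k * t).
  apply: (le_trans H); apply: ler_pM => //; [exact: nq_ge0|exact: nq_le|].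
  by rewrite ler_expR; apply: ler_wpM2l => //; rewrite /k mulr_ge0.
have E1 : 1 <= expR (k * t).
  by rewrite -expR0 ler_expR mulr_ge0// ?mulr_ge0// (le_trans u0).
rewrite -ler_sqr ?nnegrE//; last by rewrite mulr_ge0// /XiL mulr_ge0// expR_ge0.
apply: (le_trans (nq_ge (x - y))); apply: (le_trans h1).
rewrite exprMn /XiL -/k mulrAC ler_wpM2r ?exprn_ge0//.
by move: E1; move: (expR (k * t)) => E hE; nra.
Qed.

End FlowLipschitz.

(** * Evolution of the transported integrals *)

Section Evolution.
Context {R : realType}.
Local Notation C := (R * R)%type.
Implicit Types (f g h k b : C -> R) (z w y x : C).

Definition kreg (a b s : R) z : R := (2 * pi)^-1 * (a * al s z + b * be s z).

Let gap (m a b : R) : m + 2 < a -> a <= b + 1 -> m < b.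
Proof. lra. Qed.

Let three_err (g1 I1 I2 g0 hJ a1 a2 a3 a4 he : R) : `|g1 - I1| <= a1 -> `|I1 - I2| <= a2 ->
  `|I2 - g0 - hJ| <= a3 -> a2 <= he / 2 -> a1 + a3 = a4 -> a4 <= he / 2 -> `|g1 - g0 - hJ| <= he.
Proof.
move=> D1 D2 S2 E1 E2 hQ1; have -> : g1 - g0 - hJ = (g1 - I1) + ((I1 - I2) + (I2 - g0 - hJ)) by ring.
apply: (le_trans (ler_normD _ _)); have := ler_normD (I1 - I2) (I2 - g0 - hJ); lra.
Qed.

Lemma BL_kreg (a b s : R) : 0 < s -> BL (kreg a b s).
Proof. by move=> s0; apply/BL_Z/BL_D; apply: BL_Z; [exact: BL_al|exact: BL_be]. Qed.

(** The difference is [kap] times e^2 / (|z|^2 + e^2): at most |z|^-1 up to radius e and e^2 |z|^-3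
    beyond, of total mass O(e). *)
Lemma kreg_near (a b e : R) z : `|a| <= 1 -> `|b| <= 1 -> 0 < e ->
  `|kap a b z - kreg a b (e ^+ 2) z| <= near e z + e ^+ 2 * far e z.
Proof.
move=> a1 b1 e0; have s0 : 0 < e ^+ 2 by rewrite exprn_gt0.
set s := e ^+ 2 in s0 *.
have [z0|z0] := leP `|z| 0.
  have -> : z = 0 by apply/eqP; rewrite -normr_le0.
  rewrite /kap /kreg /al /be /= !mulr0 !mul0r !mulr0 !addr0 mul0r mulr0 subrr normr0.
  by rewrite addr_ge0 ?near_ge0// mulr_ge0 ?far_ge0// ltW.
have nz := nq_gt0 z0; have q0 := nqs_gt0 s0 z.
have pi0 : (pi : R) != 0 by rewrite gt_eqF ?pi_gt0.
have E : kap a b z - kreg a b s z = kap a b z * (s / (nq z + s)).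
  rewrite /kap /kreg /al /be /ga; move: (nq z) nz q0 (pi : R) pi0 => N N0 NS p p0.
  by field; rewrite p0 !gt_eqF.
rewrite E normrM [`|s / _|]ger0_norm; last by rewrite divr_ge0// ltW.
have K := kap_le z a1 b1; have zi : 0 <= `|z|^-1 by rewrite invr_ge0.
have [ze|ze] := leP `|z| e.
  rewrite near_in//; apply: (@le_trans _ _ `|z|^-1); last by rewrite lerDl mulr_ge0 ?far_ge0// ltW.
  rewrite -[leRHS]mulr1; apply: ler_pM => //; first by rewrite divr_ge0// ltW.
  by rewrite ler_pdivrMr// mul1r lerDr ltW.
rewrite far_out//; apply: (@le_trans _ _ (s * (`|z| ^+ 3)^-1)); last by rewrite lerDr near_ge0.
have -> : s * (`|z| ^+ 3)^-1 = `|z|^-1 * (s / `|z| ^+ 2) by rewrite exprS invfM; ring.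
apply: ler_pM => //; first by rewrite divr_ge0// ltW.
rewrite ler_pM2l// lef_pV2 ?posrE ?exprn_gt0//.
by apply: (le_trans (nq_ge z)); rewrite lerDl ltW.
Qed.

Lemma vel_reg (a b m e : R) f z : `|a| <= 1 -> `|b| <= 1 -> 0 < e -> Ig f -> (forall w, `|f w| <= m) ->
  `|vel a b f z - conv (kreg a b (e ^+ 2)) f z| <= 48 * m * e.
Proof.
move=> a1 b1 e0 jf fm; have s0 : 0 < e ^+ 2 by rewrite exprn_gt0.
have m0 : 0 <= m := le_trans (normr_ge0 _) (fm 0).
have jk := kap_Ig z a1 b1 jf fm; have jc := Ig_conv z (BL_kreg a b s0) jf.
rewrite /vel /conv -(JB jk jc).
have [jn Jn] := near_Ig e0; have [jr Jr] := far_Ig e0.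
have jn' := Ig_reflect z jn; have jr' := Ig_reflect z jr.
have jG := IgZ m (IgD jn' (IgZ (e ^+ 2) jr')).
apply: (le_trans (J_abs_le (Ig_meas (IgB jk jc)) jG _)).
  move=> w; rewrite -mulrBl normrM mulrC; apply: ler_pM => //; exact: kreg_near.
rewrite (JZ m (IgD jn' (IgZ (e ^+ 2) jr'))) (JD jn' (IgZ (e ^+ 2) jr')) (JZ _ jr').
rewrite (J_reflect z (measurable_near e)) (J_reflect z (measurable_far e)).
have -> : 48 * m * e = m * (16 * e + e ^+ 2 * (32 / e)) by field; rewrite gt_eqF.
by apply: ler_wpM2l => //; apply: lerD => //; apply: ler_wpM2l => //; exact: ltW.
Qed.

Variables (c d M : R) (om : R -> C -> R) (X Xi : R -> C -> C) (t q L : R).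
Hypothesis tf : tameflow c d M om X Xi t q L.
Let fl := tf_flow tf.
Variables (h0 : C -> R) (Lh B q0 : R).
Hypotheses (Lh0 : 0 <= Lh) (q00 : 0 < q0) (h0B : forall z, `|h0 z| <= B).
Hypotheses (h0L : forall z z', `|h0 z - h0 z'| <= Lh * `|z - z'|) (h0s : supp q0 h0).
Hypothesis t0 : 0 <= t.

Definition trsp u z : R := h0 (Xi u z).

Let Lr := Lh * XiL M t q L.
Definition trad : R := q0 + speedb M q * t.

Let XiL0 : 0 <= XiL M t q L.
Proof. by rewrite /XiL mulr_ge0// expR_ge0. Qed.

Let Lr0 : 0 <= Lr. Proof. exact: mulr_ge0. Qed.

Lemma trad_gt0 : 0 < trad.
Proof. by rewrite /trad; apply: (lt_le_trans q00); rewrite lerDl mulr_ge0// (speedb_ge0 tf). Qed.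

Lemma trsp_lip u z z' : 0 <= u <= t -> `|trsp u z - trsp u z'| <= Lr * `|z - z'|.
Proof.
move=> hu; apply: (le_trans (h0L _ _)); rewrite /Lr -mulrA; apply: ler_wpM2l => //.
exact: (Xi_lip tf).
Qed.

Lemma trsp_BL u : 0 <= u <= t -> BL (trsp u).
Proof.
move=> hu; have B0 : 0 <= B := le_trans (normr_ge0 _) (h0B 0).
exists (B + Lr); first exact: addr_ge0.
split=> [z|z z']; first by apply: (le_trans (h0B _)); rewrite lerDl.
by apply: (le_trans (trsp_lip z z' hu)); rewrite ler_wpM2r// lerDr.
Qed.

Lemma trsp_supp u : 0 <= u <= t -> supp trad (trsp u).
Proof.
move=> hu z; have /andP[u0 ut] := hu; rewrite /trsp ltNge => hz; apply: h0s; rewrite ltNge; apply: contra hz => hx.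
have h00 : 0 <= (0 : R) <= t by rewrite lexx.
have := tf_disp tf (Xi u z) hu h00; rewrite (tf_X0 tf) (fl_XXi fl) subr0 ger0_norm// => H.
have := ler_wpM2l (speedb_ge0 tf) ut; have := lerB_dist z (Xi u z); rewrite /trad; lra.
Qed.

Lemma trsp_Ig u : 0 <= u <= t -> Ig (trsp u).
Proof. by move=> hu; exact: (Ig_BLbox (ltW trad_gt0) (trsp_BL hu) (trsp_supp hu)). Qed.

Lemma vel_BL u : 0 <= u <= t -> BL (vel c d (om u)) /\ BL (vel d (- c) (om u)).
Proof.
move=> hu; have V0 := vlip_ge0 tf; have S0 := speedb_ge0 tf.
have SV := addr_ge0 S0 V0.
split; (exists (speedb M q + vlip M q L); first exact: SV); split=> [z|z z'];
  have [s1 s2] := tf_speed tf z hu.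
- by apply: (le_trans s1); rewrite lerDl; exact: V0.
- have [] := tf_vlip tf z z' hu hu; rewrite subrr normr0 add0r => H _.
  by apply: (le_trans H); apply: ler_wpM2r => //; rewrite lerDr; exact: S0.
- by apply: (le_trans s2); rewrite lerDl; exact: V0.
- have [] := tf_vlip tf z z' hu hu; rewrite subrr normr0 add0r => _ H.
  by apply: (le_trans H); apply: ler_wpM2r => //; rewrite lerDr; exact: S0.
Qed.

(** The trajectory through z at time u + h passes at time u within O(h^2) of the Euler point z - h
    v(u, z), because v is Lipschitz in time and space. *)
Let step_pt (u h : R) z : 0 <= u -> 0 <= h -> u + h <= t ->
  `|trsp (u + h) z - trsp u (z.1 - h * vel c d (om u) z, z.2 - h * vel d (- c) (om u) z)|
    <= Lr * (vlip M q L * (1 + speedb M q) * h ^+ 2).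
Proof.
move=> u0 hh uh; have hu : 0 <= u <= t by rewrite u0/=; lra.
have huh : 0 <= u + h <= t by rewrite uh addr_ge0.
have V0 := vlip_ge0 tf; have S0 := speedb_ge0 tf.
set x := Xi (u + h) z; have zE : X (u + h) x = z by rewrite /x (fl_XXi fl).
have -> : trsp (u + h) z = trsp u (X u x) by rewrite /trsp (fl_XiX fl).
apply: (le_trans (trsp_lip _ _ hu)); apply: ler_wpM2l => //.
have bnd v : u <= v <= u + h -> vlip M q L * (`|v - u| + `|X v x - z|) <= vlip M q L * (1 + speedb M q) * h.
  move=> /andP[uv vh]; have hv : 0 <= v <= t by rewrite (le_trans u0 uv) (le_trans vh).
  rewrite -mulrA; apply: ler_wpM2l => //; rewrite mulrDl mul1r; apply: lerD; first by rewrite ger0_norm; lra.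
  rewrite -{1}zE; apply: (le_trans (tf_disp tf x hv huh)); apply: ler_wpM2l => //.
  by rewrite distrC ger0_norm; lra.
have comp (F : R -> R) (a b : R) : (forall s : R, is_derive s 1 F (vel a b (om s) (X s x))) ->
   (forall v, 0 <= v <= t -> `|vel a b (om v) (X v x) - vel a b (om u) z| <= vlip M q L * (`|v - u| + `|X v x - z|)) ->
   `|F u - (F (u + h) - h * vel a b (om u) z)| <= vlip M q L * (1 + speedb M q) * h ^+ 2.
  move=> dF hF; set D := vel a b (om u) z.
  have := @bounded_deriv_lip R (fun v => F v - D * v) (fun v => vel a b (om v) (X v x) - D * 1)
    (vlip M q L * (1 + speedb M q) * h) u (u + h) (fun v _ => d1_B (dF v) (d1_Z D (d1_id v))).
  move=> H; have {H} : `|F u - D * u - (F (u + h) - D * (u + h))| <= vlip M q L * (1 + speedb M q) * h * `|u - (u + h)|.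
    apply: H => [v hv||]; [|by rewrite lexx lerDl|by rewrite lexx lerDl hh].
    rewrite mulr1; apply: (le_trans _ (bnd v hv)); apply: hF.
    by case/andP: hv => v1 v2; rewrite (le_trans u0 v1) (le_trans v2).
  have -> : `|u - (u + h)| = h by rewrite opprD addrA subrr sub0r normrN ger0_norm.
  rewrite -[_ * h * h]mulrA -expr2; apply: le_trans; rewrite le_eqVlt; apply/orP; left; apply/eqP.
  by congr (`| _ |); ring.
rewrite normC_le /= -{1 3}zE; apply/andP; split.
  by apply: (comp (fun s => (X s x).1)) => [s|v hv]; [exact: fl_d1 fl s x|exact: (tf_vlip tf (X v x) z hv hu).1].
by apply: (comp (fun s => (X s x).2)) => [s|v hv]; [exact: fl_d2 fl s x|exact: (tf_vlip tf (X v x) z hv hu).2].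
Qed.

Let kx s z := (2 * pi)^-1 * (c * kA s z + d * kB s z).
Let ky s z := (2 * pi)^-1 * (d * kB s z + (- c) * kD s z).

(** The regularisation error is only linear in h, so its scale x is fixed first to make it at most h
    e / 2; the Euler and shear errors are quadratic in h, and h1 is chosen afterwards. *)
Lemma step_err e : 0 < e -> exists2 x, 0 < x & exists2 h1, 0 < h1 & forall u h : R, 0 <= u -> 0 <= h <= h1 -> u + h <= t ->
  `|J (trsp (u + h)) - J (trsp u) - h * J (fun z => trsp u z * ((2 * pi)^-1 * conv (dkern (x ^+ 2) c d) (om u) z))|
    <= h * e.
Proof.
move=> e0; have V0 := vlip_ge0 tf; have S0 := speedb_ge0 tf; have m0 := trad_gt0.
set m := trad in m0 *; pose P := 4 * (m + 2) ^+ 2.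
have P0 : 0 <= P by rewrite /P mulr_ge0// exprn_ge0//; lra.
have [c1 d1] := ab_le1 (fl_cd fl).
have [d1' c1'] := ab_le1 (fl_dc fl).
have M0 := fl_M fl; have q_0 := tf_q tf.
pose K := Lr * (48 * M) * P.
have K0 : 0 <= K by rewrite /K; apply: mulr_ge0 => //; apply: mulr_ge0 => //; apply: mulr_ge0 (ltW M0); exact: (ler0n _ 48).
pose x := e / (2 * (K + 1)).
have x0 : 0 < x by rewrite /x divr_gt0// mulr_gt0// ltr_wpDl.
have Kx : K * x <= e / 2.
  have -> : e / 2 = (K + 1) * x by rewrite /x; field; rewrite gt_eqF// ltr_wpDl.
  by rewrite ler_wpM2r// ?lerDl// ltW.
exists x => //; have s0 : 0 < x ^+ 2 by rewrite exprn_gt0.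
set s := x ^+ 2 in s0 *.
have bk1 := BL_kreg c d s0; have bk2 := BL_kreg d (- c) s0.
have bkx : BL (kx s) by apply/BL_Z/BL_D; apply: BL_Z; [exact: BL_kA|exact: BL_kB].
have bky : BL (ky s) by apply/BL_Z/BL_D; apply: BL_Z; [exact: BL_kB|exact: BL_kD].
have [k [kk0 hk]] : exists k : R, 0 <= k /\ forall f, f \in [:: kreg c d s; kreg d (- c) s; kx s; ky s] ->
    (forall z, `|f z| <= k) /\ (forall z z', `|f z - f z'| <= k * `|z - z'|).
  have [k1 k10 [k1b k1l]] := bk1; have [k2 k20 [k2b k2l]] := bk2.
  have [k3 k30 [k3b k3l]] := bkx; have [k4 k40 [k4b k4l]] := bky.
  exists (k1 + k2 + k3 + k4); split; first by rewrite !addr_ge0.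
  have W (f : C -> R) (k : R) : 0 <= k -> k <= k1 + k2 + k3 + k4 -> (forall z, `|f z| <= k) ->
     (forall z z', `|f z - f z'| <= k * `|z - z'|) -> (forall z, `|f z| <= k1 + k2 + k3 + k4) /\
      (forall z z', `|f z - f z'| <= (k1 + k2 + k3 + k4) * `|z - z'|).
    move=> k_0 kl fb fl'; split=> [z|z z']; first exact: le_trans (fb z) kl.
    by apply: (le_trans (fl' _ _)); rewrite ler_wpM2r.
  move=> f; rewrite !inE => /or4P[]/eqP ->; [apply: (W _ k1)|apply: (W _ k2)|apply: (W _ k3)|apply: (W _ k4)] => //; lra.
pose A := k * (M * (4 * q ^+ 2)).
have A0 : 0 <= A by rewrite /A !mulr_ge0// ?exprn_ge0// ltW.
have cb f : BL f -> f \in [:: kreg c d s; kreg d (- c) s; kx s; ky s] -> forall u, 0 <= u <= t ->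
    BL (conv f (om u)) /\ (forall z, `|conv f (om u) z| <= A) /\
    (forall z z', `|conv f (om u) z - conv f (om u) z'| <= A * `|z - z'|).
  move=> bf /hk[fb fl'] u hu; have [jo Jo] := supp_Ig q_0 (fl_meas fl u) (fl_om fl u) (tf_supp tf hu).
  have [h1 h2] := conv_BLc bf fb fl' jo; split; first exact: BL_conv.
  have kA : k * J (fun w => `|om u w|) <= A by apply: ler_wpM2l.
  split=> [z|z z']; first exact: le_trans (h1 z) kA.
  by apply: (le_trans (h2 _ _)); rewrite ler_wpM2r.
pose Q := Lr * (vlip M q L * (1 + speedb M q)) * P + 3 * (Lr * A * A * P).
have Q0 : 0 <= Q.
  rewrite /Q; apply: addr_ge0; first exact: (mulr_ge0 (mulr_ge0 Lr0 (mulr_ge0 V0 (addr_ge0 ler01 S0))) P0).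
  exact: (mulr_ge0 (ler0n _ 3) (mulr_ge0 (mulr_ge0 (mulr_ge0 Lr0 A0) A0) P0)).
pose h1 := Num.min (Num.min (A + 1)^-1 (speedb M q + 1)^-1) (e / (2 * (Q + 1))).
have h10 : 0 < h1.
  by rewrite /h1 !lt_min !invr_gt0 !ltr_wpDl//= divr_gt0// mulr_gt0// ltr_wpDl.
exists h1 => // u h u0 /andP[hh]; rewrite /h1 !le_min => /andP[/andP[hA hS] hQ] uh.
have hu : 0 <= u <= t by rewrite u0/=; lra.
have huh : 0 <= u + h <= t by rewrite uh addr_ge0.
have hA1 : h * A <= 1.
  apply: (@le_trans _ _ (h * (A + 1))); first by apply: ler_wpM2l => //; lra.
  by rewrite -ler_pdivlMr ?ltr_wpDl// div1r.
have hS1 : h * speedb M q <= 1.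
  apply: (@le_trans _ _ (h * (speedb M q + 1))); first by apply: ler_wpM2l => //; lra.
  by rewrite -ler_pdivlMr ?ltr_wpDl// div1r.
have hQ1 : Q * h ^+ 2 <= h * (e / 2).
  have -> : Q * h ^+ 2 = h * (Q * h) by ring.
  apply: ler_wpM2l => //; apply: (@le_trans _ _ ((Q + 1) * h)); first by apply: ler_wpM2r => //; lra.
  move: hQ; rewrite ler_pdivlMr ?mulr_gt0 ?ltr_wpDl//; lra.
have [jo Jo] := supp_Ig q_0 (fl_meas fl u) (fl_om fl u) (tf_supp tf hu).
have [bv1 bv2] := vel_BL hu; have br := trsp_BL hu; have rs := trsp_supp hu; rewrite -/m in rs.
have [ba [aA aL]] := cb _ bk1 ltac:(by rewrite !inE eqxx) u hu.
have [bb [bA bL]] := cb _ bk2 ltac:(by rewrite !inE eqxx ?orbT) u hu.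
have [bda [daA daL]] := cb _ bkx ltac:(by rewrite !inE eqxx ?orbT) u hu.
have [bdb [dbA dbL]] := cb _ bky ltac:(by rewrite !inE eqxx ?orbT) u hu.
have dk1 (y1 y2 : R) : is_derive y1 1 (fun y : R => kreg c d s (y, y2)) (kx s (y1, y2)).
  by apply: d1_Z; apply: d1_D; apply: d1_Z; [exact: al_dx|exact: be_dx].
have dk2 (y1 y2 : R) : is_derive y2 1 (fun y : R => kreg d (- c) s (y1, y)) (ky s (y1, y2)).
  by apply: d1_Z; apply: d1_D; apply: d1_Z; [exact: al_dy|exact: be_dy].
have dA := conv_derive1 bk1 bkx jo dk1; have dB := conv_derive2 bk2 bky jo dk2.
have sh := shear_step m0 hh Lr0 A0 A0 br (fun z z' => trsp_lip z z' hu) rs ba bb bda bdb aA bA daA dbA bL dA dB hA1.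
have divE z : conv (kx s) (om u) z + conv (ky s) (om u) z = (2 * pi)^-1 * conv (dkern s c d) (om u) z.
  rewrite -(convZ _ _ (BL_dkern s0 c d) jo) -(convD _ bkx bky jo); congr (conv _ _ _).
  by apply/funext => w; rewrite /kx /ky /dkern; ring.
have divJ : J (fun z => trsp u z * (conv (kx s) (om u) z + conv (ky s) (om u) z)) =
    J (fun z => trsp u z * ((2 * pi)^-1 * conv (dkern s c d) (om u) z)) by apply: eq_J => z; rewrite divE.
have {sh} : `|J (fun z => trsp u (z.1 - h * conv (kreg c d s) (om u) z, z.2 - h * conv (kreg d (- c) s) (om u) z))
    - J (trsp u) - h * J (fun z => trsp u z * ((2 * pi)^-1 * conv (dkern s c d) (om u) z))| <= 3 * (Lr * A * A * P) * h ^+ 2.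
  by rewrite divJ in sh.
set I2 := J (fun z => trsp u (z.1 - h * conv (kreg c d s) (om u) z, _)) => S2.
have m20 : 0 <= m + 2 := addr_ge0 (ltW m0) (ler0n _ 2).
have sup (k1 k2 : C -> R) : (forall z, `|h * k1 z| <= 1) -> (forall z, `|h * k2 z| <= 1) ->
    forall z, m + 2 < `|z| -> trsp u (z.1 - h * k1 z, z.2 - h * k2 z) = 0.
  move=> l1 l2 z hz; apply: rs.
  have : `|z| <= `|(z.1 - h * k1 z, z.2 - h * k2 z)| + 1.
    rewrite {1}[z]surjective_pairing normC_le /=.
    have n1 := norm1_le (z.1 - h * k1 z, z.2 - h * k2 z); have n2 := norm2_le (z.1 - h * k1 z, z.2 - h * k2 z).
    rewrite /= in n1 n2.
    have w1 := ler_normD (z.1 - h * k1 z) (h * k1 z); have w2 := ler_normD (z.2 - h * k2 z) (h * k2 z).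
    rewrite !subrK in w1 w2; apply/andP; split; [apply: (le_trans w1)|apply: (le_trans w2)]; exact: lerD.
  exact: gap hz.
have hb (B' : R) (k1 : C -> R) : h * B' <= 1 -> (forall z, `|k1 z| <= B') -> forall z, `|h * k1 z| <= 1.
  by move=> hB kB' z; rewrite normrM (ger0_norm hh); exact: le_trans (ler_wpM2l hh (kB' z)) hB.
have bR (k1 k2 : C -> R) : BL k1 -> BL k2 -> BL (fun z => trsp u (z.1 - h * k1 z, z.2 - h * k2 z)).
  by move=> l1 l2; exact: BL_comp br (Lip_shift h Lip_fst l1) (Lip_shift h Lip_snd l2).
pose I1 := J (fun z => trsp u (z.1 - h * vel c d (om u) z, z.2 - h * vel d (- c) (om u) z)).
have sv := sup _ _ (hb _ _ hS1 (fun z => (tf_speed tf z hu).1)) (hb _ _ hS1 (fun z => (tf_speed tf z hu).2)).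
have sc := sup _ _ (hb _ _ hA1 aA) (hb _ _ hA1 bA).
have sm2 z : m + 2 < `|z| -> trsp (u + h) z = 0 by move=> hz; apply: (trsp_supp huh); apply: lt_trans hz; rewrite ltrDl ltr0n.
have D1 := J_diff_le m20 (trsp_BL huh) (bR _ _ bv1 bv2) sm2 sv (fun z => step_pt z u0 hh uh).
have D2 : `|I1 - I2| <= Lr * (h * (48 * M * x)) * P.
  apply: (J_diff_le m20 (bR _ _ bv1 bv2) (bR _ _ ba bb) sv sc) => z.
  apply: (le_trans (trsp_lip _ _ hu)); apply: (ler_wpM2l Lr0); rewrite normC_le /=.
  have g (z1 p p' : R) : `|p - p'| <= 48 * M * x -> `|z1 - h * p - (z1 - h * p')| <= h * (48 * M * x).
    move=> pp; have -> : z1 - h * p - (z1 - h * p') = - (h * (p - p')) by ring.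
    by rewrite normrN normrM (ger0_norm hh); apply: (ler_wpM2l hh); exact: pp.
  by apply/andP; split; apply: g; [exact: (vel_reg z c1 d1 x0 jo (fl_om fl u))|exact: (vel_reg z d1' c1' x0 jo (fl_om fl u))].
rewrite -/I1 -/P in D1.
have E2 : Lr * (h * (48 * M * x)) * P <= h * (e / 2).
  have -> : Lr * (h * (48 * M * x)) * P = h * (K * x) by rewrite /K; ring.
  by apply: ler_wpM2l.
have E1 : Lr * (vlip M q L * (1 + speedb M q) * h ^+ 2) * P + 3 * (Lr * A * A * P) * h ^+ 2 = Q * h ^+ 2.
  by rewrite /Q; ring.
rewrite (mulrA h e) in hQ1 E2; exact: three_err D1 D2 S2 E2 E1 hQ1.
Qed.

(** Discrete Gronwall: [step_err] is iterated over N equal steps, with (1 + aa h)^N <= exp(aa N h),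
    so that no derivative of the integral in time is taken. The accuracy e is removed at the end. *)
Lemma evolve (aa bb s0 s1 : R) : 0 <= aa -> 0 <= bb -> 0 <= s0 -> s0 <= s1 -> s1 <= t ->
  (forall u x : R, s0 <= u <= s1 -> 0 < x ->
    J (fun z => trsp u z * ((2 * pi)^-1 * conv (dkern (x ^+ 2) c d) (om u) z)) <= aa * J (trsp u) + bb) ->
  0 <= J (trsp s0) ->
  J (trsp s1) <= expR (aa * (s1 - s0)) * (J (trsp s0) + bb * (s1 - s0)).
Proof.
move=> aa0 bb0 s00 s01 s1t H g0.
have T0 : 0 <= s1 - s0 by lra.
suff W e : 0 < e -> J (trsp s1) <= expR (aa * (s1 - s0)) * (J (trsp s0) + (bb + e) * (s1 - s0)).
  apply/ler_addgt0Pr => e e0; have Ep := expR_gt0 (aa * (s1 - s0)).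
  pose k := expR (aa * (s1 - s0)) * (s1 - s0) + 1.
  have k0 : 0 < k by rewrite ltr_wpDl// mulr_ge0// ltW.
  apply: (le_trans (W (e / k) _)); first by rewrite divr_gt0.
  have -> : expR (aa * (s1 - s0)) * (J (trsp s0) + (bb + e / k) * (s1 - s0)) =
    expR (aa * (s1 - s0)) * (J (trsp s0) + bb * (s1 - s0)) + (k - 1) * (e / k) by rewrite /k; ring.
  rewrite lerD2l mulrBl mul1r mulrC divfK ?gt_eqF// gerBl; exact/ltW/divr_gt0.
move=> e0; have [x x0 [h1 h10 hs]] := step_err e0.
pose N := (Num.truncn ((s1 - s0) / h1)).+1; pose h := (s1 - s0) / N%:R.
have N0 : 0 < N%:R :> R by rewrite ltr0n.
have hh0 : 0 <= h by rewrite divr_ge0// ltW.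
have hh1 : h <= h1.
  rewrite ler_pdivrMr// mulrC -ler_pdivrMr//; exact/ltW/truncnS_gt.
have hN : N%:R * h = s1 - s0 by rewrite mulrC divfK// gt_eqF.
have rec n : (n <= N)%N -> J (trsp (s0 + n%:R * h)) <= (1 + aa * h) ^+ n * (J (trsp s0) + n%:R * h * (bb + e)).
  elim: n => [|n IH] nN; first by rewrite !mul0r !addr0 expr0 mul1r.
  have {}IH := IH (ltnW nN).
  have nh : n.+1%:R * h <= s1 - s0 by rewrite -hN ler_wpM2r// ler_nat.
  have nh0 : 0 <= n%:R * h by rewrite mulr_ge0.
  have E : s0 + n.+1%:R * h = s0 + n%:R * h + h by rewrite -natr1 mulrDl mul1r addrA.
  have u0 : 0 <= s0 + n%:R * h by rewrite addr_ge0.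
  have uS : s0 + n%:R * h + h <= s1 by rewrite -E; lra.
  have := hs (s0 + n%:R * h) h u0 ltac:(by rewrite hh0 hh1) (le_trans uS s1t).
  have hu : s0 <= s0 + n%:R * h <= s1 by apply/andP; split; lra.
  have := ler_wpM2l hh0 (H _ _ hu x0).
  rewrite E; set Jd := J (fun z => _); set gn := J (trsp (s0 + n%:R * h)) in IH *; set gS := J (trsp _).
  move=> l1; rewrite ler_norml => /andP[_ l2].
  have F0 : 1 <= 1 + aa * h by rewrite lerDl mulr_ge0.
  have Fn : 1 <= (1 + aa * h) ^+ n.+1 by rewrite exprn_ege1.
  have k1 : (1 + aa * h) * gn <= (1 + aa * h) ^+ n.+1 * (J (trsp s0) + n%:R * h * (bb + e)).
    by rewrite exprS -mulrA; apply: ler_wpM2l => //; lra.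
  have be0 : 0 <= h * (bb + e) by rewrite mulr_ge0// addr_ge0// ltW.
  have k2 := ler_wpM2r be0 Fn; rewrite mul1r in k2.
  have -> : J (trsp s0) + n.+1%:R * h * (bb + e) = (J (trsp s0) + n%:R * h * (bb + e)) + h * (bb + e).
    by rewrite -natr1; ring.
  rewrite mulrDr; move: l1 l2 k1 k2; move: (_ ^+ n.+1 * _) (_ ^+ n.+1 * _) => p1 p2; lra.
have := rec N (leqnn _); rewrite hN (_ : s0 + (s1 - s0) = s1); last by ring.
move=> H1; apply: (le_trans H1); rewrite [(s1 - s0) * _]mulrC; apply: ler_wpM2r.
  by apply: addr_ge0 => //; apply: mulr_ge0 => //; apply: addr_ge0 => //; exact: ltW.
have -> : aa * (s1 - s0) = N%:R * (aa * h) by rewrite -hN; ring.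
rewrite expRM_natl; apply: lerXn2r; rewrite ?nnegrE ?expR_ge0 ?addr_ge0 ?mulr_ge0//.
exact: expR_ge1Dx.
Qed.

End Evolution.

(** * Bounds uniform along the approximation *)

Section UniformBounds.
Context {R : realType}.
Local Notation C := (R * R)%type.
Implicit Types (f g h : C -> R) (z w y x : C).

Let twopi : 0 <= (2 * pi)^-1 :> R /\ (2 * pi)^-1 <= 1 :> R.
Proof.
have p := @pi_ge2 R; split; first by rewrite invr_ge0; lra.
by rewrite invf_le1; lra.
Qed.

Lemma tf_J_sqr c d M (om : R -> C -> R) X Xi t q L u : tameflow c d M om X Xi t q L -> 0 <= u <= t ->
  [/\ Ig (om u), Ig (fun w => om u w ^+ 2) & J (fun w => om u w ^+ 2) <= M * J (fun w => `|om u w|)].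
Proof.
move=> tf hu; have fl := tf_flow tf; have M0 := fl_M fl.
have [jo _] := supp_Ig (tf_q tf) (fl_meas fl u) (fl_om fl u) (tf_supp tf hu).
have le w : `|om u w ^+ 2| <= M * `|om u w| by rewrite normrX expr2 ler_wpM2r// (fl_om fl).
have j2 : Ig (fun w => om u w ^+ 2).
  apply: (Ig_le _ (IgZ M (Ig_abs jo)) le).
  by apply: measurable_funX; exact: fl_meas fl u.
split => //; rewrite -(JZ _ (Ig_abs jo)); apply: (J_le j2 (IgZ M (Ig_abs jo))) => w.
exact: le_trans (ler_norm _) (le w).
Qed.

(** The flow does not preserve area, so the L^1 norm may grow. Here h0 is |om 0|, transported to |om
    u|; the integral of |om| div v is at most (1 + 4096) times that of om^2, hence (1 + 4096) M
    times that of |om|. *)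
Lemma L1_growth c d M (om : R -> C -> R) X Xi t q L u : tameflow c d M om X Xi t q L -> 0 <= u <= t ->
  J (fun w => `|om u w|) <= expR ((1 + 4096) * M * u) * J (fun w => `|om 0 w|).
Proof.
move=> tf /andP[u0 ut]; have fl := tf_flow tf; have M0 := fl_M fl; have q0 := tf_q tf.
have t0 : 0 <= t := le_trans u0 ut.
have [k kE] : exists k : R, k = 4096 by exists 4096.
have k0 : 0 <= k by rewrite kE; exact: (ler0n _ 4096).
rewrite -kE.
have h00 : 0 <= (0 : R) <= t by rewrite lexx.
have hL z z' : `| `|om 0 z| - `|om 0 z'| | <= L * `|z - z'|.
  apply: (le_trans (ler_dist_dist _ _)).
  by have := tf_lip tf z z' h00 h00; rewrite subrr normr0 add0r.
have hB z : `| `|om 0 z| | <= M by rewrite normr_id (fl_om fl).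
have hs : supp q (fun z => `|om 0 z|) by move=> z qz; rewrite (tf_supp tf h00 qz) normr0.
have E s : (fun z => `|om s z|) = trsp Xi (fun z => `|om 0 z|) s.
  by apply/funext => z; rewrite /trsp -(fl_tr fl s) (fl_XXi fl).
have kM : 0 <= (1 + k) * M by apply: mulr_ge0; [exact: addr_ge0|exact: ltW].
have := @evolve R c d M om X Xi t q L tf (fun z => `|om 0 z|) L M q (tf_L tf) q0 hB hL hs t0
   ((1 + k) * M) 0 0 u kM (lexx 0) (lexx 0) u0 ut.
rewrite -!E !subr0 mul0r addr0; apply; last first.
  by apply: J_ge0 => z; exact: normr_ge0.
move=> v x /andP[v0 vu] x0; rewrite addr0 -E.
have hv : 0 <= v <= t by rewrite v0 (le_trans vu).
have [jo j2 J2] := tf_J_sqr tf hv; have s0 : 0 < x ^+ 2 by rewrite exprn_gt0.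
have bdk := BL_dkern s0 c d.
have bf := BL_conv bdk jo; set f := conv (dkern (x ^+ 2) c d) (om v) in bf *.
have jb : Ig (fun z => box q z * f z ^+ 2).
  apply: (Ig_boxcont (ltW q0)); apply: BL_continuous; exact: (BL_M bf bf).
have LB : J (fun z => box q z * f z ^+ 2) <= k * J (fun w => om v w ^+ 2).
  rewrite kE; exact: (L2_bound s0 (fl_meas fl v) q0 (fl_om fl v) (tf_supp tf hv) (fl_cd fl) (ltW q0)).
have [p0 p1] := twopi.
(* From 2 x y <= x^2 + y^2; outside the square of radius q the density vanishes, so f is needed only
   inside. *)
have pt z : `| `|om v z| * ((2 * pi)^-1 * f z) | <= om v z ^+ 2 + box q z * f z ^+ 2.
  have [zq|zq] := leP `|z| q; last first.
    rewrite (tf_supp tf hv zq) normr0 mul0r normr0 expr0n/= add0r.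
    by apply: mulr_ge0; [exact: box_ge0|exact: sqr_ge0].
  have -> : box q z = 1 by rewrite /box zq.
  rewrite mul1r !normrM normr_id (ger0_norm p0).
  have : (2 * pi)^-1 * `|f z| <= `|f z| by rewrite ler_piMl.
  move=> h; have := ler_wpM2l (normr_ge0 (om v z)) h.
  rewrite -[om v z ^+ 2]real_normK ?num_real// -[f z ^+ 2]real_normK ?num_real//.
  have := sqr_ge0 (`|om v z| - `|f z|); rewrite sqrrB.
  have := sqr_ge0 `|om v z|; have := sqr_ge0 `|f z|.
  move: (`|om v z| * (_ * `|f z|)) => e; move: (`|om v z|) (`|f z|) => a b; rewrite mulr2n; lra.
have mp : measurable_fun setT (fun z => `|om v z| * ((2 * pi)^-1 * f z)).
  apply: measurable_funM; first exact: measurableT_comp (fl_meas fl v).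
  by apply: measurable_funM => //; exact: BL_measurable.
apply: (le_trans (ler_norm _)); apply: (le_trans (J_abs_le mp (IgD j2 jb) pt)).
rewrite (JD j2 jb); have := ler_wpM2l k0 J2; move: LB J2.
move: (J _) (J _) (J _) => a b e; lra.
Qed.

Lemma expR_half (u : R) : 0 < u -> expR (2^-1 * ln u) ^+ 2 = u.
Proof. by move=> u0; rewrite -expRM_natl mulrA divff// mul1r lnK. Qed.

(** The parameter of [entropy_bound] is tied to the size m of the integral, which makes the additive
    term comparable to m. For cK M (s1 - s0) <= 1 / 2 the growth factor is at most (1 + 1/m)^(1/2);
    an exponent below 1 is what leaves a positive power of m. *)
Lemma small_step (M A1 e : R) : 0 < M -> 0 <= A1 -> 0 < e -> exists2 dl, 0 < dl &
  forall c d (om : R -> C -> R) X Xi t q L h0 Lh q0, tameflow c d M om X Xi t q L ->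
   (forall u, 0 <= u <= t -> J (fun w => `|om u w|) <= A1) ->
   0 <= Lh -> 0 < q0 -> (forall z, 0 <= h0 z <= 1) -> (forall z z', `|h0 z - h0 z'| <= Lh * `|z - z'|) ->
   supp q0 h0 -> forall s0 s1, 0 <= s0 -> s0 <= s1 -> s1 <= t -> cK * M * (s1 - s0) <= 2^-1 -> s1 - s0 <= 1 ->
   J (trsp Xi h0 s0) <= dl -> J (trsp Xi h0 s1) <= e.
Proof.
move=> M0 A10 e0.
have [k kE] : exists k : R, k = 6 * 4096 by exists (6 * 4096).
have k0 : 0 <= k by rewrite kE; exact: (mulr_ge0 (ler0n _ 6) (ler0n _ 4096)).
pose K2 := k * A1; have K20 : 0 <= K2 by exact: mulr_ge0.
(* The square of the final bound is (1 + 1/m) m^2 (1 + K2)^2 = m (m + 1) (1 + K2)^2 <= 2 m (1 +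
   K2)^2 <= e^2. *)
pose m := Num.min 1 (e ^+ 2 / (2 * (1 + K2) ^+ 2)).
have K21 : 0 < 1 + K2 by rewrite ltr_pwDl.
have m0 : 0 < m by rewrite lt_min ltr01 divr_gt0 ?exprn_gt0// mulr_gt0// exprn_gt0.
exists m => // c d om X Xi t q L h0 Lh q0 tf omA Lh0 q00 h01 h0L h0s s0 s1 s00 s01 s1t cs s1le gm.
have fl := tf_flow tf; have t0 : 0 <= t := le_trans s00 (le_trans s01 s1t).
have h0B z : `|h0 z| <= 1 by have /andP[a b] := h01 z; rewrite ger0_norm.
have l0 : 0 <= ln (1 + m^-1) by rewrite ln_ge0// lerDl invr_ge0 ltW.
have cK0 : 0 <= @cK R := le_trans ler01 (@cK_ge1 R).
have aa0 : 0 <= cK * M * ln (1 + m^-1) by apply: mulr_ge0 l0; exact: mulr_ge0 cK0 (ltW M0).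
have bb0 : 0 <= m * K2 by exact: mulr_ge0 (ltW m0) K20.
have g00 : 0 <= J (trsp Xi h0 s0) by apply: J_ge0 => z; rewrite /trsp; have /andP[] := h01 (Xi s0 z).
have step (u x : R) : s0 <= u <= s1 -> 0 < x ->
    J (fun z => trsp Xi h0 u z * ((2 * pi)^-1 * conv (dkern (x ^+ 2) c d) (om u) z))
      <= cK * M * ln (1 + m^-1) * J (trsp Xi h0 u) + m * K2.
  move=> /andP[u0 u1] x0; have hu : 0 <= u <= t by rewrite (le_trans s00 u0) (le_trans u1).
  have [jo j2 J2] := tf_J_sqr tf hu; have sx : 0 < x ^+ 2 by rewrite exprn_gt0.
  have bdk := BL_dkern sx c d.
  have bf := BL_conv bdk jo.
  have br := trsp_BL tf Lh0 h0B h0L hu.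
  have rs := trsp_supp tf h0s t0 hu; have tr0 := trad_gt0 tf q00 t0.
  have r01 z : 0 <= trsp Xi h0 u z <= 1 := h01 (Xi u z).
  have EB := entropy_bound sx (fl_cd fl) (fl_meas fl u) (tf_q tf) M0 (fl_om fl u) (tf_supp tf hu)
     (BL_measurable br) r01 tr0 rs m0.
  set f := conv (dkern (x ^+ 2) c d) (om u) in bf EB *.
  have jrf : Ig (fun z => trsp Xi h0 u z * f z).
    by apply: (Ig_BLbox (ltW tr0) (BL_M br bf)) => z zr; rewrite rs// mul0r.
  have -> : J (fun z => trsp Xi h0 u z * ((2 * pi)^-1 * f z)) = (2 * pi)^-1 * J (fun z => trsp Xi h0 u z * f z).
    by rewrite -(JZ _ jrf); apply: eq_J => z; ring.
  have [p0 p1] := twopi.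
  have E2 : m * (6 * (4096 * J (fun w => om u w ^+ 2))) / M <= m * K2.
    have -> : m * (6 * (4096 * J (fun w => om u w ^+ 2))) / M = m * (k * (J (fun w => om u w ^+ 2) / M)).
      by rewrite kE; ring.
    apply: (ler_wpM2l (ltW m0)); apply: (ler_wpM2l k0).
    by rewrite ler_pdivrMr// mulrC; apply: (le_trans J2); apply: (ler_wpM2l (ltW M0)); exact: omA.
  have RB := le_trans EB (lerD (lexx _) E2).
  have R0 : 0 <= cK * M * ln (1 + m^-1) * J (trsp Xi h0 u) + m * K2.
    apply: addr_ge0 bb0; apply: mulr_ge0 aa0 _; apply: J_ge0 => z.
    by have /andP[] := r01 z.
  by apply: (le_trans (ler_wpM2l p0 RB)); exact: ler_piMl R0 p1.
have H := @evolve R c d M om X Xi t q L tf h0 Lh 1 q0 Lh0 q00 h0B h0L h0s t0 _ _ _ _ aa0 bb0 s00 s01 s1t step g00.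
have T0 : 0 <= s1 - s0 by rewrite subr_ge0.
pose E := expR (2^-1 * ln (1 + m^-1)).
have E0 : 0 <= E := expR_ge0 _.
have EE : E ^+ 2 = 1 + m^-1 by rewrite expR_half// addr_gt0// invr_gt0.
have PE : expR (cK * M * ln (1 + m^-1) * (s1 - s0)) <= E.
  rewrite ler_expR (_ : cK * M * ln (1 + m^-1) * (s1 - s0) = cK * M * (s1 - s0) * ln (1 + m^-1)); last by ring.
  exact: ler_wpM2r.
have B1 : J (trsp Xi h0 s0) + m * K2 * (s1 - s0) <= m * (1 + K2).
  have -> : m * (1 + K2) = m + m * K2 * 1 by ring.
  by apply: lerD gm _; exact: ler_wpM2l.
have B0 : 0 <= J (trsp Xi h0 s0) + m * K2 * (s1 - s0) by apply: addr_ge0 g00 _; exact: mulr_ge0.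
apply: (le_trans H); apply: (le_trans (ler_pM (expR_ge0 _) B0 PE B1)).
have mK0 : 0 <= m * (1 + K2) by apply: mulr_ge0; exact: ltW.
have EM0 : 0 <= E * (m * (1 + K2)) by exact: mulr_ge0.
rewrite -ler_sqr ?nnegrE ?(ltW e0)//.
rewrite exprMn EE exprMn.
have -> : (1 + m^-1) * (m ^+ 2 * (1 + K2) ^+ 2) = m * (m + 1) * (1 + K2) ^+ 2 by field; rewrite gt_eqF.
have m1 : m <= 1 by rewrite ge_min lexx.
have m2 : m * (2 * (1 + K2) ^+ 2) <= e ^+ 2.
  by rewrite -ler_pdivlMr ?mulr_gt0 ?exprn_gt0// ge_min lexx orbT.
apply: le_trans m2; rewrite -mulrA; apply: (ler_wpM2l (ltW m0)); apply: ler_wpM2r; first exact: sqr_ge0.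
by rewrite [leRHS](_ : 2 = 1 + 1)// lerD2r.
Qed.

(* Smallness survives a time step whose length depends on the sup norm only, hence any time. *)
Lemma small_transport (M A1 T e : R) : 0 < M -> 0 <= A1 -> 0 < e -> exists2 dl, 0 < dl &
  forall c d (om : R -> C -> R) X Xi t q L h0 Lh q0, tameflow c d M om X Xi t q L ->
   (forall u, 0 <= u <= t -> J (fun w => `|om u w|) <= A1) ->
   0 <= Lh -> 0 < q0 -> (forall z, 0 <= h0 z <= 1) -> (forall z z', `|h0 z - h0 z'| <= Lh * `|z - z'|) ->
   supp q0 h0 -> forall s, 0 <= s -> s <= t -> s <= T ->
   J (trsp Xi h0 0) <= dl -> J (trsp Xi h0 s) <= e.
Proof.
move=> M0 A10 e0; have cK1 := @cK_ge1 R.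
have cM0 : 0 < 2 * (cK * M) by apply: mulr_gt0 => //; apply: mulr_gt0 => //; exact: lt_le_trans cK1.
pose h := Num.min 1 (2 * (cK * M))^-1.
have h0 : 0 < h by rewrite lt_min ltr01 invr_gt0.
have hM (x : R) : x <= h -> cK * M * x <= 2^-1 /\ x <= 1.
  rewrite le_min => /andP[x1 x2]; split => //.
  have -> : 2^-1 = cK * M * (2 * (cK * M))^-1 :> R.
    by move: cM0; move: (cK * M) => a; rewrite pmulr_rgt0// => a0; field; rewrite gt_eqF.
  by apply: ler_wpM2l => //; move: cM0; rewrite pmulr_rgt0// => /ltW.
suff [dl dl0 H] : exists2 dl, 0 < dl &
  forall c d (om : R -> C -> R) X Xi t q L h0 Lh q0, tameflow c d M om X Xi t q L ->
   (forall u, 0 <= u <= t -> J (fun w => `|om u w|) <= A1) ->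
   0 <= Lh -> 0 < q0 -> (forall z, 0 <= h0 z <= 1) -> (forall z z', `|h0 z - h0 z'| <= Lh * `|z - z'|) ->
   supp q0 h0 -> forall s, 0 <= s -> s <= t -> s <= h *+ (Num.truncn (T / h)).+1 ->
   J (trsp Xi h0 0) <= dl -> J (trsp Xi h0 s) <= e.
  exists dl => // c d om X Xi t q L g Lg q0 tf omA Lg0 q00 g01 gL gs s s0 st sT.
  apply: (H c d om X Xi t q L g Lg q0) => //; apply: (le_trans sT).
  by rewrite -mulr_natl -ler_pdivrMr//; exact/ltW/truncnS_gt.
elim: (_.+1) e e0 => [|n IH] e e0.
  exists e => // c d om X Xi t q L g Lg q0 tf omA Lg0 q00 g01 gL gs s s0 st.
  by rewrite mulr0n => s0'; have -> : s = 0 by apply/eqP; rewrite eq_le s0 s0'.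
have [d1 d10 H1] := small_step M0 A10 e0; have [d2 d20 H2] := IH _ d10.
exists (Num.min e d2); first by rewrite lt_min e0.
move=> c d om X Xi t q L g Lg q0 tf omA Lg0 q00 g01 gL gs s s0 st sn; rewrite le_min => /andP[_ gd].
have nh0 : 0 <= h *+ n by rewrite mulrn_wge0// ltW.
(* Go back by h, or to time 0 if s < h; the smallness d1 that the last step requires is the target
   of the earlier ones. *)
pose r := Num.max 0 (s - h).
have r0 : 0 <= r by rewrite le_max lexx.
have rs : r <= s by rewrite ge_max s0 gerBl ltW.
have rn : r <= h *+ n by rewrite ge_max nh0/= lerBlDr addrC -mulrS.
have sr : s - r <= h by rewrite lerBlDr -lerBlDl le_max lexx orbT.
have [k1 k2] := hM _ sr.
apply: (H1 c d om X Xi t q L g Lg q0 tf omA Lg0 q00 g01 gL gs r s r0 rs st k1 k2).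
exact: (H2 c d om X Xi t q L g Lg q0 tf omA Lg0 q00 g01 gL gs r r0 (le_trans rs st) rn gd).
Qed.

End UniformBounds.

(** * Approximation of Borel functions *)

Section Approximation.
Context {R : realType}.
Local Notation C := (R * R)%type.
Implicit Types (f g h : C -> R) (z w : C).

Definition clamp (x : R) := Num.min 1 (Num.max 0 x).

Lemma clamp01 x : 0 <= clamp x <= 1.
Proof. by rewrite /clamp ge_min lexx le_min ler01 le_max lexx. Qed.

Lemma clamp_id x : 0 <= x <= 1 -> clamp x = x.
Proof. by move=> /andP[x0 x1]; rewrite /clamp max_r// min_r. Qed.

Lemma clamp_lip x y : `|clamp x - clamp y| <= `|x - y|.
Proof.
have lmin (u v : R) : `|Num.min 1 u - Num.min 1 v| <= `|u - v|.
  have := ler_norm (u - v); have := ler_norm (v - u); rewrite [`|v - u|]distrC => h1 h2.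
  by case: (leP 1 u) => ?; case: (leP 1 v) => ?; rewrite ler_norml; lra.
apply: (le_trans (lmin _ _)).
have := ler_norm (x - y); have := ler_norm (y - x); rewrite [`|y - x|]distrC => h1 h2.
by case: (leP 0 x) => ?; case: (leP 0 y) => ?; rewrite ler_norml; lra.
Qed.

Lemma J_dct (g : nat -> C -> R) (G : C -> R) : (forall m, measurable_fun setT (g m)) -> Ig G ->
  (forall m z, `|g m z| <= G z) -> (forall z, g ^~ z @ \oo --> 0) ->
  (fun m => J (fun z => `|g m z|)) @ \oo --> 0.
Proof.
move=> mg jG gG g0.
have j m : Ig (fun z => `|g m z|) by apply: Ig_abs; exact: (Ig_le (mg m) jG (gG m)).
have [||||| _ _] := @dominated_convergence _ _ R (@leb2 R) setT measurableT
    (fun m z => (`|g m z|)%:E) (cst 0)%E (EFin \o G).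
- by move=> m; apply/measurable_EFinP; exact: Ig_meas (j m).
- exact: measurable_cst.
- apply: nearW => z _ /=; apply: cvg_EFin; first exact: nearW.
  have -> : fine \o (fun m => (`|g m z|)%:E) = (fun m => `|g m z|) by [].
  by rewrite -[X in _ --> X](normr0 R); apply: cvg_norm; exact: g0.
- exact: jG.
- by apply: nearW => z m _ /=; rewrite lee_fin normr_id.
rewrite integral0 => H.
have -> : (fun m => J (fun z => `|g m z|)) = fine \o (fun m => (\int[@leb2 R]_z (`|g m z|)%:E)%E) by [].
exact: (@fine_cvg _ _ _ _ _ _ H).
Qed.

Variables (Y : C -> C) (n1 n2 : R).
Hypotheses (cY : continuous Y) (n10 : 0 < n1) (n20 : 0 < n2).

Definition bm f := measurable_fun setT f /\ exists B, forall z, `|f z| <= B.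

Lemma measurable_cont2 : measurable_fun setT Y.
Proof.
have lc (k : C -> R) : Lip k -> continuous k by move=> [c _ hc]; exact: lip_continuous hc.
have c1 : continuous (fun z => (Y z).1) by move=> z; apply: continuous_comp; [exact: cY|exact: (lc _ Lip_fst)].
have c2 : continuous (fun z => (Y z).2) by move=> z; apply: continuous_comp; [exact: cY|exact: (lc _ Lip_snd)].
by apply/measurable_fun_pairP; split; [exact: (continuous2_measurable c1)|exact: (continuous2_measurable c2)].
Qed.

(** Distance for Lebesgue measure and for its image under Y, taken together: with absolute
    continuity of Y still to be proved, closeness for one measure says nothing about the other. *)
Definition dist f := J (fun z => box n1 z * `|f z|) + J (fun z => box n2 z * `|f (Y z)|).

Lemma bm_comp f : bm f -> bm (f \o Y).
Proof.
move=> [mf [B fB]]; split; last by exists B => z; exact: fB.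
exact: (measurableT_comp mf measurable_cont2).
Qed.

Lemma bm_box n f : 0 < n -> bm f -> Ig (fun z => box n z * `|f z|).
Proof.
move=> n0 [mf [B fB]]; have [|||//] := @bounded_Ig _ (fun z => box n z * `|f z|) B n _ (ltW n0).
- by apply: measurable_funM; [exact: measurable_box|exact: measurableT_comp].
- move=> z; rewrite /box; case: (leP `|z| n) => _; rewrite ?mul1r ?normr_id// mul0r normr0.
  exact: le_trans (fB 0).
- by move=> z; rewrite /box ltNge => /negbTE ->; rewrite mul0r.
Qed.

Lemma dist_le f g h : bm f -> bm g -> bm h -> (forall z, `|f z| <= `|g z| + `|h z|) -> dist f <= dist g + dist h.
Proof.
move=> bf bg bh l; rewrite /dist addrACA.
have A n (f1 g1 h1 : C -> R) : 0 < n -> bm f1 -> bm g1 -> bm h1 -> (forall z, `|f1 z| <= `|g1 z| + `|h1 z|) ->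
    J (fun z => box n z * `|f1 z|) <= J (fun z => box n z * `|g1 z|) + J (fun z => box n z * `|h1 z|).
  move=> n0 b1 b2 b3 l1; have jg := bm_box n0 b2; have jh := bm_box n0 b3.
  rewrite -(JD jg jh); apply: (J_le (bm_box n0 b1) (IgD jg jh)) => z.
  by rewrite -mulrDr; apply: ler_wpM2l => //; exact: box_ge0.
apply: lerD; first exact: A.
exact: (A _ (f \o Y) (g \o Y) (h \o Y) n20 (bm_comp bf) (bm_comp bg) (bm_comp bh) (fun z => l (Y z))).
Qed.

Lemma bm0 : bm (fun _ => 0).
Proof. by split; [exact: measurable_cst|exists 0 => z; rewrite normr0]. Qed.

Lemma dist0 : dist (fun _ => 0) = 0.
Proof.
have z n : J (fun z : C => box n z * `|0 : R|) = 0.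
  by rewrite -[RHS](@J0 R); apply: eq_J => z; rewrite normr0 mulr0.
by rewrite /dist !z addr0.
Qed.

Lemma distZ (k : R) f : bm f -> dist (fun z => k * f z) = `|k| * dist f.
Proof.
move=> bf; rewrite /dist mulrDr; congr (_ + _).
  by rewrite -(JZ _ (bm_box n10 bf)); apply: eq_J => z; rewrite normrM mulrCA.
by rewrite -(JZ _ (bm_box n20 (bm_comp bf))); apply: eq_J => z; rewrite normrM mulrCA.
Qed.

Lemma dist_dct (f : nat -> C -> R) (B : R) : (forall m, measurable_fun setT (f m)) -> (forall m z, `|f m z| <= B) ->
  (forall z, f ^~ z @ \oo --> 0) -> forall e, 0 < e -> exists m, dist (f m) <= e.
Proof.
move=> mf fB f0 e e0; have e2 : 0 < e / 2 by rewrite divr_gt0.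
have B0 : 0 <= B := le_trans (normr_ge0 _) (fB 0 0).
have A n (g : nat -> C -> R) : 0 < n -> (forall m, measurable_fun setT (g m)) -> (forall m z, `|g m z| <= B) ->
    (forall z, g ^~ z @ \oo --> 0) -> \forall m \near \oo, J (fun z => box n z * `|g m z|) <= e / 2.
  move=> n0 mg gB g0; have [jb _] := Ig_box (ltW n0).
  have := @J_dct (fun m z => box n z * g m z) (fun z => B * box n z) _ (IgZ B jb).
  move=> H; have {H} : (fun m => J (fun z => `|box n z * g m z|)) @ \oo --> 0.
    apply: H => [m|m z|z].
    - by apply: measurable_funM => //; exact: measurable_box.
    - rewrite normrM ger0_norm ?box_ge0// mulrC; apply: ler_wpM2r => //; exact: box_ge0.
    - by rewrite -(mulr0 (box n z)); apply: cvgM; [exact: cvg_cst|exact: g0].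
  move=> /cvgrPdist_le /(_ _ e2); apply: filterS => m; rewrite sub0r normrN => /(le_trans (ler_norm _)).
  apply: le_trans; rewrite le_eqVlt; apply/orP; left; apply/eqP; apply: eq_J => z.
  by rewrite normrM ger0_norm ?box_ge0.
have h1 := A n1 f n10 mf fB f0.
have h2 := A n2 (fun m z => f m (Y z)) n20 (fun m => measurableT_comp (mf m) measurable_cont2) (fun m z => fB m (Y z))
   (fun z => f0 (Y z)).
have [m _ hm] := filterI h1 h2; exists m; have [a b] := hm m (leqnn m).
by rewrite /dist; move: a b; move: (J _) (J _) => a b; lra.
Qed.

(** The bounded functions approximable by [BL] ones in [dist]: an algebra closed under bounded
    pointwise limits, to which a monotone class argument applies. *)
Definition W f := bm f /\ forall e, 0 < e -> exists2 h, BL h & dist (fun z => h z - f z) <= e.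

Lemma BL_bm h : BL h -> bm h.
Proof. by move=> bh; split; [exact: BL_measurable|case: bh => B _ [h1 _]; exists B]. Qed.

Lemma bmD f g : bm f -> bm g -> bm (fun z => f z + g z).
Proof.
move=> [mf [B fB]] [mg [D gD]]; split; first exact: measurable_funD.
by exists (B + D) => z; apply: (le_trans (ler_normD _ _)); exact: lerD.
Qed.

Lemma bmM f g : bm f -> bm g -> bm (fun z => f z * g z).
Proof.
move=> [mf [B fB]] [mg [D gD]]; split; first exact: measurable_funM.
by exists (B * D) => z; rewrite normrM; exact: ler_pM.
Qed.

Lemma bmZ (k : R) f : bm f -> bm (fun z => k * f z).
Proof.
move=> bf; apply: (bmM _ bf); split; first exact: measurable_cst.
by exists `|k| => z.
Qed.

Lemma bmB f g : bm f -> bm g -> bm (fun z => f z - g z).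
Proof.
move=> bf bg; have := bmD bf (bmZ (-1) bg); congr bm.
by apply/funext => z; rewrite mulN1r.
Qed.

Lemma W_BL h : BL h -> W h.
Proof.
move=> bh; split; first exact: BL_bm.
move=> e e0; exists h => //; rewrite (_ : (fun z => _) = (fun _ => 0)) ?dist0 ?ltW//.
by apply/funext => z; rewrite subrr.
Qed.

Lemma W_D f g : W f -> W g -> W (fun z => f z + g z).
Proof.
move=> [bf wf] [bg wg]; split; first exact: bmD.
move=> e e0; have e2 : 0 < e / 2 by rewrite divr_gt0.
have [h1 bh1 d1] := wf _ e2; have [h2 bh2 d2] := wg _ e2.
exists (fun z => h1 z + h2 z); first exact: BL_D.
rewrite (splitr e); apply: le_trans (lerD d1 d2); apply: dist_le.
- by apply: bmB; [apply: BL_bm; exact: BL_D|exact: bmD].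
- by apply: bmB => //; exact: BL_bm.
- by apply: bmB => //; exact: BL_bm.
- by move=> z; rewrite opprD addrACA ler_normD.
Qed.

Lemma W_M f g : W f -> W g -> W (fun z => f z * g z).
Proof.
move=> [bf wf] [bg wg]; split; first exact: bmM.
move=> e e0; have e2 : 0 < e / 2 by rewrite divr_gt0.
have [_ [D gD]] := bg; have D0 : 0 <= D := le_trans (normr_ge0 _) (gD 0).
have D1 : 0 < D + 1 by rewrite ltr_wpDl.
have [h1 bh1 d1] := wf (e / 2 / (D + 1)) ltac:(by rewrite divr_gt0).
have [B B0 [h1B _]] := bh1; have B1 : 0 < B + 1 by rewrite ltr_wpDl.
have [h2 bh2 d2] := wg (e / 2 / (B + 1)) ltac:(by rewrite divr_gt0).
exists (fun z => h1 z * h2 z); first exact: BL_M.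
have b1 : bm (fun z => h1 z - f z) by apply: bmB => //; exact: BL_bm.
have b2 : bm (fun z => h2 z - g z) by apply: bmB => //; exact: BL_bm.
have k1 : (D + 1) * dist (fun z => h1 z - f z) <= e / 2 by rewrite mulrC -ler_pdivlMr.
have k2 : (B + 1) * dist (fun z => h2 z - g z) <= e / 2 by rewrite mulrC -ler_pdivlMr.
rewrite -[D + 1]gtr0_norm// -(distZ _ b1) in k1; rewrite -[B + 1]gtr0_norm// -(distZ _ b2) in k2.
rewrite (splitr e); apply: le_trans (lerD k1 k2); apply: dist_le; try exact: bmZ.
  by apply: bmB; [apply: BL_bm; exact: BL_M|exact: bmM].
move=> z; have -> : h1 z * h2 z - f z * g z = (h1 z - f z) * g z + h1 z * (h2 z - g z) by ring.
apply: (le_trans (ler_normD _ _)); rewrite !normrM (gtr0_norm D1) (gtr0_norm B1) [_ * `|g z|]mulrC.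
apply: lerD; apply: ler_wpM2r => //.
  by apply: (le_trans (gD z)); rewrite lerDl.
by apply: (le_trans (h1B z)); rewrite lerDl.
Qed.

Lemma W_cst (k : R) : W (fun _ => k).
Proof. by apply: W_BL; exact: BL_cst. Qed.

Lemma W_Z (k : R) f : W f -> W (fun z => k * f z).
Proof. by apply: W_M; exact: W_cst. Qed.

Lemma W_lim (f : nat -> C -> R) g (B : R) : (forall m, W (f m)) -> measurable_fun setT g -> (forall m z, `|f m z| <= B) ->
  (forall z, f ^~ z @ \oo --> g z) -> W g.
Proof.
move=> wf mg fB fg.
have gB z : `|g z| <= B.
  have H : (fun m => `|f m z|) @ \oo --> `|g z| by apply: cvg_norm; exact: fg.
  rewrite -(cvg_lim _ H)//; apply: limr_le; first by apply/cvg_ex; eexists; exact: H.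
  by apply: nearW => m; exact: fB.
have bg : bm g by split => //; exists B.
split=> // e e0; have e2 : 0 < e / 2 by rewrite divr_gt0.
have [|m z|z|m hm] := @dist_dct (fun m z => f m z - g z) (B + B) _ _ _ _ e2.
- by move=> m; apply: measurable_funB => //; case: (wf m) => -[].
- by apply: (le_trans (ler_normB _ _)); exact: lerD.
- by rewrite -(subrr (g z)); apply: cvgB; [exact: fg|exact: cvg_cst].
have [bf wfm] := wf m; have [h bh dh] := wfm _ e2; exists h => //.
have bh' := BL_bm bh.
rewrite (splitr e); apply: le_trans (lerD dh hm); apply: dist_le; try exact: bmB.
by move=> z; have := ler_normD (h z - f m z) (f m z - g z); rewrite addrA subrK.
Qed.

Let ind (A : set C) : C -> R := \1_A.

Let ind_le A z : `|ind A z| <= 1.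
Proof. by rewrite /ind indicE; case: (_ \in _); rewrite ?normr1 ?normr0. Qed.

Let indC A : ind (~` A) = (fun z => 1 - ind A z).
Proof. by apply/funext => z; rewrite /ind !indicE in_setC; case: (z \in A); rewrite ?subrr ?subr0. Qed.

Lemma W_setC A : W (ind A) -> W (ind (~` A)).
Proof.
move=> wA; rewrite indC; have := W_D (W_cst 1) (W_Z (-1) wA); congr W.
by apply/funext => z; rewrite mulN1r.
Qed.

(** Finite intersections are products of indicators; the algebra property thus replaces a pi-system
    argument. *)
Lemma W_bigcap (A : (set C)^nat) : (forall m, W (ind (A m))) -> measurable (\bigcap_k A k) -> W (ind (\bigcap_k A k)).
Proof.
move=> wA mA; pose f m z := \prod_(i < m) ind (A i) z.
apply: (@W_lim f _ 1).
- elim=> [|m IH].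
    by have := W_cst 1; congr W; apply/funext => z; rewrite /f big_ord0.
  by have := W_M IH (wA m); congr W; apply/funext => z; rewrite /f big_ord_recr.
- exact: measurable_indic.
- move=> m z; rewrite /f; elim: m => [|m IH]; first by rewrite big_ord0 normr1.
  by rewrite big_ord_recr/= normrM mulr_ile1//; exact: ind_le.
move=> z; have [h|h] := pselect ((\bigcap_k A k) z).
  have -> : f ^~ z = cst 1.
    apply/funext => m; rewrite /f big1// => i _; rewrite /ind indicE mem_set//; exact: h.
  by rewrite /ind indicE mem_set//; exact: cvg_cst.
have [k hk] : exists k, ~ A k z by apply/existsNP => hh; apply: h => k _; exact: hh.
rewrite /ind indicE memNset//=; apply: cvg_near_cst; exists k.+1 => // m /= km.
apply/eqP/prodf_eq0; exists (Ordinal km) => //; by rewrite /ind indicE memNset.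
Qed.

Let clampP (a : R) : exists f : nat -> R -> R, [/\ forall m, exists2 c : R, 0 <= c & forall x y, `|f m x - f m y| <= c * `|x - y|,
  forall m x, `|f m x| <= 1 & forall x : R, f ^~ x @ \oo --> ((a < x)%R%:R : R)].
Proof.
pose f (m : nat) (x : R) : R := clamp (m%:R * (x - a)).
exists f; split=> [m|m x|x].
- exists m%:R => // x y; apply: (le_trans (clamp_lip _ _)); rewrite -mulrBr normrM ger0_norm//.
  by rewrite opprB addrA subrK.
- by have /andP[h1 h2] := clamp01 (m%:R * (x - a)); rewrite ger0_norm.
have [xa|xa] := leP x a.
  apply: cvg_near_cst; apply: nearW => m; rewrite /f /clamp max_l; first by rewrite min_r.
  by rewrite mulr_ge0_le0// subr_le0.
apply: cvg_near_cst; exists (Num.truncn (x - a)^-1).+1 => // m /= km.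
rewrite /f /clamp min_l//; rewrite le_max; apply/orP; right; rewrite -ler_pdivrMr ?subr_gt0// div1r.
by apply: ltW; apply: (lt_le_trans (truncnS_gt _)); rewrite ler_nat.
Qed.

Lemma W_ray (k : C -> R) (a : R) : Lip k -> measurable_fun setT k -> W (fun z => (a < k z)%R%:R).
Proof.
move=> [c c0 kc] mk; have [f [fl fb fc]] := clampP a.
apply: (@W_lim (fun m z => f m (k z)) _ 1) => // [m|].
  apply: W_BL; have [d d0 hd] := fl m; exists (1 + d * c); first by rewrite addr_ge0// mulr_ge0.
  split=> [z|z z']; first by apply: (le_trans (fb m _)); rewrite lerDl mulr_ge0.
  apply: (le_trans (hd _ _)); apply: (@le_trans _ _ (d * c * `|z - z'|)).
    by rewrite -mulrA; apply: ler_wpM2l.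
  by apply: ler_wpM2r => //; rewrite lerDr.
have := @measurable_lt1 R _ C (fun z => 1 + a - k z) (measurable_funB (measurable_cst _) mk).
congr (measurable_fun _ _); apply/funext => z; congr (nat_of_bool _)%:R; apply/idP/idP; lra.
Qed.

Lemma W_preimage (k : C -> R) : Lip k -> measurable_fun setT k -> forall A : set R, measurable A -> W (ind (k @^-1` A)).
Proof.
move=> lk mk A mA.
have mp (B : set R) : measurable B -> measurable (k @^-1` B).
  by move=> mB; rewrite -[X in measurable X]setTI; exact: mk.
suff : [set B : set R | measurable B /\ W (ind (k @^-1` B))] A by case.
move: A mA; apply: smallest_sub.
  split=> [|B [mB wB]|B hB].
  - split; first exact: measurable0.
    by have := W_cst 0; congr W; apply/funext => z; rewrite /ind preimage_set0 indic0.
  - rewrite setTD; split; first exact: measurableC.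
    by rewrite preimage_setC; exact: W_setC.
  - split; first by apply: bigcup_measurable => i _; case: (hB i).
    rewrite preimage_bigcup -[X in ind X]setCK setC_bigcup; apply: W_setC; apply: W_bigcap.
      by move=> m; apply: W_setC; case: (hB m).
    by apply: bigcap_measurable => // i _; apply: measurableC; apply: mp; case: (hB i).
move=> _ [[a b] _ <-] /=; split; first exact: measurable_itv.
have wa := W_ray a lk mk; have wb := W_ray b lk mk.
have := W_M wa (W_D (W_cst 1) (W_Z (-1) wb)); congr W; apply/funext => z.
rewrite /ind indicE mulN1r; have -> : (z \in k @^-1` `]a, b]%classic) = (a < k z) && ~~ (b < k z).
  by apply/idP/idP => [/set_mem|h]; [|apply/mem_set]; rewrite /= in_itv/= leNgt.
by case: (a < k z); case: (b < k z); rewrite ?mul0r ?mul1r ?subrr ?subr0.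
Qed.

Lemma W_measurable (A : set C) : measurable A -> W (ind A).
Proof.
move=> mA; suff : [set B : set C | measurable B /\ W (ind B)] A by case.
move: A mA; apply: smallest_sub.
  split=> [|B [mB wB]|B hB].
  - split; first exact: measurable0.
    by have := W_cst 0; congr W; apply/funext => z; rewrite /ind indic0.
  - by rewrite setTD; split; [exact: measurableC|exact: W_setC].
  - split; first by apply: bigcup_measurable => i _; case: (hB i).
    rewrite -[X in ind X]setCK setC_bigcup; apply: W_setC; apply: W_bigcap.
      by move=> m; apply: W_setC; case: (hB m).
    by apply: bigcap_measurable => // i _; apply: measurableC; case: (hB i).
move=> B [] [D mD <-]; rewrite setTI; split.
- by rewrite -[X in measurable X]setTI; exact: measurable_fst.
- exact: (W_preimage Lip_fst measurable_fst mD).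
- by rewrite -[X in measurable X]setTI; exact: measurable_snd.
- exact: (W_preimage Lip_snd measurable_snd mD).
Qed.

Lemma W_fun (f : C -> R) : measurable_fun setT f -> (forall z, 0 <= f z <= 1) -> W f.
Proof.
move=> mf f01.
(* Layer-cake sums over the superlevel sets of f at the levels i / (m + 1). *)
pose g (m : nat) z : R := m.+1%:R^-1 * \sum_(i < m.+1) (i%:R < m.+1%:R * f z)%R%:R.
have gE m z : `|g m z - f z| <= m.+1%:R^-1.
  have m0 : 0 < m.+1%:R :> R by rewrite ltr0n.
  have /andP[f0 f1] := f01 z; set y := m.+1%:R * f z.
  have y0 : 0 <= y by rewrite mulr_ge0.
  have y1 : y <= m.+1%:R by rewrite -[leRHS]mulr1 ler_pM2l.
  (* For y <= n the number of i < n with i < y lies between y and y + 1; the other two bounds feed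
     the induction. *)
  have S n : (\sum_(i < n) (i%:R < y)%R%:R : R) <= y + 1 /\ (y <= n%:R -> y <= \sum_(i < n) (i%:R < y)%R%:R) /\
     \sum_(i < n) (i%:R < y)%R%:R <= n%:R :> R /\ (n%:R <= y -> n%:R <= \sum_(i < n) (i%:R < y)%R%:R :> R).
    elim: n => [|n [h1 [h2 [h3 h4]]]]; first by rewrite big_ord0; split; [lra|split => //].
    rewrite big_ord_recr/= -natr1; case: (ltP n%:R y) => hn.
      by have := h4 (ltW hn); rewrite /=; split; [lra|split; [lra|split; lra]].
    by have := h2 hn; rewrite /=; split; [lra|split; [lra|split; lra]].
  have [h1 [h2 _]] := S m.+1; have {}h2 := h2 y1.
  have -> : g m z - f z = m.+1%:R^-1 * (\sum_(i < m.+1) (i%:R < y)%R%:R - y).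
    by rewrite mulrBr /y mulrA mulVf ?mul1r// gt_eqF.
  have i0 : 0 <= m.+1%:R^-1 :> R by rewrite invr_ge0 ltW.
  rewrite normrM (ger0_norm i0); apply: ler_piMr => //.
  by rewrite ler_norml; lra.
have mg i m : measurable [set z | (i%:R < m.+1%:R * f z :> R)].
  have -> : [set z | (i%:R < m.+1%:R * f z :> R)] = (fun z => m.+1%:R * f z) @^-1` [set u | i%:R < u] by [].
  rewrite -[X in measurable X]setTI; apply: (measurable_funM (measurable_cst _) mf) => //.
  by apply: open_measurable; exact: open_gt.
apply: (@W_lim g _ 2) => // [m|m z|z].
- have wS n : W (fun z => \sum_(i < n) (i%:R < m.+1%:R * f z)%R%:R).
    elim: n => [|n IH]; first by have := W_cst 0; congr W; apply/funext => z; rewrite big_ord0.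
    have := W_D IH (W_measurable (mg n m)); congr W; apply/funext => z; rewrite big_ord_recr/=.
    congr (_ + _); rewrite /ind indicE; congr (nat_of_bool _)%:R.
    by apply/idP/idP => [/set_mem//|h]; exact/mem_set.
  exact: W_Z (wS m.+1).
- have /andP[f0 f1] := f01 z; have := gE m z; have : m.+1%:R^-1 <= 1 :> R by rewrite invf_le1 ?ler1n// ltr0n.
  move=> h1 h2; have h3 := le_trans h2 h1.
  by have := ler_normD (g m z - f z) (f z); rewrite subrK (ger0_norm f0); move: (`|g m z - f z|) (`|g m z|) (f z) h3 f1 => p q x h3 f1; lra.
apply/cvgrPdist_le => /= e e0; exists (Num.truncn e^-1) => // m /= em; rewrite distrC.
apply: (le_trans (gE m z)); rewrite -[e]invrK lef_pV2 ?posrE ?invr_gt0 ?ltr0n//.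
by apply: ltW; apply: (lt_le_trans (truncnS_gt _)); rewrite ler_nat ltnS.
Qed.

End Approximation.

(** * Passage to the limit *)

Section Limit.
Context {R : realType}.
Local Notation C := (R * R)%type.
Implicit Types (f g h : C -> R) (z w : C).

Variables (c d M A1 t : R) (omk : nat -> R -> C -> R) (Xk Xik : nat -> R -> C -> C) (qk Lk : nat -> R) (Y : C -> C).
Hypothesis tfk : forall k, tameflow c d M (omk k) (Xk k) (Xik k) t (qk k) (Lk k).
Hypothesis A1k : forall k u, 0 <= u <= t -> J (fun w => `|omk k u w|) <= A1.
Hypotheses (t0 : 0 <= t) (A10 : 0 <= A1) (cY : continuous Y).
Hypothesis ZY : forall r e : R, 0 < r -> 0 < e ->
  \forall k \near \oo, forall z, `|z| <= r -> `|Xik k t z - Y z| <= e.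

Let Z k z := Xik k t z.
Let D := (16 * M + A1) * t + 1.
Let M0 : 0 < M := fl_M (tf_flow (tfk 0)).
Let tt : 0 <= t <= t. Proof. by rewrite t0 lexx. Qed.
Let t00 : 0 <= (0 : R) <= t. Proof. by rewrite lexx. Qed.
Let D0 : 0 <= D.
Proof. by rewrite addr_ge0// mulr_ge0// addr_ge0// mulr_ge0// ltW. Qed.

(** [kap_bound] with r = 1 bounds the speed by 16 M + A1, uniformly in k, unlike [tf_speed], which
    involves the support radius. *)
Let Zdist k z : `|Z k z - z| <= D.
Proof.
have fl := tf_flow (tfk k).
have sp u w : 0 <= u <= t -> `|vel c d (omk k u) w| <= 16 * M + A1 /\ `|vel d (- c) (omk k u) w| <= 16 * M + A1.
  move=> hu; have [jo _ _] := tf_J_sqr (tfk k) hu.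
  have B (a b : R) : a ^+ 2 + b ^+ 2 = 1 -> `|vel a b (omk k u) w| <= 16 * M + A1.
    move=> ab; have [a1 b1] := ab_le1 ab.
    apply: (le_trans (kap_bound w a1 b1 jo (fl_om fl u) ltr01)).
    by rewrite mulr1 divr1 lerD2l; exact: A1k.
  by split; apply: B; [exact: fl_cd fl|exact: fl_dc fl].
have := displacement fl (a := 0) (b := t) (x := Z k z) (fun v hv => sp v _ hv) t00 tt.
rewrite (tf_X0 (tfk k)) (fl_XXi fl) sub0r normrN (ger0_norm t0) => H.
by apply: (le_trans H); rewrite lerDl.
Qed.

Let Ydist z : `|Y z - z| <= D + 1.
Proof.
have [k _ hk] := ZY (ltr_pwDl ltr01 (normr_ge0 z)) (@ltr01 R).
have := hk k (leqnn k) z; rewrite lerDr => /(_ ler01) H.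
have -> : Y z - z = (Y z - Z k z) + (Z k z - z) by rewrite addrA subrK.
apply: (le_trans (ler_normD _ _)); rewrite addrC; apply: lerD; first exact: Zdist.
by rewrite distrC.
Qed.

Let mY : measurable_fun setT Y := measurable_cont2 cY.

Let transport k h (Lh q : R) : 0 <= Lh -> 0 < q -> (forall z, 0 <= h z <= 1) ->
  (forall z z', `|h z - h z'| <= Lh * `|z - z'|) -> supp q h ->
  Ig (fun z => h (Z k z)) /\ J (trsp (Xik k) h 0) = J h.
Proof.
move=> Lh0 q0 h01 hL hs; split.
  have hB z : `|h z| <= 1 by have /andP[a b] := h01 z; rewrite ger0_norm.
  exact: (trsp_Ig (tfk k) Lh0 q0 hB hL hs t0 tt).
apply: eq_J => z; rewrite /trsp; congr h.
by rewrite -{1}(tf_X0 (tfk k) z) (fl_XiX (tf_flow (tfk k))).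
Qed.

Let BL_clamp h : BL h -> BL (fun z => clamp (h z)).
Proof.
move=> [k k0 [_ hk]]; exists (1 + k); first exact: addr_ge0.
split=> [z|z z']; first by have /andP[a b] := clamp01 (h z); rewrite ger0_norm//; apply: (le_trans b); rewrite lerDl.
by apply: (le_trans (clamp_lip _ _)); apply: (le_trans (hk _ _)); rewrite ler_wpM2r// lerDr.
Qed.

Let cut (n : R) z := clamp (n - `|z|).
Let BL_cut n : BL (cut n).
Proof.
exists 1 => //; split=> [z|z z'].
  by have /andP[a b] := clamp01 (n - `|z|); rewrite ger0_norm.
rewrite mul1r; apply: (le_trans (clamp_lip _ _)).
have -> : n - `|z| - (n - `|z'|) = `|z'| - `|z| by ring.
by rewrite distrC; exact: ler_dist_dist.
Qed.

(** The transported estimate needs a Lipschitz density. Closeness of h to f for Lebesgue measure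
    keeps the mass of h small, closeness for the image under Y brings the conclusion back to f, and
    in between locally uniform convergence exchanges Z k and Y. *)
Lemma limit_abs_continuous e : 0 < e -> exists2 dl, 0 < dl & forall n f, 0 < n -> measurable_fun setT f ->
  (forall z, 0 <= f z <= 1) -> Ig f -> J f <= dl -> J (fun z => box n z * f (Y z)) <= e.
Proof.
move=> e0; have e4 : 0 < e / 4 by rewrite divr_gt0.
have [dl dl0 H] := small_transport t M0 A10 e4.
exists (dl / 2); first by rewrite divr_gt0.
move=> n f n0 mf f01 jf Jf.
(* n3 bounds |Y z| on the square of radius n, and the cut-off at n1 equals 1 up to radius n3 = n1 -
   1. *)
pose n3 := n + D + 1; pose n1 := n3 + 1.
have n10 : 0 < n1 by rewrite /n1 /n3; have := D0; lra.
have [bf wf] := W_fun cY n10 n0 mf f01.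
have [h bh dh] := wf (Num.min (dl / 2) (e / 4)) ltac:(by rewrite lt_min divr_gt0).
have [dh1 dh2] : dist Y n1 n (fun z => h z - f z) <= dl / 2 /\ dist Y n1 n (fun z => h z - f z) <= e / 4.
  by move: dh; rewrite le_min => /andP.
have bhf := bmB (BL_bm bh) bf.
pose B1 := J (fun z => box n1 z * `|h z - f z|); pose B2 := J (fun z => box n z * `|h (Y z) - f (Y z)|).
have pos (k : R) (g : C -> R) : 0 <= J (fun z => box k z * `|g z|).
  by apply: J_ge0 => z; apply: mulr_ge0 => //; exact: box_ge0.
have B12 : B1 + B2 = dist Y n1 n (fun z => h z - f z) by [].
have B10 : 0 <= B1 := pos n1 (fun z => h z - f z); have B20 : 0 <= B2 := pos n (fun z => h (Y z) - f (Y z)).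
pose h' z := cut n1 z * clamp (h z).
have bh' : BL h' by apply: BL_M; [exact: BL_cut|exact: BL_clamp].
have h'01 z : 0 <= h' z <= 1.
  have /andP[a1 a2] := clamp01 (n1 - `|z|); have /andP[b1 b2] := clamp01 (h z).
  by rewrite /h' mulr_ge0//= mulr_ile1.
have sh' : supp n1 h'.
  move=> z hz; have q : n1 - `|z| <= 0 by rewrite subr_le0 ltW.
  by rewrite /h' /cut /clamp (max_l q) (min_r ler01) mul0r.
have [Lh Lh0 [_ h'L]] := bh'.
have jh' := Ig_BLbox (ltW n10) bh' sh'.
have cf z : `|clamp (h z) - f z| <= `|h z - f z| by rewrite -{1}(clamp_id (f01 z)); exact: clamp_lip.
have j1 := bm_box n10 bhf.
have Jh' : J h' <= dl.
  apply: (@le_trans _ _ (B1 + J f)).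
    rewrite -(JD j1 jf); apply: (J_le jh' (IgD j1 jf)) => z.
    have /andP[a1 a2] := clamp01 (n1 - `|z|); have /andP[b1 b2] := clamp01 (h z); have /andP[f0 f1] := f01 z.
    rewrite /box; case: (leP `|z| n1) => hz; last by rewrite sh'// mul0r add0r.
    rewrite mul1r; apply: (@le_trans _ _ (clamp (h z))); first by rewrite /h' ler_piMl.
    by have := ler_norm (clamp (h z) - f z); have := cf z; lra.
  by lra.
have Hk k : J (fun z => h' (Z k z)) <= e / 4.
  have [_ E0] := transport k Lh0 n10 h'01 h'L sh'.
  apply: (H c d (omk k) (Xk k) (Xik k) t (qk k) (Lk k) h' Lh n1 (tfk k) (A1k k) Lh0 n10 h'01 h'L sh' t t0 (lexx t) (lexx t)).
  by rewrite E0.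
pose r := e / 4 / (Lh * (4 * n ^+ 2) + 1).
have Ln0 : 0 <= Lh * (4 * n ^+ 2) by rewrite mulr_ge0// mulr_ge0// exprn_ge0// ltW.
have r0 : 0 < r by rewrite divr_gt0// ltr_wpDl.
have rL : Lh * r * (4 * n ^+ 2) <= e / 4.
  have -> : Lh * r * (4 * n ^+ 2) = Lh * (4 * n ^+ 2) * r by ring.
  have : (Lh * (4 * n ^+ 2) + 1) * r = e / 4 by rewrite mulrC divfK// gt_eqF// ltr_wpDl.
  by move=> <-; rewrite ler_wpM2r ?lerDl// ltW.
have [k _ hk] := ZY n0 r0; have {}hk := hk k (leqnn k).
have [jZ _] := transport k Lh0 n10 h'01 h'L sh'.
have [jb Jb] := Ig_box (ltW n0).
have bfY := bm_box n0 (bm_comp cY bhf).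
have jfY : Ig (fun z => box n z * f (Y z)).
  apply: eq_Ig (bm_box n0 (bm_comp cY bf)) => z /=; rewrite ger0_norm//.
  by have /andP[] := f01 (Y z).
have jR := IgD (IgD jZ (IgZ (Lh * r) jb)) bfY.
apply: (@le_trans _ _ (J (fun z => h' (Z k z)) + Lh * r * J (box n) + B2)); last first.
  by rewrite Jb; have := Hk k; lra.
rewrite -(JZ (Lh * r) jb) -(JD jZ (IgZ (Lh * r) jb)) -(JD (IgD jZ (IgZ (Lh * r) jb)) bfY).
apply: (J_le jfY jR) => z /=; rewrite /box; have /andP[h0 h1] := h'01 (Z k z).
case: (leP `|z| n) => hz; last by rewrite !mul0r mulr0 !addr0.
rewrite !mul1r mulr1.
have e1 : f (Y z) <= h' (Y z) + `|h (Y z) - f (Y z)|.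
  rewrite /h' /cut (_ : clamp (n1 - _) = 1).
    by rewrite mul1r; have := ler_norm (f (Y z) - clamp (h (Y z))); rewrite distrC; have := cf (Y z); lra.
  have YY : `|Y z| <= n3.
    have := ler_normD (Y z - z) z; rewrite subrK => Q; apply: (le_trans Q).
    by have := Ydist z; rewrite /n3; lra.
  by rewrite /clamp min_l// le_max; apply/orP; right; rewrite /n1; lra.
have := le_trans (h'L (Y z) (Z k z)) (ler_wpM2l Lh0 (_ : _ <= r)).
rewrite distrC => /(_ (hk z hz)) => h2.
by have := ler_norm (h' (Y z) - h' (Z k z)); lra.
Qed.

Variables (w0 : C -> R) (r0 : R).
Hypotheses (mw : measurable_fun setT w0) (wM : forall z, `|w0 z| <= M) (r00 : 0 < r0) (sw : supp r0 w0).
Hypothesis w_lim : forall e, 0 < e -> \forall k \near \oo, J (fun z => `|omk k 0 z - w0 z|) <= e.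

Let jw : Ig w0. Proof. by have [] := supp_Ig r00 mw wM sw. Qed.
Let jo k u : 0 <= u <= t -> Ig (omk k u). Proof. by move=> hu; have [] := tf_J_sqr (tfk k) hu. Qed.

Lemma limit_supp (q : R) f : supp q f -> supp (q + D + 1) (fun z => f (Y z)).
Proof.
move=> sf z hz; apply: sf; have := ler_normD z (Y z - z); rewrite addrC subrK; have := Ydist z.
have := ler_normD (z - Y z) (Y z); rewrite subrK distrC; lra.
Qed.

Lemma Ig_limit : Ig (fun z => w0 (Y z)).
Proof.
have q0 : 0 < r0 + D + 1 by have := D0; have := r00; lra.
have [//] := supp_Ig q0 (measurableT_comp mw mY) (fun z => wM (Y z)) (limit_supp sw).
Qed.

Lemma vorticity_L1 e : 0 < e -> \forall k \near \oo, J (fun z => `|omk k t z - w0 (Y z)|) <= e.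
Proof.
move=> e0; have MM : 0 < 2 * M by have := M0; lra.
pose e1 := e / 3 / (2 * M).
have e10 : 0 < e1 by rewrite !divr_gt0.
have Me1 : 2 * M * e1 = e / 3 by rewrite /e1 mulrC divfK// gt_eqF.
have [dl dl0 HT] := small_transport t M0 A10 e10.
have [de de0 HA] := limit_abs_continuous e10.
have m0 : 0 < 2 * M * Num.min (dl / 2) de by rewrite mulr_gt0// lt_min de0 divr_gt0.
have [j _ hj] := w_lim m0.
have hj' k : (j <= k)%N -> J (fun z => `|omk k 0 z - w0 z|) <= 2 * M * (dl / 2) /\
    J (fun z => `|omk k 0 z - w0 z|) <= 2 * M * de.
  move=> /hj H; split; apply: (le_trans H); apply: (ler_wpM2l (ltW MM)); by rewrite ge_min lexx ?orbT.
(* An initial datum of the sequence itself is the Lipschitz approximation of w0. It is fixed before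
   k, so its Lipschitz constant affects only the accuracy r demanded of Z k - Y. Outside the square
   of radius n every term in ph or w0 vanishes. *)
pose ph := omk j 0; pose n := qk j + r0 + D + 1.
have qj := tf_q (tfk j); have n0 : 0 < n by rewrite /n; have := D0; have := r00; lra.
pose Lj := Lk j; have Lj0 : 0 <= Lj := tf_L (tfk j).
have phL z z' : `|ph z - ph z'| <= Lj * `|z - z'|.
  by have := tf_lip (tfk j) z z' t00 t00; rewrite subrr normr0 add0r.
have phM z : `|ph z| <= M := fl_om (tf_flow (tfk j)) 0 z.
have sph : supp (qk j) ph := tf_supp (tfk j) t00.
pose r := e / 3 / (Lj * (4 * n ^+ 2) + 1).
have Ln0 : 0 <= Lj * (4 * n ^+ 2) by rewrite mulr_ge0// mulr_ge0// exprn_ge0// ltW.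
have rr0 : 0 < r by rewrite !divr_gt0// ltr_wpDl.
have rL : Lj * r * (4 * n ^+ 2) <= e / 3.
  have -> : Lj * r * (4 * n ^+ 2) = Lj * (4 * n ^+ 2) * r by ring.
  have : (Lj * (4 * n ^+ 2) + 1) * r = e / 3 by rewrite mulrC divfK// gt_eqF// ltr_wpDl.
  by move=> <-; rewrite ler_wpM2r ?lerDl// ltW.
(* Both transport estimates take values in [0, 1], and the differences of data are at most 2 M. *)
pose f z := (2 * M)^-1 * `|ph z - w0 z|.
have i0 : 0 <= (2 * M)^-1 by rewrite invr_ge0 ltW.
have f01 z : 0 <= f z <= 1.
  rewrite /f mulr_ge0//= mulrC ler_pdivrMr// mul1r; apply: (le_trans (ler_normB _ _)).
  by have := phM z; have := wM z; lra.
have jd k : Ig (fun z => `|omk k 0 z - w0 z|) by apply: Ig_abs; exact: IgB (jo k t00) jw.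
have jf : Ig f by exact: IgZ (jd j).
have Jf : J f <= de.
  by rewrite (JZ _ (jd j)) mulrC ler_pdivrMr// mulrC; exact: (hj' j (leqnn j)).2.
have T3 := HA n f n0 (Ig_meas jf) f01 jf Jf.
near=> k.
have jk : (j <= k)%N by near: k; exists j.
have hk : forall z, `|z| <= n -> `|Z k z - Y z| <= r by near: k; exact: ZY.
have qk0 := tf_q (tfk k).
pose g z := (2 * M)^-1 * `|omk k 0 z - ph z|.
have gL z z' : `|g z - g z'| <= (2 * M)^-1 * (Lk k + Lj) * `|z - z'|.
  rewrite /g -mulrBr normrM (ger0_norm i0) -mulrA; apply: ler_wpM2l => //.
  apply: (le_trans (ler_dist_dist _ _)).
  have -> : omk k 0 z - ph z - (omk k 0 z' - ph z') = (omk k 0 z - omk k 0 z') - (ph z - ph z') by ring.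
  apply: (le_trans (ler_normB _ _)); rewrite mulrDl; apply: lerD (phL z z').
  by have := tf_lip (tfk k) z z' t00 t00; rewrite subrr normr0 add0r.
have g01 z : 0 <= g z <= 1.
  rewrite /g mulr_ge0//= mulrC ler_pdivrMr// mul1r; apply: (le_trans (ler_normB _ _)).
  by have := phM z; have := fl_om (tf_flow (tfk k)) 0 z; lra.
have gs : supp (qk k + qk j) g.
  move=> z hz; rewrite /g (tf_supp (tfk k) t00) ?(sph z) ?subrr ?normr0 ?mulr0//; move: hz; lra.
have gL0 : 0 <= (2 * M)^-1 * (Lk k + Lj) by rewrite mulr_ge0// addr_ge0// (tf_L (tfk k)).
have q2 : 0 < qk k + qk j by exact: addr_gt0.
have [jg E0] := transport k gL0 q2 g01 gL gs.
have Jg : J g <= dl.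
  have jkj := Ig_abs (IgB (jo k t00) (jo j t00)).
  rewrite (JZ _ jkj) mulrC ler_pdivrMr// mulrC.
  apply: (@le_trans _ _ (J (fun z => `|omk k 0 z - w0 z|) + J (fun z => `|ph z - w0 z|))).
    rewrite -(JD (jd k) (jd j)); apply: (J_le jkj (IgD (jd k) (jd j))) => z.
    have -> : omk k 0 z - omk j 0 z = (omk k 0 z - w0 z) - (ph z - w0 z) by rewrite /ph; ring.
    exact: ler_normB.
  have [h1 _] := hj' k jk; have [h2 _] := hj' j (leqnn j); have := lerD h1 h2.
  by move=> h; apply: (le_trans h); rewrite le_eqVlt; apply/orP; left; apply/eqP; field.
have T1 : J (fun z => g (Z k z)) <= e1.
  apply: (HT c d (omk k) (Xk k) (Xik k) t (qk k) (Lk k) g _ _ (tfk k) (A1k k) gL0 q2 g01 gL gs t t0 (lexx t) (lexx t)).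
  by rewrite E0.
have [jb Jb] := Ig_box (ltW n0).
have jfY : Ig (fun z => box n z * f (Y z)).
  have bf : bm f by split; [exact: Ig_meas jf|exists 1 => z; have /andP[a b] := f01 z; rewrite ger0_norm].
  apply: eq_Ig (bm_box n0 (bm_comp cY bf)) => z /=; rewrite ger0_norm//.
  by have /andP[] := f01 (Y z).
have jR := IgD (IgD (IgZ (2 * M) jg) (IgZ (Lj * r) jb)) (IgZ (2 * M) jfY).
have jL := Ig_abs (IgB (jo k tt) Ig_limit).
apply: (@le_trans _ _ (2 * M * J (fun z => g (Z k z)) + Lj * r * J (box n) + 2 * M * J (fun z => box n z * f (Y z)))); last first.
  rewrite Jb; have := ler_wpM2l (ltW MM) T1; have := ler_wpM2l (ltW MM) T3; rewrite Me1; lra.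
rewrite -(JZ (2 * M) jg) -(JZ (Lj * r) jb) -(JZ (2 * M) jfY) -(JD (IgZ (2 * M) jg) (IgZ (Lj * r) jb)).
rewrite -(JD (IgD (IgZ (2 * M) jg) (IgZ (Lj * r) jb)) (IgZ (2 * M) jfY)).
apply: (J_le jL jR) => z.
have om_t : omk k t z = omk k 0 (Z k z).
  by rewrite -(fl_tr (tf_flow (tfk k)) t (Z k z)) /Z (fl_XXi (tf_flow (tfk k))).
have gE w : 2 * M * g w = `|omk k 0 w - ph w| by rewrite /g mulVKf// gt_eqF.
have fE w : 2 * M * f w = `|ph w - w0 w| by rewrite /f mulVKf// gt_eqF.
rewrite gE [2 * M * (box n z * _)]mulrCA fE om_t.
have -> : omk k 0 (Z k z) - w0 (Y z) = (omk k 0 (Z k z) - ph (Z k z)) + ((ph (Z k z) - ph (Y z)) + (ph (Y z) - w0 (Y z))).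
  by ring.
apply: (le_trans (ler_normD _ _)); rewrite -[X in _ <= X]addrA lerD2l; apply: (le_trans (ler_normD _ _)).
rewrite /box; case: (leP `|z| n) => hz.
  rewrite mulr1 mul1r; apply: lerD => //; apply: (le_trans (phL _ _)); apply: ler_wpM2l => //; exact: hk.
rewrite mulr0 mul0r addr0.
have b1 : ph (Y z) = 0 by apply: (limit_supp sph); move: hz; rewrite /n; have := r00; lra.
have b2 : w0 (Y z) = 0 by apply: (limit_supp sw); move: hz; rewrite /n; lra.
have b3 : ph (Z k z) = 0.
  apply: sph; have := Zdist k z; have := ler_normB (Z k z) (Z k z - z); rewrite subKr; move: hz; rewrite /n; have := r00; lra.
by rewrite b1 b2 b3 !subrr normr0 addr0.
Unshelve. all: by end_near.
Qed.

Lemma velocity_sup (a b e : R) : a ^+ 2 + b ^+ 2 = 1 -> 0 < e ->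
  \forall k \near \oo, forall z, `|vel a b (omk k t) z - vel a b (fun z => w0 (Y z)) z| <= e.
Proof.
move=> ab e0; have [a1 b1] := ab_le1 ab; have MM := M0.
pose K := 16 * (M + M).
have K0 : 0 < K by rewrite /K; lra.
(* The near radius is fixed first, by the sup norm alone; the L^1 accuracy e r / 2 then controls the
   far part. *)
pose r := e / 2 / K; have r_0 : 0 < r by rewrite !divr_gt0.
have er : 0 < e / 2 * r by rewrite mulr_gt0// divr_gt0.
have := vorticity_L1 er; apply: filterS => k hk z.
have oM w : `|omk k t w| <= M := fl_om (tf_flow (tfk k)) t w.
rewrite -(velB z a1 b1 (jo k tt) Ig_limit oM (fun w => wM (Y w))).
have bd w : `|omk k t w - w0 (Y w)| <= M + M.
  by apply: (le_trans (ler_normB _ _)); apply: lerD.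
apply: (le_trans (kap_bound z a1 b1 (IgB (jo k tt) Ig_limit) bd r_0)).
have -> : 16 * (M + M) * r = e / 2 by rewrite -/K /r mulrC divfK// gt_eqF.
have : J (fun w => `|omk k t w - w0 (Y w)|) / r <= e / 2 by rewrite ler_pdivrMr.
lra.
Qed.

End Limit.

(** * The limit *)

Section Setting.
Context {R : realType}.
Local Notation C := (R * R)%type.
Local Notation V3 := (R * (R * R))%type.
Implicit Types (f g h : C -> R) (z w : C).

Lemma cnorm_ge z : `|z| <= cnorm z.
Proof.
by rewrite -[`|z|]ger0_norm// -sqrtr_sqr ler_wsqrtr//; exact: nq_ge.
Qed.

Lemma cnorm_le z : cnorm z <= 2 * `|z|.
Proof.
rewrite -[leRHS]ger0_norm ?mulr_ge0// -sqrtr_sqr ler_wsqrtr// exprMn.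
by apply: (le_trans (nq_le z)); apply: ler_wpM2r; [exact: exprn_ge0|lra].
Qed.

Lemma J_indic (A : set C) : measurable A -> (@leb2 R A < +oo)%E -> Ig (\1_A : C -> R) /\ (J (\1_A))%:E = @leb2 R A.
Proof.
move=> mA fA.
have E : (\int[@leb2 R]_z (\1_A z)%:E = @leb2 R A)%E by rewrite integral_indic// setIT.
have fA' : @leb2 R A \is a fin_num by rewrite ge0_fin_numE.
have [|||j _] := @ge0_Ig R (\1_A) (fine (@leb2 R A)).
- exact: measurable_indic.
- by move=> z; rewrite indicE.
- by rewrite E fineK.
by split => //; rewrite (JE j).
Qed.

Lemma measurable_box_at z0 (r : R) : measurable [set w : C | `|z0 - w| <= r].
Proof.
have := measurable_reflect z0 measurableT (measurable_box_set r).
by rewrite setTI.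
Qed.

(** The data are bounded in essential supremum, but transport along trajectories needs the bound at
    every point. A violation would persist on a small square, which has positive area. *)
Lemma cont_ae_le f (M : R) : continuous f -> {ae @leb2 R, forall z, `|f z| <= M} -> forall z, `|f z| <= M.
Proof.
move=> cf [N [mN N0 hN]] z0; rewrite leNgt; apply/negP => hz.
have e0 : 0 < `|f z0| - M by rewrite subr_gt0.
have [d /= d0 hd] := proj1 (nbhs_ballP _ _) (proj1 (cvgrPdist_lt _ _) (cf z0) _ e0).
have r0 : 0 < d / 2 by rewrite divr_gt0.
pose S := [set w : C | `|z0 - w| <= d / 2].
have SN : S `<=` N.
  move=> w Sw; apply: hN => /= fw; have := hd w; rewrite -ball_normE /ball_/= => H.
  have {}H := H (le_lt_trans Sw (ltac:(lra) : d / 2 < d)).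
  by have := lerB_dist (f z0) (f w); lra.
have mS : measurable S := measurable_box_at z0 (d / 2).
have S0 : @leb2 R S = 0%E by apply: measure_negligible => //; exists N.
have [_] := J_indic mS ltac:(by rewrite S0).
have [jb Jb] := Ig_box (ltW r0).
have -> : (\1_S : C -> R) = (fun w => box (d / 2) (z0 - w)).
  apply/funext => w; rewrite indicE /box; congr (nat_of_bool _)%:R.
  by apply/idP/idP => [/set_mem//|h]; exact/mem_set.
rewrite (J_reflect z0 (measurable_box (d / 2))) Jb S0 => -[] /eqP.
by rewrite gt_eqF// mulr_gt0// exprn_gt0.
Qed.

Lemma Kconv_vel (theta : R) f z : Kconv theta f z = (vel (cos theta) (sin theta) f z, vel (sin theta) (- cos theta) f z).
Proof.
rewrite /Kconv; congr (_, _).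
by apply: eq_J => w; rewrite /Kim /kap mulNr.
Qed.

(** The chain rule and the equation make om constant along trajectories, which carries the sup bound
    to all times. Compact support on [0, t] then turns local smoothness into a global Lipschitz
    constant. *)
Lemma setting_tame (theta t M r0 : R) (om : R -> C -> R) (X Xi : R -> C -> C) :
  0 <= t -> 0 < M -> 0 < r0 -> (forall z, `|om 0 z| <= M) -> supp r0 (om 0) ->
  smooth (fun p : V3 => om p.1 p.2) ->
  (forall (s : R) (z : R * R),
            derive (fun p : R * (R * R) => om p.1 p.2) (s, z) (1, (0, 0))
            + (Kconv theta (om s) z).1
                * derive (fun p : R * (R * R) => om p.1 p.2) (s, z) (0, (1, 0))
            + (Kconv theta (om s) z).2
                * derive (fun p : R * (R * R) => om p.1 p.2) (s, z) (0, (0, 1))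
            = 0) ->
  (forall (s : R) (z : R * R), derivable (fun u => X u z) s 1 /\
            derive (fun u => X u z) s 1 = Kconv theta (om s) (X s z)) ->
  (forall z, X 0 z = z) ->
  (forall (s : R) (z : R * R), Xi s (X s z) = z /\ X s (Xi s z) = z) ->
  exists q L, tameflow (cos theta) (sin theta) M om X Xi t q L.
Proof.
move=> t0 M0 r00 om0M om0s sF pde ode X0 inv; set F := (fun p : V3 => om p.1 p.2) in sF pde.
have dX s z := is_derive_pair (ode s z).1 (ode s z).2.
have tr s z : om s (X s z) = om 0 z.
  have dG (u : R) : is_derive u 1 (fun v => om v (X v z)) 0.
    have [d1 d2] := dX u z.
    have := smooth_chain sF d1 d2; have -> : (fun v => F (v, ((X v z).1, (X v z).2))) = (fun v => om v (X v z)).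
      by apply/funext => v; rewrite /F /= -surjective_pairing.
    move=> H; apply: (d1_eq H); rewrite -surjective_pairing; exact: pde.
  by rewrite (deriv0_const dG) X0.
have omM s z : `|om s z| <= M by rewrite -(inv s z).2 tr.
have com s : continuous (om s).
  move=> z; have [cF _] := sF [::].
  have c : (fun z : C => (s, z) : V3) @ z --> (s, z).
    exact: (@cvg_pair _ _ _ (nbhs z) (nbhs s) (nbhs z) _ _ _ (cst s) id (cvg_cst s) cvg_id).
  exact: (cvg_comp _ _ c (cF (s, z))).
have fl : flow (cos theta) (sin theta) M om X Xi.
  split=> //.
  - exact: cos2Dsin2.
  - by move=> s; exact: (continuous2_measurable (com s)).
  - by move=> s z; have [h _] := dX s z; move: h; rewrite Kconv_vel.
  - by move=> s z; have [_ h] := dX s z; move: h; rewrite Kconv_vel.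
  - by move=> s z; exact: (inv s z).1.
  - by move=> s z; exact: (inv s z).2.
have [q q0 hq] := flow_compact fl t r00 om0s.
(* The summand t puts the time coordinate in the box, and the margin 1 keeps points outside it at
   distance at least 1 from the support, where the sup bound M acts as a Lipschitz constant. *)
pose n := t + q + 1; have n0 : 0 <= n by rewrite /n; lra.
have [L L0 hL] := smooth_lip n0 sF.
exists q, (L + M); split => //; first by rewrite addr_ge0// ltW.
move=> u v z z' hu hv; have /andP[u0 ut] := hu; have /andP[v0 vt] := hv.
have a0 : 0 <= `|u - v| by []; have b0 : 0 <= `|z - z'| by [].
have s0 : 0 <= L * `|z - z'| + L * `|u - v| by rewrite addr_ge0// mulr_ge0.
have out w w' : n < `|w| -> `|om u w| = 0 /\ (`|w'| <= q -> 1 <= `|w - w'|).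
  move=> hw; split; first by rewrite (hq u hu) ?normr0//; move: hw; rewrite /n; lra.
  by move=> hw'; have := lerB_dist w w'; move: hw; rewrite /n; lra.
have inb w (x : R) : 0 <= x <= t -> `|w| <= n -> `|(x, w) : V3| <= n.
  by move=> /andP[x0 xt] wn; rewrite (surjective_pairing w) norm3_le ger0_norm//; move: wn; rewrite normC_le => /andP[-> ->]; rewrite /n; lra.
have far2 w w' (x y : R) : 0 <= x <= t -> 0 <= y <= t -> n < `|w| -> `|om x w - om y w'| <= M * `|w - w'|.
  move=> hx hy hw; rewrite (hq x hx w) ?sub0r ?normrN; last by move: hw; rewrite /n; lra.
  have [w'q|w'q] := leP `|w'| q; last by rewrite (hq y hy)// normr0 mulr_ge0// ltW.
  have : 1 <= `|w - w'| by have := lerB_dist w w'; move: hw; rewrite /n; lra.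
  by move=> h; apply: (le_trans (omM _ _)); rewrite ler_peMr// ltW.
have fin (e : R) : e <= M * `|z - z'| -> e <= (L + M) * (`|u - v| + `|z - z'|).
  move=> h; have := mulr_ge0 (ltW M0) a0; move: s0 h; lra.
have [zn|zn] := leP `|z| n; last by apply: fin; exact: far2.
have [z'n|z'n] := leP `|z'| n; last by apply: fin; rewrite distrC [`|z - z'|]distrC; exact: far2.
have := hL (u, z) (v, z') (inb z u hu zn) (inb z' v hv z'n).
move=> H; apply: (le_trans H); apply: ler_pM => //; first by rewrite lerDl ltW.
have -> : `|((u, z) : V3) - (v, z')| = Num.max `|u - v| `|z - z'| by [].
by rewrite ge_max lerDl lerDr a0 b0.
Qed.

Lemma ge0_cvg0E (u : nat -> \bar R) : (forall k, 0 <= u k)%E ->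
  (forall e : R, 0 < e -> \forall k \near \oo, (u k <= e%:E)%E) -> u @ \oo --> 0%E.
Proof.
move=> u0 ue; apply/fine_cvgP; split.
  have := ue _ (@ltr01 R); apply: filterS => k uk.
  by rewrite ge0_fin_numE// (le_lt_trans uk)// ltry.
apply/cvgrPdist_le => e e0; have := ue _ e0; apply: filterS => k uk.
rewrite /= sub0r normrN ger0_norm ?fine_ge0// -lee_fin fineK//.
by rewrite ge0_fin_numE// (le_lt_trans uk)// ltry.
Qed.

Lemma L1norm_J f : Ig f -> L1norm f = (J (fun z => `|f z|))%:E.
Proof. by move=> jf; rewrite /L1norm (JE (Ig_abs jf)). Qed.

Lemma ae_L1norm f g : measurable_fun setT f -> measurable_fun setT g ->
  {ae @leb2 R, forall z, f z = g z} -> L1norm f = L1norm g.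
Proof.
move=> mf mg fg; apply: ge0_ae_eq_integral => //; try by apply/measurable_EFinP; exact: measurableT_comp.
by have [N [mN N0 hN]] := fg; exists N; split => //; apply: subset_trans hN => z /= h fgz; apply: h => _; rewrite fgz.
Qed.

Lemma ae_J f g : measurable_fun setT f -> measurable_fun setT g ->
  {ae @leb2 R, forall z, f z = g z} -> J f = J g.
Proof.
move=> mf mg fg; rewrite /J /Rintegral; congr fine; apply: ae_eq_integral => //; try exact/measurable_EFinP.
by have [N [mN N0 hN]] := fg; exists N; split => //; apply: subset_trans hN => z /= h fgz; apply: h => _; rewrite /= fgz.
Qed.

End Setting.

Theorem theorem3 (R : realType) (theta : R)
  (om0 : R * R -> R)
  (om0e : R -> R * R -> R)
  (om : R -> R -> R * R -> R)
  (X Xinv : R -> R -> R * R -> R * R)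
  (t : R) (eps : nat -> R) (Y : R * R -> R * R) :
  (* theta in [0, 2 pi] *)
  0 <= theta <= 2 * pi ->
  (* omega_0 : real-valued, in L^infty, with compact support *)
  measurable_fun setT om0 ->
  (Linfnorm om0 < +oo)%E ->
  (exists r : R, {ae @leb2 R, forall z, r < cnorm z -> om0 z = 0}) ->
  (* the regularised initial data omega_0^e, e > 0 *)
  (forall e : R, 0 < e ->
     [/\ smooth (om0e e), compact_support (om0e e),
         (Linfnorm (om0e e) <= Linfnorm om0)%E &
         (L1norm (om0e e) <= L1norm om0)%E]) ->
  (fun e => L1norm (fun z => om0e e z - om0 z)) @ 0^'+ --> 0%E ->
  (* omega^e : smooth solution, v^e = K * omega^e, X^e its flow,
     Xinv e t = X^e(-t, .) the inverse map of X^e(t, .) *)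
  (forall e : R, 0 < e ->
     [/\ smooth (fun p : R * (R * R) => om e p.1 p.2) /\ om e 0 = om0e e,
         (forall (s : R) (z : R * R),
            derive (fun p : R * (R * R) => om e p.1 p.2) (s, z) (1, (0, 0))
            + (Kconv theta (om e s) z).1
                * derive (fun p : R * (R * R) => om e p.1 p.2) (s, z) (0, (1, 0))
            + (Kconv theta (om e s) z).2
                * derive (fun p : R * (R * R) => om e p.1 p.2) (s, z) (0, (0, 1))
            = 0),
         (forall (s : R) (z : R * R),
            derivable (fun u => X e u z) s 1 /\
            derive (fun u => X e u z) s 1 = Kconv theta (om e s) (X e s z)),
         (forall z, X e 0 z = z) &
         (forall (s : R) (z : R * R),
            Xinv e s (X e s z) = z /\ X e s (Xinv e s z) = z)]) ->
  (* t >= 0 and e_k -> 0 *)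
  0 <= t ->
  (forall k, 0 < eps k) ->
  eps @ \oo --> 0 ->
  (* X(-t, .) := Y is a quasiconformal homeomorphism, and
     X^{e_k}(-t, .) -> Y locally uniformly on C *)
  quasiconformal Y ->
  (forall r d : R, 0 < r -> 0 < d ->
     \forall k \near \oo, forall z : R * R, cnorm z <= r ->
       cnorm (Xinv (eps k) t z - Y z) <= d) ->
  (* (a) || omega^{e_k}(t) - omega(t) ||_1 -> 0, omega(t) = omega_0 o X(-t,.) *)
  (fun k => L1norm (fun z => om (eps k) t z - om0 (Y z))) @ \oo --> 0%E /\
  (* (b) || v^{e_k}(t) - v(t) ||_infty -> 0, v(t) = K * omega(t) *)
  (fun k => Linfnorm_vec
              (fun z => Kconv theta (om (eps k) t) z - Kconv theta (om0 \o Y) z))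
    @ \oo --> 0%E.
Proof.
move=> _ mom0 Linf0 [r1 hr1] reg regL1 dyn t0 eps0 epsC [[Yi [_ [_ [cY _]]]] _] ZY.
pose M := Num.max 1 (fine (Linfnorm om0)).
have M0 : 0 < M by rewrite lt_max ltr01.
have LM : (Linfnorm om0 <= M%:E)%E.
  move: Linf0; rewrite /M; case: (Linfnorm om0) => [x| |]//= _; last by rewrite leNye.
  by rewrite lee_fin le_max lexx orbT.
pose r0 := Num.max r1 1.
have r00 : 0 < r0 by rewrite lt_max ltr01 orbT.
(* The bound and the support condition on om0 hold off a null set; cutting off on A gives a
   representative w0 for which they hold everywhere. *)
pose A := [set z | `|om0 z| <= M] `&` [set z : R * R | `|z| <= r0].
have mabs : measurable_fun setT (fun z => `|om0 z|) by exact: measurableT_comp.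
have mA : measurable A.
  apply: measurableI; last exact: measurable_box_set.
  have -> : [set z | `|om0 z| <= M] = (fun z => `|om0 z|) @^-1` `]-oo, M] by apply/seteqP; split => z /=; rewrite in_itv.
  by rewrite -[X in measurable X]setTI; apply: mabs => //; exact: measurable_itv.
pose w0 z := om0 z * \1_A z.
have mw : measurable_fun setT w0 by apply: measurable_funM => //; exact: measurable_indic.
have wA z : A z -> w0 z = om0 z by move=> h; rewrite /w0 indicE mem_set// mulr1.
have wnA z : ~ A z -> w0 z = 0 by move=> h; rewrite /w0 indicE memNset// mulr0.
have wM z : `|w0 z| <= M.
  by have [h|h] := pselect (A z); [rewrite wA//; case: h|rewrite wnA// normr0 ltW].
have sw : supp r0 w0 by move=> z hz; apply: wnA => -[_ /=]; rewrite leNgt hz.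
have [N [mN N0 hN]] : {ae @leb2 R, forall z, om0 z = w0 z}.
  have [N1 [m1 n1 h1]] : {ae @leb2 R, forall z, ((`|om0 z|)%:E <= M%:E)%E} by apply/ess_supP.
  have [N2 [m2 n2 h2]] := hr1.
  exists (N1 `|` N2); split.
  - exact: measurableU.
  - have g1 : (@leb2 R).-negligible N1 by exists N1; split.
    have g2 : (@leb2 R).-negligible N2 by exists N2; split.
    exact: measure_negligible (measurableU _ _ m1 m2) (negligibleU g1 g2).
  - move=> z /= hz; apply: contrapT => /not_orP[a b]; apply: hz.
    have oM : `|om0 z| <= M by rewrite -lee_fin; apply: contrapT => h; apply: a; exact: h1.
    have [zr|zr] := leP `|z| r0; first by rewrite wA.
    rewrite (sw z zr); apply: contrapT => h; apply: b; apply: h2 => /= hh; apply: h; apply: hh.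
    by apply: (lt_le_trans _ (cnorm_ge z)); apply: le_lt_trans zr; rewrite le_max lexx.
have aew : {ae @leb2 R, forall z, om0 z = w0 z} by exists N.
have [jw _] := supp_Ig r00 mw wM sw.
pose A0 := J (fun z => `|w0 z|).
have L1E : L1norm om0 = A0%:E by rewrite (ae_L1norm mom0 mw aew) L1norm_J.
have A00 : 0 <= A0 by apply: J_ge0 => z; exact: normr_ge0.
have tame k : exists q L, tameflow (cos theta) (sin theta) M (om (eps k)) (X (eps k)) (Xinv (eps k)) t q L.
  have [[s1 s2] pde ode X0 inv] := dyn _ (eps0 k); have [sm [rc hrc] li _] := reg _ (eps0 k).
  have rc0 : 0 < Num.max rc 1 by rewrite lt_max ltr01 orbT.
  apply: (@setting_tame R theta t M (Num.max rc 1)) => //; rewrite s2.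
  - apply: cont_ae_le; first by have [] := sm [::].
    have [P [mP P0 hP]] : {ae @leb2 R, forall z, ((`|om0e (eps k) z|)%:E <= M%:E)%E}.
      by apply/ess_supP; exact: (le_trans li LM).
    by exists P; split => //; apply: subset_trans hP => z /= h E; apply: h; rewrite -lee_fin.
  - move=> z hz; apply: hrc; apply: (lt_le_trans _ (cnorm_ge z)); apply: le_lt_trans hz.
    by rewrite le_max lexx.
have [qk [Lk tfk]] : exists qk Lk, forall k,
    tameflow (cos theta) (sin theta) M (om (eps k)) (X (eps k)) (Xinv (eps k)) t (qk k) (Lk k).
  exists (fun k => sval (cid (tame k))), (fun k => sval (cid (svalP (cid (tame k))))) => k.
  exact: (svalP (cid (svalP (cid (tame k))))).
have t00 : 0 <= (0 : R) <= t by rewrite lexx.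
have tt : 0 <= t <= t by rewrite t0 lexx.
have om_0 k : om (eps k) 0 = om0e (eps k) by have [[]] := dyn _ (eps0 k).
have jo k u : 0 <= u <= t -> Ig (om (eps k) u) by move=> hu; have [] := tf_J_sqr (tfk k) hu.
have mo k u : 0 <= u <= t -> measurable_fun setT (om (eps k) u) by move=> hu; exact: Ig_meas (jo k u hu).
have init k : J (fun z => `|om (eps k) 0 z|) <= A0.
  have [_ _ _ l1] := reg _ (eps0 k).
  by rewrite -lee_fin -L1E -(L1norm_J (jo k 0 t00)) om_0.
pose A1 := expR ((1 + 4096) * M * t) * A0.
have A10 : 0 <= A1 by exact: (mulr_ge0 (expR_ge0 _) A00).
have kM0 : 0 <= (1 + 4096) * M by exact: (mulr_ge0 (addr_ge0 ler01 (ler0n _ 4096)) (ltW M0)).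
have A1k k u : 0 <= u <= t -> J (fun w => `|om (eps k) u w|) <= A1.
  move=> hu; apply: (le_trans (L1_growth (tfk k) hu)).
  apply: (ler_pM (expR_ge0 _) _ _ (init k)); first by apply: J_ge0 => z; exact: normr_ge0.
  by rewrite ler_expR; apply: (ler_wpM2l kM0); case/andP: hu.
have w_lim e : 0 < e -> \forall k \near \oo, J (fun z => `|om (eps k) 0 z - w0 z|) <= e.
  move=> e0; have [h1 h2] := proj1 (fine_cvgP _ _) regL1.
  have [d /= d0 hd] := proj1 (nbhs_ballP _ _) (filterI h1 (proj1 (cvgrPdist_le _ _) h2 _ e0)).
  have [K _ hK] := proj1 (cvgrPdist_lt _ _) epsC _ d0.
  exists K => // k /hK hk.
  have [f1 f2] := hd (eps k) hk (eps0 k).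
  have mk := mo k 0 t00.
  have E : L1norm (fun z => om0e (eps k) z - om0 z) = (J (fun z => `|om (eps k) 0 z - w0 z|))%:E.
    rewrite -(L1norm_J (IgB (jo k 0 t00) jw)) om_0; apply: ae_L1norm.
    - by apply: measurable_funB => //; rewrite -om_0.
    - by apply: measurable_funB => //; rewrite -om_0.
    - by exists N; split => //; apply: subset_trans hN => z /= h E; apply: h; rewrite E.
  by move: f2; rewrite /= E /= sub0r normrN; exact: (le_trans (ler_norm _)).
have ZY' r e : 0 < r -> 0 < e -> \forall k \near \oo, forall z, `|z| <= r -> `|Xinv (eps k) t z - Y z| <= e.
  move=> rp ep; have := ZY (2 * r) e (mulr_gt0 (ltr0n _ 2) rp) ep; apply: filterS => k hk z zr.
  apply: (le_trans (cnorm_ge _)); apply: hk; apply: (le_trans (cnorm_le z)).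
  by apply: ler_wpM2l.
have mY := measurable_cont2 cY.
(* Composition with Y respects equality almost everywhere: [limit_abs_continuous] for the indicator
   of the null set N makes its preimage null on every square. *)
have aeY : {ae @leb2 R, forall z, om0 (Y z) = w0 (Y z)}.
  have [jN JN] := J_indic mN ltac:(by rewrite N0); rewrite N0 in JN; case: JN => JN.
  have i01 z : 0 <= (\1_N z : R) <= 1 by rewrite indicE; case: (_ \in _); rewrite ?lexx ler01.
  have mi : measurable_fun setT (\1_N : R * R -> R) by exact: measurable_indic.
  have bi : bm (\1_N : R * R -> R) by split => //; exists 1 => z; have /andP[a b] := i01 z; rewrite ger0_norm.
  have z0 m : {ae @leb2 R, forall z, setT z -> (box m.+1%:R z * \1_N (Y z))%:E = cst 0%E z}.
    have m0 : 0 < m.+1%:R :> R by rewrite ltr0n.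
    have jm : Ig (fun z => box m.+1%:R z * `|\1_N (Y z)|) := bm_box m0 (bm_comp cY bi).
    have Jle e : 0 < e -> J (fun z => box m.+1%:R z * \1_N (Y z)) <= e.
      move=> e0; have [dl dl0 H] := limit_abs_continuous tfk A1k t0 A10 cY ZY' e0.
      by apply: H => //; rewrite JN ltW.
    have pos z : 0 <= box m.+1%:R z * \1_N (Y z) by apply: mulr_ge0; [exact: box_ge0|have /andP[] := i01 (Y z)].
    have jm' : Ig (fun z => box m.+1%:R z * \1_N (Y z)).
      by apply: eq_Ig jm => z; have /andP[a _] := i01 (Y z); rewrite ger0_norm.
    apply/(ae_eq_integral_abs _ measurableT); first by apply/measurable_EFinP; exact: Ig_meas jm'.
    apply: (@eq_trans _ _ (\int[@leb2 R]_z (box m.+1%:R z * \1_N (Y z))%:E)%E).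
      by apply: eq_integral => z _; rewrite /= ger0_norm.
    rewrite -(JE jm'); congr EFin; apply/eqP; rewrite eq_le J_ge0// andbT.
    by apply/ler_addgt0Pr => e e0; rewrite add0r; exact: Jle.
  have [P [mP P0 hP]] := ae_foralln z0.
  exists P; split => //; apply: subset_trans hP => z /= h hz; apply: h; apply: contrapT => ne.
  have YN : N (Y z) by apply: hN.
  have := hz (Num.truncn `|z|) I; rewrite indicE mem_set// mulr1 /box ltW ?truncnS_gt// => -[] /eqP.
  by rewrite oner_eq0.
have moY : measurable_fun setT (fun z => om0 (Y z)) by exact: (measurableT_comp mom0 mY).
have mwY : measurable_fun setT (fun z => w0 (Y z)) by exact: (measurableT_comp mw mY).
have jwY : Ig (fun z => w0 (Y z)) := Ig_limit tfk A1k t0 A10 cY ZY' mw wM r00 sw.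
split.
  apply: ge0_cvg0E => [k|e e0]; first by apply: integral_ge0 => z _; rewrite lee_fin.
  have := vorticity_L1 tfk A1k t0 A10 cY ZY' mw wM r00 sw w_lim e0; apply: filterS => k hk.
  have mk := mo k t tt.
  rewrite (ae_L1norm (g := fun z => om (eps k) t z - w0 (Y z))).
  - by rewrite (L1norm_J (IgB (jo k t tt) jwY)) lee_fin.
  - exact: measurable_funB.
  - exact: measurable_funB.
  - by have [P [mP P0 hP]] := aeY; exists P; split => //; apply: subset_trans hP => z /= h E; apply: h; rewrite E.
apply: ge0_cvg0E => [k|e e0].
  (* Non-negativity of the essential supremum requires a space of positive measure, witnessed by the
     unit square. *)
  apply: ess_sup_gee; last by apply: nearW => z; rewrite lee_fin sqrtr_ge0.
  apply: (@lt_le_trans _ _ (@leb2 R [set z : R * R | `|z| <= 1])).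
    by rewrite leb2_box// lte_fin mulr_gt0// exprn_gt0.
  by apply: le_measure; rewrite ?inE//; exact: measurable_box_set.
have e2 : 0 < e / 2 by rewrite divr_gt0.
have cs : cos theta ^+ 2 + sin theta ^+ 2 = 1 := cos2Dsin2 theta.
have sc : sin theta ^+ 2 + (- cos theta) ^+ 2 = 1 by rewrite sqrrN addrC.
have velE a b z : vel a b (om0 \o Y) z = vel a b (fun z => w0 (Y z)) z.
  have mk := measurable_shift z (measurable_kap a b).
  apply: ae_J; try exact: measurable_funM.
  by have [P [mP P0 hP]] := aeY; exists P; split => //; apply: subset_trans hP => w /= h E; apply: h; rewrite E.
have h1 := velocity_sup tfk A1k t0 A10 cY ZY' mw wM r00 sw w_lim cs e2.
have h2 := velocity_sup tfk A1k t0 A10 cY ZY' mw wM r00 sw w_lim sc e2.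
have [K _ hK] := filterI h1 h2; exists K => // k /hK[g1 g2].
apply/ess_supP; apply: nearW => z; rewrite lee_fin.
apply: (le_trans (cnorm_le _)); rewrite mulrC -ler_pdivlMr//.
by rewrite !Kconv_vel !velE normC_le /= g1 g2.
Qed.
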